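(* Let $m,d\in\mathbb{N}$, let $A$ be a real $m\times m$ matrix and $D$ a real $m\times d$ matrix. The following statements are equivalent: (i) $\mathrm{Rank}\,[AD,A^2D,\ldots,A^{m}D]=m$; (ii) for every $k\in\mathbb{N}$, every real $m\times k$ matrix $B$, every Wiener process $W$ in $\mathbb{R}^k$, and every $\mathbb{R}^d$-valued Lévy process $$Z(t)=\int_0^t\int_{\|u\|_{\mathbb{R}^d}>1}u\,\nu(ds,du)+\int_0^t\int_{\|u\|_{\mathbb{R}^d}\le1}u\,\tilde\nu(ds,du),\quad t\ge0,$$ independent of $W$, whose Lévy measure $\Pi$ is essentially linearly non-degenerated, the solution $X$ of the equation $$X(t)=\int_0^tAX(s)\,ds+BW(t)+DZ(t),\quad t\ge0,$$ is such that the law of the random vector $X(t)$ is absolutely continuous with respect to Lebesgue measure on $\mathbb{R}^m$ for every $t>0$.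
   Context: $[AD,A^2D,\ldots,A^mD]$ is the $m\times md$ block matrix obtained by placing the listed matrices side by side. A Lévy measure $\Pi$ on $\mathbb{R}^d$ is a Borel measure with $\Pi(\{0\})=0$ and $\int(\|u\|^2\wedge1)\,\Pi(du)<\infty$. It is called essentially linearly non-degenerated (Yamazato condition) if $\Pi(\mathbb{R}^d\setminus L)=+\infty$ for every proper linear subspace $L\subsetneq\mathbb{R}^d$; equivalently, its essential linear support, i.e. the smallest linear subspace $L$ with $\Pi(\mathbb{R}^d\setminus L)<+\infty$, equals $\mathbb{R}^d$. $\nu$ is the Poisson random point measure on $[0,\infty)\times\mathbb{R}^d$ with intensity $dt\times\Pi(du)$, independent of $W$, and $\tilde\nu(ds,du)=\nu(ds,du)-ds\,\Pi(du)$. The equation is solved pathwise; its unique solution with locally bounded trajectories is $$X(t)=\int_0^te^{(t-s)A}B\,dW(s)+\int_0^t\int_{\|u\|>1}e^{(t-s)A}Du\,\nu(ds,du)+\int_0^t\int_{\|u\|\le1}e^{(t-s)A}Du\,\tilde\nu(ds,du).$$ *)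

(* Defs.v *)
From HB Require Import structures.
From mathcomp Require Import all_boot all_order all_algebra.
From mathcomp Require Import all_classical all_reals all_analysis.
From mathcomp Require Import measurable_realfun.

Set Implicit Arguments.
Unset Strict Implicit.
Unset Printing Implicit Defensive.

Import Order.TTheory GRing.Theory Num.Theory.
Import numFieldNormedType.Exports.

Local Open Scope classical_set_scope.
Local Open Scope ring_scope.

(* The Borel sigma-algebra of the finite-dimensional space 'M[R]_(m, n), as the
   product sigma-algebra: the one generated by the coordinate maps. *)
Definition measurable_mx (R : realType) (m n : nat) : set (set 'M[R]_(m, n)) :=
  <<s \bigcup_(ij in [set: 'I_m * 'I_n])
        preimage_set_system [set: 'M[R]_(m, n)]
          (fun M => M ij.1 ij.2) (measurable : set (set R)) >>.

HB.instance Definition _ (R : realType) (m n : nat) :=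
  @isMeasurable.Build default_measure_display 'M[R]_(m, n)
    (@measurable_mx R m n)
    (@sigma_algebra0 _ setT _) (@sigma_algebraC _ _)
    (@sigma_algebra_bigcup _ setT _).

(* Lebesgue measure on R^n, as the n-fold product of lebesgue_measure: on Borel
   sets, the measure of A is the integral over the first coordinate x of the
   (n-1)-dimensional measure of the section of A at x. *)
Fixpoint lebesgue_cV (R : realType) (n : nat) : set 'cV[R]_n -> \bar R :=
  match n with
  | 0%N => fun A => \d_(0 : 'cV[R]_0) A
  | n'.+1 => fun A => (\int[lebesgue_measure]_(x in [set: R])
      lebesgue_cV [set v : 'cV[R]_n' | A (col_mx (x%:M : 'cV[R]_1) v)])%E
  end.

(* Euclidean norm; the norm that the library puts on matrices is the sup norm. *)
Definition enorm (R : realType) (n : nat) (u : 'cV[R]_n) : R :=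
  Num.sqrt (\sum_(i < n) u i 0 ^+ 2).

Definition vintegral (R : realType) (disp : measure_display)
    (T : measurableType disp) (n : nat) (mu : {measure set T -> \bar R})
    (E : set T) (f : T -> 'cV[R]_n) : 'cV[R]_n :=
  \col_(i < n) \int[mu]_(x in E) f x i 0.

Section Probability.
Context (R : realType) (disp : measure_display) (Omega : measurableType disp).
Variable P : probability Omega R.

(* Applied to the complete finite family, the product rule for all choices of
   events contains the product rule for subfamilies (take A i = setT). *)
Definition mutually_independent (disp' : measure_display)
    (T : measurableType disp') (n : nat) (X : 'I_n -> Omega -> T) : Prop :=
  forall A : 'I_n -> set T, (forall i, measurable (A i)) ->
    P (\bigcap_(i in [set: 'I_n]) (X i @^-1` A i)) =
    (\prod_(i < n) P (X i @^-1` A i))%E.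

Definition sigma_generated (disp' : measure_display)
    (T : measurableType disp') (I : Type) (S : set I) (X : I -> Omega -> T) :
    set (set Omega) :=
  <<s \bigcup_(i in S) preimage_set_system [set: Omega] (X i) measurable >>.

Definition independent_systems (F G : set (set Omega)) : Prop :=
  forall A B, F A -> G B -> P (A `&` B) = (P A * P B)%E.

(* A process indexed by [0, +oo[ is a function on R of which only the values at
   nonnegative times matter. *)
Definition is_process (n : nat) (X : R -> Omega -> 'cV[R]_n) : Prop :=
  forall t, 0 <= t -> measurable_fun [set: Omega] (X t).

Definition independent_increments (n : nat) (X : R -> Omega -> 'cV[R]_n) :
    Prop :=
  forall (N : nat) (s : nat -> R), 0 <= s 0%N ->
    {homo s : i j / (i <= j)%N >-> i <= j} ->
    mutually_independent
      (fun (i : 'I_N) (w : Omega) => X (s i.+1) w - X (s i) w).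

Definition stationary_increments (n : nat) (X : R -> Omega -> 'cV[R]_n) :
    Prop :=
  forall (s h : R) (A : set 'cV[R]_n), 0 <= s -> 0 <= h -> measurable A ->
    P [set w | A (X (s + h) w - X s w)] = P [set w | A (X h w - X 0 w)].

Definition cadlag (n : nat) (x : R -> 'cV[R]_n) : Prop :=
  (forall t, 0 <= t -> x s @[s --> t^'+] --> x t) /\
  (forall t, 0 < t -> cvg (x s @[s --> t^'-])).

Definition is_levy_process (n : nat) (Z : R -> Omega -> 'cV[R]_n) : Prop :=
  [/\ is_process Z,
      {ae P, forall w, Z 0 w = 0},
      independent_increments Z,
      stationary_increments Z &
      {ae P, forall w, cadlag (fun t => Z t w)}].

Definition is_wiener_process (n : nat) (W : R -> Omega -> 'cV[R]_n) : Prop :=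
  [/\ is_process W,
      {ae P, forall w, W 0 w = 0},
      independent_increments W,
      (* W t - W s has law N(0, (t - s) I_n); the second parameter of
         normal_prob is the standard deviation *)
      (forall s t, 0 <= s -> s < t ->
        mutually_independent
          (fun (i : 'I_n) (w : Omega) => (W t w - W s w) i 0) /\
        (forall (i : 'I_n) (A : set R), measurable A ->
          P [set w | A ((W t w - W s w) i 0)] =
          normal_prob 0 (Num.sqrt (t - s)) A)) &
      {ae P, forall w, {within `[0, +oo[, continuous (fun t => W t w)}}].

Definition is_levy_measure (d : nat)
    (Pi : {measure set 'cV[R]_d -> \bar R}) : Prop :=
  Pi [set 0] = 0%E /\
  (\int[Pi]_(u in [set: 'cV[R]_d]) (Num.min (enorm u ^+ 2) 1)%:E < +oo)%E.

Definition ess_lin_nondegenerated (d : nat)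
    (Pi : {measure set 'cV[R]_d -> \bar R}) : Prop :=
  forall L : {vspace 'cV[R]_d}, L != fullv ->
    Pi (~` [set u | u \in L]) = +oo%E.

(* The intensity dt x Pi(du) on [0, +oo[ x R^d, viewed as a measure on R x R^d
   that does not charge negative times. *)
Definition intensity (d : nat) (Pi : {measure set 'cV[R]_d -> \bar R})
    (E : set (R * 'cV[R]_d)) : \bar R :=
  (lebesgue_measure \x Pi)%E (E `&` (`[0, +oo[ `*` [set: 'cV[R]_d])).

Definition is_poisson_random_measure (disp' : measure_display)
    (T : measurableType disp') (lam : set T -> \bar R)
    (nu : Omega -> {measure set T -> \bar R}) : Prop :=
  [/\ (forall E, measurable E ->
        measurable_fun [set: Omega] (fun w => nu w E)),
      (* the second argument of poisson_prob is a dummy *)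
      (forall E, measurable E -> (lam E < +oo)%E -> forall k : nat,
        P [set w | nu w E = k%:R%:E] = poisson_prob (fine (lam E)) 0 [set k]),
      (forall E, measurable E -> lam E = +oo%E ->
        {ae P, forall w, nu w E = +oo%E}) &
      (forall (N : nat) (E : 'I_N -> set T), (forall i, measurable (E i)) ->
        trivIset [set: 'I_N] E ->
        mutually_independent (fun i w => nu w (E i)))].

Section LevyIto.
Variables (d : nat) (Pi : {measure set 'cV[R]_d -> \bar R}).
Variable nu : Omega -> {measure set (R * 'cV[R]_d) -> \bar R}.

(* int_0^t int_{||u|| > 1} u nu(ds, du) *)
Definition large_jumps (t : R) (w : Omega) : 'cV[R]_d :=
  vintegral (nu w) (`[0, t] `*` [set u | 1 < enorm u]) snd.

(* int_0^t int_{eps < ||u|| <= 1} u (nu(ds, du) - ds Pi(du)) *)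
Definition truncated_small_jumps (eps t : R) (w : Omega) : 'cV[R]_d :=
  let E := [set u : 'cV[R]_d | eps < enorm u <= 1] in
  vintegral (nu w) (`[0, t] `*` E) snd - t *: vintegral Pi E id.

(* M is a version of int_0^t int_{||u|| <= 1} u (nu(ds, du) - ds Pi(du)), the
   L^2(P)-limit of the truncated integrals. *)
Definition is_small_jumps (t : R) (M : Omega -> 'cV[R]_d) : Prop :=
  measurable_fun [set: Omega] M /\
  (\int[P]_w (enorm (M w - truncated_small_jumps eps t w) ^+ 2)%:E)%E
    @[eps --> (0 : R)^'+] --> 0%E.

Definition is_levy_ito (Z : R -> Omega -> 'cV[R]_d) : Prop :=
  forall t, 0 <= t -> exists2 M : Omega -> 'cV[R]_d,
    is_small_jumps t M & {ae P, forall w, Z t w = large_jumps t w + M w}.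

End LevyIto.

Definition locally_bounded (n : nat) (x : R -> 'cV[R]_n) : Prop :=
  forall t, 0 <= t -> exists C, forall s, 0 <= s <= t -> enorm (x s) <= C.

(* The equation is understood pathwise; measurability of the path gives a
   meaning to the Lebesgue integral of the (locally bounded) path. *)
Definition is_solution (m k d : nat) (A : 'M[R]_m) (B : 'M[R]_(m, k))
    (D : 'M[R]_(m, d)) (W : R -> Omega -> 'cV[R]_k)
    (Z : R -> Omega -> 'cV[R]_d) (X : R -> Omega -> 'cV[R]_m) : Prop :=
  is_process X /\
  {ae P, forall w,
    [/\ measurable_fun (`[0, +oo[ : set R) (fun s => X s w),
        locally_bounded (fun s => X s w) &
        forall t, 0 <= t ->
          X t w = vintegral lebesgue_measure `[0, t] (fun s => A *m X s w)
                  + B *m W t w + D *m Z t w]}.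

End Probability.

(* Main.v *)
Require Import Defs.
From HB Require Import structures.
From mathcomp Require Import all_boot all_order all_algebra.
From mathcomp Require Import all_classical all_reals all_analysis.
From mathcomp Require Import measurable_realfun ring lra.

Set Implicit Arguments.
Unset Strict Implicit.
Unset Printing Implicit Defensive.

Import Order.TTheory GRing.Theory Num.Theory.
Import numFieldNormedType.Exports.

Local Open Scope classical_set_scope.
Local Open Scope ring_scope.

(* Rank condition => density. Fix t and finitely many disjoint space-time cells.
   On the event that each cell carries exactly one jump (s_a, u_a), the times s_a
   are independent, uniform on their intervals and independent of the marks u_a
   and of everything else (the jumps outside the cells and W), while variation
   of constants gives X t = Y + \sum_a exp((t - s_a) A) D u_a. For frozen Y and
   marks this is a C^1 map of the times, so wherever its Jacobian, with columns
   - A exp((t - s_a) A) D u_a, is invertible the preimage of a null set is null.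
   Almost surely some finite configuration of cells isolates m jumps with an
   invertible Jacobian: by the rank condition the vectors A exp((t - s) A) D u
   span the whole space, and a nondegenerate Levy measure gives infinitely many
   small jumps outside of any proper subspace.

   Density => rank condition. If the rank is smaller than m, some row vector
   l <> 0 satisfies l A^j D = 0 for all j >= 1, so that l X = l D Z when B = 0.
   A Levy process Z is built from coin tossing whose jumps decrease so fast that
   every fixed linear functional of Z 1 lies, with positive probability, in a
   deterministic Lebesgue-null set; then so does l X 1. *)

(** * Borel sets and Lebesgue measure on matrices *)

(** The jump sizes carry no regularity, since [Pi] may be purely atomic: the density must come from
    the jump times alone. Moving a jump in time differentiates the exponential, which produces a
    factor A and explains why the rank condition starts with AD and not with D. No change of
    variables is used: a map with invertible Jacobian is locally inverse Lipschitz, and this is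
    enough for null sets. Two obstacles shape this half. [nu] is known only through its counts, so
    integrality and atoms must be proved almost surely; and Z is an L2-limit at each fixed time, so
    Y is measurable for the outside information only up to null sets.

    The converse needs an actual noise. The Poisson measure is a superposition of independent
    clusters with Poisson(1) many points, and its independence is read off Laplace transforms, which
    tolerate infinite intensities. For the null set, each index is allowed boundedly many
    occurrences: the partial sums then have few values compared with the size of the remaining
    jumps, and Chebyshev's inequality gives these bounds positive probability. *)

Lemma measurable_set_bool d (T : measurableType d) (b : T -> bool) :
  measurable_fun setT b -> measurable [set x | b x].
Proof. by move=> mb; have := mb measurableT [set true] (I : measurable [set true]); rewrite setTI. Qed.

Lemma measurable_set_le d (T : measurableType d) (R : realType) (f g : T -> R) :
  measurable_fun setT f -> measurable_fun setT g ->
  measurable [set x | f x <= g x].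
Proof. by move=> mf mg; apply: measurable_set_bool; exact: measurable_fun_ler. Qed.

Lemma measurable_set_lt d (T : measurableType d) (R : realType) (f g : T -> R) :
  measurable_fun setT f -> measurable_fun setT g ->
  measurable [set x | f x < g x].
Proof. by move=> mf mg; apply: measurable_set_bool; exact: measurable_fun_ltr. Qed.

Lemma measure_bigcup_null d (T : measurableType d) (R : realType)
    (m : {measure set T -> \bar R}) (F : (set T)^nat) :
  (forall i, measurable (F i)) -> (forall i, m (F i) = 0%E) ->
  m (\bigcup_i F i) = 0%E.
Proof.
move=> mF F0; apply/negligibleP; first exact: bigcupT_measurable.
by apply: negligible_bigcup => i; apply/negligibleP; [exact: mF|exact: F0].
Qed.

Definition pushm d d' (T1 : measurableType d) (T2 : measurableType d')
    (R : realType) (m : {measure set T1 -> \bar R}) (f : T1 -> T2)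
    (mf : measurable_fun [set: T1] f) : {measure set T2 -> \bar R} :=
  measure_function_pushforward__canonical__measure_function_Measure m mf.

Lemma pushmE d d' (T1 : measurableType d) (T2 : measurableType d')
    (R : realType) (m : {measure set T1 -> \bar R}) (f : T1 -> T2)
    (mf : measurable_fun [set: T1] f) A : pushm m mf A = m (f @^-1` A).
Proof. by []. Qed.

Definition restm d (T : measurableType d) (R : realType)
    (m : {measure set T -> \bar R}) (D : set T) (mD : measurable D) :
    {measure set T -> \bar R} :=
  measure_function_mrestr__canonical__measure_function_Measure m mD.

Lemma restmE d (T : measurableType d) (R : realType)
    (m : {measure set T -> \bar R}) (D : set T) (mD : measurable D) A :
  restm m mD A = m (A `&` D).
Proof. by []. Qed.

(** A copy of the measure indexed by the proof [sf]: the structure declared on it makes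
    sigma-finiteness available to inference, as product measures require. *)
Definition sigma_finite_copy d (T : measurableType d) (R : realType)
    (m : {measure set T -> \bar R}) (sf : sigma_finite [set: T] m) :
  set T -> \bar R := m.

HB.instance Definition _ d (T : measurableType d) (R : realType)
    (m : {measure set T -> \bar R}) (sf : sigma_finite [set: T] m) :=
  Measure.on (sigma_finite_copy sf).

HB.instance Definition _ d (T : measurableType d) (R : realType)
    (m : {measure set T -> \bar R}) (sf : sigma_finite [set: T] m) :=
  @Measure_isSigmaFinite.Build _ _ _ (sigma_finite_copy sf) sf.

Section MeasurableMx.
Context (R : realType).

Lemma measurable_mx_entry (m n : nat) (i : 'I_m) (j : 'I_n) :
  measurable_fun [set: 'M[R]_(m, n)] (fun M => M i j).
Proof.
move=> _ B mB; apply: sub_sigma_algebra.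
by exists (i, j) => //=; exists B.
Qed.

Lemma measurable_fun_mx d (T : measurableType d) (m n : nat)
    (D : set T) (f : T -> 'M[R]_(m, n)) :
  (forall i j, measurable_fun D (fun x => f x i j)) -> measurable_fun D f.
Proof.
move=> mf mD; apply: (@measurability _ _ _ _ D f (\bigcup_(ij in [set: 'I_m * 'I_n])
   preimage_set_system [set: 'M[R]_(m, n)]
          (fun M => M ij.1 ij.2) (measurable : set (set R)))) => //.
by move=> _ /= [_ [[i j] _ [B mB <-]] <-]; rewrite setTI; exact: mf.
Qed.

Lemma measurable_fun_mx_entry d (T : measurableType d) (m n : nat)
    (D : set T) (f : T -> 'M[R]_(m, n)) i j :
  measurable_fun D f -> measurable_fun D (fun x => f x i j).
Proof.
by move=> mf; apply: (measurable_comp measurableT _ (measurable_mx_entry i j) mf).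
Qed.

Lemma measurable_fun_mulmx d (T : measurableType d) (m n p : nat)
    (D : set T) (f : T -> 'M[R]_(m, n)) (g : T -> 'M[R]_(n, p)) :
  measurable_fun D f -> measurable_fun D g ->
  measurable_fun D (fun x => f x *m g x).
Proof.
move=> mf mg; apply: measurable_fun_mx => i j.
under eq_fun do rewrite mxE.
apply: measurable_sum => k; apply: measurable_funM;
  exact: measurable_fun_mx_entry.
Qed.

Lemma measurable_fun_addmx d (T : measurableType d) (m n : nat)
    (D : set T) (f g : T -> 'M[R]_(m, n)) :
  measurable_fun D f -> measurable_fun D g ->
  measurable_fun D (fun x => f x + g x).
Proof.
move=> mf mg; apply: measurable_fun_mx => i j.
under eq_fun do rewrite mxE.
by apply: measurable_funD; exact: measurable_fun_mx_entry.
Qed.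

Lemma measurable_fun_oppmx d (T : measurableType d) (m n : nat)
    (D : set T) (f : T -> 'M[R]_(m, n)) :
  measurable_fun D f -> measurable_fun D (fun x => - f x).
Proof.
move=> mf; apply: measurable_fun_mx => i j.
under eq_fun do rewrite mxE.
by apply: measurable_funN; exact: measurable_fun_mx_entry.
Qed.

Lemma measurable_fun_det d (T : measurableType d) (n : nat)
    (D : set T) (f : T -> 'M[R]_n) :
  measurable_fun D f -> measurable_fun D (fun x => \det (f x)).
Proof.
move=> mf; rewrite /determinant; apply: measurable_sum => s.
apply: measurable_funM => //; apply: measurable_prod => i _.
exact: measurable_fun_mx_entry.
Qed.

Lemma measurable_enorm (n : nat) : measurable_fun [set: 'cV[R]_n] (@enorm R n).
Proof.
apply: measurableT_comp.
  apply: continuous_measurable_fun; exact: sqrt_continuous.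
apply: measurable_sum => i; apply: measurable_funX; exact: measurable_mx_entry.
Qed.

Definition box (n : nat) (B : 'I_n -> set R) : set 'cV[R]_n :=
  [set v | forall i, B i (v i 0)].

Lemma measurable_box (n : nat) (B : 'I_n -> set R) :
  (forall i, measurable (B i)) -> measurable (box B).
Proof.
move=> mB; rewrite (_ : box B =
  \bigcap_(i in [set: 'I_n]) ((fun v : 'cV[R]_n => v i 0) @^-1` B i)).
  apply: fin_bigcap_measurable => // i _.
  by rewrite -[X in measurable X]setTI; exact: measurable_mx_entry.
by apply/seteqP; split => [v Bv i _|v Bv i]; [exact: Bv|exact: Bv].
Qed.

Definition boxes (n : nat) : set (set 'cV[R]_n) :=
  [set box B | B in [set B : 'I_n -> set R | forall i, measurable (B i)]].

Lemma setI_closed_boxes n : setI_closed (@boxes n).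
Proof.
move=> _ _ [B mB <-] [C mC <-]; exists (fun i => B i `&` C i).
  by move=> i; exact: measurableI.
by apply/seteqP; split => v /=; [move=> h; split => i; have [] := h i|
  move=> [h1 h2] i; split; [exact: h1|exact: h2]].
Qed.

End MeasurableMx.

Lemma prodEFin (R : realType) (I : Type) (r : seq I) (P : pred I) (f : I -> R) :
  (\prod_(i <- r | P i) (f i)%:E)%E = (\prod_(i <- r | P i) f i)%:E.
Proof. by elim/big_rec2: _ => // i x y _ ->; rewrite EFinM. Qed.

Section LebesgueCV.
Context (R : realType).

Lemma col_mx1_0 n (x : R) (v : 'cV[R]_n) :
  (col_mx (x%:M : 'cV[R]_1) v : 'cV[R]_n.+1) ord0 0 = x.
Proof.
have e : ord0 = lshift n (0 : 'I_1) :> 'I_(1 + n) by exact: val_inj.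
by rewrite [X in fun_of_matrix _ X _]e (col_mxEu (x%:M : 'cV[R]_1)) mxE eqxx.
Qed.

Lemma col_mx1_S n (x : R) (v : 'cV[R]_n) i :
  (col_mx (x%:M : 'cV[R]_1) v : 'cV[R]_n.+1) (lift ord0 i) 0 = v i 0.
Proof.
have e : lift ord0 i = rshift 1 i :> 'I_(1 + n) by exact: val_inj.
by rewrite [X in fun_of_matrix _ X _]e (col_mxEd (x%:M : 'cV[R]_1)).
Qed.

Lemma measurable_col_mx1 n :
  measurable_fun [set: R * 'cV[R]_n]
    (fun p => col_mx (p.1%:M : 'cV[R]_1) p.2 : 'cV[R]_n.+1).
Proof.
apply: measurable_fun_mx => i j; rewrite ord1 {j}.
case: (unliftP ord0 i) => [k|] ->.
  under eq_fun do rewrite col_mx1_S.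
  by apply: measurable_fun_mx_entry; exact: measurable_snd.
under eq_fun do rewrite col_mx1_0.
exact: measurable_fst.
Qed.

(** Outside the Borel sets [lebesgue_cV] is only an iterated integral with no evident additivity, so
    it is exchanged here for a genuine measure [L]. Apart from the agreement on Borel sets, later
    arguments know [L] only through its values on boxes. *)
Lemma lebesgue_cV_measure n :
  exists L : {sigma_finite_measure set 'cV[R]_n -> \bar R},
  (forall A, measurable A -> lebesgue_cV A = L A) /\
  (forall B : 'I_n -> set R, (forall i, measurable (B i)) ->
     L (box B) = (\prod_(i < n) lebesgue_measure (B i))%E).
Proof.
elim: n => [|n [L [LE Lbox]]].
  exists (dirac (0 : 'cV[R]_0)); split => // B mB.
  rewrite big_ord0.
  have : \d_(0 : 'cV[R]_0) (box B) = 1%E :> \bar R.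
    by rewrite diracE mem_set//; case.
  exact.
pose f (p : R * 'cV[R]_n) := col_mx (p.1%:M : 'cV[R]_1) p.2 : 'cV[R]_n.+1.
have mf : measurable_fun [set: R * 'cV[R]_n] f by exact: measurable_col_mx1.
pose L1 := pushforward (@lebesgue_measure R \x L)%E f.
have L1E A : measurable A -> lebesgue_cV A = L1 A.
  move=> mA; rewrite /= /L1 /pushforward /product_measure1.
  apply: eq_integral => x _ /=.
  have e : xsection (f @^-1` A) x =
      [set v : 'cV[R]_n | A (col_mx (x%:M : 'cV[R]_1) v)].
    by apply/seteqP; split => v /=; rewrite /xsection/= ?inE.
  rewrite e LE// -e; apply: measurable_xsection.
  by rewrite -[X in measurable X]setTI; exact: mf.
have L1box (B : 'I_n.+1 -> set R) : (forall i, measurable (B i)) ->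
     L1 (box B) = (\prod_(i < n.+1) lebesgue_measure (B i))%E.
  move=> mB; rewrite /L1 /pushforward big_ord_recl.
  rewrite (_ : f @^-1` box B = B ord0 `*` box (fun i => B (lift ord0 i))).
    by rewrite product_measure1E ?Lbox//; [exact: mB|exact: measurable_box].
  apply/seteqP; split => -[x v] /=.
    by move=> h; split => [|i]; [have := h ord0|have := h (lift ord0 i)];
      rewrite /f ?col_mx1_0 ?col_mx1_S.
  move=> [h0 h] i.
  by case: (unliftP ord0 i) => [j|] ->; rewrite /f ?col_mx1_0 ?col_mx1_S.
pose L2 : {measure set 'cV[R]_n.+1 -> \bar R} :=
  pushm (@lebesgue_measure R \x L)%E mf.
have L2E : L2 = L1 :> (set _ -> _) by [].
have sf : sigma_finite [set: 'cV[R]_n.+1] L2.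
  exists (fun k => box (fun=> `[- k%:R, k%:R]%classic)).
    apply/esym; rewrite -subTset => v0 _; pose v : 'cV[R]_n.+1 := v0.
    have [k hk] : exists k : nat, forall i, `|v i 0| <= k%:R.
      exists (\sum_i Num.bound `|v i ord0|)%N => i.
      rewrite (le_trans (ltW (archi_boundP (normr_ge0 _))))// ler_nat.
      by rewrite (bigD1 i)//= leq_addr.
    by exists k => // i; rewrite /= in_itv/= -ler_norml.
  move=> k; split; first exact: measurable_box.
  rewrite L2E L1box//; rewrite lebesgue_measure_itv/=.
  case: ifPn => _; last by rewrite big_ord_recl mul0e.
  by rewrite -EFinD prodEFin ltry.
by exists (sigma_finite_copy sf).
Qed.

End LebesgueCV.

(** * Null preimages *)

Section MonotoneComparison.
Context d (T : measurableType d) (R : realType).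
Local Open Scope ereal_scope.

(** An inequality between measures is not stable under proper differences, so Dynkin's lemma does
    not apply. It does survive monotone limits, hence the monotone class theorem for a ring;
    decreasing limits are where the finite total masses enter. *)
Lemma setring_le_measure (G : set (set T)) (m1 m2 : {measure set T -> \bar R})
    (C : R) : (0 <= C)%R -> setring G -> G setT -> measurable = <<s G >> ->
  m1 setT < +oo -> m2 setT < +oo ->
  (forall A, G A -> m1 A <= C%:E * m2 A) ->
  forall A, measurable A -> m1 A <= C%:E * m2 A.
Proof.
move=> C0 rG GT mE m1oo m2oo le12 A mA.
pose H := [set A : set T | measurable A /\ m1 A <= C%:E * m2 A].
have fin (m : {measure set T -> \bar R}) B : m setT < +oo -> measurable B ->
    m B < +oo.
  by move=> moo mB; rewrite (le_lt_trans _ moo)// le_measure// inE.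
have Gm B : G B -> measurable B by move=> GB; rewrite mE; exact: sub_sigma_algebra.
suff : <<sr G >> `<=` H.
  move=> /(_ A)[]//; move: mA; rewrite mE; apply; split.
    have [sr0 srD srU] := smallest_sigma_ring G.
    by split => // B srB; apply: srD => //; exact: sub_g_sigma_ring.
  exact: sub_g_sigma_ring.
apply: monotone_setring_sub_g_sigma_ring => //; last first.
  by move=> B GB; split; [exact: Gm|exact: le12].
split=> F ndF HF; (split; first by
    (apply: bigcupT_measurable || apply: bigcapT_measurable) => i; have [] := HF i).
- have mF i : measurable (F i) by have [] := HF i.
  have mUF : measurable (\bigcup_i F i) by exact: bigcupT_measurable.
  have c1 := nondecreasing_cvg_mu (mu := m1) mF mUF ndF.
  have c2 := nondecreasing_cvg_mu (mu := m2) mF mUF ndF.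
  have c3 := cvgeZl (erefl : C%:E \is a fin_num) c2.
  rewrite -(cvg_lim _ c1)// -(cvg_lim _ c3)//; apply: lee_lim.
  - by apply/cvg_ex; eexists; exact: c1.
  - by apply/cvg_ex; eexists; exact: c3.
  - by near=> i; have [] := HF i.
- have mF i : measurable (F i) by have [] := HF i.
  have mUF : measurable (\bigcap_i F i) by exact: bigcapT_measurable.
  have c1 := nonincreasing_cvg_mu (mu := m1) (fin _ _ m1oo (mF 0%N)) mF mUF ndF.
  have c2 := nonincreasing_cvg_mu (mu := m2) (fin _ _ m2oo (mF 0%N)) mF mUF ndF.
  have c3 := cvgeZl (erefl : C%:E \is a fin_num) c2.
  rewrite -(cvg_lim _ c1)// -(cvg_lim _ c3)//; apply: lee_lim.
  - by apply/cvg_ex; eexists; exact: c1.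
  - by apply/cvg_ex; eexists; exact: c3.
  - by near=> i; have [] := HF i.
Unshelve. all: by end_near. Qed.

End MonotoneComparison.

Section Dyadic.
Context (R : realType) (n : nat).

Definition dyadic (k : nat) (v : 'cV[R]_n) : {ffun 'I_n -> int} :=
  [ffun i => Num.floor (2 ^+ k * v i 0)].

(** Unions of half-open cubes of one generation [k]. Passing to the finer of two generations makes
    this a ring, because finer cubes refine coarser ones. *)
Definition dyadic_sets : set (set 'cV[R]_n) :=
  [set A | exists k, forall v w, dyadic k v = dyadic k w -> A v -> A w].

Lemma dyadic_cubeE k z : dyadic k @^-1` [set z] =
  box (fun i => `[(z i)%:~R / 2 ^+ k, ((z i)%:~R + 1) / 2 ^+ k[%classic).
Proof.
have p2 : 0 < 2 ^+ k :> R by rewrite exprn_gt0.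
apply/seteqP; split => v /= h.
  move=> i; rewrite -h ffunE /= in_itv/= ler_pdivrMr// ltr_pdivlMr//.
  rewrite mulrC floor_le/=; have := floorD1_gt (2 ^+ k * v i 0).
  by rewrite intrD [v i 0 * _]mulrC.
apply/ffunP => i; rewrite ffunE; apply/eqP; rewrite floor_eq.
have := h i; rewrite /= in_itv/= ler_pdivrMr// ltr_pdivlMr// mulrC.
by rewrite intrD.
Qed.

Lemma measurable_dyadic_cube k z : measurable (dyadic k @^-1` [set z]).
Proof. by rewrite dyadic_cubeE; apply: measurable_box => i. Qed.

Lemma dyadic_S k v w : dyadic k.+1 v = dyadic k.+1 w -> dyadic k v = dyadic k w.
Proof.
have aux (x y : R) : Num.floor (2 * x) = Num.floor (2 * y) ->
    Num.floor x <= Num.floor y.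
  move=> e; rewrite floor_ge_int.
  suff : 2 * (Num.floor x)%:~R <= 2 * y by rewrite ler_pM2l.
  rewrite -[2](_ : (2%:Z)%:~R = _)// -intrM -floor_ge_int -e floor_ge_int.
  by rewrite intrM ler_pM2l// floor_le.
move=> /ffunP e; apply/ffunP => i; have := e i; rewrite !ffunE.
rewrite exprS -!mulrA => ei; apply/eqP; rewrite eq_le.
by rewrite !aux.
Qed.

Lemma dyadic_le k k' v w : (k <= k')%N ->
  dyadic k' v = dyadic k' w -> dyadic k v = dyadic k w.
Proof.
move=> /subnKC <-; elim: (k' - k)%N => [|j IH]; first by rewrite addn0.
by rewrite addnS => /dyadic_S.
Qed.

Lemma setring_dyadic_sets : setring dyadic_sets.
Proof.
split; first by exists 0%N.
- move=> A B [k kA] [l lB]; exists (maxn k l) => v w e [Av|Bv].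
    by left; apply: (kA v) => //; apply: dyadic_le e; rewrite leq_maxl.
  by right; apply: (lB v) => //; apply: dyadic_le e; rewrite leq_maxr.
- move=> A B [k kA] [l lB]; exists (maxn k l) => v w e [Av NBv]; split.
    by apply: (kA v) => //; apply: dyadic_le e; rewrite leq_maxl.
  move=> Bw; apply: NBv; apply: (lB w) => //.
  by apply: dyadic_le (esym e); rewrite leq_maxr.
Qed.

(** The cubes of generation [k] that meet [A], listed through the countable type of their lower
    corners; a number that codes no such cube yields the empty set. *)
Definition cubes_of (A : set 'cV[R]_n) k (j : nat) : set 'cV[R]_n :=
  if (pickle_inv j : option {ffun 'I_n -> int}) is Some z
  then (if `[< exists2 v, A v & dyadic k v = z >]
        then dyadic k @^-1` [set z] else set0)
  else set0.

Lemma measurable_cubes_of A k j : measurable (cubes_of A k j).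
Proof.
rewrite /cubes_of; case: pickle_inv => // z; case: ifP => // _.
exact: measurable_dyadic_cube.
Qed.

Lemma trivIset_cubes_of A k : trivIset setT (cubes_of A k).
Proof.
apply/trivIsetP => i j _ _ /eqP ij; rewrite -subset0 => v [vi vj]; apply: ij; move: vi vj.
rewrite /cubes_of.
case ei : pickle_inv => [z|//]; case: ifP => // _ /= vz.
case ej : pickle_inv => [z'|//]; case: ifP => // _ /= vz'.
move: ei ej; rewrite -vz' vz => ei ej.
have := @pickle_invK {ffun 'I_n -> int} i; rewrite ei /= => <-.
by have := @pickle_invK {ffun 'I_n -> int} j; rewrite ej /= => <-.
Qed.

Lemma bigcup_cubes_of A k : (forall v w, dyadic k v = dyadic k w -> A v -> A w) ->
  \bigcup_j cubes_of A k j = A.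
Proof.
move=> kA; apply/seteqP; split => v.
  move=> [j _]; rewrite /cubes_of; case: pickle_inv => [z|//].
  by case: asboolP => // -[w Aw e] /= vz; apply: kA Aw; rewrite e vz.
move=> Av; exists (pickle (dyadic k v)) => //.
by rewrite /cubes_of pickleK_inv; case: asboolP => //= -[]; exists v.
Qed.

Lemma measurable_dyadic_sets A : dyadic_sets A -> measurable A.
Proof.
move=> [k kA]; rewrite -(bigcup_cubes_of kA); apply: bigcupT_measurable => j.
exact: measurable_cubes_of.
Qed.

Lemma measurable_dyadicE : @measurable _ 'cV[R]_n = <<s dyadic_sets >>.
Proof.
apply/seteqP; split; last first.
  apply: smallest_sub; first exact: sigma_algebra_measurable.
  exact: measurable_dyadic_sets.
pose T' := g_sigma_algebraType dyadic_sets.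
have mi i : measurable_fun [set: T'] (fun v : T' => (v : 'cV[R]_n) i 0).
  apply: (measurability _ (RGenOInfty.measurableE R)).
  move=> _ [_ [x ->] <-]; rewrite setTI.
  (* Lower corners increase to the point, so [x < v i 0] holds exactly when the lower corner of some
     generation exceeds [x]. *)
  rewrite (_ : _ @^-1` _ =
      \bigcup_k [set v : 'cV[R]_n | x < (dyadic k v i)%:~R / 2 ^+ k]).
    apply: bigcupT_measurable => k; apply: sub_sigma_algebra.
    by exists k => v w /= ->.
  apply/seteqP; split => [v /=|v [k _ /=]].
    rewrite in_itv/= andbT => xv.
    have [k hk] : exists k : nat, (v i 0 - x)^-1 < 2 ^+ k.
      exists (Num.bound (v i 0 - x)^-1).
      rewrite (lt_le_trans (archi_boundP _))//; first by rewrite invr_ge0; lra.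
      by rewrite -natrX ler_nat ltnW// ltn_expl.
    have p2 : 0 < 2 ^+ k :> R by rewrite exprn_gt0.
    exists k => //=; rewrite ffunE ltr_pdivlMr//.
    have := floorD1_gt (2 ^+ k * v i 0); rewrite intrD.
    have : 1 < (v i 0 - x) * 2 ^+ k.
      by rewrite -ltr_pdivrMl ?mulr1//; lra.
    by lra.
  have p2 : 0 < 2 ^+ k :> R by rewrite exprn_gt0.
  rewrite ffunE ltr_pdivlMr// in_itv/= andbT => h.
  have := floor_le (2 ^+ k * v i 0); have := p2.
  by nra.
move=> A mA.
have /(_ measurableT A mA) : measurable_fun [set: T'] (id : T' -> 'cV[R]_n).
  by apply: measurable_fun_mx => i j; rewrite ord1; exact: mi.
by rewrite setTI.
Qed.

End Dyadic.

Section LipschitzInverse.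
Context (R : realType) (n : nat).
Variables (L : {sigma_finite_measure set 'cV[R]_n -> \bar R}).
Hypothesis Lbox : forall B : 'I_n -> set R, (forall i, measurable (B i)) ->
  L (box B) = (\prod_(i < n) lebesgue_measure (B i))%E.

Lemma L_dyadic_cube k z :
  L (@dyadic R n k @^-1` [set z]) = ((2 ^+ k)^-1 ^+ n)%:E.
Proof.
have p2 : 0 < 2 ^+ k :> R by rewrite exprn_gt0.
rewrite dyadic_cubeE Lbox// (eq_bigr (fun=> ((2 ^+ k)^-1)%:E)).
  by rewrite prodEFin prodr_const card_ord.
move=> i _; rewrite lebesgue_measure_itv/= lte_fin ltr_pM2r ?invr_gt0//.
by rewrite ltrDl ltr01 -EFinD -mulrBl addrC addKr mul1r.
Qed.

(** Domination on cubes passes to unions of cubes by countable additivity, and to Borel sets inside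
    a region of finite mass by monotone classes. *)
Lemma le_dyadic_measure (m : {measure set 'cV[R]_n -> \bar R}) (C : R) :
  0 <= C ->
  (forall k z, m (@dyadic R n k @^-1` [set z]) <= C%:E * L (@dyadic R n k @^-1` [set z]))%E ->
  forall A, measurable A -> L A = 0%E -> m A = 0%E.
Proof.
move=> C0 mC A mA LA0.
have mCd E : dyadic_sets E -> (m E <= C%:E * L E)%E.
  move=> [k kE]; rewrite -(bigcup_cubes_of kE).
  rewrite !measure_semi_bigcup; try by [move=> i; exact: measurable_cubes_of|
    exact: trivIset_cubes_of|apply: bigcupT_measurable => i; exact: measurable_cubes_of].
  rewrite -nneseriesZl//; apply: lee_nneseries => [j _ _|j _]; first exact: measure_ge0.
  rewrite /cubes_of; case: pickle_inv => [z|]; last by rewrite !measure0 mule0.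
  by case: ifP => // _; rewrite !measure0 mule0.
(* Boxes with integer bounds are unions of unit cubes, so they belong to the ring, and both measures
   are finite on them. *)
pose K (M : nat) : set 'cV[R]_n := box (fun=> `[- M%:R, M%:R[%classic).
have mK M : measurable (K M) by apply: measurable_box => i.
have dK M : dyadic_sets (K M).
  exists 0%N => v w /ffunP e Kv i; have := e i; rewrite !ffunE expr0 !mul1r => ei.
  have lo (x : R) : (- M%:R <= x) = (- M%:Z <= Num.floor x).
    by rewrite floor_ge_int mulrNz.
  have hi (x : R) : (x < M%:R) = (Num.floor x < M%:Z) by rewrite floor_lt_int.
  by have := Kv i; rewrite /= !in_itv/= !lo !hi ei.
have KT : \bigcup_M K M = setT.
  rewrite -subTset => v0 _; pose v : 'cV[R]_n := v0.
  have [k hk] : exists k : nat, forall i, `|v i 0| < k%:R.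
    exists (\sum_i Num.bound `|v i ord0|)%N => i.
    rewrite (lt_le_trans (archi_boundP (normr_ge0 _)))// ler_nat.
    by rewrite (bigD1 i)//= leq_addr.
  by exists k => // i; rewrite /= in_itv/=; have := hk i; rewrite ltr_norml => /andP[/ltW -> ->].
rewrite -(setIT A) -KT setI_bigcupr.
apply: measure_bigcup_null => M; first exact: measurableI.
rewrite -(restmE m (mK M)); apply/eqP; rewrite -measure_le0.
have : (restm m (mK M) A <= C%:E * restm L (mK M) A)%E.
  apply: (setring_le_measure C0 (@setring_dyadic_sets R n)) => //.
  - by exists 0%N.
  - exact: measurable_dyadicE.
  - rewrite restmE setTI (le_lt_trans (mCd _ (dK M)))//.
    rewrite Lbox// lebesgue_measure_itv/= -EFinD; case: ifP => _.
      by rewrite prodEFin -EFinM ltry.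
    by rewrite prodEFin -EFinM ltry.
  - have : (L (K M) < +oo)%E.
      rewrite Lbox// lebesgue_measure_itv/= -EFinD; case: ifP => _.
        by rewrite prodEFin ltry.
      by rewrite prodEFin ltry.
    by rewrite restmE setTI.
  - move=> B dB; rewrite !restmE; apply: mCd.
    have [_ _ dD] := @setring_dyadic_sets R n.
    rewrite -(setDD B (K M)); apply: (dD) => //; exact: dD.
move=> /le_trans; apply; rewrite restmE.
rewrite [X in (_ * X)%E](_ : _ = 0%E) ?mule0//.
by apply: (subset_measure0 _ _ _ LA0) => //; exact: measurableI.
Qed.

(** The restriction of [L] to [B], pushed forward by [F], is compared with [L] on cubes. The part of
    [B] sent into a cube of side 2^-k stays within c 2^-k, in every coordinate, of any one of its
    points, which gives the constant (2c)^n. *)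
Lemma lipschitz_inverse_null (B : set 'cV[R]_n) (F : 'cV[R]_n -> 'cV[R]_n)
    (c : R) (N : set 'cV[R]_n) : 0 <= c -> measurable B ->
  measurable_fun setT F ->
  (forall s s' e, B s -> B s' -> (forall i, `|F s i 0 - F s' i 0| <= e) ->
     forall i, `|s i 0 - s' i 0| <= c * e) ->
  measurable N -> L N = 0%E -> L (B `&` F @^-1` N) = 0%E.
Proof.
move=> c0 mB mF lipF mN LN0.
pose m := pushm (restm L mB) mF.
have mE A : m A = L (B `&` F @^-1` A) by rewrite /m pushmE restmE setIC.
rewrite -mE; apply: (@le_dyadic_measure m ((2 * c) ^+ n)) => //.
  by rewrite exprn_ge0// mulr_ge0.
move=> k z; rewrite mE L_dyadic_cube.
set Q := (X in F @^-1` X).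
have Qb v : Q v -> box (fun i => `[(z i)%:~R / 2 ^+ k, ((z i)%:~R + 1) / 2 ^+ k[%classic) v.
  by rewrite /Q dyadic_cubeE.
have p2 : 0 < 2 ^+ k :> R by rewrite exprn_gt0.
have [->|/set0P[s [Bs Qs]]] := eqVneq (B `&` F @^-1` Q) set0.
  by rewrite measure0 -EFinM lee_fin !(mulr_ge0, exprn_ge0)// invr_ge0 ltW.
pose r := c * (2 ^+ k)^-1.
have r0 : 0 <= r by rewrite mulr_ge0// invr_ge0 ltW.
pose S : set 'cV[R]_n := box (fun i => `[s i 0 - r, s i 0 + r]%classic).
have mQ : measurable Q by exact: measurable_dyadic_cube.
have mS : measurable S by apply: measurable_box => i.
apply: (@le_trans _ _ (L S)).
  apply: le_measure; rewrite ?inE//.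
    by apply: measurableI => //; have := mF measurableT _ mQ; rewrite setTI.
  move=> s' [Bs' Qs'] i; rewrite /= in_itv/=.
  have : `|s' i 0 - s i 0| <= r.
    apply: (lipF _ _ _ Bs' Bs) => j.
    have := Qb _ Qs j; have := Qb _ Qs' j => /=.
    rewrite !in_itv/= mulrDl mul1r => /andP[b1 b2] /andP[a1 a2].
    by rewrite ler_norml; apply/andP; split; lra.
  by rewrite ler_norml => /andP[a1 a2]; apply/andP; split; lra.
rewrite Lbox// (eq_bigr (fun=> (2 * r)%:E)).
  rewrite prodEFin prodr_const card_ord -EFinM lee_fin -exprMn.
  by rewrite /r mulrA.
move=> i _; rewrite lebesgue_measure_itv/= lte_fin.
case: ltP => h; first by rewrite -EFinD; congr EFin; lra.
congr EFin; lra.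
Qed.

End LipschitzInverse.

(** * The matrix exponential *)

Section MatrixExponential.
Context (R : realType) (m : nat).
Variable A : 'M[R]_m.

Lemma cvg_sumr (I : Type) (r : seq I) (f : I -> nat -> R) (l : I -> R) :
  (forall i, f i n @[n --> \oo] --> l i) ->
  \sum_(i <- r) f i n @[n --> \oo] --> \sum_(i <- r) l i.
Proof.
move=> fl; elim: r => [|i r IH].
  by under eq_fun do rewrite big_nil; rewrite big_nil; exact: cvg_cst.
under eq_fun do rewrite big_cons.
by rewrite big_cons; apply: cvgD.
Qed.

Lemma cvg_pseries_exp_bound (c : nat -> R) (C K : R) :
  0 <= K -> (forall n, `|c n| <= C * (K ^+ n / n`!%:R)) ->
  forall x, cvgn (pseries c x).
Proof.
move=> K0 cb x; apply: normed_cvg.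
have C0 : 0 <= C by have := le_trans (normr_ge0 _) (cb 0%N); rewrite fact0 expr0 divr1 mulr1.
apply: (@series_le_cvg _ _ (fun n => C * exp_coeff (K * `|x|) n)) => /= [n|n|n|].
- exact: normr_ge0.
- by rewrite mulr_ge0// /exp_coeff/= divr_ge0// exprn_ge0// mulr_ge0.
- rewrite normrM normrX /exp_coeff/= exprMn mulrAC mulrA ler_wpM2r ?exprn_ge0//.
- by apply: is_cvg_seriesZ; exact: is_cvg_series_exp_coeff.
Qed.

(** The flanking matrices are kept so that every entry of B exp(tA) C is a single power series,
    whose derivative has the same form with [C] replaced by [A *m C]. *)
Definition exp_mx_coef p q (B : 'M[R]_(p, m)) (C : 'M[R]_(m, q)) i j (n : nat) : R :=
  (B *m A ^+ n *m C) i j / n`!%:R.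

Definition exp_mx (t : R) : 'M[R]_m :=
  \matrix_(i, j) limn (pseries (exp_mx_coef 1%:M 1%:M i j) t).

Let K := 1 + \sum_i \sum_j `|A i j|.

Let K0 : 0 <= K.
Proof. by rewrite addr_ge0// sumr_ge0// => i _; rewrite sumr_ge0. Qed.

Let exp_bound n i j : `|(A ^+ n) i j| <= K ^+ n.
Proof.
elim: n i j => [|n IH] i j.
  by rewrite expr0 mxE; case: (i == j); rewrite ?normr1 ?normr0.
rewrite exprS mxE (le_trans (ler_norm_sum _ _ _))//.
apply: (@le_trans _ _ (\sum_k `|A i k| * K ^+ n)).
  by apply: ler_sum => k _; rewrite normrM ler_wpM2l.
rewrite -mulr_suml exprS ler_wpM2r ?exprn_ge0//.
rewrite /K ler_wpDl// [leRHS](bigD1 i)//= lerDl.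
by rewrite sumr_ge0// => k _; rewrite sumr_ge0.
Qed.

Lemma mulmx3E p q (B : 'M[R]_(p, m)) (M : 'M[R]_m) (C : 'M[R]_(m, q)) i j :
  (B *m M *m C) i j = \sum_k \sum_l B i l * M l k * C k j.
Proof.
by rewrite mxE; apply: eq_bigr => k _; rewrite mxE mulr_suml.
Qed.

Lemma cvg_exp_mx_coef p q (B : 'M[R]_(p, m)) (C : 'M[R]_(m, q)) i j x :
  cvgn (pseries (exp_mx_coef B C i j) x).
Proof.
apply: (@cvg_pseries_exp_bound _ (\sum_k \sum_l `|B i l| * `|C k j|) K) => // n.
rewrite /exp_mx_coef normrM mulrA normfV normr_nat ler_wpM2r ?invr_ge0//.
rewrite mulmx3E (le_trans (ler_norm_sum _ _ _))// mulr_suml ler_sum// => k _.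
rewrite (le_trans (ler_norm_sum _ _ _))// mulr_suml ler_sum// => l _.
by rewrite !normrM mulrAC ler_wpM2l ?mulr_ge0.
Qed.

Lemma exp_mxE p q (B : 'M[R]_(p, m)) (C : 'M[R]_(m, q)) i j t :
  (B *m exp_mx t *m C) i j = limn (pseries (exp_mx_coef B C i j) t).
Proof.
apply/esym/cvg_lim => //; rewrite mulmx3E.
rewrite (_ : pseries _ _ = fun n => \sum_k \sum_l
    (B i l * C k j) * pseries (exp_mx_coef 1%:M 1%:M l k) t n).
  apply: cvg_sumr => k; apply: cvg_sumr => l.
  rewrite mxE mulrAC; apply: cvgZr; exact: cvg_exp_mx_coef.
apply/funext => n; rewrite /pseries /series/=.
under [in RHS]eq_bigr => k _ do under eq_bigr => l _ do rewrite mulr_sumr.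
under [in RHS]eq_bigr => k _ do rewrite exchange_big/=.
rewrite [in RHS]exchange_big/=; apply: eq_bigr => a _.
rewrite /exp_mx_coef mulmx3E !mulr_suml; apply: eq_bigr => k _.
rewrite !mulr_suml; apply: eq_bigr => l _.
by rewrite mul1mx mulmx1; ring.
Qed.

Lemma exp_mx_diffs p q (B : 'M[R]_(p, m)) (C : 'M[R]_(m, q)) i j :
  pseries_diffs (exp_mx_coef B C i j) = exp_mx_coef B (A *m C) i j.
Proof.
apply/funext => n; rewrite /pseries_diffs /exp_mx_coef factS natrM invfM.
rewrite mulrCA mulVKf ?pnatr_eq0//; congr (_ * _); rewrite exprSr.
by rewrite !mulmxA -(mulmxA B).
Qed.

Lemma is_derive_exp_mx p q (B : 'M[R]_(p, m)) (C : 'M[R]_(m, q)) i j (t : R) :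
  is_derive t (1 : R) (fun t => (B *m exp_mx t *m C) i j)
    ((B *m exp_mx t *m (A *m C)) i j).
Proof.
rewrite exp_mxE -exp_mx_diffs.
under eq_fun do rewrite exp_mxE.
apply: (@pseries_snd_diffs _ _ (`|t| + 1)); rewrite ?exp_mx_diffs;
  try exact: cvg_exp_mx_coef.
by rewrite [ltRHS]ger0_norm ?addr_ge0// ltrDl.
Qed.

Lemma mulmx_exp_mx t : A *m exp_mx t = exp_mx t *m A.
Proof.
apply/matrixP => i j.
have := exp_mxE A 1%:M i j t; have := exp_mxE 1%:M A i j t.
rewrite mulmx1 mul1mx => -> ->; congr (limn (pseries _ _)); apply/funext => n.
by rewrite /exp_mx_coef mul1mx mulmx1 -[_ *m _]/(A * A ^+ n) -exprS exprSr.
Qed.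

Lemma exp_mx0 : exp_mx 0 = 1%:M.
Proof.
apply/matrixP => i j; rewrite [LHS]mxE.
set c := exp_mx_coef _ _ _ _.
apply/cvg_lim => //; rewrite -cvg_shiftS/=.
rewrite (_ : (fun n => _) = cst ((1%:M : 'M[R]_m) i j)); first exact: cvg_cst.
apply/funext => n; rewrite /pseries /series/= big_nat_recl//= expr0 mulr1.
rewrite big1 ?addr0 => [|k _]; last by rewrite exprS mul0r mulr0.
by rewrite /c /exp_mx_coef mul1mx mulmx1 expr0 fact0 divr1.
Qed.

Lemma continuous_exp_mx p q (B : 'M[R]_(p, m)) (C : 'M[R]_(m, q)) i j :
  continuous (fun t => (B *m exp_mx t *m C) i j).
Proof.
move=> t; apply: differentiable_continuous; apply/derivable1_diffP.
by have [] := is_derive_exp_mx B C i j t.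
Qed.

(** Differentiating l exp(tA) A^(k+1) D = 0 on the open interval adds one factor A. Letting t tend
    to 0 from the right gives l A^(k+1) D = 0 for all k, so [l] annihilates a matrix of full row
    rank. *)
Lemma exp_mx_kalman d (D : 'M[R]_(m, d)) (l : 'rV[R]_m) (b : R) : 0 < b ->
  \rank (\mxrow_(j < m) (A ^+ j.+1 *m D)) = m ->
  (forall t, 0 < t < b -> l *m A *m exp_mx t *m D = 0) -> l = 0.
Proof.
move=> b0 rk l0.
have h k t : 0 < t < b -> l *m exp_mx t *m (A ^+ k.+1 *m D) = 0.
  elim: k t => [|k IH] t tb.
    by rewrite expr1 mulmxA -(mulmxA l) -mulmx_exp_mx mulmxA l0.
  apply/matrixP => i j; rewrite [RHS]mxE.
  have d1 := is_derive_exp_mx l (A ^+ k.+1 *m D) i j t.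
  have e : A *m (A ^+ k.+1 *m D) = A ^+ k.+2 *m D.
    by rewrite mulmxA [A ^+ k.+2]exprS.
  rewrite e in d1.
  have [_ <-] := d1.
  rewrite (@near_eq_derive _ _ _ _ (cst 0)); first exact: derive_cst.
  near=> s; rewrite IH ?mxE//.
  near: s; have : t \in `]0, b[ by rewrite in_itv.
  by move/near_in_itvoo; apply: filterS => s; rewrite in_itv.
have h0 k : l *m (A ^+ k.+1 *m D) = 0.
  apply/matrixP => i j; rewrite [RHS]mxE.
  have /cvg_at_right_filter := @continuous_exp_mx _ _ l (A ^+ k.+1 *m D) i j 0.
  rewrite exp_mx0 mulmx1 => /cvg_lim <-//; apply/cvg_lim => //; apply: (cvg_near_cst 0).
  near=> s; rewrite h ?mxE//; apply/andP; split.
    by near: s; exact: nbhs_right_gt.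
  by near: s; exact: nbhs_right_lt.
have : l *m \mxrow_(j < m) (A ^+ j.+1 *m D) = 0.
  by rewrite mul_mxrow; apply/matrixP => i j; rewrite mxE h0 !mxE.
have : row_free (\mxrow_(j < m) (A ^+ j.+1 *m D)) by rewrite /row_free rk.
by move=> /mulmx_free_eq0 free /eqP; rewrite free => /eqP.
Unshelve. all: by end_near. Qed.

End MatrixExponential.

(** * Variation of constants *)

Definition bounded_on (T : Type) (R : realType) (D : set T) (f : T -> R) :=
  exists M, forall x, D x -> `|f x| <= M.

Section BoundedOn.
Context (T : Type) (R : realType) (D : set T).

Lemma bounded_on_cst (c : R) : bounded_on D (fun=> c).
Proof. by exists `|c|. Qed.

Lemma bounded_onD (f g : T -> R) :
  bounded_on D f -> bounded_on D g -> bounded_on D (fun x => f x + g x).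
Proof.
move=> [M fM] [N gN]; exists (M + N) => x Dx.
by rewrite (le_trans (ler_normD _ _))// lerD ?fM ?gN.
Qed.

Lemma bounded_onM (f g : T -> R) :
  bounded_on D f -> bounded_on D g -> bounded_on D (fun x => f x * g x).
Proof.
move=> [M fM] [N gN]; exists (M * N) => x Dx.
by rewrite normrM ler_pM ?fM ?gN.
Qed.

Lemma bounded_on_sum (I : Type) (r : seq I) (f : I -> T -> R) :
  (forall i, bounded_on D (f i)) -> bounded_on D (fun x => \sum_(i <- r) f i x).
Proof.
move=> bf; elim: r => [|i r IH].
  by under eq_fun do rewrite big_nil; exact: bounded_on_cst.
by under eq_fun do rewrite big_cons; exact: bounded_onD.
Qed.

Lemma bounded_on_mulmx m n p (f : T -> 'M[R]_(m, n)) (g : T -> 'M[R]_(n, p)) :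
  (forall i j, bounded_on D (fun x => f x i j)) ->
  (forall i j, bounded_on D (fun x => g x i j)) ->
  forall i j, bounded_on D (fun x => (f x *m g x) i j).
Proof.
move=> bf bg i j; under eq_fun do rewrite mxE.
by apply: bounded_on_sum => k; exact: bounded_onM.
Qed.

End BoundedOn.

Lemma integrable_bounded_on d (T : measurableType d) (R : realType)
    (mu : {measure set T -> \bar R}) (D : set T) (f : T -> R) :
  measurable D -> (mu D < +oo)%E -> measurable_fun D f -> bounded_on D f ->
  mu.-integrable D (EFin \o f).
Proof.
move=> mD Doo mf [M fM]; apply: measurable_bounded_integrable => //.
exists M; split; first exact: num_real.
by move=> N MN x Dx /=; rewrite (le_trans (fM x Dx))// ltW.
Qed.

Section TriangleFubini.
Context (R : realType).
Notation leb := (@lebesgue_measure R).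

Lemma lebesgue_segment_lty (a b : R) : (leb `[a, b]%classic < +oo)%E.
Proof. by rewrite lebesgue_measure_itv/=; case: ifP; rewrite ?ltry// -EFinD ltry. Qed.

Section Fubini.
Variables (k : R * R -> R) (t : R).
Hypothesis mk : measurable_fun [set: R * R] k.
Hypothesis bk : bounded_on (`[0, t] `*` `[0, t]) k.

Let tri : set (R * R) := [set p | 0 <= p.2 <= p.1 /\ p.1 <= t].

Let mtri : measurable tri.
Proof.
have -> : tri = [set p | 0 <= p.2] `&` [set p | p.2 <= p.1] `&` [set p | p.1 <= t].
  apply/seteqP; split => -[s r]/=; first by move=> [/andP[? ?] ?].
  by move=> [[? ?] ?]; split => //; apply/andP.
by apply: measurableI; first apply: measurableI; apply: measurable_set_le.
Qed.

Let sq : set (measurableTypeR R * measurableTypeR R)%type := `[0, t] `*` `[0, t].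

Let msq : measurable sq. Proof. exact: measurableX. Qed.

Let sqoo : ((leb \x leb)%E sq < +oo)%E.
Proof.
rewrite product_measure1E// lte_mul_pinfty//; last exact: lebesgue_segment_lty.
by rewrite ge0_fin_numE//; exact: lebesgue_segment_lty.
Qed.

Let g (p : R * R) : R := k p * \1_tri p.

Let tri_sq : tri `<=` sq.
Proof.
move=> [s r]/= [/andP[r0 rs] st]; rewrite /sq/= !in_itv/= r0 st.
by rewrite (le_trans r0 rs) (le_trans rs st).
Qed.

Let mg : measurable_fun setT g.
Proof. by apply: measurable_funM => //; exact: measurable_indic. Qed.

Let ig : (leb \x leb)%E.-integrable setT (EFin \o g).
Proof.
have -> : EFin \o g = (EFin \o g) \_ sq.
  apply/funext => p; rewrite patchE; case: ifPn => //.
  rewrite notin_setE => h; rewrite /= /g indicE memNset ?mulr0//.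
  by apply: contra_not h; exact: tri_sq.
apply/(@integrable_mkcond _ _ _ _ sq) => //.
apply: integrable_bounded_on => //; first exact: measurable_funTS.
have [M kM] := bk; exists M => p sp; rewrite /g indicE.
have [_|_] := boolP (p \in tri); first by rewrite mulr1 kM.
by rewrite mulr0 normr0 (le_trans _ (kM _ sp)).
Qed.

Let inner1 s : 0 <= s <= t -> (\int[leb]_(r in `[0%R, s]) (k (s, r))%:E =
  fubini_F leb (EFin \o g) s)%E.
Proof.
move=> /andP[s0 st]; rewrite integral_mkcond /fubini_F.
apply: eq_integral => r _ /=.
rewrite patchE /g indicE; case: ifPn; rewrite ?inE ?notin_setE /= in_itv/= => h.
  by rewrite mem_set ?mulr1//= /tri/= h.
by rewrite memNset ?mulr0//= /tri/= => -[].
Qed.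

Let inner2 r : 0 <= r <= t -> (\int[leb]_(s in `[r, t]) (k (s, r))%:E =
  fubini_G leb (EFin \o g) r)%E.
Proof.
move=> /andP[r0 rt]; rewrite integral_mkcond /fubini_G.
apply: eq_integral => s _ /=.
rewrite patchE /g indicE; case: ifPn; rewrite ?inE ?notin_setE /= in_itv/= => h.
  by rewrite mem_set ?mulr1//= /tri/= r0; case/andP: h.
rewrite memNset ?mulr0//= /tri/= r0/= => -[rs st].
by move: h; rewrite rs st.
Qed.

Let fin1 s : 0 <= s <= t ->
  (\int[leb]_(r in `[0%R, s]) (k (s, r))%:E)%E \is a fin_num.
Proof.
move=> /andP[s0 st]; apply: integrable_fin_num => //.
apply: integrable_bounded_on => //; first exact: lebesgue_segment_lty.
  by apply: measurable_funTS; apply: measurableT_comp => //; exact: measurable_fun_pair.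
have [M kM] := bk; exists M => r; rewrite /= in_itv/= => /andP[r0 rs].
by apply: kM; rewrite /= !in_itv/= s0 st r0 (le_trans rs).
Qed.

Let fin2 r : 0 <= r <= t ->
  (\int[leb]_(s in `[r, t]) (k (s, r))%:E)%E \is a fin_num.
Proof.
move=> /andP[r0 rt]; apply: integrable_fin_num => //.
apply: integrable_bounded_on => //; first exact: lebesgue_segment_lty.
  by apply: measurable_funTS; apply: (measurableT_comp (f := k)) => //; exact: measurable_fun_pair.
have [M kM] := bk; exists M => s; rewrite /= in_itv/= => /andP[rs st].
by apply: kM; rewrite /= !in_itv/= rt st r0 (le_trans r0).
Qed.

Lemma triangle_integrable :
  leb.-integrable `[0, t] (EFin \o (fun s => \int[leb]_(r in `[0, s]) k (s, r))).
Proof.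
have iF := integrable_fubini_F ig.
apply: (@eq_integrable _ _ _ leb _ _ (fubini_F leb (EFin \o g))) => //.
  move=> s; rewrite inE/= in_itv/= => h.
  by rewrite -inner1// /Rintegral fineK// fin1.
by apply: integrableS iF.
Qed.

Lemma triangle_fubini :
  \int[leb]_(s in `[0, t]) (\int[leb]_(r in `[0, s]) k (s, r)) =
  \int[leb]_(r in `[0, t]) (\int[leb]_(s in `[r, t]) k (s, r)).
Proof.
rewrite /Rintegral; congr fine.
transitivity (\int[leb]_s fubini_F leb (EFin \o g) s)%E.
  rewrite integral_mkcond; apply: eq_integral => s _ /=.
  rewrite patchE; case: ifPn; rewrite ?inE ?notin_setE /= in_itv/= => h.
    by rewrite fineK ?fin1// inner1.
  rewrite /fubini_F integral0_eq// => r _ /=; rewrite /g indicE memNset ?mulr0//.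
  by move=> [/andP[/= r0 rs] st]; apply: h; rewrite (le_trans r0 rs).
rewrite -[RHS]/(\int[leb]_(r in _) _)%E.
transitivity (\int[leb]_r fubini_G leb (EFin \o g) r)%E; first exact: Fubini.
rewrite [RHS]integral_mkcond; apply: eq_integral => r _ /=.
rewrite patchE; case: ifPn; rewrite ?inE ?notin_setE /= in_itv/= => h.
  by rewrite fineK ?fin2// inner2.
rewrite /fubini_G integral0_eq// => s _ /=; rewrite /g indicE memNset ?mulr0//.
by move=> [/andP[/= r0 rs] st]; apply: h; rewrite r0 (le_trans rs st).
Qed.

End Fubini.

Lemma Rintegral_sum d (T : measurableType d) (mu : {measure set T -> \bar R})
    (D : set T) (I : Type) (r : seq I) (f : I -> T -> R) :
  measurable D -> (forall i, mu.-integrable D (EFin \o f i)) ->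
  \int[mu]_(x in D) (\sum_(i <- r) f i x) = \sum_(i <- r) \int[mu]_(x in D) f i x.
Proof.
move=> mD intf; elim: r => [|i r IH].
  under eq_Rintegral do rewrite big_nil.
  by rewrite big_nil Rintegral_cst// mul0r.
under eq_Rintegral do rewrite big_cons.
rewrite big_cons RintegralD ?IH//.
rewrite (_ : EFin \o _ = fun x => (\sum_(j <- r) (EFin \o f j) x)%E).
  exact: integrable_sum.
by apply/funext => x /=; rewrite sumEFin.
Qed.

Section VariationOfConstants.
Variables (m : nat) (A : 'M[R]_m).

Lemma measurable_exp_mx d (T : measurableType d) (D : set T) (f : T -> R) :
  measurable_fun D f -> measurable_fun D (fun x => exp_mx A (f x)).
Proof.
move=> mf; apply: measurable_fun_mx => i j.
apply: (measurableT_comp (f := fun t => exp_mx A t i j)) => //.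
apply: continuous_measurable_fun => t.
have := @continuous_exp_mx R m A m m 1%:M 1%:M i j t.
by under eq_fun do rewrite mul1mx mulmx1.
Qed.

Lemma bounded_exp_mx (a b : R) i j : bounded_on `[a, b] (fun t => exp_mx A t i j).
Proof.
have c : {within `[a, b], continuous (fun t => exp_mx A t i j)}.
  apply: continuous_subspaceT => t.
  have := @continuous_exp_mx R m A m m 1%:M 1%:M i j t.
  by under eq_fun do rewrite mul1mx mulmx1.
have /compact_bounded[M [_ mrt]] := continuous_compact c (@segment_compact R a b).
exists (M + 1) => x xab; apply: (mrt (M + 1)); first by rewrite ltrDl.
by exists x.
Qed.

Lemma integral_exp_mx (r t : R) p (B : 'M[R]_(p, m)) (v : 'cV[R]_m) i : r <= t ->
  \int[leb]_(s in `[r, t]) (B *m exp_mx A (s - r) *m (A *m v)) i 0 =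
  (B *m exp_mx A (t - r) *m v) i 0 - (B *m v) i 0.
Proof.
rewrite le_eqVlt => /predU1P[->|rt].
  by rewrite set_itv1 Rintegral_set1 subrr exp_mx0 mulmx1 subrr.
pose F s := (B *m exp_mx A (s - r) *m v) i 0.
have dF s : is_derive s (1 : R) F ((B *m exp_mx A (s - r) *m (A *m v)) i 0).
  have d1 := @is_derive_exp_mx R m A p 1 B v i 0 (s - r).
  have d2 : is_derive s (1 : R) (fun s => s - r) 1.
    rewrite (_ : (fun s => s - r) = (id - cst r))//.
    by apply: is_derive_eq; rewrite subr0.
  have := @is_derive1_comp _ (fun t => (B *m exp_mx A t *m v) i 0) (fun s => s - r) s _ _ d1 d2.
  by rewrite ?scale1r ?mul1r ?mulr1.
have cF : continuous F.
  move=> s; apply: differentiable_continuous; apply/derivable1_diffP.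
  by have [] := dF s.
rewrite /Rintegral (@continuous_FTC2 _ _ F)//.
- by rewrite -EFinB/= /F subrr exp_mx0 mulmx1.
- apply: continuous_subspaceT => s.
  apply: (@continuous_comp _ _ _ (fun s => s - r)
    (fun t => (B *m exp_mx A t *m (A *m v)) i 0)).
    by apply: cvgB; [exact: cvg_id|exact: cvg_cst].
  exact: continuous_exp_mx.
- split; first by move=> s _; have [] := dF s.
  + by apply: cvg_at_right_filter; exact: cF.
  + by apply: cvg_at_left_filter; exact: cF.
- by move=> s _; rewrite derive1E; have [_ ->] := dF s.
Qed.

Lemma integral_exp_mx_rev (r t : R) p (B : 'M[R]_(p, m)) (v : 'cV[R]_m) i : r <= t ->
  \int[leb]_(s in `[r, t]) (B *m exp_mx A (t - s) *m (A *m v)) i 0 =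
  (B *m exp_mx A (t - r) *m v) i 0 - (B *m v) i 0.
Proof.
rewrite le_eqVlt => /predU1P[->|rt].
  by rewrite set_itv1 Rintegral_set1 subrr exp_mx0 mulmx1 subrr.
pose F s := - (B *m exp_mx A (t - s) *m v) i 0.
have dF s : is_derive s (1 : R) F ((B *m exp_mx A (t - s) *m (A *m v)) i 0).
  have d1 := @is_derive_exp_mx R m A p 1 B v i 0 (t - s).
  have d2 : is_derive s (1 : R) (fun s => t - s) (-1).
    rewrite (_ : (fun s => t - s) = (cst t - id))//.
    by apply: is_derive_eq; rewrite sub0r.
  have := is_deriveN (@is_derive1_comp _ (fun t => (B *m exp_mx A t *m v) i 0) (fun s => t - s) s _ _ d1 d2).
  by rewrite ?mulN1r ?mulrN1 ?opprK.
have cF : continuous F.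
  move=> s; apply: differentiable_continuous; apply/derivable1_diffP.
  by have [] := dF s.
rewrite /Rintegral (@continuous_FTC2 _ _ F)//.
- by rewrite -EFinB/= /F subrr exp_mx0 mulmx1 opprK addrC.
- apply: continuous_subspaceT => s.
  apply: (@continuous_comp _ _ _ (fun s => t - s)
    (fun t => (B *m exp_mx A t *m (A *m v)) i 0)).
    by apply: cvgB; [exact: cvg_cst|exact: cvg_id].
  exact: continuous_exp_mx.
- split; first by move=> s _; have [] := dF s.
  + by apply: cvg_at_right_filter; exact: cF.
  + by apply: cvg_at_left_filter; exact: cF.
- by move=> s _; rewrite derive1E; have [_ ->] := dF s.
Qed.

Lemma mulmx_vintegral p (D : set R) (B : 'M[R]_(p, m)) (f : R -> 'cV[R]_m) :
  measurable D -> (forall i, leb.-integrable D (EFin \o (fun s => f s i 0))) ->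
  B *m vintegral leb D f = vintegral leb D (fun s => B *m f s).
Proof.
move=> mD intf; apply/matrixP => i j; rewrite !mxE.
under [RHS]eq_Rintegral do rewrite mxE.
have h k : leb.-integrable D (EFin \o (fun s => B i k * f s k 0)).
  rewrite (_ : EFin \o _ = fun x => ((B i k)%:E * (EFin \o (fun s => f s k 0%R)) x)%E).
    exact: integrableZl.
  by apply/funext => x /=; rewrite EFinM.
rewrite Rintegral_sum//.
by apply: eq_bigr => k _; rewrite mxE RintegralZl.
Qed.

(** The path is merely measurable and bounded, so it cannot be differentiated. Instead [v] is
    replaced by x minus the integral of Ax, and the resulting double integral over the triangle r <=
    s is computed by Fubini. *)
Lemma variation_of_constants (x v : R -> 'cV[R]_m) (t : R) : 0 <= t ->
  measurable_fun setT x -> (forall i, bounded_on `[0, t] (fun s => x s i 0)) ->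
  (forall s, 0 <= s <= t ->
     x s = vintegral leb `[0, s] (fun r => A *m x r) + v s) ->
  x t = v t + vintegral leb `[0, t] (fun s => exp_mx A (t - s) *m A *m v s).
Proof.
move=> t0 mx bx eqx.
have mAx : measurable_fun setT (fun r => A *m x r).
  by apply: measurable_fun_mulmx => //; exact: measurable_cst.
have bAx i j : bounded_on `[0, t] (fun r => (A *m x r) i j).
  apply: bounded_on_mulmx => [a b|a b]; first exact: bounded_on_cst.
  by rewrite ord1; exact: bx.
have mE : measurable_fun [set: R] (fun s => exp_mx A (t - s)).
  by apply: measurable_exp_mx; exact: measurable_funB.
have bE i j : bounded_on `[0, t] (fun s => exp_mx A (t - s) i j).
  have [M EM] := @bounded_exp_mx 0 t i j; exists M => s.
  by rewrite /= in_itv/= => /andP[s0 st]; apply: EM; rewrite /= in_itv/=; lra.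
rewrite (eqx t) ?t0/=; last by rewrite lexx.
rewrite addrC; congr (_ + _); apply/matrixP => i j; rewrite ord1 !mxE {j}.
pose k (p : R * R) := (exp_mx A (t - p.1) *m (A *m (A *m x p.2))) i 0.
have mk : measurable_fun setT k.
  apply: measurable_fun_mx_entry; apply: measurable_fun_mulmx.
    by apply: (measurableT_comp mE); exact: measurable_fst.
  apply: measurable_fun_mulmx; first exact: measurable_cst.
  by apply: (measurableT_comp mAx); exact: measurable_snd.
have bk : bounded_on (`[0, t] `*` `[0, t]) k.
  apply: bounded_on_mulmx => [a b|a b].
    by have [M EM] := bE a b; exists M => p [/= p1 p2]; exact: EM.
  apply: bounded_on_mulmx => [a' b'|a' b']; first exact: bounded_on_cst.
  by have [M EM] := bAx a' b'; exists M => p [/= p1 p2]; exact: EM.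
have I1 : leb.-integrable `[0, t] (EFin \o (fun s => (exp_mx A (t - s) *m (A *m x s)) i 0)).
  apply: integrable_bounded_on => //; first exact: lebesgue_segment_lty.
    apply: measurable_funTS; apply: measurable_fun_mx_entry.
    exact: measurable_fun_mulmx.
  exact: bounded_on_mulmx.
have I3 : leb.-integrable `[0, t] (EFin \o (fun s => (A *m x s) i 0)).
  apply: integrable_bounded_on => //; first exact: lebesgue_segment_lty.
  by apply: measurable_funTS; exact: measurable_fun_mx_entry.
have -> : \int[leb]_(s in `[0, t]) (exp_mx A (t - s) *m A *m v s) i 0 =
  \int[leb]_(s in `[0, t]) ((exp_mx A (t - s) *m (A *m x s)) i 0 -
     \int[leb]_(r in `[0, s]) k (s, r)).
  apply: eq_Rintegral => s; rewrite inE/= in_itv/= => /andP[s0 st].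
  have -> : v s = x s - vintegral leb `[0, s] (fun r => A *m x r).
    by have := eqx s; rewrite s0 st => /(_ isT) ->; rewrite addrAC subrr add0r.
  rewrite mulmxBr [LHS]mxE -!mulmxA; congr (_ + _); rewrite [LHS]mxE; congr (- _).
  rewrite mulmx_vintegral// => [|a].
    rewrite mulmx_vintegral// => [|a]; first by rewrite mxE.
    apply: integrable_bounded_on => //; first exact: lebesgue_segment_lty.
      apply: measurable_funTS; apply: measurable_fun_mx_entry.
      by apply: measurable_fun_mulmx => //; exact: measurable_cst.
    apply: bounded_on_mulmx => [a' b'|a' b']; first exact: bounded_on_cst.
    have [M EM] := bAx a' b'; exists M => r; rewrite /= in_itv/= => /andP[r0 rs].
    by apply: EM; rewrite /= in_itv/= r0 (le_trans rs).
  apply: integrable_bounded_on => //; first exact: lebesgue_segment_lty.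
    by apply: measurable_funTS; apply: measurable_fun_mx_entry.
  have [M EM] := bAx a 0; exists M => r; rewrite /= in_itv/= => /andP[r0 rs].
  by apply: EM; rewrite /= in_itv/= r0 (le_trans rs).
rewrite RintegralB//; last exact: triangle_integrable.
rewrite triangle_fubini//.
(* The inner integral in s has an explicit primitive. Its term at s = r cancels the single integral,
   and its term at s = t leaves the integral of Ax. *)
rewrite (_ : \int[leb]_(r in `[0, t]) (\int[leb]_(s in _) _) = \int[leb]_(r in `[0, t])
    ((exp_mx A (t - r) *m (A *m x r)) i 0 - (A *m x r) i 0)).
  by rewrite RintegralB// subKr.
apply: eq_Rintegral => r; rewrite inE/= in_itv/= => /andP[r0 rt].
have := integral_exp_mx_rev 1%:M (A *m x r) i rt.
by rewrite !mul1mx => <-; apply: eq_Rintegral => s _; rewrite mul1mx.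
Qed.

(** Needed to construct a solution: the formula is inserted into the equation and the same triangle
    is integrated in the other order. *)
Lemma variation_of_constants_solution (v : R -> 'cV[R]_m) (t : R) : 0 <= t ->
  measurable_fun setT v -> (forall i, bounded_on `[0, t] (fun s => v s i 0)) ->
  let x s := v s + vintegral leb `[0, s] (fun r => exp_mx A (s - r) *m A *m v r) in
  x t = vintegral leb `[0, t] (fun s => A *m x s) + v t.
Proof.
move=> t0 mv bv x.
have mAv : measurable_fun setT (fun r => A *m v r).
  by apply: measurable_fun_mulmx => //; exact: measurable_cst.
have bAv i j : bounded_on `[0, t] (fun r => (A *m v r) i j).
  apply: bounded_on_mulmx => [a b|a b]; first exact: bounded_on_cst.
  by rewrite ord1; exact: bv.
have bE i j : bounded_on (`[0, t] `*` `[0, t]) (fun p => exp_mx A (p.1 - p.2) i j).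
  have [M EM] := @bounded_exp_mx (- t) t i j; exists M => -[s r] /= [].
  rewrite /= !in_itv/= => /andP[s0 st] /andP[r0 rt].
  by apply: EM; rewrite /= in_itv/=; lra.
rewrite {1}/x addrC; congr (_ + _); apply/matrixP => i j; rewrite ord1 !mxE {j}.
pose k (p : R * R) := (exp_mx A (p.1 - p.2) *m (A *m (A *m v p.2))) i 0.
have mk : measurable_fun setT k.
  apply: measurable_fun_mx_entry; apply: measurable_fun_mulmx.
    by apply: measurable_exp_mx; exact: measurable_funB.
  apply: measurable_fun_mulmx; first exact: measurable_cst.
  by apply: (measurableT_comp mAv); exact: measurable_snd.
have bk : bounded_on (`[0, t] `*` `[0, t]) k.
  apply: bounded_on_mulmx => [a b|a b]; first exact: bE.
  apply: bounded_on_mulmx => [a' b'|a' b']; first exact: bounded_on_cst.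
  by have [M EM] := bAv a' b'; exists M => p [/= p1 p2]; exact: EM.
have I1 : leb.-integrable `[0, t] (EFin \o (fun s => (exp_mx A (t - s) *m (A *m v s)) i 0)).
  apply: integrable_bounded_on => //; first exact: lebesgue_segment_lty.
    apply: measurable_funTS; apply: measurable_fun_mx_entry.
    apply: measurable_fun_mulmx => //.
    by apply: measurable_exp_mx; exact: measurable_funB.
  apply: bounded_on_mulmx => // a b.
  have [M EM] := bE a b; exists M => s st; apply: (EM (t, s)); split => //=.
  by rewrite in_itv/= t0 lexx.
have I3 : leb.-integrable `[0, t] (EFin \o (fun s => (A *m v s) i 0)).
  apply: integrable_bounded_on => //; first exact: lebesgue_segment_lty.
  by apply: measurable_funTS; exact: measurable_fun_mx_entry.
have -> : \int[leb]_(s in `[0, t]) (A *m x s) i 0 =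
  \int[leb]_(s in `[0, t]) ((A *m v s) i 0 +
     \int[leb]_(r in `[0, s]) k (s, r)).
  apply: eq_Rintegral => s; rewrite inE/= in_itv/= => /andP[s0 st].
  rewrite mulmxDr [LHS]mxE; congr (_ + _).
  rewrite mulmx_vintegral// => [|a].
    rewrite mxE; apply: eq_Rintegral => r _; rewrite /k/=.
    by rewrite !mulmxA mulmx_exp_mx.
  apply: integrable_bounded_on => //; first exact: lebesgue_segment_lty.
    apply: measurable_funTS; apply: measurable_fun_mx_entry.
    apply: measurable_fun_mulmx => //; apply: measurable_fun_mulmx => //.
    by apply: measurable_exp_mx; exact: measurable_funB.
  rewrite (_ : (fun r => _) = fun r => (exp_mx A (s - r) *m (A *m v r)) a 0); last first.
    by apply/funext => r; rewrite mulmxA.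
  apply: bounded_on_mulmx => a' b'.
    have [M EM] := bE a' b'; exists M => r; rewrite /= in_itv/= => /andP[r0 rs].
    by apply: (EM (s, r)); rewrite /= !in_itv/= s0 st r0 (le_trans rs).
  have [M EM] := bAv a' b'; exists M => r; rewrite /= in_itv/= => /andP[r0 rs].
  by apply: EM; rewrite /= in_itv/= r0 (le_trans rs).
rewrite RintegralD//; last exact: triangle_integrable.
rewrite triangle_fubini//.
rewrite (_ : \int[leb]_(r in `[0, t]) (\int[leb]_(s in _) _) = \int[leb]_(r in `[0, t])
    ((exp_mx A (t - r) *m (A *m v r)) i 0 - (A *m v r) i 0)).
  rewrite RintegralB// addrC subrK.
  by apply: eq_Rintegral => r _; rewrite mulmxA.
apply: eq_Rintegral => r; rewrite inE/= in_itv/= => /andP[r0 rt].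
have := integral_exp_mx 1%:M (A *m v r) i rt.
by rewrite !mul1mx => <-; apply: eq_Rintegral => s _; rewrite mul1mx.
Qed.

End VariationOfConstants.

End TriangleFubini.

(** * Independence of generated sigma-algebras *)

Section Independence.
Context (R : realType) (disp : measure_display) (Omega : measurableType disp).
Local Open Scope ereal_scope.
Implicit Types (F G S : set (set Omega)).

Lemma sub_sigma_measurable S : S `<=` measurable -> <<s S >> `<=` @measurable _ Omega.
Proof. by move=> Sm; apply: smallest_sub => //; exact: sigma_algebra_measurable. Qed.

(* For a finite measure q of total mass c, independence of A and B under the
   normalized measure reads q (A `&` B) * c = q A * q B. *)
Lemma indep_sigma_l (q : {measure set Omega -> \bar R}) S G :
  q setT < +oo -> S `<=` measurable -> setI_closed S -> S setT ->
  G `<=` measurable ->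
  (forall A B, S A -> G B -> q (A `&` B) * q setT = q A * q B) ->
  forall A B, <<s S >> A -> G B -> q (A `&` B) * q setT = q A * q B.
Proof.
move=> qoo Sm SI ST Gm h A B SA GB.
have mB := Gm _ GB.
have fq C : measurable C -> q C \is a fin_num.
  by move=> mC; rewrite ge0_fin_numE// (le_lt_trans _ qoo)// le_measure// inE.
have c0 : (0 <= fine (q setT))%R by exact: fine_ge0.
have b0 : (0 <= fine (q B))%R by exact: fine_ge0.
pose m1 := mscale (NngNum c0) (restm q mB).
pose m2 := mscale (NngNum b0) q.
have m1E C : m1 C = q (C `&` B) * q setT by rewrite /m1/= /mscale/= fineK ?fq// muleC.
have m2E C : m2 C = q C * q B by rewrite /m2/= /mscale/= fineK ?fq// muleC.
rewrite -m1E -m2E.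
apply: (g_sigma_algebra_measure_unique S _ (fun=> setT)) => //.
- by apply/seteqP; split => // x _; exists 0%N.
- by move=> C SC; rewrite [LHS]m1E [RHS]m2E; exact: h.
- by move=> k; rewrite [ltLHS]m1E setTI lte_mul_pinfty ?fq.
Qed.

Lemma indep_sigma (q : {measure set Omega -> \bar R}) S G :
  q setT < +oo -> S `<=` measurable -> setI_closed S -> S setT ->
  G `<=` measurable -> setI_closed G -> G setT ->
  (forall A B, S A -> G B -> q (A `&` B) * q setT = q A * q B) ->
  forall A B, <<s S >> A -> <<s G >> B -> q (A `&` B) * q setT = q A * q B.
Proof.
move=> qoo Sm SI ST Gm GI GT h A B SA GB.
have h1 : forall A B, <<s S >> A -> G B -> q (A `&` B) * q setT = q A * q B.
  exact: indep_sigma_l.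
rewrite setIC muleC [RHS]muleC [LHS]muleC.
apply: (@indep_sigma_l q G <<s S >>) => //; first exact: sub_sigma_measurable.
by move=> C D GC SD; rewrite setIC h1// muleC.
Qed.

Lemma independent_systems_sigma (P : probability Omega R) S G :
  S `<=` measurable -> setI_closed S -> S setT ->
  G `<=` measurable -> setI_closed G -> G setT ->
  independent_systems P S G -> independent_systems P <<s S >> <<s G >>.
Proof.
move=> Sm SI ST Gm GI GT h A B SA GB.
have h' C D : S C -> G D -> P (C `&` D) * P setT = P C * P D.
  by move=> SC GD; rewrite probability_setT mule1 h.
have -> : P (A `&` B) = P (A `&` B) * P setT by rewrite probability_setT mule1.
have Poo : P setT < +oo by rewrite probability_setT ltry.
exact: (indep_sigma Poo Sm SI ST Gm GI GT h').
Qed.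

(** Measurability for a sub-sigma-algebra is expressed, here and below, as measurability on [Omega]
    retyped with the generated sigma-algebra. *)
Lemma sigma_generated_measurable_fun d (T : measurableType d) (I : Type)
    (S : set I) (X : I -> Omega -> T) i : S i ->
  measurable_fun (setT : set (g_sigma_algebraType
    (\bigcup_(i in S) preimage_set_system setT (X i) measurable))) (X i).
Proof.
move=> Si _ B mB; apply: sub_sigma_algebra; exists i => //.
by exists B.
Qed.

Lemma sub_sigma_generated d (T : measurableType d) (I : Type)
    (S S' : set I) (X : I -> Omega -> T) : S `<=` S' ->
  sigma_generated S X `<=` sigma_generated S' X.
Proof.
move=> SS'; apply: sub_smallest2r; first exact: smallest_sigma_algebra.
have h : \bigcup_(i in S) preimage_set_system setT (X i) measurable `<=`
    \bigcup_(i in S') preimage_set_system setT (X i) measurable.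
  exact: bigcup_subset.
exact: h.
Qed.

Lemma sigma_generated_measurable d (T : measurableType d) (I : Type)
    (S : set I) (X : I -> Omega -> T) :
  (forall i, S i -> measurable_fun setT (X i)) ->
  sigma_generated S X `<=` measurable.
Proof.
move=> mX; apply: sub_sigma_measurable => _ [i Si [B mB <-]].
exact: mX.
Qed.

Section Grouping.
Context (P : probability Omega R) d (T : measurableType d) (N : nat).
Variable X : 'I_N -> Omega -> T.
Hypothesis mX : forall i, measurable_fun setT (X i).
Hypothesis iX : mutually_independent P X.

Let rect (J : pred 'I_N) : set (set Omega) :=
  [set C | exists2 A : 'I_N -> set T,
     (forall i, measurable (A i)) /\ (forall i, ~~ J i -> A i = setT) &
     C = \bigcap_(i in [set: 'I_N]) (X i @^-1` A i)].

Let rectI J : setI_closed (rect J).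
Proof.
move=> _ _ [A [mA A1] ->] [B [mB B1] ->]; exists (fun i => A i `&` B i).
  by split=> i; [exact: measurableI|move=> Ji; rewrite A1// B1// setTI].
by rewrite -bigcapI.
Qed.

Let rectT J : rect J setT.
Proof.
exists (fun=> setT) => //; apply/seteqP; split => //.
Qed.

Let rect_measurable J : rect J `<=` measurable.
Proof.
move=> _ [A [mA _] ->]; apply: fin_bigcap_measurable => // i _.
by rewrite -[X in measurable X]setTI; exact: mX.
Qed.

Lemma sigma_rect (J : pred 'I_N) : sigma_generated [set i | J i] X `<=` <<s rect J >>.
Proof.
apply: smallest_sub; first exact: smallest_sigma_algebra.
move=> _ [i Ji [B mB <-]]; apply: sub_sigma_algebra.
exists (fun k => if k == i then B else setT).
  split=> k; first by case: ifP.
  by move=> Jk; case: eqP => // ki; move: Jk; rewrite ki Ji.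
rewrite setTI; apply/seteqP; split => w /=.
  by move=> Bw k _ /=; case: ifP => // /eqP ->.
by move=> /(_ i I)/=; rewrite eqxx.
Qed.

(** Rectangles that leave the coordinates outside a group free form a generating pi-system for that
    group, and two rectangles from complementary groups intersect in a rectangle, to which [iX]
    applies. *)
Lemma independent_grouping (J : pred 'I_N) :
  independent_systems P (sigma_generated [set i | J i] X)
                        (sigma_generated [set i | ~~ J i] X).
Proof.
move=> C D CJ DJ; move: (sigma_rect CJ) (@sigma_rect (predC J) D DJ) => {}CJ {}DJ.
apply: (@independent_systems_sigma P (rect J) (rect (predC J))) => //.
move=> _ _ [A [mA A1] ->] [B [mB B1] ->].
rewrite -bigcapI.
under eq_bigcapr do rewrite -preimage_setI.
rewrite !iX//; last by move=> i; exact: measurableI.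
rewrite -big_split/=; apply: eq_bigr => i _.
have [Ji|Ji] := boolP (J i).
  by rewrite (B1 i) ?negbK//= setIT preimage_setT probability_setT mule1.
by rewrite (A1 i)//= setTI preimage_setT probability_setT mul1e.
Qed.

End Grouping.

End Independence.

(** * Poisson random measures *)

Lemma bigsetU_mem (T : Type) (I : finType) (Q : pred I) (f : I -> set T) x :
  (\big[setU/set0]_(k | Q k) f k) x <-> exists2 k, Q k & f k x.
Proof.
split; first by elim/big_rec: _ => // k A Qk IH [fx|/IH//]; exists k.
by move=> [k Qk fx]; rewrite (bigD1 k)//=; left.
Qed.

Section PoissonIndependence.
Context (R : realType) (disp : measure_display) (Omega : measurableType disp).
Context (P : probability Omega R).
Context (d : measure_display) (T : measurableType d).
Variables (lam : set T -> \bar R) (nu : Omega -> {measure set T -> \bar R}).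
Hypothesis prm : is_poisson_random_measure P lam nu.
Local Open Scope ereal_scope.

Definition prm_sigma (E : set T) : set (set Omega) :=
  sigma_generated [set F | measurable F /\ F `<=` E] (fun F w => nu w F).

Lemma measurable_prm F : measurable F -> measurable_fun setT (fun w => nu w F).
Proof. by case: prm => + _ _ _; exact. Qed.

Lemma prm_sigma_measurable E : prm_sigma E `<=` measurable.
Proof. by apply: sigma_generated_measurable => F [mF _]; exact: measurable_prm. Qed.

Lemma sub_prm_sigma E E' : E `<=` E' -> prm_sigma E `<=` prm_sigma E'.
Proof.
by move=> EE'; apply: sub_sigma_generated => F [mF FE]; split => //; exact: subset_trans EE'.
Qed.

Let cyl E : set (set Omega) := [set C | exists n (F : nat -> set T) (B : nat -> set (\bar R)),
  (forall i, [/\ measurable (F i), F i `<=` E & measurable (B i)]) /\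
  C = \bigcap_(i in `I_n) ((fun w => nu w (F i)) @^-1` B i)].

Let cyl_measurable E : cyl E `<=` measurable.
Proof.
move=> _ [n [F [B [h ->]]]]; apply: fin_bigcap_measurable => [|i _].
  exact: finite_II.
have [mF _ mB] := h i; rewrite -[X in measurable X]setTI; exact: measurable_prm.
Qed.

Let cylT E : cyl E setT.
Proof.
exists 0%N, (fun=> set0), (fun=> setT); split; first by move=> _; split.
by apply/seteqP; split.
Qed.

Let cylI E : setI_closed (cyl E).
Proof.
move=> _ _ [n [F [B [h ->]]]] [n' [F' [B' [h' ->]]]].
exists (n + n')%N, (fun i => if (i < n)%N then F i else F' (i - n)%N),
  (fun i => if (i < n)%N then B i else B' (i - n)%N).
split; first by move=> i; case: ifP.
apply/seteqP; split => w /=.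
  move=> [h1 h2] i /= ii; case: ifP => il; first exact: h1.
  by apply: h2; rewrite /= ltn_subLR// leqNgt il.
move=> h0; split => i /= ii.
  by have := h0 i; rewrite /= ii ltn_addr// => /(_ isT).
have := h0 (n + i)%N; rewrite /= ltn_add2l ii => /(_ isT).
by rewrite ltnNge leq_addr/= addKn.
Qed.

Let sub_cyl E : prm_sigma E `<=` <<s cyl E >>.
Proof.
apply: smallest_sub; first exact: smallest_sigma_algebra.
move=> _ [F [mF FE] [B mB <-]]; apply: sub_sigma_algebra.
exists 1%N, (fun=> F), (fun=> B); split => //.
rewrite setTI; apply/seteqP; split => w /=; first by move=> h i _.
by move=> /(_ 0%N); exact.
Qed.

Section Atoms.
Variables (K : finType) (G : K -> set T).
Hypothesis mG : forall i, measurable (G i).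

(** Independence of counts is given for disjoint sets only. Overlapping sets are therefore cut into
    the atoms of the Boolean algebra they generate, and each count becomes a sum of independent
    counts. *)
Definition atom (S : {ffun K -> bool}) : set T :=
  [set x | forall i, `[< G i x >] = S i].

Lemma measurable_atom S : measurable (atom S).
Proof.
rewrite (_ : atom S = \bigcap_(i in [set: K]) (if S i then G i else ~` G i)).
  apply: fin_bigcap_measurable => // i _; case: ifP => _ //; exact: measurableC.
apply/seteqP; split => x /= h i.
  move=> _; have := h i; case: (S i); first by move/asboolP.
  by move/asboolP.
by have := h i I; case: (S i) => ?; apply/asboolP.
Qed.

Lemma atom_disjoint S S' : atom S `&` atom S' !=set0 -> S = S'.
Proof. by move=> [x [h h']]; apply/ffunP => i; rewrite -h -h'. Qed.

Definition atom_sign (k : 'I_#|{ffun K -> bool}|) : {ffun K -> bool} :=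
  enum_val k.

Definition atom_seq (k : 'I_#|{ffun K -> bool}|) : set T := atom (atom_sign k).

Lemma trivIset_atom_seq D : trivIset D atom_seq.
Proof. by move=> i j _ _ /atom_disjoint /enum_val_inj. Qed.

Lemma measure_atoms (m : {measure set T -> \bar R}) i
    (Q : pred 'I_#|{ffun K -> bool}|) :
  (forall k, Q k -> atom_sign k i) ->
  (forall k, atom_sign k i -> ~~ Q k -> atom_seq k = set0) ->
  m (G i) = \sum_(k < #|{ffun K -> bool}| | Q k) m (atom_seq k).
Proof.
move=> Qi Q0; rewrite -measure_bigsetU_ord_cond.
- congr (m _); apply/seteqP; split => x.
    move=> Gx; apply/bigsetU_mem; pose S : {ffun K -> bool} := [ffun j => `[< G j x >]].
    have Sx : atom_seq (enum_rank S) x.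
      by rewrite /atom_seq /atom_sign enum_rankK => j; rewrite ffunE.
    have [QS|nQS] := boolP (Q (enum_rank S)).
      by exists (enum_rank S).
    have := Q0 (enum_rank S); rewrite {1}/atom_sign {1}enum_rankK ffunE.
    by case: asboolP => // _ /(_ isT nQS) S0; move: Sx; rewrite S0.
  move=> /bigsetU_mem[k Qk Sx]; have := Qi _ Qk; rewrite -(Sx i).
  by move/asboolP.
- by move=> k _; exact: measurable_atom.
- exact: trivIset_atom_seq.
Qed.

End Atoms.

Lemma prm_independent E : measurable E ->
  independent_systems P (prm_sigma E) (prm_sigma (~` E)).
Proof.
move=> mE A B /sub_cyl AE /sub_cyl BE.
apply: (@independent_systems_sigma _ _ _ P (cyl E) (cyl (~` E))); (try exact: cyl_measurable);
  (try exact: cylI); (try exact: cylT); try assumption.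
move=> _ _ [n [F [C [h ->]]]] [n' [F' [C' [h' ->]]]].
(* The index [None] stands for [E] itself, so that every atom lies either in [E] or in its
   complement. *)
pose K : finType := option ('I_n + 'I_n')%type.
pose G (i : K) := match i with None => E | Some (inl i) => F i
                  | Some (inr i) => F' i end.
have mG i : measurable (G i).
  by case: i => [[i|i]|] //=; [have [] := h i|have [] := h' i].
pose X (k : 'I_#|{ffun K -> bool}|) w := nu w (atom_seq G k).
have mX k : measurable_fun setT (X k).
  by apply: measurable_prm; exact: measurable_atom.
have iX : mutually_independent P X.
  case: prm => _ _ _; apply; first by move=> k; exact: measurable_atom.
  exact: trivIset_atom_seq.
pose J : pred 'I_#|{ffun K -> bool}| := fun k => atom_sign k None.
have key (i : K) (J' : pred 'I_#|{ffun K -> bool}|) (D : set (\bar R)) :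
    (forall k, atom_sign k i -> ~~ J' k -> atom_seq G k = set0) ->
    measurable D ->
    sigma_generated [set k | J' k] X ((fun w => nu w (G i)) @^-1` D).
  move=> J'0 mD.
  pose Q : pred 'I_#|{ffun K -> bool}| := fun k => atom_sign k i && J' k.
  rewrite (_ : (fun w => nu w (G i)) = fun w => \sum_(k < _ | Q k) X k w).
    have mS : measurable_fun (setT : set (g_sigma_algebraType
      (\bigcup_(i in [set k | J' k]) preimage_set_system setT (X i) measurable)))
      (fun w => \sum_(k < _ | Q k) X k w).
      rewrite (_ : (fun w => \sum_(k < _ | Q k) X k w) =
        fun w => \sum_(k < #|{ffun K -> bool}|) (if Q k then X k w else 0)); last first.
        by apply/funext => w; rewrite big_mkcond.
      apply: emeasurable_sum => k; have [/andP[_ J'k]|_] := boolP (Q k).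
        exact: sigma_generated_measurable_fun.
      exact: measurable_cst.
    have := mS measurableT D mD; rewrite setTI; exact.
  apply/funext => w; apply: measure_atoms => // k; first by case/andP.
  by move=> ki; rewrite /Q ki/=; exact: J'0.
have sg J' : sigma_algebra setT (sigma_generated [set k | J' k] X).
  exact: smallest_sigma_algebra.
have capS J' n0 (f : 'I_n0 -> set Omega) :
    (forall i, sigma_generated [set k | J' k] X (f i)) ->
    sigma_generated [set k | J' k] X (\bigcap_(i in [set: 'I_n0]) f i).
  move=> hf.
  apply: (@fin_bigcap_measurable _ (g_sigma_algebraType
      (\bigcup_(i in [set k | J' k]) preimage_set_system setT (X i) measurable))) => // i _.
  exact: hf.
have bigcapE n0 (f : nat -> set Omega) :
    \bigcap_(i in `I_n0) f i = \bigcap_(i in [set: 'I_n0]) f i.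
  apply/seteqP; split => w fw i; first by move=> _; apply: fw => /=.
  by move=> /= ii; exact: (fw (Ordinal ii) Logic.I).
have := independent_grouping mX iX (J := J); apply.
  rewrite bigcapE; apply: (capS J) => i.
  apply: (key (Some (inl i)) J); last by have [] := h i.
  move=> k ki Jk; rewrite -subset0 => x Sx.
  have := Sx (Some (inl i)); rewrite ki => /asboolP /=.
  have [_ FE _] := h i => /FE Ex.
  have := Sx None; move: Jk; rewrite /J => /negbTE -> /asboolP.
  exact.
rewrite bigcapE; apply: (capS (fun k => ~~ J k)) => i.
apply: (key (Some (inr i)) (predC J)); last by have [] := h' i.
move=> k ki Jk; rewrite -subset0 => x Sx.
have := Sx (Some (inr i)); rewrite ki => /asboolP /=.
have [_ FE _] := h' i => /FE Ex.
have := Sx None; move: Jk; rewrite /= negbK /J => -> /asboolP.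
exact: Ex.
Qed.

Lemma prm_sigma_setT E : prm_sigma E setT.
Proof. exact: (@measurableT _ (g_sigma_algebraType _)). Qed.

Lemma prm_sigma_setI E : setI_closed (prm_sigma E).
Proof. by move=> A B EA EB; exact: (@measurableI _ (g_sigma_algebraType _)). Qed.

Lemma prm_independent_disjoint E F : measurable E -> E `&` F = set0 ->
  independent_systems P (prm_sigma E) (prm_sigma F).
Proof.
move=> mE EF0 A B EA FB; apply: (prm_independent mE) => //.
by apply: sub_prm_sigma FB; rewrite -disjoints_subset setIC.
Qed.

Lemma prm_independent_family (I : eqType) (r : seq I) (E : I -> set T)
    (A : I -> set Omega) : uniq r ->
  (forall i, measurable (E i)) ->
  (forall i j, i != j -> E i `&` E j = set0) ->
  (forall i, prm_sigma (E i) (A i)) ->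
  P (\big[setI/setT]_(i <- r) A i) = \prod_(i <- r) P (A i).
Proof.
move=> + mE Edisj EA; elim: r => [|i r IH] /=.
  by rewrite !big_nil probability_setT.
move=> /andP[ir ur]; rewrite !big_cons -IH//.
apply: (@prm_independent (E i)) => //.
rewrite big_seq; elim/big_ind : _ => [|B C ? ?|j jr].
- exact: prm_sigma_setT.
- exact: prm_sigma_setI.
- apply: sub_prm_sigma (EA j).
  rewrite -disjoints_subset setIC Edisj//.
  by apply: contraNneq ir => ->.
Qed.

End PoissonIndependence.

Section Restriction.
Context d (T : measurableType d) (R : realType).

Lemma integral_restm (m : {measure set T -> \bar R}) F (mF : measurable F)
    (f : T -> \bar R) :
  (\int[restm m mF]_x (f \_ F) x = \int[m]_(x in F) f x)%E.
Proof.
rewrite -integral_mkcond; apply: eq_measure_integral => A mA AF.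
by rewrite restmE; congr (m _); apply/setIidPl.
Qed.

Lemma poisson_prob_set1 (r : R) k (n : nat) : 0 <= r ->
  poisson_prob r n [set k] = (r ^+ k * k`!%:R^-1 * expR (- r))%:E.
Proof.
rewrite /poisson_prob le_eqVlt => /predU1P[<-|r0].
  rewrite ltxx diracE oppr0 expR0 mulr1 expr0n.
  case: k => [|k]; first by rewrite mem_set// fact0 invr1 mulr1.
  by rewrite memNset// mul0r.
by rewrite r0 esum_set1 ?lee_fin ?poisson_pmf_ge0// /poisson_pmf r0.
Qed.

Lemma adde_eq1 (x : \bar R) : (1 + x = 1)%E -> x = 0%E.
Proof.
case: x => [r||]//= [] /eqP; rewrite -subr_eq0 addrAC subrr add0r.
by move=> /eqP ->.
Qed.

End Restriction.

Section PoissonCounts.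
Context (R : realType) (disp : measure_display) (Omega : measurableType disp).
Context (P : probability Omega R).
Context (d : measure_display) (T : measurableType d).
Variables (lam : {measure set T -> \bar R}) (nu : Omega -> {measure set T -> \bar R}).
Hypothesis prm : is_poisson_random_measure P lam nu.

Definition prm_alg (E : set T) :=
  \bigcup_(F in [set F | measurable F /\ F `<=` E])
    preimage_set_system [set: Omega] (fun w => nu w F) measurable.

Lemma measurable_prm_alg (E F : set T) : measurable F -> F `<=` E ->
  measurable_fun (setT : set (g_sigma_algebraType (prm_alg E))) (fun w => nu w F).
Proof.
by move=> mF FE; apply: (sigma_generated_measurable_fun (X := fun F w => nu w F)).
Qed.

(** Restricted to [F], the random measure is a kernel over the sigma-algebra of the counts inside
    [E]; integrals over [F] therefore depend measurably on those counts alone. *)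
Lemma measurable_prm_integral (E F : set T) (g : T -> R) :
  measurable F -> F `<=` E -> measurable_fun setT g ->
  measurable_fun (setT : set (g_sigma_algebraType (prm_alg E)))
    (fun w => \int[nu w]_(x in F) g x).
Proof.
move=> mF FE mg.
have ml U : measurable U -> measurable_fun
    (setT : set (g_sigma_algebraType (prm_alg E))) (fun w => restm (nu w) mF U).
  move=> mU; apply: (@measurable_prm_alg E (U `&` F)); first exact: measurableI.
  by move=> x [_ /FE].
have mI (f : T -> \bar R) : (forall x, 0 <= f x)%E -> measurable_fun setT f ->
    measurable_fun (setT : set (g_sigma_algebraType (prm_alg E)))
    (fun w => \int[nu w]_(x in F) f x)%E.
  move=> f0 mf; under eq_fun do rewrite -(integral_restm _ mF).
  apply: (@measurable_fun_integral_kernel _ _ (g_sigma_algebraType (prm_alg E)) T R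
    (fun w => restm (nu w) mF) ml (f \_ F)).
    by move=> x; rewrite patchE; case: ifPn.
  by apply/(measurable_restrictT _ mF); exact: measurable_funTS.
apply: (measurableT_comp (f := fine)) => //.
under eq_fun do rewrite integralE.
by apply: emeasurable_funB; apply: mI => //; [apply: measurable_funepos|
  apply: measurable_funeneg]; exact/measurable_EFinP.
Qed.

Lemma measurable_sub_sigma d' (T' : measurableType d') (G : set (set Omega))
    (f : Omega -> T') : G `<=` measurable ->
  measurable_fun (setT : set (g_sigma_algebraType G)) f ->
  measurable_fun setT f.
Proof.
move=> Gm mf _ B mB; rewrite setTI; apply: (sub_sigma_measurable Gm).
by have := mf measurableT B mB; rewrite setTI.
Qed.

Lemma prm_alg_measurable E : prm_alg E `<=` measurable.
Proof.
move=> _ [F [mF _] [B mB <-]]; apply: (measurable_prm prm mF) => //.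
Qed.

Lemma prm_poisson E k : measurable E -> (lam E < +oo)%E ->
  P [set w | nu w E = k%:R%:E] =
  (fine (lam E) ^+ k * k`!%:R^-1 * expR (- fine (lam E)))%:E.
Proof.
move=> mE lE; case: prm => _ + _ _ => ->//.
by rewrite poisson_prob_set1// fine_ge0.
Qed.

(** The counts are not integers by definition, but the Poisson probabilities of the integers add up
    to one. *)
Lemma prm_nat E : measurable E -> (lam E < +oo)%E ->
  {ae P, forall w, exists k : nat, nu w E = k%:R%:E}.
Proof.
move=> mE lE; have mN := measurable_prm prm mE.
have mk k : measurable [set w | nu w E = k%:R%:E].
  by have := mN measurableT [set k%:R%:E] (emeasurable_set1 _); rewrite setTI.
pose A := \bigcup_k [set w | nu w E = k%:R%:E].
have mA : measurable A by exact: bigcupT_measurable.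
have PA : P A = 1%E.
  rewrite measure_semi_bigcup//; last first.
    move=> i j _ _ [w [/= -> [/eqP]]]; rewrite eqr_nat => /eqP //.
  rewrite (eq_eseriesr (g := fun k => poisson_prob (fine (lam E)) 0 [set k])); last first.
    by move=> k _; have [_ h _ _] := prm; exact: h.
  rewrite -measure_semi_bigcup//; last by move=> i j _ _ [x [/= -> ->]].
    have -> : \bigcup_n [set n] = [set: nat] by apply/seteqP; split => // x _; exists x.
    exact: probability_setT.
exists (~` A); split; first exact: measurableC.
  by rewrite probability_setC// PA subee.
by apply: subsetC => w [k _ wk]; exists k.
Qed.

(** The counts of [F] and of [E] minus [F] are independent Poisson variables, and their exponential
    factors multiply to that of [E]. Up to a constant the answer is [lam F]: a single point in [E]
    is distributed according to the normalized intensity. *)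
Lemma prm_one_point E F : measurable E -> measurable F -> F `<=` E ->
  (lam E < +oo)%E ->
  P [set w | nu w E = 1%E /\ nu w F = 1%E] =
  (fine (lam F) * expR (- fine (lam E)))%:E.
Proof.
move=> mE mF FE lE; have mD : measurable (E `\` F) by exact: measurableD.
have lF : (lam F < +oo)%E by apply: le_lt_trans lE; rewrite le_measure ?inE.
have lD : (lam (E `\` F) < +oo)%E.
  by apply: le_lt_trans lE; rewrite le_measure ?inE//; exact: subDsetl.
have EFD (m : {measure set T -> \bar R}) : m E = (m F + m (E `\` F))%E.
  rewrite -measureU//; first by rewrite setDUK.
  by rewrite -subset0 => x [Fx [_]]; exact.
have mset (x : \bar R) (B : set T) : measurable B -> measurable [set w | nu w B = x].
  move=> mB; have := measurable_prm prm mB measurableT (emeasurable_set1 x).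
  by rewrite setTI.
have -> : [set w | nu w E = 1%E /\ nu w F = 1%E] =
    [set w | nu w F = 1%:R%:E] `&` [set w | nu w (E `\` F) = 0%:R%:E].
  apply/seteqP; split => w /= [].
    rewrite EFD => + h; rewrite h; split => //.
    exact: adde_eq1.
  by move=> h1 h2; rewrite EFD h1 h2 adde0.
have FD0 : F `&` (E `\` F) = set0 by rewrite -subset0 => x [Fx [_]]; exact.
rewrite (prm_independent_disjoint prm mF FD0); last 2 first.
- apply: sub_sigma_algebra; exists F; first by split.
  by exists [set 1%:R%:E]; [exact: emeasurable_set1|rewrite setTI].
- apply: sub_sigma_algebra; exists (E `\` F); first by split.
  by exists [set 0%:R%:E]; [exact: emeasurable_set1|rewrite setTI].
rewrite !prm_poisson// -EFinM; congr EFin.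
rewrite EFD fineD ?ge0_fin_numE// opprD expRD; by rewrite !fact0 expr0 expr1 !invr1; ring.
Qed.

End PoissonCounts.

Section ZeroOne.
Context (R : realType) (d : measure_display) (T : measurableType d).
Variables (m : {measure set T -> \bar R}) (E : set T).
Hypotheses (mE : measurable E) (mE1 : m E = 1%E).

Let fin (F : set T) : measurable F -> (m (E `&` F) < +oo)%E.
Proof.
move=> mF; apply: (@le_lt_trans _ _ (m E)); last by rewrite mE1 ltry.
by rewrite le_measure ?inE//; exact: measurableI.
Qed.

Let measure_bigcup_countable_null (J : countType) (F : J -> set T) :
  (forall q, measurable (F q)) -> (forall q, m (F q) = 0%E) ->
  measurable (\bigcup_q F q) /\ m (\bigcup_q F q) = 0%E.
Proof.
move=> mF F0.
have -> : \bigcup_q F q = \bigcup_n (if unpickle n is Some q then F q else set0).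
  apply/seteqP; split => x.
    by move=> [q _ Fx]; exists (pickle q) => //; rewrite pickleK.
  by move=> [n _]; case: unpickle => // q Fx; exists q.
split; first by apply: bigcupT_measurable => n; case: unpickle.
by apply: measure_bigcup_null => n; case: unpickle => // q; rewrite ?measure0//.
Qed.

(** The distribution function of [f] takes only the values 0 and 1 at the rationals, so it jumps
    once, at the supremum [c] of the rationals with null sublevel set. This is how the coordinates
    of an atom are located. *)
Lemma zero_one_constant (f : T -> R) : measurable_fun setT f ->
  (forall q : rat, m (E `&` [set x | f x <= ratr q]) = 0%E \/
                   m (E `&` [set x | f x <= ratr q]) = 1%E) ->
  exists c, m (E `&` [set x | f x != c]) = 0%E.
Proof.
move=> mf h01.
pose L q := E `&` [set x | f x <= ratr q].
have mfl r : measurable [set x | f x <= r] by exact: measurable_set_le.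
have mL q : measurable (L q) by exact: measurableI.
have Lmon q q' : q <= q' -> L q `<=` L q'.
  by move=> qq x [Ex fx]; split => //=; rewrite (le_trans fx)// ler_rat.
pose Z := [set (ratr q : R) | q in [set q | m (L q) = 0%E]].
have [q1 Lq1] : exists q, m (L q) = 1%E.
  apply: contrapT => /forallNP h.
  have : m E = 0%E.
    have -> : E = \bigcup_k L k%:R.
      apply/seteqP; split => [x Ex|x [k _ []]//].
      exists (Num.bound `|f x|) => //; split => //=.
      rewrite ratr_nat (le_trans (ler_norm _))//.
      exact: ltW (archi_boundP (normr_ge0 _)).
    apply: measure_bigcup_null => // k.
    by have [//|/h] := h01 k%:R.
  by rewrite mE1 => /eqP; rewrite onee_eq0.
have [q0 Lq0] : exists q, m (L q) = 0%E.
  apply: contrapT => /forallNP h.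
  have : m (\bigcap_k L (- k%:R)) = 1%E.
    have cv := nonincreasing_cvg_mu (mu := m) (F := fun k : nat => L (- k%:R)).
    have /cvg_lim <-// : m (L (- k%:R)) @[k --> \oo] --> m (\bigcap_k L (- k%:R)).
      apply: cv => [|k||]; first exact: fin.
      - exact: mL.
      - exact: bigcapT_measurable.
      - move=> a b ab; apply/subsetPset; apply: Lmon.
        by rewrite lerN2 ler_nat.
    apply/cvg_lim => //; rewrite (_ : (fun k => _) = cst 1%E); first exact: cvg_cst.
    by apply/funext => k; have [/h|] := h01 (- k%:R).
  rewrite (_ : \bigcap_k _ = set0) ?measure0 => [/eqP|].
    by rewrite eq_sym onee_eq0.
  rewrite -subset0 => x hx.
  have [_ /=] := hx (Num.bound `|f x|).+1 I.
  rewrite rmorphN/= ratr_nat lerNr => h'.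
  have b := archi_boundP (normr_ge0 (f x)).
  have c := le_trans h' (ler_norm _); rewrite normrN -natr1 in c.
  by have := le_lt_trans c b; rewrite gtrDl ltr10.
have Zne : Z !=set0 by exists (ratr q0); exists q0.
have Zub : has_ubound Z.
  exists (ratr q1) => _ [q /= Lq <-]; rewrite ler_rat leNgt; apply/negP => qq.
  have : (m (L q1) <= m (L q))%E by rewrite le_measure ?inE//; apply: Lmon; exact: ltW.
  by rewrite Lq1 Lq leNgt lte01.
pose c := sup Z; exists c.
have -> : E `&` [set x | f x != c] =
  (\bigcup_q (if ratr q < c then L q else set0)) `|`
  (\bigcup_q (if c < ratr q then E `\` L q else set0)).
  apply/seteqP; split => x.
    move=> [Ex /= fc]; have [lt|lt|/eqP] := ltgtP (f x) c; last by rewrite (negbTE fc).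
      have [q] := rat_in_itvoo lt; rewrite in_itv/= => /andP[fq qc].
      by left; exists q => //; rewrite qc; split => //=; exact: ltW.
    have [q] := rat_in_itvoo lt; rewrite in_itv/= => /andP[fq qc].
    by right; exists q => //; rewrite fq; split => // -[_ /=]; rewrite leNgt qc.
  move=> [[q _]|[q _]]; case: ifPn => // qc [Ex /= h]; split => //=.
    by rewrite lt_eqF// (le_lt_trans h).
  by rewrite gt_eqF// (lt_le_trans qc)// leNgt; apply/negP => /ltW fq; exact: h.
have [m1 e1] : measurable (\bigcup_q (if ratr q < c then L q else set0)) /\
    m (\bigcup_q (if ratr q < c then L q else set0)) = 0%E.
  apply: measure_bigcup_countable_null => q; first by case: ifPn.
  case: ifPn => [qc|_]; last exact: measure0.
  have [_ [q' /= Lq' <-] qq'] := sup_gt Zne qc.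
  apply/eqP; rewrite -measure_le0 -Lq' le_measure ?inE//.
  by apply: Lmon; move: qq'; rewrite ltr_rat => /ltW.
have [m2 e2] : measurable (\bigcup_q (if c < ratr q then E `\` L q else set0)) /\
    m (\bigcup_q (if c < ratr q then E `\` L q else set0)) = 0%E.
  apply: measure_bigcup_countable_null => q.
    by case: ifPn => // _; exact: measurableD.
  case: ifPn => [qc|_]; last exact: measure0.
  have Lq : m (L q) = 1%E.
    have [Lq|//] := h01 q.
    by have := ub_le_sup Zub (ex_intro2 _ _ q Lq erefl); rewrite leNgt qc.
  have Efin : (m E < +oo)%E by rewrite mE1 ltry.
  have mLq := mL q; have -> : m (E `\` L q) = (m E - m (E `&` L q))%E by exact: measureD.
  have -> : E `&` L q = L q by apply/seteqP; split => [x []//|x [Ex fx]]; split.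
  by apply: (etrans (congr2 (fun a b => a - b)%E mE1 Lq)); rewrite subee.
by rewrite measureU0.
Qed.

End ZeroOne.

(** * Null sets of joint laws *)

Section LawNull.
Context (R : realType) (disp : measure_display) (Omega : measurableType disp).
Context (m : nat) (L : {sigma_finite_measure set 'cV[R]_m -> \bar R}).
Hypothesis Lbox : forall B : 'I_m -> set R, (forall i, measurable (B i)) ->
  L (box B) = (\prod_(i < m) lebesgue_measure (B i))%E.
Context (d2 : measure_display) (T2 : measurableType d2).
Variables (q : {measure set Omega -> \bar R}) (S : Omega -> 'cV[R]_m) (V : Omega -> T2).
Hypotheses (qoo : (q setT < +oo)%E) (mS : measurable_fun setT S)
  (mV : measurable_fun setT V).
Hypothesis ind : forall A B, measurable A -> measurable B ->
  (q (S @^-1` A `&` V @^-1` B) * q setT = q (S @^-1` A) * q (V @^-1` B))%E.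
Variable (C : R).
Hypotheses (C0 : 0 <= C).
Hypothesis ac : forall B : 'I_m -> set R, (forall i, measurable (B i)) ->
  (q (S @^-1` box B) <= C%:E * L (box B))%E.
Local Open Scope ereal_scope.

Let fin d (T : measurableType d) (f : Omega -> T) (mf : measurable_fun setT f) :
  sigma_finite setT (pushm q mf).
Proof.
exists (fun=> setT) => [|i]; first by apply/seteqP; split => // x _; exists 0%N.
by split => //; rewrite pushmE preimage_setT.
Qed.

(** Independence makes the joint law of [V] and [S] a product up to the factor [q setT], so Fubini
    reduces the claim to sections; on these the law of [S] vanishes by domination on cubes. *)
Lemma law_null (N : set (T2 * 'cV[R]_m)) : measurable N ->
  (forall v, L (xsection N v) = 0) ->
  q ((fun w => (V w, S w)) @^-1` N) = 0.
Proof.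
move=> mN LN.
have [q0|q0] := eqVneq (q setT) 0.
  apply: (subset_measure0 _ _ _ q0) => //.
  rewrite -[X in measurable X]setTI; apply: (measurable_fun_pair mV mS) => //.
have mVS := measurable_fun_pair mV mS.
have fq : q setT \is a fin_num by rewrite ge0_fin_numE.
have c0 : (0 <= fine (q setT))%R by exact: fine_ge0.
pose m1 := sigma_finite_copy (fin mV).
pose m2 := sigma_finite_copy (fin mS).
pose m12 := mscale (NngNum c0) (pushm q mVS).
have m12E A : m12 A = q setT * q ((fun w => (V w, S w)) @^-1` A).
  by rewrite /m12/= /mscale/= fineK.
have : (m1 \x m2) N = m12 N.
  apply: product_measure_unique => // A B mA mB.
  rewrite [LHS]m12E muleC.
  rewrite (_ : _ @^-1` _ = S @^-1` B `&` V @^-1` A); last first.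
    by apply/seteqP; split => w /= [].
  by rewrite ind// muleC.
rewrite [X in _ = X]m12E => e.
have : q setT * q ((fun w => (V w, S w)) @^-1` N) = 0.
  rewrite -e; apply: integral0_eq => v _ /=.
  have := @le_dyadic_measure R m L Lbox (pushm q mS) C C0.
  apply => //; last exact: measurable_xsection.
  by move=> k z; rewrite pushmE dyadic_cubeE; apply: ac => i.
by move=> /eqP; rewrite mule_eq0 (negbTE q0)/= => /eqP.
Qed.

End LawNull.

Lemma measurable_fun_section_kernel d1 d2 (X : measurableType d1)
    (Y : measurableType d2) (R : realType) (l : X -> {measure set Y -> \bar R})
    (A : set (X * Y)) :
  (forall x, (l x setT < +oo)%E) ->
  (forall U, measurable U -> measurable_fun setT (fun x => l x U)) ->
  measurable A -> measurable_fun setT (fun x => l x (xsection A x)).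
Proof.
move=> loo ml; rewrite measurable_prod_measurableType => mA.
pose G := [set A1 `*` A2 | A1 in (measurable : set (set X)) & A2 in (measurable : set (set Y))].
apply: (@dynkin_induction _ (X * Y)%type G
   (fun A => measurable_fun setT (fun x => l x (xsection A x)))) => //.
- by rewrite measurable_prod_measurableType.
- move=> _ _ [A1 mA1 [A2 mA2 <-]] [B1 mB1 [B2 mB2 <-]].
  exists (A1 `&` B1); first exact: measurableI.
  by exists (A2 `&` B2); [exact: measurableI|rewrite setXI].
- rewrite (_ : (fun x => _) = fun x => l x setT); first exact: ml.
  by apply/funext => x; congr (l x _); apply/seteqP; split => y // _; rewrite /xsection/= inE.
- move=> _ [A1 mA1 [A2 mA2 <-]].
  rewrite (_ : (fun x => _) = fun x => (\1_A1 x)%:E * l x A2)%E.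
    apply: emeasurable_funM; last exact: ml.
    by apply/measurable_EFinP; exact: measurable_indic.
  apply/funext => x; rewrite indicE; have [xA|xA] := boolP (x \in A1).
    by rewrite in_xsectionX// mul1e.
  by rewrite notin_xsectionX// measure0 mul0e.
- move=> S mS ms.
  rewrite (_ : (fun x => _) = fun x => l x setT - l x (xsection S x))%E.
    by apply: emeasurable_funB => //; exact: ml.
  apply/funext => x.
  have mSx : measurable (xsection S x) by exact: measurable_xsection.
  have -> : xsection (~` S) x = setT `\` xsection S x.
    by apply/seteqP; split => y /=; rewrite /xsection/= !inE/=; tauto.
  by rewrite measureD ?setTI// loo.
- move=> F mF tF ms.
  rewrite (_ : (fun x => _) = fun x => (\sum_(k <oo) l x (xsection (F k) x))%E).
    by apply: ge0_emeasurable_sum.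
  apply/funext => x; rewrite xsection_bigcup measure_semi_bigcup//.
  - by move=> k; exact: measurable_xsection.
  - exact: trivIset_xsection.
  - by apply: bigcupT_measurable => k; exact: measurable_xsection.
Qed.

(** * Poisson points in an independent random set *)

Section RandomSection.
Context (R : realType) (disp : measure_display) (Omega : measurableType disp).
Context (P : probability Omega R).
Context (d : measure_display) (T : measurableType d).
Variables (lam : {measure set T -> \bar R}) (nu : Omega -> {measure set T -> \bar R}).
Hypothesis prm : is_poisson_random_measure P lam nu.
Context (d' : measure_display) (T' : measurableType d') (M : Omega -> T').
Variables (E : nat -> set T) (K : set T') (D : set (T' * T)).
Hypotheses (mM : measurable_fun setT M) (mE : forall n, measurable (E n))
  (ndE : nondecreasing_seq E) (Eoo : forall n, (lam (E n) < +oo)%E)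
  (mK : measurable K) (mD : measurable D).
Hypothesis ind : forall B, measurable B ->
  independent_systems P [set M @^-1` B] (prm_sigma nu (\bigcup_n E n)).
Hypothesis Doo : forall a, K a -> lam (\bigcup_n E n `&` xsection D a) = +oo%E.
Local Open Scope ereal_scope.

Let alg n := g_sigma_algebraType (prm_alg nu (E n)).

(** The sample point itself, seen through the counts inside [E n], serves as a random element
    independent of [M], so that the joint law of the pair is a product. *)
Let mid n : measurable_fun setT (id : Omega -> alg n).
Proof.
move=> _ B mB; rewrite setTI.
exact: (sub_sigma_measurable (prm_alg_measurable prm (E := E n))).
Qed.

(** [nu w] may be infinite on [E n] for exceptional [w]; replacing it there by zero gives a finite
    kernel, as measurability of the mass of sections requires. *)
Let l n (p : T' * alg n) : {measure set T -> \bar R} :=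
  if nu p.2 (E n) < +oo then restm (nu p.2) (mE n)
  else [the {measure set T -> \bar R} of mzero].
Arguments l : clear implicits.

Let lE n (p : T' * alg n) U : l n p U = if nu p.2 (E n) < +oo then nu p.2 (U `&` E n) else 0.
Proof. by rewrite /l; case: ifP. Qed.

Let mnuE n U : measurable U -> U `<=` E n ->
  measurable_fun [set: T' * alg n] (fun p => nu p.2 U).
Proof.
move=> mU UE; apply: (measurableT_comp (f := fun w : alg n => nu w U)) => //.
exact: measurable_prm_alg.
Qed.

Let mfinE n : measurable [set p : T' * alg n | nu p.2 (E n) < +oo].
Proof.
rewrite (_ : [set _ | _] = ~` [set p : T' * alg n | nu p.2 (E n) = +oo]).
  apply: measurableC; rewrite -[X in measurable X]setTI.
  exact: (mnuE (mE n) (@subset_refl _ _) measurableT (emeasurable_set1 +oo)).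
apply/seteqP; split => p /=; first by move=> + e; rewrite e ltxx.
by move=> /eqP; rewrite ltey.
Qed.

Let ml n U : measurable U -> measurable_fun [set: T' * alg n] (fun p => l n p U).
Proof.
move=> mU; under eq_fun do rewrite lE.
apply: measurable_fun_ifT => //.
- apply: (measurable_fun_bool true); rewrite setTI; exact: mfinE.
- by apply: mnuE; [exact: measurableI|exact: subIsetr].
Qed.

Let Z n : set (T' * alg n) := [set p | K p.1 /\ nu p.2 (E n) < +oo /\
  nu p.2 (E n `&` xsection D p.1) = 0].
Arguments Z : clear implicits.

Let mZ n : measurable (Z n).
Proof.
pose A : set ((T' * alg n) * T) := [set p | D (p.1.1, p.2)].
have mA : measurable A.
  rewrite -[X in measurable X]setTI.
  have : measurable_fun [set: (T' * alg n) * T] (fun p => (p.1.1, p.2)).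
    by apply: measurable_fun_pair => //; apply: measurableT_comp.
  exact.
have := @measurable_fun_section_kernel _ _ (T' * alg n)%type T R (l n) A.
move=> /(_ _ (@ml n) mA) h.
have {}h : measurable_fun setT (fun p => l n p (xsection A p)).
  apply: h => p; rewrite lE; case: ifP => // + ; rewrite setTI//.
rewrite (_ : Z n = ([set p | K p.1] `&` [set p : T' * alg n | nu p.2 (E n) < +oo]) `&`
   [set p | l n p (xsection A p) = 0]).
  apply: measurableI; first apply: measurableI => //.
    by rewrite -[X in measurable X]setTI; exact: measurable_fst.
  by rewrite -[X in measurable X]setTI; exact: (h measurableT _ (emeasurable_set1 0)).
have e p : xsection A p `&` E n = E n `&` xsection D p.1.
  by apply/seteqP; split => x /=; rewrite /xsection/= !inE/=; tauto.
apply/funext => p; apply/propext; rewrite /Z/= lE e.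
split => [[Kp [fp zp]]|[[Kp fp]]]; first by rewrite fp.
by rewrite fp.
Qed.

Let PToo : P setT < +oo. Proof. by rewrite probability_setT ltry. Qed.

Let law n : pushm P (measurable_fun_pair mM (@mid n)) (Z n) =
  \int[pushm P mM]_a P [set w | Z n (a, w)].
Proof.
have fin d0 (T0 : measurableType d0) (f : Omega -> T0) (mf : measurable_fun setT f) :
    sigma_finite setT (pushm P mf).
  exists (fun=> setT) => [|i]; first by apply/seteqP; split => // x _; exists 0%N.
  by split => //; rewrite pushmE preimage_setT; exact: PToo.
pose m1 := sigma_finite_copy (fin _ _ _ mM).
pose m2 := sigma_finite_copy (fin _ _ _ (@mid n)).
transitivity ((m1 \x m2) (Z n)).
  apply: esym.
  apply: (@product_measure_unique _ _ _ _ R m1 m2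
    (pushm P (measurable_fun_pair mM (@mid n)))) _ (@mZ n) => A B mA mB; rewrite pushmE.
  apply: (@ind _ mA (M @^-1` A) B) => //.
  apply: sub_prm_sigma mB; exact: bigcup_sup.
rewrite /product_measure1; apply: eq_integral => a _ /=.
have -> : [set w | Z n (a, w)] = xsection (Z n) a; last by [].
by apply/seteqP; split => w /=; rewrite /xsection/= inE.
Qed.

(** For [a] in [K], the Poisson probability that no point falls into the section at [a] within
    [E n]. *)
Let f n a : \bar R := (\1_K a * expR (- fine (lam (E n `&` xsection D a))))%:E.

Let mEDa n a : measurable (E n `&` xsection D a).
Proof. by apply: measurableI => //; exact: measurable_xsection. Qed.

Let EDoo n a : lam (E n `&` xsection D a) < +oo.
Proof. by apply: le_lt_trans (Eoo n); rewrite le_measure ?inE. Qed.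

Let mf n : measurable_fun setT (f n).
Proof.
apply/measurable_EFinP; apply: measurable_funM; first exact: measurable_indic.
apply: measurableT_comp => //; apply: measurable_funN; apply: measurableT_comp => //.
have := @measurable_fun_section_kernel _ _ T' T R (fun=> restm lam (mE n)) D.
rewrite (_ : (fun x => lam _) = fun x => restm lam (mE n) (xsection D x)); last first.
  by apply/funext => a; rewrite restmE setIC.
apply => // a; rewrite restmE setTI; exact: Eoo.
Qed.

Let cvf a : f n a @[n --> \oo] --> 0.
Proof.
rewrite /f indicE; have [Ka|_] := boolP (a \in K); last first.
  by under eq_fun do rewrite mul0r; exact: cvg_cst.
under eq_fun do rewrite mul1r.
have : lam (E n `&` xsection D a) @[n --> \oo] --> +oo.
  rewrite -(Doo (set_mem Ka)) setI_bigcupl; apply: nondecreasing_cvg_mu => //.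
  - by apply: bigcupT_measurable => n.
  - by move=> i j ij; apply/subsetPset; apply: setSI; exact/subsetPset/ndE.
move=> /cvgeyPge h; apply: cvg_EFin; first by near=> n.
apply/cvgrPdist_lt => e e0; near=> n.
rewrite /= sub0r normrN ger0_norm ?expR_ge0// expRN.
have : (e^-1)%:E <= lam (E n `&` xsection D a) by near: n; exact: h.
rewrite -(fineK (_ : lam (E n `&` xsection D a) \is a fin_num)); last first.
  by rewrite ge0_fin_numE.
rewrite lee_fin => le.
rewrite -[ltRHS]invrK ltf_pV2 ?posrE ?expR_gt0 ?invr_gt0//.
by apply: le_lt_trans le _; apply: lt_le_trans (expR_ge1Dx _); rewrite ltrDr.
Unshelve. all: by end_near. Qed.

Let PZ0 : (\int[pushm P mM]_a f n a) @[n --> \oo] --> 0.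
Proof.
have [||||_ _] := @dominated_convergence _ _ _ (pushm P mM) _ measurableT f (cst 0) (cst 1) mf.
- exact: measurable_cst.
- by apply: aeW => a _; exact: cvf.
- apply: (integrable_bounded_on (f := cst 1%R)) => //; last exact: bounded_on_cst.
- apply: aeW => a n _; rewrite lee_fin ger0_norm; last first.
    by rewrite mulr_ge0 ?expR_ge0.
  rewrite -[leRHS]mulr1 ler_pM ?expR_ge0//.
by rewrite integral0.
Qed.

Let PZ_le n : \int[pushm P mM]_a P [set w | Z n (a, w)] <= \int[pushm P mM]_a f n a.
Proof.
have mZa a : measurable [set w | nu w (E n `&` xsection D a) = 0].
  have := measurable_prm prm (mEDa n a) measurableT (emeasurable_set1 0).
  by rewrite setTI.
have PZa a : P [set w | Z n (a, w)] <= f n a.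
  rewrite /f indicE; have [Ka|Ka] := boolP (a \in K).
    rewrite mul1r.
    have := prm_poisson prm 0 (mEDa n a) (EDoo n a).
    rewrite fact0 expr0 invr1 !mul1r => <-.
    apply: le_measure; rewrite ?inE.
    + have := measurable_xsection a (@mZ n) => h.
      apply: (sub_sigma_measurable (prm_alg_measurable prm (E := E n))).
      rewrite (_ : [set w | _] = xsection (Z n) a)//.
      by apply/seteqP; split => w; rewrite /xsection/= inE.
    + exact: mZa.
    + by move=> w [_ [_ ]].
  rewrite mul0r (_ : [set w | _] = set0) ?measure0// -subset0 => w [/= Ka' _].
  by move: Ka; rewrite notin_setE.
apply: ge0_le_integral => //.
- have h := measurable_fun_xsection _ (@mZ n).
  have fin0 : sigma_finite setT (pushm P (@mid n)).
    exists (fun=> setT) => [|i]; first by apply/seteqP; split => // x _; exists 0%N.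
    by split => //; rewrite pushmE preimage_setT; exact: PToo.
  have := h _ (sigma_finite_copy fin0).
  rewrite (_ : _ \o _ = fun a => P [set w | Z n (a, w)])//.
  apply/funext => a /=; have -> : [set w | Z n (a, w)] = xsection (Z n) a; last by [].
  by apply/seteqP; split => w; rewrite /xsection/= inE.
Qed.

(** Conditionally on [M] the section is deterministic with infinite intensity, so the probability of
    missing it inside [E n] tends to 0; dominated convergence removes the conditioning. *)
Lemma random_section_negligible :
  P.-negligible [set w | K (M w) /\ nu w (\bigcup_n E n `&` xsection D (M w)) = 0].
Proof.
have mZn n : measurable ((fun w => (M w, w) : T' * alg n) @^-1` Z n).
  by rewrite -[X in measurable X]setTI; exact: (measurable_fun_pair mM (@mid n)) (@mZ n).
pose G n := (fun w => (M w, w) : T' * alg n) @^-1` Z n `|` [set w | nu w (E n) = +oo].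
have mnu n : measurable [set w | nu w (E n) = +oo].
  have := measurable_prm prm (mE n) measurableT (emeasurable_set1 +oo).
  by rewrite setTI.
have nu0 n : P [set w | nu w (E n) = +oo] = 0.
  apply/negligibleP => //.
  have [N [mN N0 NP]] := prm_nat prm (mE n) (Eoo n).
  by exists N; split => // w /= e; apply: NP => /= -[k]; rewrite e.
have mG n : measurable (G n) by exact: measurableU.
have PG n : P (G n) <= \int[pushm P mM]_a f n a.
  apply: le_trans (PZ_le n); rewrite -law pushmE /G measureU0//; exact: nu0.
apply: (ex_intro _ (\bigcap_n G n)); split.
- exact: bigcapT_measurable.
- apply/eqP; rewrite eq_le measure_ge0 andbT.
  rewrite -(cvg_lim _ PZ0)//; apply: lime_ge.
    by apply/cvg_ex; eexists; exact: PZ0.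
  near=> n; apply: le_trans (PG n); rewrite le_measure ?inE//.
    exact: bigcapT_measurable.
  exact: bigcap_inf.
- move=> w [Kw nu0w] n _; have [fin|] := ltP (nu w (E n)) +oo; last first.
    by rewrite leye_eq => /eqP; right.
  left; split => //; split => //=.
  apply: (subset_measure0 _ _ _ nu0w) => //.
  + by apply: measurableI; [exact: bigcupT_measurable|exact: measurable_xsection].
  + by apply: setSI; exact: bigcup_sup.
Unshelve. all: by end_near. Qed.

End RandomSection.

(** * Sums of curves *)

Section Gram.
Context (R : realType).

(** The Gram determinant detects independence of the columns by one polynomial in the entries. This
    keeps the condition measurable, also for matrices that are not square. *)
Lemma gram_neq0P m k (N : 'M[R]_(m, k)) :
  \det (N^T *m N) != 0 <-> (forall w : 'cV[R]_k, N *m w = 0 -> w = 0).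
Proof.
split.
  move=> dN w Nw0; have uN : N^T *m N \in unitmx by rewrite unitmxE unitfE.
  by rewrite -(mulKmx uN w) -mulmxA Nw0 !mulmx0.
move=> h; rewrite -unitfE -unitmxE -row_free_unit; apply: inj_row_free => v v0.
have Nv : N *m v^T = 0.
  have : \tr ((N *m v^T)^T *m (N *m v^T)) = 0.
    by rewrite trmx_mul trmxK -mulmxA (mulmxA N^T) mulmxA v0 mul0mx mxtrace0.
  rewrite mxtrace_mulC /mxtrace => /eqP.
  under eq_bigr => i _ do rewrite mxE big_ord1 [X in _ * X]mxE -expr2.
  rewrite psumr_eq0 => [|i _]; last exact: sqr_ge0.
  move=> /allP h0; apply/matrixP => i j; rewrite ord1 [RHS]mxE.
  by have := h0 i (mem_index_enum i); rewrite sqrf_eq0 => /eqP.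
by apply: trmx_inj; rewrite trmx0 (h _ Nv).
Qed.

Lemma gram_row_mx m k (N : 'M[R]_(m, k)) (l : 'rV[R]_m) (v : 'cV[R]_m) :
  \det (N^T *m N) != 0 -> l *m N = 0 -> l *m v != 0 ->
  \det ((row_mx N v)^T *m row_mx N v) != 0.
Proof.
move=> /gram_neq0P hN lN lv; apply/gram_neq0P => w.
rewrite -(vsubmxK w) mul_row_col => e.
have : l *m (N *m usubmx w + v *m dsubmx w) = 0 by rewrite e mulmx0.
rewrite mulmxDr !mulmxA lN mul0mx add0r => /matrixP/(_ 0 0).
rewrite [X in X = _]mxE big_ord1 [RHS]mxE => /eqP.
rewrite mulf_eq0 => /orP[/eqP lv0|/eqP w0].
  by case/eqP: lv; apply/matrixP => i j; rewrite !ord1 lv0 mxE.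
have w20 : dsubmx w = 0 by apply/matrixP => i j; rewrite !ord1 w0 mxE.
move: e; rewrite w20 mulmx0 addr0 => /hN ->.
by rewrite col_mx0.
Qed.

Lemma exists_left_kernel m k (N : 'M[R]_(m, k)) : (k < m)%N ->
  exists2 l : 'rV[R]_m, l != 0 & l *m N = 0.
Proof.
move=> km; have : kermx N != 0.
  rewrite kermx_eq0; apply/negP => /eqP rN.
  by have := rank_leq_col N; rewrite rN leqNgt km.
move=> /rowV0Pn[l lk l0]; exists l => //.
exact/sub_kermxP.
Qed.

End Gram.

Section CurveSums.
Context (R : realType) (m : nat).
Variables (L : {sigma_finite_measure set 'cV[R]_m -> \bar R}).
Hypothesis Lbox : forall B : 'I_m -> set R, (forall i, measurable (B i)) ->
  L (box B) = (\prod_(i < m) lebesgue_measure (B i))%E.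
Variables (f f' : 'I_m -> R -> 'cV[R]_m) (y : 'cV[R]_m).
Hypothesis df : forall j i s,
  is_derive s (1 : R) (fun s => f j s i 0) (f' j s i 0).
Hypothesis cf' : forall j i, continuous (fun s => f' j s i 0).

Definition curve_sum (s : 'cV[R]_m) : 'cV[R]_m := y + \sum_j f j (s j 0).

Definition curve_jacobian (s : 'cV[R]_m) : 'M[R]_m :=
  \matrix_(i, j) f' j (s j 0) i 0.

Let cf j i : continuous (fun s => f j s i 0).
Proof.
move=> s; apply: differentiable_continuous; apply/derivable1_diffP.
by have [] := df j i s.
Qed.

Lemma measurable_curve_sum : measurable_fun setT curve_sum.
Proof.
apply: measurable_fun_mx => i j; rewrite ord1 {j}.
under eq_fun do rewrite mxE summxE.
apply: measurable_funD; first exact: measurable_cst.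
apply: measurable_sum => j.
apply: (measurableT_comp (f := fun s => f j s i 0)).
  exact: continuous_measurable_fun.
exact: measurable_mx_entry.
Qed.

Lemma measurable_curve_jacobian : measurable_fun setT curve_jacobian.
Proof.
apply: measurable_fun_mx => i j; under eq_fun do rewrite mxE.
apply: (measurableT_comp (f := fun s => f' j s i 0)).
  exact: continuous_measurable_fun.
exact: measurable_mx_entry.
Qed.

Let mean_value j i a b c e : `|a - c| <= e -> `|b - c| <= e ->
  exists2 x, `|x - c| <= e & f j b i 0 - f j a i 0 = f' j x i 0 * (b - a).
Proof.
wlog ab : a b / a < b => [h ac bc|ac bc].
  have [/h|/h H|->] := ltgtP a b; [exact| |].
    have [x xb xe] := H bc ac; exists x => //.
    by rewrite -opprB xe -mulrN opprB.
  by exists b; rewrite // !subrr mulr0.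
have [|x] := @MVT _ (fun s => f j s i 0) (fun s => f' j s i 0) a b ab.
  by apply: continuous_subspaceT; exact: cf.
rewrite in_itv/= => /andP[ax xb] ->; exists x => //.
by move: ac bc; rewrite !ler_norml => /andP[? ?] /andP[? ?]; apply/andP; split; lra.
Qed.

Let continuous_scale (s0 : 'cV[R]_m) eta : 0 < eta ->
  exists k, forall i j x, `|x - s0 j 0| <= (2 ^+ k)^-1 ->
    `|f' j x i 0 - f' j (s0 j 0) i 0| <= eta.
Proof.
move=> eta0.
have : \forall k \near \oo, forall p : 'I_m * 'I_m, forall x,
    `|x - s0 p.2 0| <= (2 ^+ k)^-1 ->
    `|f' p.2 x p.1 0 - f' p.2 (s0 p.2 0) p.1 0| <= eta.
  apply: filter_forall => -[i j] /=.
  have /cvgrPdist_le/(_ _ eta0)/nbhs_ballP[e /= e0 he] := @cf' j i (s0 j 0).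
  have /cvgrPdist_lt/(_ _ e0) : (2^-1 : R) ^+ k @[k --> \oo] --> 0.
    by apply: cvg_expr; rewrite gtr0_norm ?invr_gt0// invf_lt1// ltr1n.
  apply: filterS => k; rewrite sub0r normrN exprVn gtr0_norm ?invr_gt0 ?exprn_gt0//.
  move=> ke x xk; rewrite distrC; apply: he; rewrite /ball/= distrC.
  exact: le_lt_trans ke.
by move=> [k _ /(_ k (leqnn k)) h]; exists k => i j x; exact: (h (i, j)).
Qed.

(** Each curve depends on one variable, so the mean value theorem applies entry by entry. Near [s0]
    the map differs from its Jacobian there by an error with constant [eta], half the inverse of a
    bound [beta] for the inverse matrix, and this error is absorbed on the left. *)
Let inverse_lipschitz (s0 : 'cV[R]_m) : \det (curve_jacobian s0) != 0 ->
  exists k (K : nat), forall s s' e, dyadic k s = dyadic k s0 ->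
    dyadic k s' = dyadic k s0 ->
    (forall i, `|curve_sum s i 0 - curve_sum s' i 0| <= e) ->
    forall i, `|s i 0 - s' i 0| <= K%:R * e.
Proof.
move=> dJ; set J := curve_jacobian s0 in dJ.
have uJ : J \in unitmx by rewrite unitmxE unitfE.
pose B := invmx J.
pose beta := 1 + \sum_i \sum_k `|B i k|.
have beta1 : 1 <= beta by rewrite lerDl sumr_ge0// => i _; rewrite sumr_ge0.
pose eta := (2 * beta)^-1.
have eta0 : 0 < eta by rewrite invr_gt0 mulr_gt0// (lt_le_trans ltr01).
have [k hk] := continuous_scale s0 eta0.
(* The Lipschitz constant is rounded up to a natural number, so that [curve_sum_null] meets only
   countably many cases. *)
exists k, (Num.bound (2 * beta)) => s s' e es es' hF.
have p2 : 0 < 2 ^+ k :> R by rewrite exprn_gt0.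
have near0 (v : 'cV[R]_m) j : dyadic k v = dyadic k s0 -> `|v j 0 - s0 j 0| <= (2 ^+ k)^-1.
  move=> /ffunP/(_ j); rewrite !ffunE => ev.
  have := floor_itv (2 ^+ k * v j 0); rewrite ev => /andP[a1 a2].
  have := floor_itv (2 ^+ k * s0 j 0) => /andP[b1 b2].
  rewrite intrD in a2 b2.
  rewrite -(ler_pM2l p2) mulfV ?gt_eqF// -[2 ^+ k in X in X <= _]gtr0_norm// -normrM.
  by rewrite mulrBr ler_norml; apply/andP; split; lra.
pose h : 'cV[R]_m := s - s'.
pose H := \sum_j `|h j 0|.
have H0 : 0 <= H by rewrite sumr_ge0.
pose r : 'cV[R]_m := curve_sum s - curve_sum s' - J *m h.
have rH i : `|r i 0| <= eta * H.
  rewrite /r /curve_sum opprD addrACA subrr add0r -sumrB !mxE summxE -sumrB.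
  rewrite (le_trans (ler_norm_sum _ _ _))// mulr_sumr ler_sum// => j _.
  have [x xb] := mean_value j i (near0 _ j es') (near0 _ j es).
  rewrite !mxE => ->; rewrite -mulrBl normrM ler_wpM2r//.
  exact: hk.
have hE : h = B *m (curve_sum s - curve_sum s' - r).
  by rewrite /r opprB addrCA subrr addr0 mulKmx.
move=> i0; have e0 : 0 <= e := le_trans (normr_ge0 _) (hF i0).
have HB : H <= beta * (e + eta * H).
  apply: (@le_trans _ _ (\sum_i \sum_k `|B i k| * (e + eta * H))).
    apply: ler_sum => i _; rewrite {1}hE mxE.
    rewrite (le_trans (ler_norm_sum _ _ _))// ler_sum// => l _.
    rewrite normrM ler_wpM2l// !mxE.
    by rewrite (le_trans (ler_normB _ _))// lerD//; have := rH l; have := hF l; rewrite !mxE.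
  under eq_bigr do rewrite -mulr_suml.
  rewrite -mulr_suml ler_wpM2r// ?lerDr//.
  by rewrite addr_ge0// mulr_ge0// ltW.
have hi : `|s i0 0 - s' i0 0| <= H.
  rewrite /H (bigD1 i0)//= /h !mxE lerDl; apply: sumr_ge0 => //.
rewrite (le_trans hi)//.
have H2 : H <= 2 * beta * e.
  have eb : beta * eta = 2^-1.
    by rewrite /eta invfM mulrCA mulfV ?mulr1// gt_eqF// (lt_le_trans ltr01).
  move: HB; rewrite mulrDr mulrA eb; lra.
rewrite (le_trans H2)// ler_wpM2r//.
by rewrite ltW// (le_lt_trans _ (archi_boundP _))// mulr_ge0// (le_trans ler01).
Qed.

(** The points with invertible Jacobian are covered by countably many dyadic cubes, on each of which
    the map is inverse Lipschitz with some natural constant. *)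
Lemma curve_sum_null (N : set 'cV[R]_m) : measurable N -> L N = 0%E ->
  L [set s | \det (curve_jacobian s) != 0 /\ N (curve_sum s)] = 0%E.
Proof.
move=> mN LN.
pose good (p : nat * {ffun 'I_m -> int} * nat) := forall s s' e,
  dyadic p.1.1 s = p.1.2 -> dyadic p.1.1 s' = p.1.2 ->
    (forall i, `|curve_sum s i 0 - curve_sum s' i 0| <= e) ->
    forall i, `|s i 0 - s' i 0| <= p.2%:R * e.
pose Q (p : nat * {ffun 'I_m -> int} * nat) : set 'cV[R]_m :=
  dyadic p.1.1 @^-1` [set p.1.2].
have mF : measurable (curve_sum @^-1` N).
  by rewrite -[X in measurable X]setTI; exact: measurable_curve_sum.
pose F (n : nat) : set 'cV[R]_m :=
  if (unpickle n : option (nat * {ffun 'I_m -> int} * nat)) is Some p then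
    if `[< good p >] then Q p `&` curve_sum @^-1` N else set0 else set0.
have mFn n : measurable (F n).
  rewrite /F; case: unpickle => // p; case: ifP => // _.
  by apply: measurableI => //; exact: measurable_dyadic_cube.
have F0 : L (\bigcup_n F n) = 0%E.
  apply: measure_bigcup_null => // n; rewrite /F.
  case: unpickle => [p|]; last by rewrite measure0.
  case: ifPn => [/asboolP gp|_]; last by rewrite measure0.
  apply: (lipschitz_inverse_null Lbox (c := p.2%:R)) => //.
  - exact: measurable_dyadic_cube.
  - exact: measurable_curve_sum.
apply: (subset_measure0 _ _ _ F0) => //.
- apply: measurableI => //.
  rewrite (_ : (fun x => is_true _) = ~` [set x | \det (curve_jacobian x) == 0]).
    apply: measurableC; apply: measurable_set_bool; apply: measurable_fun_eqr => //.
    by apply: measurable_fun_det; exact: measurable_curve_jacobian.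
  by apply/seteqP; split => x /=; [move/negP|move/negP].
- exact: bigcupT_measurable.
- move=> s [dJ Ns]; have [k [K h]] := inverse_lipschitz dJ.
  exists (pickle (k, dyadic k s, K)) => //; rewrite /F pickleK.
  by case: asboolP => // -[]; exact: h.
Qed.

End CurveSums.

(** * Atoms of Poisson random measures *)

Lemma ae_countable (disp : measure_display) (T : measurableType disp) (R : realType)
    (mu : {measure set T -> \bar R}) (I : countType) (Q : I -> T -> Prop) :
  (forall i, {ae mu, forall w, Q i w}) -> {ae mu, forall w, forall i, Q i w}.
Proof.
move=> h; have : {ae mu, forall w, forall n, forall i : I, unpickle n = Some i -> Q i w}.
  apply/ae_foralln => n; case: (unpickle n) => [i|]; last exact: aeW.
  by apply: filterS (h i) => w ? _ [<-].
by apply: filterS => w hw i; apply: (hw (pickle i)); exact: pickleK.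
Qed.

Lemma measurable_point (R : realType) n (u : 'cV[R]_n) : measurable [set u].
Proof.
rewrite (_ : [set u] = box (fun i => [set u i 0])).
  by apply: measurable_box => i; exact: measurable_set1.
apply/seteqP; split => [_ -> i//|v h /=].
by apply/matrixP => i j; rewrite ord1; exact: h.
Qed.

Lemma measure_bigsetU_le (disp : measure_display) (T : measurableType disp) (R : realType)
    (mu : {measure set T -> \bar R}) (I : finType) (F : I -> set T) :
  (forall i, measurable (F i)) -> (mu (\big[setU/set0]_i F i) <= \sum_i mu (F i))%E.
Proof.
move=> mF; have [] : measurable (\big[setU/set0]_i F i) /\
  (mu (\big[setU/set0]_i F i) <= \sum_i mu (F i))%E.
  elim/big_rec2 : _ => [|i A x _ [mA IH]]; first by rewrite measure0.
  split; first exact: measurableU.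
  by rewrite (le_trans (measureU2 _ _ _))// leeD2l.
by [].
Qed.

Section Atoms.
Context (d : measure_display) (T : measurableType d) (R : realType).
Variables (mu : {measure set T -> \bar R}) (C : set T) (p : T).
Hypotheses (mC : measurable C) (mp : measurable [set p]) (Cp : C p)
  (muC : mu C = 1%E) (mup : mu [set p] = 1%E).

Lemma atom_diff : mu (C `\` [set p]) = 0%E.
Proof.
apply: adde_eq1; rewrite -[X in (X + _)%E]mup -measureU//.
- by rewrite setDUK// => _ ->.
- exact: measurableD.
- by apply/seteqP; split => // x [xp [_ /(_ xp)]].
Qed.

Lemma atom_integral (f : T -> R) : measurable_fun setT f ->
  \int[mu]_(x in C) f x = f p.
Proof.
move=> mf; have mg : measurable_fun C f by exact: measurable_funTS.
rewrite -[RHS]mulr1 -[X in _ * X](_ : fine (mu C) = 1); last by rewrite muC.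
rewrite -Rintegral_cst//; congr fine; apply: ae_eq_integral => //.
- exact/measurable_EFinP.
exists (C `\` [set p]); split; [exact: measurableD|exact: atom_diff|].
move=> x /= /not_implyP[Cx h]; split=> //= xp; apply: h.
by rewrite xp.
Qed.

Lemma atom_unique (q : T) : measurable [set q] -> C q -> mu [set q] = 1%E -> q = p.
Proof.
move=> mq Cq muq; apply: contrapT => qp.
have : (mu [set q] <= mu (C `\` [set p]))%E.
  by rewrite le_measure ?inE//; [exact: measurableD|move=> _ ->].
by rewrite atom_diff muq lee_fin ler10.
Qed.

End Atoms.

Section PoissonAtoms.
Context (R : realType) (disp : measure_display) (Omega : measurableType disp).
Context (P : probability Omega R).

Section NoDouble.
Context (d : measure_display) (T : measurableType d).
Variables (lam : {measure set T -> \bar R}) (nu : Omega -> {measure set T -> \bar R}).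
Hypothesis prm : is_poisson_random_measure P lam nu.

Let mnu E x : measurable E -> measurable [set w | nu w E = x].
Proof.
by move=> mE; have := measurable_prm prm mE measurableT (emeasurable_set1 x); rewrite setTI.
Qed.

(** The inequality 1 - (1 + a) exp(-a) <= a^2 follows from exp(-a) >= 1 - a. *)
Lemma prm_two_points E : measurable E -> (lam E < +oo)%E ->
  (P (~` ([set w | nu w E = 0%E] `|` [set w | nu w E = 1%E])) <=
  (fine (lam E) ^+ 2)%:E)%E.
Proof.
move=> mE lE; have m0 := mnu 0%E mE; have m1 := mnu 1%E mE.
have p0 : P [set w | nu w E = 0%E] = _ := prm_poisson prm 0 mE lE.
have p1 : P [set w | nu w E = 1%E] = _ := prm_poisson prm 1 mE lE.
rewrite probability_setC ?measureU//; first last.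
- exact: measurableU.
- by apply/seteqP; split => // w [/= ->] /eqP; rewrite eqe eq_sym oner_eq0.
set a := fine (lam E) in p0 p1 *.
apply: (@le_trans _ _ (1 - (expR (- a) + a * expR (- a)))%:E).
  rewrite le_eqVlt EFinB EFinD; apply/orP; left; apply/eqP.
  congr (1 - (_ + _))%E.
    by apply: (etrans p0); rewrite fact0 expr0 invr1 !mul1r.
  by apply: (etrans p1); rewrite expr1 (_ : 1`! = 1%N)// invr1 mulr1.
rewrite lee_fin.
have r0 : 0 <= a by exact: fine_ge0.
have := expR_ge1Dx (- a); nra.
Qed.

(** Summing the quadratic bound over the 2^k cells gives c^2 / 2^k, so the event that every scale
    has a cell with count other than 0 and 1 has probability zero. *)
Lemma prm_no_double (C : forall k, 'I_(2 ^ k) -> set T) (c : R) : 0 <= c ->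
  (forall k i, measurable (C k i)) ->
  (forall k i, (lam (C k i) <= (c / 2 ^+ k)%:E)%E) ->
  {ae P, forall w, exists k, forall i, nu w (C k i) = 0%E \/ nu w (C k i) = 1%E}.
Proof.
move=> c0 mC lC.
pose B k i := ~` ([set w | nu w (C k i) = 0%E] `|` [set w | nu w (C k i) = 1%E]).
have mB k i : measurable (B k i) by apply: measurableC; apply: measurableU; exact: mnu.
pose U k := \big[setU/set0]_i B k i.
have mU k : measurable (U k) by exact: bigsetU_measurable.
have PU k : (P (U k) <= (c ^+ 2 / 2 ^+ k)%:E)%E.
  have PB i : (P (B k i) <= ((c / 2 ^+ k) ^+ 2)%:E)%E.
    have lf : (lam (C k i) < +oo)%E by rewrite (le_lt_trans (lC k i))// ltry.
    apply: (le_trans (prm_two_points (mC k i) lf)).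
    rewrite lee_fin lerXn2r ?nnegrE ?fine_ge0//.
      by rewrite divr_ge0// exprn_ge0.
    by rewrite -lee_fin fineK// ge0_fin_numE.
  apply: (@le_trans _ _ (\sum_(i < 2 ^ k) P (B k i))%E).
    exact: measure_bigsetU_le.
  apply: (le_trans (lee_sum _ (fun i _ => PB i))).
  rewrite sumEFin lee_fin sumr_const card_ord -[leLHS]mulr_natr natrX.
  rewrite le_eqVlt; apply/orP; left; apply/eqP.
  by rewrite expr_div_n -!mulrA; congr (_ * _); rewrite expr2 invfM -mulrA mulVf ?mulr1// gt_eqF// exprn_gt0.
exists (\bigcap_k U k); split; first exact: bigcapT_measurable.
  apply/eqP; rewrite eq_le measure_ge0 andbT; apply/lee_addgt0Pr => e e0.
  have c2 : 0 <= c ^+ 2 / e by rewrite divr_ge0// ?sqr_ge0// ltW.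
  have b0 := archi_boundP c2; set b := Num.bound _ in b0.
  rewrite add0e (@le_trans _ _ (P (U b)))//.
    by rewrite le_measure ?inE//; [exact: bigcapT_measurable|exact: bigcap_inf].
  rewrite (le_trans (PU b))// lee_fin ler_pdivrMr ?exprn_gt0// -ler_pdivrMl//.
  rewrite mulrC ltW// (lt_le_trans b0)// -natrX ler_nat ltnW//.
  exact: ltn_expl.
move=> w /= h k _; apply: contrapT => Uk; apply: h; exists k => i.
apply: contrapT => /not_orP[n0 n1]; apply: Uk; apply/bigsetU_mem; exists i => //.
by move=> [].
Qed.

End NoDouble.

Context (n : nat).
Notation T := (R * 'cV[R]_n)%type.
Variables (lam : {measure set T -> \bar R}) (nu : Omega -> {measure set T -> \bar R}).
Hypothesis prm : is_poisson_random_measure P lam nu.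

Let coord (o : option 'I_n) (p : T) : R := if o is Some i then p.2 i 0 else p.1.

Let measurable_coord o : measurable_fun setT (coord o).
Proof.
case: o => [i|]; last exact: measurable_fst.
apply: measurable_fun_mx_entry; exact: measurable_snd.
Qed.

(** All rational sublevel sets of all coordinates have integral mass at once, almost surely. When
    [C] has mass one these masses are 0 or 1, so every coordinate is almost constant under [nu w],
    and the constants are the coordinates of the atom. *)
Lemma prm_atom C : measurable C -> (lam C < +oo)%E ->
  {ae P, forall w, nu w C = 1%E -> exists2 p, C p & nu w [set p] = 1%E}.
Proof.
move=> mC lC.
pose L (x : option 'I_n * rat) := C `&` [set p | coord x.1 p <= ratr x.2].
have mL x : measurable (L x).
  by apply: measurableI => //; apply: measurable_set_le => //; exact: measurable_cst.
have : {ae P, forall w, forall x, exists k : nat, nu w (L x) = k%:R%:E}.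
  apply: ae_countable => x; apply: (prm_nat prm) => //.
  by apply: le_lt_trans lC; rewrite le_measure ?inE//; exact: subIsetl.
apply: filterS => w h w1.
have z1 x : nu w (L x) = 0%E \/ nu w (L x) = 1%E.
  have : (nu w (L x) <= 1)%E by rewrite -w1 le_measure ?inE//; exact: subIsetl.
  have [[|[|k]] ->] := h x; [by left|by right|].
  by rewrite lee_fin -[X in _ <= X]/(1%:R) ler_nat.
have hc o := zero_one_constant mC w1 (measurable_coord o) (fun q => z1 (o, q)).
pose c o := projT1 (cid (hc o)).
have c0 o : nu w (C `&` [set p | coord o p != c o]) = 0%E := projT2 (cid (hc o)).
pose p : T := (c None, \col_i c (Some i)).
have mne o : measurable (C `&` [set p | coord o p != c o]).
  apply: measurableI => //; apply: measurable_set_bool.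
  rewrite (_ : (fun x => _) = (fun x => ~~ (coord o x == c o))) //.
  apply: measurableT_comp => //; apply: measurable_fun_eqr => //; exact: measurable_cst.
have U0 : nu w (\big[setU/set0]_o (C `&` [set p | coord o p != c o])) = 0%E.
  apply/eqP; rewrite eq_le measure_ge0 andbT (le_trans (measure_bigsetU_le _ _))//.
  by rewrite big1.
have mp : measurable [set p].
  rewrite (_ : [set p] = [set p.1] `*` [set p.2]).
    by apply: measurableX; [exact: measurable_set1|exact: measurable_point].
  by apply/seteqP; split => [_ ->//|[a b] /= [-> ->]].
have CU : C `<=` [set p] `|` \big[setU/set0]_o (C `&` [set p | coord o p != c o]).
  move=> q Cq; have [/existsP H|/existsPn hq] := boolP [exists o, coord o q != c o].
    by right; case: H => o oc; apply/bigsetU_mem; exists o.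
  left => /=.
  have e o : coord o q = c o by apply/eqP; have := hq o; rewrite negbK.
  rewrite /p; case: q {Cq hq} e => s u e; congr pair; first exact: (e None).
  by apply/matrixP => i j; rewrite ord1 mxE; exact: (e (Some i)).
have np : nu w (C `&` [set p]) = 1%E.
  apply/eqP; rewrite eq_le -{1}w1 le_measure ?inE//=; last first.
  - exact: measurableI.
  rewrite -w1 -[leRHS]adde0 -[X in (_ <= _ + X)%E]U0.
  rewrite (le_trans _ (measureU2 _ _ _))//.
  - rewrite le_measure ?inE//.
      by apply: measurableU; [exact: measurableI|exact: bigsetU_measurable].
    by move=> q Cq; case: (CU q Cq) => [?|]; [left|right].
  - exact: measurableI.
  - exact: bigsetU_measurable.
have Cp : C p.
  apply: contrapT => Cp.
  move: np; rewrite (_ : _ `&` _ = set0); last first.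
    by apply/seteqP; split => // x [/[swap] ->].
  by rewrite measure0 => /eqP; rewrite eqe eq_sym oner_eq0.
by exists p => //; rewrite -np; congr (nu w _); apply/seteqP; split => [_ ->//|x []].
Qed.

End PoissonAtoms.

(** * Levy measures and space-time cells *)

Section LevyMeasure.
Context (R : realType) (n : nat).
Implicit Types u : 'cV[R]_n.

Lemma enorm_ge0 u : 0 <= enorm u.
Proof. exact: sqrtr_ge0. Qed.

Lemma enorm_eq0 u : enorm u = 0 -> u = 0.
Proof.
move=> /eqP; rewrite sqrtr_eq0 => h.
have : \sum_(i < n) u i 0 ^+ 2 == 0.
  by rewrite eq_le h sumr_ge0// => i _; exact: sqr_ge0.
rewrite psumr_eq0 => [|i _]; last exact: sqr_ge0.
move=> /allP h0; apply/matrixP => i j; rewrite ord1 mxE.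
by have := h0 i (mem_index_enum i); rewrite sqrf_eq0 => /eqP.
Qed.

Definition shell (a b : R) : set 'cV[R]_n := [set u | a < enorm u <= b].

Lemma measurable_shell a b : measurable (shell a b).
Proof.
rewrite (_ : shell a b = [set u | a < enorm u] `&` [set u | enorm u <= b]).
  apply: measurableI; [apply: measurable_set_lt|apply: measurable_set_le];
    try exact: measurable_enorm; exact: measurable_cst.
by apply/seteqP; split => u; [move=> /andP|move=> /andP].
Qed.

Lemma eps_lt (a : R) : 0 < a -> exists k, forall j, (k <= j)%N -> j.+1%:R^-1 < a.
Proof.
move=> a0; exists (Num.bound a^-1) => j kj.
rewrite invf_plt ?posrE//; apply: (lt_le_trans (archi_boundP _)).
  by rewrite invr_ge0 ltW.
by rewrite ler_nat (leq_trans kj).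
Qed.

Variable Pi : {measure set 'cV[R]_n -> \bar R}.
Hypothesis levy : is_levy_measure Pi.

Lemma levy_tail_lty (a : R) : 0 < a -> (Pi [set u | (a < enorm u)%R] < +oo)%E.
Proof.
move=> a0; case: levy => _ Pioo.
pose c := Num.min (a ^+ 2) 1.
have c0 : 0 < c by rewrite lt_min exprn_gt0/=.
have mg : measurable_fun setT (fun u => (Num.min (enorm u ^+ 2) 1)%:E).
  apply/measurable_EFinP; apply: measurable_minr; last exact: measurable_cst.
  by apply: measurable_funX; exact: measurable_enorm.
have mS : measurable [set u : 'cV[R]_n | a < enorm u].
  by apply: measurable_set_lt; [exact: measurable_cst|exact: measurable_enorm].
have g0 u : (0 <= (Num.min (enorm u ^+ 2) 1)%:E)%E by rewrite lee_fin le_min sqr_ge0 ler01.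
have h : (c%:E * Pi [set u | (a < enorm u)%R] < +oo)%E.
  rewrite -integral_cst//; apply: le_lt_trans Pioo.
  apply: (@le_trans _ _ (\int[Pi]_(u in [set u | (a < enorm u)%R]) (Num.min (enorm u ^+ 2) 1)%:E)%E).
    apply: ge0_le_integral => //.
    - by move=> u _; rewrite lee_fin ltW.
    - exact: measurable_funTS.
    - move=> u /= au; rewrite lee_fin le_min !ge_min lexx orbT andbT.
      by rewrite lerXn2r// ?nnegrE ?enorm_ge0 ?ltW.
  exact: ge0_subset_integral.
rewrite ltey; apply/eqP => e; move: h.
by rewrite e gt0_muley ?lte_fin.
Qed.

Lemma levy_shell_lty (a b : R) : 0 < a -> (Pi (shell a b) < +oo)%E.
Proof.
move=> a0; apply: le_lt_trans (levy_tail_lty a0).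
rewrite le_measure ?inE//; first exact: measurable_shell.
  apply: measurable_set_lt; [exact: measurable_cst|exact: measurable_enorm].
by move=> u /= /andP[].
Qed.

Lemma levy_sigma_finite : sigma_finite setT Pi.
Proof.
exists (fun k => [set u | enorm u <= 0] `|` [set u | k.+1%:R^-1 < enorm u]).
  apply/esym; rewrite -subTset => u _.
  have [u0|u0] := leP (enorm u) 0; first by exists 0%N => //; left.
  by have [k hk] := eps_lt u0; exists k => //; right => /=; exact: hk.
have m1 : measurable [set u : 'cV[R]_n | enorm u <= 0].
  by apply: measurable_set_le; [exact: measurable_enorm|exact: measurable_cst].
have m2 k : measurable [set u : 'cV[R]_n | k.+1%:R^-1 < enorm u].
  by apply: measurable_set_lt; [exact: measurable_cst|exact: measurable_enorm].
move=> k; split; first exact: measurableU.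
apply: (le_lt_trans (measureU2 _ m1 (m2 k))); rewrite lte_add_pinfty//.
  rewrite (_ : [set u | _] = [set 0]); first by case: levy => h _; apply: (@le_lt_trans _ _ 0%E); [rewrite -h|exact: ltry].
  apply/seteqP; split => [u /= u0|_ ->/=].
    by apply: enorm_eq0; apply/eqP; rewrite eq_le u0 enorm_ge0.
  by rewrite /enorm big1 ?sqrtr0// => i _; rewrite mxE expr0n.
by apply: levy_tail_lty; rewrite invr_gt0.
Qed.

End LevyMeasure.

Section Intensity.
Context (R : realType) (d : nat) (Pi : {measure set 'cV[R]_d -> \bar R}).
Hypothesis levy : is_levy_measure Pi.
Notation T := (R * 'cV[R]_d)%type.

Lemma measurable_future : measurable (`[0%R, +oo[ `*` setT : set T).
Proof. by apply: measurableX. Qed.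

Let mid : measurable_fun setT (id : measurableTypeR R * 'cV[R]_d -> T).
Proof. by move=> _ B mB; rewrite setTI. Qed.

(** The set function [intensity Pi] as a bundled measure: integrability makes a Levy measure
    sigma-finite, and the product is then additive. The two agree by conversion. *)
Definition intensity_measure : {measure set T -> \bar R} :=
  restm (pushm (lebesgue_measure \x sigma_finite_copy (levy_sigma_finite levy))%E mid)
    measurable_future.

Lemma intensity_measure_rect (J : set R) (U : set 'cV[R]_d) : measurable J ->
  measurable U -> J `<=` `[0, +oo[ ->
  intensity_measure (J `*` U) = (lebesgue_measure J * Pi U)%E.
Proof.
move=> mJ mU Jp; rewrite /intensity_measure restmE.
rewrite (_ : _ `&` _ = J `*` U); first exact: product_measure1E.
apply/seteqP; split => [[s u] [] //|[s u] /= [Js Uu]]; split => //; split => //=.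
exact: Jp.
Qed.

End Intensity.

Section Cells.
Context (R : realType) (d : nat) (t : R).
Hypothesis t0 : 0 < t.
Notation T := (R * 'cV[R]_d)%type.

(** The outer radius 1 keeps the jumps to be selected inside the compensated part, so that the large
    jumps never interfere with them. *)
Definition annulus (n : nat) : set 'cV[R]_d := shell n.+1%:R^-1 1.

Definition window (n : nat) : set T := `]0, t] `*` annulus n.

Definition slot (k i : nat) : set R := `]t / 2 ^+ k * i%:R, t / 2 ^+ k * i.+1%:R].

Definition cell (n k : nat) (i : 'I_(2 ^ k)) : set T := slot k i `*` annulus n.

Lemma slotE k i s :
  slot k i s = (t / 2 ^+ k * i%:R < s <= t / 2 ^+ k * i.+1%:R) :> Prop.
Proof. by rewrite /slot/= in_itv. Qed.

Lemma measurable_slot k i : measurable (slot k i).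
Proof. exact: measurable_itv. Qed.

Lemma measurable_annulus n : measurable (annulus n).
Proof. exact: measurable_shell. Qed.

Lemma measurable_window n : measurable (window n).
Proof. by apply: measurableX => //; exact: measurable_annulus. Qed.

Lemma measurable_cell n k i : measurable (@cell n k i).
Proof. by apply: measurableX; [exact: measurable_slot|exact: measurable_annulus]. Qed.

Lemma annulus_le n n' : (n <= n')%N -> annulus n `<=` annulus n'.
Proof.
move=> nn u /andP[nu u1]; apply/andP; split => //; apply: le_lt_trans nu.
by rewrite lef_pV2 ?posrE// ler_nat.
Qed.

Lemma window_le n n' : (n <= n')%N -> window n `<=` window n'.
Proof. by move=> nn p [ps pu]; split => //; exact: annulus_le pu. Qed.

Let step0 k : 0 < t / 2 ^+ k.
Proof. by rewrite divr_gt0// exprn_gt0. Qed.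

Lemma slot_sub k i : (i < 2 ^ k)%N -> slot k i `<=` `]0, t].
Proof.
move=> ik s; rewrite slotE => /andP[s1 s2]; rewrite /= in_itv/=; apply/andP; split.
  by apply: le_lt_trans s1; rewrite mulr_ge0// ltW.
apply: (le_trans s2); rewrite -mulrA ger_pMr// mulrC ler_pdivrMr ?exprn_gt0// mul1r.
by rewrite -natrX ler_nat.
Qed.

Lemma cell_window n k i : @cell n k i `<=` window n.
Proof. by move=> p [p1 p2]; split => //; apply: slot_sub p1. Qed.

Lemma slot_disjoint k i j : i != j -> slot k i `&` slot k j = set0.
Proof.
wlog ij : i j / (i < j)%N => [h|_].
  rewrite neq_ltn => /orP[ij|ij]; first by rewrite h// neq_ltn ij.
  by rewrite setIC h// neq_ltn ij.
apply/seteqP; split => // s []; rewrite !slotE => /andP[_ s1] /andP[s2 _].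
have := lt_le_trans s2 s1; rewrite ltr_pM2l// ltr_nat ltnS leqNgt ij //.
Qed.

Lemma cell_disjoint n k (i j : 'I_(2 ^ k)) : i != j ->
  @cell n k i `&` @cell n k j = set0.
Proof.
move=> ij; apply/seteqP; split => // p [[p1 _] [p2 _]].
by have := slot_disjoint k ij; move=> /seteqP[h _]; apply: (h p.1).
Qed.

Lemma slot_cover k s : 0 < s <= t -> exists i : 'I_(2 ^ k), slot k i s.
Proof.
move=> /andP[s0 st].
have ex : exists i, s <= t / 2 ^+ k * i.+1%:R.
  exists (2 ^ k).-1; rewrite prednK ?expn_gt0// natrX divfK// gt_eqF// exprn_gt0//.
case: (ex_minnP ex) => i si imin.
have ik : (i < 2 ^ k)%N.
  have := imin (2 ^ k).-1; rewrite prednK ?expn_gt0// natrX divfK ?gt_eqF ?exprn_gt0//.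
  by move=> /(_ st); rewrite -ltnS prednK ?expn_gt0.
exists (Ordinal ik) => /=; rewrite slotE si andbT ltNge; apply/negP => h.
case: i => [|i] in si imin ik h *; first by move: h; rewrite mulr0 leNgt s0.
by have := imin i h; rewrite ltnn.
Qed.

Lemma window_cell n k p : window n p -> exists i, @cell n k i p.
Proof.
move=> [p1 p2]; have [|i hi] := slot_cover k (s := p.1).
  by move: p1; rewrite /= in_itv.
by exists i.
Qed.

Lemma slot_measure k i : lebesgue_measure (slot k i) = (t / 2 ^+ k)%:E.
Proof.
rewrite /slot lebesgue_measure_itv/= lte_fin ltr_pM2l// ltr_nat ltnSn.
by rewrite -EFinB -mulrBr -natrB// subSnn mulr1.
Qed.

Variable Pi : {measure set 'cV[R]_d -> \bar R}.
Hypothesis levy : is_levy_measure Pi.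
Let lam := intensity_measure levy.

Lemma intensity_cell n k i :
  lam (@cell n k i) = (t / 2 ^+ k * fine (Pi (annulus n)))%:E.
Proof.
rewrite /lam/= intensity_measure_rect; last 3 first.
- exact: measurable_slot.
- exact: measurable_annulus.
- by move=> s /(slot_sub (ltn_ord i)); rewrite /= !in_itv/= => /andP[/ltW->].
rewrite slot_measure [RHS]EFinM fineK ?ge0_fin_numE//.
by apply: levy_shell_lty => //; rewrite invr_gt0.
Qed.

Lemma intensity_window_lty n : (lam (window n) < +oo)%E.
Proof.
rewrite /lam/= intensity_measure_rect//; last 2 first.
- exact: measurable_annulus.
- by move=> s; rewrite /= !in_itv/= => /andP[/ltW->].
apply: lte_mul_pinfty => //; last by apply: levy_shell_lty => //; rewrite invr_gt0.
by rewrite lebesgue_measure_itv/= lte_fin t0 -EFinB.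
Qed.

End Cells.

Section Mark.
Context (R : realType) (d : nat).
Notation T := (R * 'cV[R]_d)%type.

(** When [mu] restricted to [C] is a unit point mass, integrating the coordinates returns its
    location. Unlike a choice of the atom, this depends measurably on the counts. *)
Definition mark (mu : {measure set T -> \bar R}) (C : set T) : T :=
  (\int[mu]_(x in C) x.1, vintegral mu C snd).

Lemma measurable_point2 (p : T) : measurable [set p].
Proof.
rewrite (_ : [set p] = [set p.1] `*` [set p.2]).
  by apply: measurableX; [exact: measurable_set1|exact: measurable_point].
by case: p => s u; apply/seteqP; split => [_ ->//|[a b] /= [-> ->]].
Qed.

Lemma mark_atom (mu : {measure set T -> \bar R}) C p : measurable C -> C p ->
  mu C = 1%E -> mu [set p] = 1%E -> mark mu C = p.
Proof.
move=> mC Cp C1 p1; have mp := measurable_point2 p.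
rewrite /mark (atom_integral mC mp Cp C1 p1 measurable_fst).
case: p Cp p1 mp => s u Cp p1 mp; congr pair.
apply/matrixP => i j; rewrite ord1 mxE.
apply: (atom_integral mC mp Cp C1 p1 (f := fun x => x.2 i 0)).
by apply: measurable_fun_mx_entry; exact: measurable_snd.
Qed.

End Mark.

Section GoodConfigurations.
Context (R : realType) (d : nat) (t : R).
Hypothesis t0 : 0 < t.
Notation T := (R * 'cV[R]_d)%type.

(** The almost sure properties are collected for all of the countably many cells, which makes the
    rest pathwise: a cell of mass one has an atom, and every annulus has a scale without multiple
    occupation. *)
Definition good_configuration (mu : {measure set T -> \bar R}) :=
  (forall x : {n : nat & {k : nat & 'I_(2 ^ k)}},
     mu (cell t (tag x) (tagged (tagged x))) = 1%E ->
     exists2 p, cell t (tag x) (tagged (tagged x)) p & mu [set p] = 1%E) /\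
  (forall n, exists k, forall i : 'I_(2 ^ k),
     mu (cell t n i) = 0%E \/ mu (cell t n i) = 1%E).

Lemma good_cell (mu : {measure set T -> \bar R}) n k (i : 'I_(2 ^ k)) :
  good_configuration mu -> mu (cell t n i) = 1%E ->
  exists p, [/\ cell t n i p, mu [set p] = 1%E & mark mu (cell t n i) = p].
Proof.
move=> [h _] c1; have [p cp p1] := h (Tagged _ (Tagged (fun k => 'I_(2 ^ k)) i)) c1.
by exists p; split => //; apply: mark_atom => //; exact: measurable_cell.
Qed.

(** At a scale without multiple occupation, in an annulus containing all the points, distinct atoms
    fall into distinct cells. Random points are thereby replaced by one of countably many choices of
    cells. *)
Lemma good_atoms (mu : {measure set T -> \bar R}) j (p : 'I_j -> T) :
  good_configuration mu -> injective p ->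
  (forall a, mu [set p a] = 1%E) -> (forall a, exists n, window t n (p a)) ->
  exists n k (c : 'I_j -> 'I_(2 ^ k)), injective c /\
    forall a, mu (cell t n (c a)) = 1%E /\ mark mu (cell t n (c a)) = p a.
Proof.
move=> [g1 g2] pinj p1 pw.
have [n hn] : exists n, forall a, window t n (p a).
  have [f hf] := choice pw.
  by exists (\max_a f a) => a; apply: window_le (hf a); exact: leq_bigmax.
have [k hk] := g2 n.
have [c hc] := choice (fun a => window_cell k (hn a)).
have c1 a : mu (cell t n (c a)) = 1%E.
  have [c0|//] := hk (c a); have : (mu [set p a] <= mu (cell t n (c a)))%E.
    rewrite le_measure ?inE//; [exact: measurable_point2|exact: measurable_cell|].
    by move=> _ ->.
  by rewrite p1 c0 lee_fin ler10.
exists n, k, c; split; last first.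
  by move=> a; split=> //; apply: mark_atom => //; exact: measurable_cell.
move=> a b ab; apply: pinj.
apply: (atom_unique (@measurable_cell _ _ t n k (c b))) => //.
- exact: measurable_point2.
- exact: measurable_point2.
- by rewrite -ab.
Qed.

Context (disp : measure_display) (Omega : measurableType disp) (P : probability Omega R).
Variable Pi : {measure set 'cV[R]_d -> \bar R}.
Hypothesis levy : is_levy_measure Pi.
Variable nu : Omega -> {measure set T -> \bar R}.
Hypothesis prm : is_poisson_random_measure P (intensity_measure levy) nu.

Lemma ae_good_configuration : {ae P, forall w, good_configuration (nu w)}.
Proof.
have h1 : {ae P, forall w, forall x : {n : nat & {k : nat & 'I_(2 ^ k)}},
     nu w (cell t (tag x) (tagged (tagged x))) = 1%E ->
     exists2 p, cell t (tag x) (tagged (tagged x)) p & nu w [set p] = 1%E}.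
  apply: ae_countable => -[n [k i]] /=; apply: (prm_atom prm).
    exact: measurable_cell.
  by rewrite intensity_cell ?ltry.
have h2 : {ae P, forall w, forall n, exists k, forall i : 'I_(2 ^ k),
     nu w (cell t n i) = 0%E \/ nu w (cell t n i) = 1%E}.
  apply/ae_foralln => n.
  have c0 : 0 <= t * fine (Pi (@annulus R d n)).
    by rewrite mulr_ge0 ?fine_ge0// ltW.
  apply: (prm_no_double prm (C := fun k i => cell t n i) c0).
  - by move=> k i; exact: measurable_cell.
  - by move=> k i; rewrite intensity_cell// lee_fin mulrAC.
by apply: filterS2 h1 h2 => w.
Qed.

End GoodConfigurations.

Lemma measurable_set_neq0 dT (X : measurableType dT) (R : realType) (f : X -> R) :
  measurable_fun setT f -> measurable [set x | f x != 0].
Proof.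
move=> mf; rewrite (_ : [set x | _] = ~` (f @^-1` [set 0])).
  apply: measurableC; rewrite -[X in measurable X]setTI.
  by apply: mf => //; exact: measurable_set1.
by apply/seteqP; split => x /= /eqP.
Qed.

Lemma measurable_set_mx1_neq0 dT (X : measurableType dT) (R : realType)
    (f : X -> 'M[R]_1) :
  measurable_fun setT f -> measurable [set x | f x != 0].
Proof.
move=> mf; rewrite (_ : [set x | _] = [set x | f x 0 0 != 0]).
  by apply: measurable_set_neq0; exact: measurable_fun_mx_entry.
apply/seteqP; split => x /=; apply: contraNN => /eqP h; last by rewrite h mxE.
by apply/eqP/matrixP => i j; rewrite !ord1 h mxE.
Qed.

(** * Jumps with linearly independent velocities *)

Section Spanning.
Context (R : realType) (m d : nat) (A : 'M[R]_m) (D : 'M[R]_(m, d)) (t : R).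
Hypothesis t0 : 0 < t.
Hypothesis rk : \rank (\mxrow_(j < m) (A ^+ j.+1 *m D)) = m.
Notation T := (R * 'cV[R]_d)%type.
Context (disp : measure_display) (Omega : measurableType disp) (P : probability Omega R).
Variable Pi : {measure set 'cV[R]_d -> \bar R}.
Hypothesis levy : is_levy_measure Pi.
Hypothesis nondeg : ess_lin_nondegenerated Pi.
Variable nu : Omega -> {measure set T -> \bar R}.
Hypothesis prm : is_poisson_random_measure P (intensity_measure levy) nu.
Let lam := intensity_measure levy.

(** The derivative in s of exp((t - s)A) D u at the space-time point (s, u). *)
Definition velocity (p : T) : 'cV[R]_m :=
  - (A *m exp_mx A (t - p.1) *m (D *m p.2)).

Lemma measurable_velocity : measurable_fun setT velocity.
Proof.
apply: measurable_fun_oppmx; apply: measurable_fun_mulmx.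
  apply: measurable_fun_mulmx; first exact: measurable_cst.
  by apply: measurable_exp_mx; apply: measurable_funB => //; exact: measurable_fst.
by apply: measurable_fun_mulmx; [exact: measurable_cst|exact: measurable_snd].
Qed.

Definition velocities j (p : 'I_j -> T) : 'M[R]_(m, j) :=
  \matrix_(i, a) velocity (p a) i 0.

Let gram j (N : 'M[R]_(m, j)) : R := \det (N^T *m N).

Let measurable_gram j dT (X : measurableType dT) (N : X -> 'M[R]_(m, j)) :
  measurable_fun setT N -> measurable_fun setT (fun x => gram (N x)).
Proof.
move=> mN; apply: measurable_fun_det; apply: measurable_fun_mulmx => //.
by apply: measurable_fun_mx => a b; under eq_fun do rewrite mxE; exact: measurable_fun_mx_entry.
Qed.

Let measurable_gram_neq0 j dT (X : measurableType dT) (N : X -> 'M[R]_(m, j)) :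
  measurable_fun setT N -> measurable [set x | gram (N x) != 0].
Proof.
move=> mN; apply: measurable_set_neq0; exact: measurable_gram.
Qed.

(** Jumps too small for [window n]. They are independent of everything selected there, yet those
    with velocity off a given hyperplane still have infinite total intensity. *)
Let inner n k : set T := `]0, t] `*` shell (n + k).+2%:R^-1 n.+1%:R^-1.

Let measurable_inner n k : measurable (inner n k).
Proof. by apply: measurableX => //; exact: measurable_shell. Qed.

Let inner_window n k : inner n k `<=` window t (n + k).+1.
Proof.
move=> p [p1 /andP[p2 p3]]; split => //; apply/andP; split => //.
by rewrite (le_trans p3)// invf_le1// ler1n.
Qed.

Let inner_disjoint n k : inner n k `&` window t n = set0.
Proof.
apply/seteqP; split => // p [[_ /andP[_ p1]] [_ /andP[p2 _]]].
by have := lt_le_trans p2 p1; rewrite ltxx.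
Qed.

Let inner_bigcup n : \bigcup_k inner n k =
  `]0, t] `*` [set u : 'cV[R]_d | 0 < enorm u <= n.+1%:R^-1].
Proof.
apply/seteqP; split => [p [k _ [p1 /andP[p2 p3]]]|p [p1 /andP[p2 p3]]].
  by split => //; apply/andP; split => //; apply: le_lt_trans p2.
have [k hk] := eps_lt p2; exists k => //; split => //; apply/andP; split => //.
by apply: hk; rewrite -addSn leq_addl.
Qed.

(** The kernel of the row [r] is a proper subspace, so [Pi] is infinite off it, while jumps of norm
    above 1/(n+1) contribute only a finite amount. *)
Let section_infinite n s (l : 'rV[R]_m) :
  l *m A *m exp_mx A (t - s) *m D != 0 ->
  Pi ([set u | 0 < enorm u <= n.+1%:R^-1] `&` [set u | l *m velocity (s, u) != 0]) = +oo%E.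
Proof.
set r := l *m A *m exp_mx A (t - s) *m D => r0.
pose L : {vspace 'cV[R]_d} := lker (linfun (mulmx r)).
have LE u : (u \in L) = (r *m u == 0) by rewrite memv_ker lfunE.
have vE u : l *m velocity (s, u) = - (r *m u).
  by rewrite /velocity/= mulmxN /r !mulmxA.
have Lfull : L != fullv.
  apply/negP => /eqP Lf; case/eqP: r0; apply/matrixP => i j; rewrite ord1 [RHS]mxE.
  have : delta_mx j 0 \in L by rewrite Lf memvf.
  rewrite LE => /eqP/matrixP/(_ 0 0); rewrite [RHS]mxE => <-.
  rewrite [RHS]mxE (bigD1 j)//= big1 => [|k /negbTE kj]; last by rewrite [X in _ * X]mxE kj mulr0.
  by rewrite [X in _ * X]mxE !eqxx mulr1 addr0.
have := nondeg Lfull.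
have mU : measurable [set u | l *m velocity (s, u) != 0].
  apply: measurable_set_mx1_neq0; apply: measurable_fun_mulmx; first exact: measurable_cst.
  by apply: measurableT_comp; [exact: measurable_velocity|exact: pair1_measurable].
have mS : measurable [set u : 'cV[R]_d | 0 < enorm u <= n.+1%:R^-1] := measurable_shell _ _.
have mB : measurable [set u : 'cV[R]_d | n.+1%:R^-1 < enorm u].
  by apply: measurable_set_lt; [exact: measurable_cst|exact: measurable_enorm].
set S := [set u | 0 < _ <= _] in mS *; set U := [set u | _ != 0] in mU *.
move=> Loo; have : (+oo <= Pi (S `&` U) + Pi [set u | (n.+1%:R^-1 < enorm u)%R])%E.
  rewrite -Loo; apply: le_trans (measureU2 _ _ _) => //; last exact: measurableI.
  rewrite le_measure ?inE//.
  - rewrite (_ : ~` _ = U) //; apply/seteqP; split => u; rewrite /U/= vE LE oppr_eq0 => /negP //.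
  - by apply: measurableU => //; exact: measurableI.
  - move=> u /=; rewrite LE => /negP ru; have [un|un] := ltP n.+1%:R^-1 (enorm u); first by right.
    left; split; last by rewrite /U/= vE oppr_eq0.
    rewrite /S/= un andbT lt_neqAle enorm_ge0 andbT eq_sym; apply: contra ru => /eqP/enorm_eq0 ->.
    by rewrite mulmx0.
have := levy_tail_lty levy (a := n.+1%:R^-1); rewrite invr_gt0 ltr0n => /(_ isT).
set b := Pi [set u | (_ < _)%R]; set a := Pi (_ `&` _) => boo h.
apply/eqP; rewrite -leye_eq leNgt; apply/negP => aoo.
by have := lte_add_pinfty aoo boo; rewrite ltNge h.
Qed.

(** By the rank condition the row l A exp(sA) D is not identically zero, hence by continuity it is
    nonzero on an interval of times. Over each of these times the slice has infinite [Pi]-mass. *)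
Let inner_infinite n (l : 'rV[R]_m) : l != 0 ->
  lam (\bigcup_k inner n k `&` [set p | l *m velocity p != 0]) = +oo%E.
Proof.
move=> l0.
have [s0 /andP[s00 s0t] rs0] : exists2 s, 0 < s < t & l *m A *m exp_mx A s *m D != 0.
  apply: contrapT => h; case/eqP: l0; apply: (exp_mx_kalman t0 rk) => s st.
  by apply/eqP/negP => /negP rs; apply: h; exists s.
have [j rj] : exists j, (l *m A *m exp_mx A s0 *m D) 0 j != 0.
  apply: contrapT => /forallNP h; case/eqP: rs0; apply/matrixP => i j; rewrite ord1 [RHS]mxE.
  by apply/eqP/negP => /negP; exact: h.
have cf := @continuous_exp_mx R m A _ _ (l *m A) D 0 j s0.
have [e /= e0 he] : exists2 e, 0 < e & forall s, `|s0 - s| < e -> (l *m A *m exp_mx A s *m D) 0 j != 0.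
  have : \forall s \near s0, (l *m A *m exp_mx A s *m D) 0 j != 0.
    move: cf => /cvgrPdist_lt/(_ `|(l *m A *m exp_mx A s0 *m D) 0 j|).
    rewrite normr_gt0 => /(_ rj); apply: filterS => s.
    by apply: contraTN => /eqP ->; rewrite subr0 ltxx.
  by move=> /nbhs_ballP[e /= e0 he]; exists e.
(* Besides the radius given by continuity, the two other bounds keep the reflected interval [J]
   between the times 0 and t. *)
pose e' := Num.min e (Num.min s0 (t - s0)).
have e'0 : 0 < e' by rewrite !lt_min e0 s00 subr_gt0.
pose J := `]t - s0 - e', t - s0 + e'[%classic : set R.
have Jp s : J s -> 0 < s <= t /\ l *m A *m exp_mx A (t - s) *m D != 0.
  rewrite /J/= in_itv/= => /andP[s1 s2].
  have h1 : e' <= e by rewrite ge_min lexx.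
  have h2 : e' <= s0 by rewrite !ge_min lexx orbT.
  have h3 : e' <= t - s0 by rewrite !ge_min lexx !orbT.
  split; first by apply/andP; split; lra.
  have : (l *m A *m exp_mx A (t - s) *m D) 0 j != 0.
    by apply: he; rewrite ltr_norml; apply/andP; split; lra.
  by apply: contraNN => /eqP ->; rewrite mxE.
set E := _ `&` _.
have mE : measurable E.
  apply: measurableI; first by apply: bigcupT_measurable => k.
  apply: measurable_set_mx1_neq0; apply: measurable_fun_mulmx; first exact: measurable_cst.
  exact: measurable_velocity.
have mEf : measurable (E `&` (`[0%R, +oo[ `*` setT)).
  by apply: measurableI => //; exact: measurable_future.
apply/eqP; rewrite -leye_eq /lam /intensity_measure restmE pushmE /=.
have J0 : (0 < lebesgue_measure J)%E.
  rewrite /J lebesgue_measure_itv/= lte_fin ltrD2l gtrN//.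
  by rewrite -EFinB lte_fin; lra.
have mJ : measurable (J : set (measurableTypeR R)) by exact: measurable_itv.
rewrite -[leLHS](gt0_mulye J0) -integral_cst//.
apply: (@le_trans _ _ (\int[lebesgue_measure]_(s in J)
   Pi (xsection (E `&` (`[0%R, +oo[ `*` setT)) s))%E); last first.
  pose g s := Pi (xsection (E `&` (`[0%R, +oo[ `*` setT)) s).
  have mg : measurable_fun (setT : set (measurableTypeR R)) g.
    exact: (measurable_fun_xsection (sigma_finite_copy (levy_sigma_finite levy)) mEf).
  exact: (@ge0_subset_integral _ _ _ lebesgue_measure J setT mJ measurableT g mg
    (fun _ _ => measure_ge0 _ _) (@subsetT _ _)).
rewrite le_eqVlt; apply/orP; left; apply/eqP; apply: eq_integral => s.
rewrite inE => /Jp[/andP[sp st] rs]; apply/esym.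
rewrite -[RHS](section_infinite n rs); congr (Pi _).
apply/seteqP; split => u; rewrite xsectionP.
  by rewrite /E inner_bigcup => -[[[_ h1] h2] _].
move=> [h1 h2]; split; last by split => //=; rewrite in_itv/= ltW.
split => //; rewrite inner_bigcup; split => //=.
by rewrite in_itv/= sp st.
Qed.

(** The statement of an induction on the number of jumps. Independence of the velocities is recorded
    by a Gram determinant, as for [j < m] their matrix is not square. *)
Let claim j := {ae P, forall w, exists p : 'I_j -> T,
  [/\ forall a, nu w [set p a] = 1%E, forall a, exists n, window t n (p a) &
      gram (velocities p) != 0]}.

Let gram_velocities_inj j (p : 'I_j -> T) : gram (velocities p) != 0 -> injective p.
Proof.
move=> /gram_neq0P h a b pab; apply/eqP; apply: contraT => ab.
have : delta_mx a 0 - delta_mx b 0 = 0 :> 'cV[R]_j.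
  apply: h; apply/matrixP => i k; rewrite (ord1 k) [RHS]mxE mulmxBr mxE.
  rewrite -!colE !mxE pab subrr //.
move=> /matrixP/(_ a 0); rewrite !mxE !eqxx (negbTE ab) subr0 => /eqP.
by rewrite oner_eq0.
Qed.

Let random_velocities n k j (c : 'I_j -> 'I_(2 ^ k)) (w : Omega) : 'M[R]_(m, j) :=
  velocities (fun a => mark (nu w) (cell t n (c a))).

Let random_velocities_sigma n k j (c : 'I_j -> 'I_(2 ^ k)) :
  measurable_fun (setT : set (g_sigma_algebraType (prm_alg nu (window t n))))
    (random_velocities n c).
Proof.
apply: measurable_fun_mx => i a; rewrite /random_velocities.
under eq_fun do rewrite mxE.
apply: measurable_fun_mx_entry; apply: measurableT_comp; first exact: measurable_velocity.
have mC := @measurable_cell _ d t n k (c a).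
have CW := @cell_window _ d _ t0 n k (c a).
apply: measurable_fun_pair.
  have h := measurable_prm_integral mC CW (g := fst) measurable_fst.
  exact: (h _ _ nu).
apply: measurable_fun_mx => i' j'; rewrite (ord1 j').
rewrite (_ : (fun x => _) = (fun w => \int[nu w]_(x in cell t n (c a)) x.2 i' 0)); last first.
  by apply/funext => w; rewrite mxE.
have mg : measurable_fun setT (fun x : T => x.2 i' 0).
  by apply: measurable_fun_mx_entry; exact: measurable_snd.
have h := measurable_prm_integral mC CW mg.
exact: (h _ _ nu).
Qed.

Let measurable_extension j :
  measurable [set x : 'M[R]_(m, j) * T | gram (row_mx x.1 (velocity x.2)) != 0].
Proof.
  apply: measurable_gram_neq0; apply: measurable_fun_mx => i a.
  under eq_fun do rewrite mxE.
  case: (fintype.split a) => b; first by apply: measurable_fun_mx_entry; exact: measurable_fst.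
  apply: measurable_fun_mx_entry; apply: measurableT_comp; first exact: measurable_velocity.
  exact: measurable_snd.
Qed.

(** The velocities chosen in [window n] are independent of the smaller jumps. For each value [N]
    with independent columns some nonzero [l] annihilates [N]; any velocity that [l] does not
    annihilate extends [N], and such jumps have infinite intensity. *)
Let jump_off n k j (c : 'I_j -> 'I_(2 ^ k)) : (j < m)%N ->
  P.-negligible [set w | gram (random_velocities n c w) != 0 /\
    nu w (\bigcup_i inner n i `&`
      xsection [set x : 'M[R]_(m, j) * T | gram (row_mx x.1 (velocity x.2)) != 0]
        (random_velocities n c w)) = 0%E].
Proof.
move=> jm.
have mM : measurable_fun setT (random_velocities n c).
  have h := measurable_sub_sigma (prm_alg_measurable prm (E := window t n)) (@random_velocities_sigma n k j c).
  exact h.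
apply: (random_section_negligible prm (M := random_velocities n c) (E := inner n)
  (K := [set N | gram N != 0])) => //.
- by move=> k1 k2 k12 ; apply/subsetPset => p [p1 /andP[p2 p3]]; split => //; apply/andP; split => //;
    apply: le_lt_trans p2; rewrite lef_pV2 ?posrE// ler_nat !ltnS leq_add2l.
- move=> i; apply: le_lt_trans (intensity_window_lty t0 levy (n + i).+1).
  by rewrite le_measure ?inE//; first [exact: measurable_window|exact: inner_window].
- by apply: measurable_gram_neq0; exact: measurable_id.
- exact: measurable_extension.
- move=> B mB.
  have mU : measurable (\bigcup_i inner n i) by apply: bigcupT_measurable.
  have UW : (\bigcup_i inner n i) `&` window t n = set0.
    apply/seteqP; split => // p [[i _ hp] wp]; rewrite -(inner_disjoint n i).
    by split; [exact: hp|exact: wp].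
  have HX : prm_sigma nu (window t n) (random_velocities n c @^-1` B).
    by have := @random_velocities_sigma n k j c measurableT B mB; rewrite setTI; exact.
  move=> X Y -> HY; rewrite setIC muleC.
  exact: (prm_independent_disjoint prm mU UW HY HX).
- have mU : measurable (\bigcup_i inner n i) by apply: bigcupT_measurable.
  have mD : measurable [set x : 'M[R]_(m, j) * T | gram (row_mx x.1 (velocity x.2)) != 0] by exact: measurable_extension.
  move=> N gN; have [l l0 lN] := exists_left_kernel N jm.
  apply/eqP; rewrite eq_le leey/= -(inner_infinite n l0) le_measure ?inE//.
  + apply: measurableI => //; apply: measurable_set_mx1_neq0.
    by apply: measurable_fun_mulmx; [exact: measurable_cst|exact: measurable_velocity].
  + by apply: measurableI => //; exact: measurable_xsection.
  + move=> p [p1 p2]; split => //; rewrite xsectionP/=.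
    exact: gram_row_mx lN p2.
Qed.

Let claim_step j : (j < m)%N -> claim j -> claim (j + 1).
Proof.
move=> jm IH.
(* The suitable cells depend on the sample point, so the null sets are united over all choices;
   finite functions make these choices a countable type. *)
have : {ae P, forall w, forall x : {n : nat & {k : nat & {ffun 'I_j -> 'I_(2 ^ k)}}},
  ~ (gram (random_velocities (tag x) (tagged (tagged x)) w) != 0 /\
    nu w (\bigcup_i inner (tag x) i `&`
      xsection [set x : 'M[R]_(m, j) * T | gram (row_mx x.1 (velocity x.2)) != 0]
        (random_velocities (tag x) (tagged (tagged x)) w)) = 0%E)}.
  apply: ae_countable => -[n [k c]] /=.
  by have := jump_off n c jm; apply: negligibleS => w /= /contrapT.
apply: filterS3 (ae_good_configuration t0 prm) IH => w gw [p [p1 pw pg]] h.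
have [n [k [c [cinj hc]]]] := good_atoms gw (gram_velocities_inj pg) p1 pw.
have : ~ (gram (random_velocities n (finfun c) w) != 0 /\
    nu w (\bigcup_i inner n i `&`
      xsection [set x : 'M[R]_(m, j) * T | gram (row_mx x.1 (velocity x.2)) != 0]
        (random_velocities n (finfun c) w)) = 0%E).
  exact: (h (Tagged _ (Tagged (fun k => {ffun 'I_j -> 'I_(2 ^ k)}) (finfun c)))).
have -> : random_velocities n (finfun c) w = velocities p.
  apply/matrixP => i a; rewrite !mxE ffunE.
  by have [_ ->] := hc a.
move=> /not_andP[//|nu0].
set X := xsection _ _ in nu0.
have mX : measurable X.
  by apply: measurable_xsection; exact: measurable_extension.
(* Positive mass on the section is localized to one shell, then to one cell at a scale without
   multiple points. That cell has mass one, so its atom must lie in the section. *)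
have [i nui] : exists i, nu w (inner n i `&` X) <> 0%E.
  apply: contrapT => /forallNP H; apply: nu0; rewrite setI_bigcupl.
  by apply: measure_bigcup_null => i; [exact: measurableI|apply: contrapT; exact: H].
have [k' hk'] := gw.2 (n + i).+1.
have [l nul] : exists l : 'I_(2 ^ k'), nu w (cell t (n + i).+1 l `&` (inner n i `&` X)) <> 0%E.
  apply: contrapT => /forallNP H; apply: nui; apply/eqP; rewrite eq_le measure_ge0 andbT.
  apply: (@le_trans _ _ (nu w (\big[setU/set0]_l (cell t (n + i).+1 l `&` (inner n i `&` X))))).
    rewrite le_measure ?inE//; first exact: measurableI.
      apply: bigsetU_measurable => l _; apply: measurableI; first exact: measurable_cell.
      exact: measurableI.
    move=> q [q1 q2]; apply/bigsetU_mem.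
    by have [l ql] := window_cell k' (inner_window q1); exists l.
  apply: le_trans (measure_bigsetU_le _ _) _.
    move=> l; apply: measurableI; first exact: measurable_cell.
    exact: measurableI.
  by rewrite big1// => l _; apply: contrapT; exact: H.
have mCl : measurable (cell t (n + i).+1 l : set T) by exact: measurable_cell.
have nucl : nu w (cell t (n + i).+1 l) = 1%E.
  have [c0|//] := hk' l; case: nul; apply: (subset_measure0 _ _ _ c0) => //.
  by apply: measurableI => //; exact: measurableI.
have [q [ql q1 _]] := good_cell gw nucl.
have mq := measurable_point2 q.
have [qi qX] : (inner n i `&` X) q.
  apply: contrapT => nq; case: nul.
  apply: (subset_measure0 _ _ _ (atom_diff mCl mq ql nucl q1)).
  - by apply: measurableI => //; exact: measurableI.
  - exact: measurableD.
  - by move=> x [x1 x2]; split => //= xq; apply: nq; rewrite -xq.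
pose p' (a : 'I_(j + 1)) := if fintype.split a is inl b then p b else q.
exists p'; split.
- by move=> a; rewrite /p'; case: fintype.split.
- move=> a; rewrite /p'; case: fintype.split => // _.
  by exists (n + i).+1; exact: cell_window ql.
- rewrite (_ : velocities p' = row_mx (velocities p) (velocity q)).
    by move: qX; rewrite /X xsectionP.
  by apply/matrixP => r a; rewrite !mxE /p'; case: fintype.split => b; rewrite ?mxE ?(ord1 b).
Qed.

Lemma ae_spanning_jumps : {ae P, forall w, good_configuration t (nu w) /\
  exists n k (c : 'I_m -> 'I_(2 ^ k)), [/\ injective c,
    forall a, nu w (cell t n (c a)) = 1%E &
    \det (velocities (fun a => mark (nu w) (cell t n (c a)))) != 0]}.
Proof.
have cl j : (j <= m)%N -> claim j.
  elim: j => [_|j IH jm]; last by rewrite -addn1; apply: claim_step => //; exact: IH (ltnW jm).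
  apply: aeW => w; exists (fun a => (0, 0)); split => [[]//|[]//|].
  by rewrite /gram det_mx00 oner_neq0.
apply: filterS2 (ae_good_configuration t0 prm) (cl m (leqnn m)) => w gw [p [p1 pw pg]].
split => //; have [n [k [c [cinj hc]]]] := good_atoms gw (gram_velocities_inj pg) p1 pw.
exists n, k, c; split => //; first by move=> a; have [] := hc a.
rewrite (_ : velocities _ = velocities p).
  by move: pg; rewrite /gram det_mulmx det_tr mulf_eq0 orbb.
by apply/matrixP => i a; rewrite !mxE; have [_ ->] := hc a.
Qed.

End Spanning.

(** * Almost sure measurability *)

Section AeSigma.
Context (R : realType) (disp : measure_display) (Omega : measurableType disp).
Variables (q : {measure set Omega -> \bar R}) (H : set (set Omega)).

(** Limits are available almost surely only, while [H] is not completed, so what is preserved is the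
    existence of a version measurable for [H]. *)
Definition ae_sigma (f : Omega -> R) := exists2 g : Omega -> R,
  measurable_fun (setT : set (g_sigma_algebraType H)) g & {ae q, forall w, f w = g w}.

Lemma ae_sigma_measurable f :
  measurable_fun (setT : set (g_sigma_algebraType H)) f -> ae_sigma f.
Proof. by move=> mf; exists f => //; exact: aeW. Qed.

Lemma ae_sigma_eq f f' : {ae q, forall w, f w = f' w} -> ae_sigma f' -> ae_sigma f.
Proof.
by move=> ff' [g mg f'g]; exists g => //; apply: filterS2 ff' f'g => w ->.
Qed.

Lemma ae_sigmaD f f' : ae_sigma f -> ae_sigma f' -> ae_sigma (fun w => f w + f' w).
Proof.
move=> [g mg fg] [g' mg' fg']; exists (fun w => g w + g' w).
  exact: measurable_funD.
by apply: filterS2 fg fg' => w -> ->.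
Qed.

Lemma ae_sigmaZ c f : ae_sigma f -> ae_sigma (fun w => c * f w).
Proof.
move=> [g mg fg]; exists (fun w => c * g w); first exact: measurable_funM.
by apply: filterS fg => w ->.
Qed.

Lemma ae_sigma_sum (I : Type) (r : seq I) (f : I -> Omega -> R) :
  (forall i, ae_sigma (f i)) -> ae_sigma (fun w => \sum_(i <- r) f i w).
Proof.
move=> hf; elim: r => [|i r IH].
  apply: (@ae_sigma_eq _ (fun=> 0)); first by apply: aeW => w; rewrite big_nil.
  by apply: ae_sigma_measurable; exact: measurable_cst.
apply: (@ae_sigma_eq _ (fun w => f i w + \sum_(j <- r) f j w)).
  by apply: aeW => w; rewrite big_cons.
exact: ae_sigmaD.
Qed.

Lemma ae_sigma_cvg (f : nat -> Omega -> R) l : (forall n, ae_sigma (f n)) ->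
  {ae q, forall w, f n w @[n --> \oo] --> l w} -> ae_sigma l.
Proof.
move=> hf fl; have hf' n : exists g, measurable_fun (setT : set (g_sigma_algebraType H)) g /\
    {ae q, forall w, f n w = g w}.
  by have [g ? ?] := hf n; exists g.
have [g hg] := choice hf'.
(* The upper limit of the versions is defined everywhere and measurable for [H]; almost surely it is
   the limit. *)
exists (fun w => fine (limn_esup (fun n => (g n w)%:E))).
  apply: measurableT_comp; first exact: fine_measurable.
  apply: measurable_fun_limn_esup => n; apply/measurable_EFinP.
  by have [] := hg n.
have : {ae q, forall w, forall n, f n w = g n w}.
  by apply/ae_foralln => n; have [] := hg n.
apply: filterS2 fl => w fl fg.
have c : (g n w)%:E @[n --> \oo] --> (l w)%:E.
  apply: cvg_EFin; first by near=> n.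
  rewrite (_ : _ \o _ = (fun n => f n w))//.
  by apply/funext => n /=; rewrite fg.
by rewrite (cvg_limn_einf_sup c).2.
Unshelve. all: by end_near. Qed.

End AeSigma.

Lemma ae_cvg0_of_summable (R : realType) (disp : measure_display)
    (Omega : measurableType disp) (P : {measure set Omega -> \bar R})
    (F : nat -> Omega -> R) :
  (forall n, measurable_fun setT (F n)) -> (forall n w, 0 <= F n w) ->
  (forall n, \int[P]_w (F n w)%:E <= ((2 ^+ n)^-1)%:E)%E ->
  {ae P, forall w, F n w @[n --> \oo] --> 0}.
Proof.
move=> mF F0 PF.
have mE n : measurable_fun setT (fun w => (F n w)%:E) by exact/measurable_EFinP.
pose S w := (\sum_(0 <= n <oo) (F n w)%:E)%E.
have F0' n w : (0 <= (F n w)%:E)%E by rewrite lee_fin.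
have mS : measurable_fun setT S by apply: ge0_emeasurable_sum => // n w _ _.
have S0 w : (0 <= S w)%E by apply: nneseries_ge0.
have Soo : (\int[P]_w S w < +oo)%E.
  rewrite integral_nneseries//.
  apply: (@le_lt_trans _ _ (\sum_(0 <= n <oo) (2 / (2 ^ (n + 1))%:R)%:E)%E).
    apply: lee_nneseries => n _; first by move=> _; apply: integral_ge0 => w _; exact: F0'.
    apply: (le_trans (PF n)); rewrite lee_fin natrX addn1 exprS invfM mulrA divff//.
    by rewrite mul1r.
  have := @cvg_geometric_eseries_half R 2 0 => /cvg_lim ->//.
  by rewrite ltry.
have iS : P.-integrable setT S.
  apply/integrableP; split => //.
  by under eq_integral => w _ do rewrite gee0_abs//.
have := integrable_ae measurableT iS; apply: filterS => w /(_ I) Sfin.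
have sc : (\sum_(0 <= n <oo) (F n w)%:E < +oo)%E by rewrite -ge0_fin_numE ?S0//; exact: S0.
have c : cvgn (series (fun n => F n w)).
  apply: nondecreasing_is_cvgn; first by apply: nondecreasing_series => n _ _; exact: F0.
  exists (fine (S w)) => _ [n _ <-].
  rewrite -lee_fin fineK// /series/= -sumEFin.
  by apply: nneseries_lim_ge.
exact: cvg_series_cvg_0 c.
Qed.

Section StepIntegral.
Context (R : realType) (t : R).
Hypothesis t0 : 0 < t.
Local Notation leb := (@lebesgue_measure R).
Variables (K x : R -> R).
Hypotheses (mK : measurable_fun setT K) (bK : bounded_on `[0, t] K)
  (bx : bounded_on `[0, t] x)
  (cx : forall s, 0 < s < t -> x r @[r --> s^'+] --> x s).

(** The sample on each slot is taken at its right end, so that right-continuity suffices for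
    convergence. *)
Let step k s := \sum_(i < 2 ^ k) x (t / 2 ^+ k * i.+1%:R) * \1_(slot t k i) s.

Let stepE k s : 0 < s < t -> exists2 r, s <= r <= s + t / 2 ^+ k &
  r <= t /\ step k s = x r.
Proof.
move=> /andP[s0 st]; have [|i si] := slot_cover (t := t) k (s := s).
  by rewrite s0 ltW.
have := si; rewrite slotE => /andP[s1 s2].
have step0 : 0 < t / 2 ^+ k by rewrite divr_gt0// exprn_gt0.
exists (t / 2 ^+ k * i.+1%:R).
  by rewrite s2 -[i.+1%:R]natr1 mulrDr mulr1 lerD2r ltW.
split.
  rewrite -mulrA ger_pMr// mulrC ler_pdivrMr ?exprn_gt0// mul1r -natrX ler_nat.
  exact: ltn_ord.
rewrite /step (bigD1 i)//= big1 => [|j ji].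
  by rewrite addr0 indicE mem_set// mulr1.
rewrite indicE memNset ?mulr0// => sj.
by have /seteqP[h _] := slot_disjoint t0 k ji; apply: (h s).
Qed.

Let step_cvg s : 0 < s < t -> step k s @[k --> \oo] --> x s.
Proof.
move=> st; apply/cvgrPdist_le => e e0.
have /cvgrPdist_le/(_ _ e0)/nbhs_ballP[c /= c0 hc] := cx st.
have /cvgrPdist_lt/(_ (c / t)) : (2^-1 : R) ^+ k @[k --> \oo] --> 0.
  by apply: cvg_expr; rewrite gtr0_norm ?invr_gt0// invf_lt1// ltr1n.
rewrite divr_gt0// => /(_ isT); apply: filterS => k.
rewrite sub0r normrN exprVn gtr0_norm ?invr_gt0 ?exprn_gt0// => kc.
have [r /andP[sr rs] [_ ->]] := stepE k st.
move: sr; rewrite le_eqVlt => /predU1P[->|sr]; first by rewrite subrr normr0 ltW.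
apply: hc => //; rewrite /ball/= distrC gtr0_norm ?subr_gt0// ltrBlDl.
apply: (le_lt_trans rs); rewrite ltrD2l mulrC -ltr_pdivlMr//.
Qed.

Lemma right_continuous_measurable : measurable_fun (`]0, t[%classic : set R) x.
Proof.
apply: (@measurable_fun_cvg _ _ _ _ step) => [k|s].
  apply: measurable_sum => i; apply: measurable_funM; first exact: measurable_cst.
  by apply: measurable_funTS; apply: measurable_indic; exact: measurable_slot.
by rewrite /= in_itv/= => st; exact: step_cvg.
Qed.

(** A path integral becomes a limit of linear combinations of values at fixed times. Measurability
    of the individual values thus passes to the integral, without joint measurability in time and
    sample point. *)
Lemma step_integral_cvg :
  (\sum_(i < 2 ^ k) x (t / 2 ^+ k * i.+1%:R) *
      \int[leb]_(s in `]0, t[) (K s * \1_(slot t k i) s)) @[k --> \oo] -->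
  \int[leb]_(s in `[0, t]) (K s * x s).
Proof.
have [M KM] := bK; have [N xN] := bx.
have oc s : `]0, t[%classic s -> 0 < s < t /\ `[0, t]%classic s.
  rewrite /= !in_itv/= => /andP[s0 st]; by rewrite s0 st !ltW.
have loo : (leb `]0%R, t[%classic < +oo)%E.
  by rewrite lebesgue_measure_itv/= lte_fin t0 -EFinB ltry.
have mstep k : measurable_fun (`]0, t[%classic : set R) (step k).
  apply: measurable_sum => i; apply: measurable_funM; first exact: measurable_cst.
  by apply: measurable_funTS; apply: measurable_indic; exact: measurable_slot.
have mKo : measurable_fun (`]0, t[%classic : set R) K by exact: measurable_funTS.
have mKx : measurable_fun (`]0, t[%classic : set R) (fun s => K s * x s).
  apply: (@measurable_fun_cvg _ _ _ _ (fun k s => K s * step k s)) => [k|s].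
    exact: measurable_funM.
  by move=> /oc[st _]; apply: cvgM; [exact: cvg_cst|exact: step_cvg].
have bstep k s : `]0, t[%classic s -> `|K s * step k s| <= M * N.
  move=> /oc[st s0t]; rewrite normrM; apply: ler_pM => //; first exact: KM.
  have [r /andP[sr _] [rt ->]] := stepE k st; apply: xN.
  by rewrite /= in_itv/= rt andbT (le_trans _ sr)// ltW//; case/andP: st.
have iKx : leb.-integrable `]0, t[ (EFin \o (fun s => K s * x s)).
  apply: integrable_bounded_on => //; exists (M * N) => s /oc[st s0t].
  by rewrite normrM; apply: ler_pM => //; [exact: KM|exact: xN].
have e1 : \int[leb]_(s in `[0, t]) (K s * x s) = \int[leb]_(s in `]0, t]) (K s * x s).
  apply/esym; apply: Rintegral_itv_obnd_cbnd.
  have h := lebesgue_segment_lty 0 t.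
  apply: integrable_bounded_on => //.
  - by apply: le_lt_trans h; rewrite le_measure ?inE// => s; rewrite /= !in_itv/= => /andP[/ltW-> ->].
  - by apply/measurable_fun_itv_bndo_bndcP.
  - exists (M * N) => s; rewrite /= in_itv/= => /andP[s0 st].
    by rewrite normrM; apply: ler_pM => //; [apply: KM|apply: xN]; rewrite /= in_itv/= st ltW.
have e2 : \int[leb]_(s in `]0, t]) (K s * x s) = \int[leb]_(s in `]0, t[) (K s * x s).
  by apply/esym; apply: Rintegral_itv_bndo_bndc.
rewrite e1 e2 {e1 e2}.
have E k : \sum_(i < 2 ^ k) x (t / 2 ^+ k * i.+1%:R) *
      \int[leb]_(s in `]0, t[) (K s * \1_(slot t k i) s) =
    \int[leb]_(s in `]0, t[) (K s * step k s).
  have ij i : leb.-integrable `]0, t[ (EFin \o (fun s => K s * \1_(slot t k i) s)).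
    apply: integrable_bounded_on => //.
      apply: measurable_funM => //.
      by apply: measurable_funTS; apply: measurable_indic; exact: measurable_slot.
    apply: bounded_onM; first by exists M => s /oc[_]; exact: KM.
    by exists 1 => s _; rewrite indicE; case: (_ \in _); rewrite ?normr1 ?normr0.
  rewrite /step; under [RHS]eq_Rintegral => s _ do rewrite mulr_sumr.
  rewrite Rintegral_sum// => [|i]; last first.
    rewrite (_ : EFin \o _ = fun s => ((x (t / 2 ^+ k * i.+1%:R))%:E *
        (EFin \o (fun s => K s * \1_(slot t k i) s)%R) s)%E); first exact: integrableZl.
    by apply/funext => s /=; rewrite -EFinM mulrCA.
  apply: eq_bigr => i _; rewrite -RintegralZl//.
  by apply: eq_Rintegral => s _; rewrite mulrCA.
under eq_fun do rewrite E.
have mm k : measurable_fun (`]0, t[%classic : set R) (fun s => K s * step k s).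
  exact: measurable_funM.
have := @dominated_cvg _ _ _ leb `]0, t[%classic (measurable_itv _)
  (fun k s => (K s * step k s)%:E) (fun s => (K s * x s)%:E) (fun=> (M * N)%:E).
move=> h; apply: fine_cvg; rewrite fineK; last exact: integrable_fin_num.
apply: h.
- by move=> k; apply/measurable_EFinP; exact: mm.
- by move=> s /oc[st _]; apply: cvg_EFin; [near=> n|apply: cvgM; [exact: cvg_cst|exact: step_cvg]].
- by [].
- apply: (integrable_bounded_on (f := fun=> M * N)) => //.
  by exists `|M * N| => s _.
- by move=> k s /bstep; rewrite lee_fin.
Unshelve. all: by end_near. Qed.

End StepIntegral.

(** * Absolute continuity under the rank condition *)

Lemma measure_ae_le (disp : measure_display) (T : measurableType disp) (R : realType)
    (mu : {measure set T -> \bar R}) (A B : set T) : measurable A -> measurable B ->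
  {ae mu, forall w, A w -> B w} -> (mu A <= mu B)%E.
Proof.
move=> mA mB [N [mN N0 AB]].
apply: (@le_trans _ _ (mu (B `|` N))).
  rewrite le_measure ?inE//; first exact: measurableU.
  by move=> w Aw; apply: contrapT => /not_orP[nB nN]; apply: nN; apply: AB => /= /(_ Aw).
by rewrite -[leRHS]adde0 -[X in (_ <= _ + X)%E]N0; exact: measureU2.
Qed.

Lemma measure_ae_eq (disp : measure_display) (T : measurableType disp) (R : realType)
    (mu : {measure set T -> \bar R}) (A B : set T) : measurable A -> measurable B ->
  {ae mu, forall w, A w <-> B w} -> mu A = mu B.
Proof.
move=> mA mB AB; apply/eqP; rewrite eq_le !measure_ae_le//.
  by apply: filterS AB => w [].
by apply: filterS AB => w [].
Qed.

(** * Law of the times and sizes of the chosen jumps *)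

Section MarkedCells.
Context (R : realType) (m d : nat) (t : R).
Hypothesis t0 : 0 < t.
Notation T := (R * 'cV[R]_d)%type.
Context (disp : measure_display) (Omega : measurableType disp) (P : probability Omega R).
Variable Pi : {measure set 'cV[R]_d -> \bar R}.
Hypothesis levy : is_levy_measure Pi.
Variable nu : Omega -> {measure set T -> \bar R}.
Hypothesis prm : is_poisson_random_measure P (intensity_measure levy) nu.
Variable Sig : set (set Omega).
Hypothesis SigT : Sig setT.
Hypothesis SigI : setI_closed Sig.
Hypothesis Sig_prm : independent_systems P Sig (prm_sigma nu setT).
Hypothesis Sig_meas : Sig `<=` measurable.
Variables (n k : nat) (c : 'I_m -> 'I_(2 ^ k)).
Hypothesis c_inj : injective c.
Let lam := intensity_measure levy.

Definition chosen_cells : set T := \big[setU/set0]_(a < m) cell t n (c a).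

Lemma measurable_chosen_cells : measurable chosen_cells.
Proof. by apply: bigsetU_measurable => a _; exact: measurable_cell. Qed.

Lemma cell_chosen a : cell t n (c a) `<=` chosen_cells.
Proof. by move=> p pa; apply/bigsetU_mem; exists a. Qed.

Let E := chosen_cells.
Let C a : set T := cell t n (c a).

Let mC a : measurable (C a). Proof. exact: measurable_cell. Qed.

(** The information not affected by the chosen jumps: [Sig], later the events of the Wiener process,
    together with the counts off the chosen cells. *)
Definition outside_system : set (set Omega) :=
  [set A `&` B | A in Sig & B in prm_sigma nu (~` E)].

Lemma outside_system_measurable : outside_system `<=` measurable.
Proof.
move=> _ [A SA [B NB <-]]; apply: measurableI; first exact: Sig_meas.
exact: (prm_sigma_measurable prm NB).
Qed.

(** Two independences are composed: that of [Sig] from all counts, and that of the counts off [E]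
    from those inside [E]. *)
Lemma outside_independent :
  independent_systems P <<s outside_system >> (prm_sigma nu E).
Proof.
have mE := measurable_chosen_cells.
have h : independent_systems P <<s outside_system >> <<s prm_sigma nu E >>.
  apply: independent_systems_sigma.
  - exact: outside_system_measurable.
  - move=> _ _ [A SA [B NB <-]] [A' SA' [B' NB' <-]].
    exists (A `&` A'); first exact: SigI.
    by exists (B `&` B'); [exact: prm_sigma_setI|rewrite setIACA].
  - by exists setT => //; exists setT; [exact: prm_sigma_setT|rewrite setIT].
  - exact: (prm_sigma_measurable prm).
  - exact: (@prm_sigma_setI _ _ _ _ _ nu E).
  - exact: (@prm_sigma_setT _ _ _ _ _ nu E).
  - move=> _ D [A SA [B NB <-]] ND.
    have NT F : prm_sigma nu F `<=` prm_sigma nu setT by exact: sub_prm_sigma.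
    rewrite -setIA (Sig_prm SA); last by apply: prm_sigma_setI; apply: NT; eassumption.
    rewrite (Sig_prm SA); last exact: NT NB.
    rewrite -muleA; congr (_ * _)%E; rewrite setIC muleC.
    exact: (prm_independent prm mE).
move=> A B HA HB; apply: h => //; exact: sub_sigma_algebra.
Qed.

Definition one_each : set Omega := [set w | forall a, nu w (cell t n (c a)) = 1%E].

Let mnu F x : measurable F -> measurable [set w | nu w F = x].
Proof.
by move=> mF; have := measurable_prm prm mF measurableT (emeasurable_set1 x); rewrite setTI.
Qed.

Let sig_nu F F' x : measurable F -> F `<=` F' -> prm_sigma nu F' [set w | nu w F = x].
Proof.
move=> mF FF; apply: sub_sigma_algebra; exists F => //.
by exists [set x]; [exact: emeasurable_set1|rewrite setTI].
Qed.

Lemma measurable_one_each : measurable one_each.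
Proof.
rewrite (_ : one_each = \bigcap_(a in [set: 'I_m]) [set w | nu w (C a) = 1%E]).
  by apply: fin_bigcap_measurable => // a _; exact: mnu.
by apply/seteqP; split => w h a; [move=> _; exact: h|exact: (h a)].
Qed.

Definition mark_times (w : Omega) : 'cV[R]_m := \col_a (mark (nu w) (cell t n (c a))).1.

Definition mark_jumps (w : Omega) : 'M[R]_(d, m) :=
  \matrix_(i, a) (mark (nu w) (cell t n (c a))).2 i 0.

Let measurable_mark a : measurable_fun setT (fun w => mark (nu w) (C a)).
Proof.
have sub : C a `<=` setT by [].
apply: (@measurable_sub_sigma _ _ _ _ (prm_alg nu setT)); first exact: (prm_alg_measurable prm).
apply: measurable_fun_pair.
  have h := measurable_prm_integral (mC a) sub (g := fst) measurable_fst; exact: (h _ _ nu).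
apply: measurable_fun_mx => i j; rewrite (ord1 j).
rewrite (_ : (fun x => _) = (fun w => \int[nu w]_(x in C a) x.2 i 0)); last first.
  by apply/funext => w; rewrite mxE.
have mg : measurable_fun setT (fun x : T => x.2 i 0).
  by apply: measurable_fun_mx_entry; exact: measurable_snd.
have h := measurable_prm_integral (mC a) sub mg; exact: (h _ _ nu).
Qed.

Lemma measurable_mark_times : measurable_fun setT mark_times.
Proof.
apply: measurable_fun_mx => i j; under eq_fun do rewrite mxE.
by apply: measurableT_comp; [exact: measurable_fst|exact: measurable_mark].
Qed.

Lemma measurable_mark_jumps : measurable_fun setT mark_jumps.
Proof.
apply: measurable_fun_mx => i j; under eq_fun do rewrite mxE.
apply: measurable_fun_mx_entry.
by apply: measurableT_comp; [exact: measurable_snd|exact: measurable_mark].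
Qed.

Definition colbox (B : 'I_m -> set 'cV[R]_d) : set 'M[R]_(d, m) :=
  [set U | forall a, B a (col a U)].

Lemma measurable_colbox B : (forall a, measurable (B a)) -> measurable (colbox B).
Proof.
move=> mB; rewrite (_ : colbox B = \bigcap_(a in [set: 'I_m]) ((col a) @^-1` B a)).
  apply: fin_bigcap_measurable => // a _; rewrite -[X in measurable X]setTI.
  have mc : measurable_fun setT (col a : 'M[R]_(d, m) -> 'cV[R]_d); last exact: mc.
  by apply: measurable_fun_mx => i j; under eq_fun do rewrite mxE; exact: measurable_mx_entry.
by apply/seteqP; split => U h a; [move=> _; exact: h|exact: (h a)].
Qed.

Let Ev (A : 'I_m -> set R) (B : 'I_m -> set 'cV[R]_d) : set Omega :=
  \big[setI/setT]_(a <- index_enum 'I_m)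
    [set w | nu w (C a) = 1%E /\ nu w (C a `&` (A a `*` B a)) = 1%E].

(** The probability that a cell carries one jump and that it falls into a rectangle. The Lebesgue
    factor of the time separates from the factor of the size, which is what makes times and sizes
    independent. *)
Let rate (A : 'I_m -> set R) (B : 'I_m -> set 'cV[R]_d) a : R :=
  fine (lebesgue_measure (slot t k (c a) `&` A a)) *
  (fine (Pi (annulus n `&` B a)) * expR (- fine (lam (C a)))).

Section Rectangles.
Variables (A : 'I_m -> set R) (B : 'I_m -> set 'cV[R]_d).
Hypotheses (mA : forall a, measurable (A a)) (mB : forall a, measurable (B a)).

Let mAB a : measurable (C a `&` (A a `*` B a)).
Proof. by apply: measurableI => //; exact: measurableX. Qed.

Let Ev_sigma : prm_sigma nu E (Ev A B).
Proof.
rewrite /Ev; elim: (index_enum _) => [|a r IH].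
  by rewrite big_nil; exact: prm_sigma_setT.
rewrite big_cons; apply: prm_sigma_setI => //; apply: prm_sigma_setI.
  by apply: sig_nu => //; exact: cell_chosen.
by apply: sig_nu => //; apply: subset_trans (@cell_chosen a); exact: subIsetl.
Qed.

Let P_Ev : P (Ev A B) = (\prod_a rate A B a)%:E.
Proof.
rewrite (prm_independent_family prm (E := C)) ?index_enum_uniq//.
- rewrite -prodEFin; apply: eq_bigr => a _.
  have lC : (lam (C a) < +oo)%E by rewrite /lam /C intensity_cell// ltry.
  rewrite (prm_one_point prm (mC a) (mAB a) (@subIsetl _ _ _) lC).
  rewrite /rate mulrA; congr (_ * _)%:E.
  rewrite (_ : C a `&` _ = (slot t k (c a) `&` A a) `*` (annulus n `&` B a)).
    have mann : measurable (annulus n `&` B a).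
      by apply: measurableI => //; exact: measurable_annulus.
    have msl : measurable (slot t k (c a) `&` A a).
      by apply: measurableI => //; exact: measurable_slot.
    rewrite intensity_measure_rect ?fineM//.
    + rewrite ge0_fin_numE//; apply: (@le_lt_trans _ _ (lebesgue_measure (slot t k (c a)))).
        by rewrite le_measure ?inE//; exact: measurable_slot.
      by rewrite slot_measure// ltry.
    + rewrite ge0_fin_numE//; apply: (@le_lt_trans _ _ (Pi (annulus n))).
        by rewrite le_measure ?inE//; exact: measurable_annulus.
      by apply: levy_shell_lty => //; rewrite invr_gt0.
    + move=> s [/(slot_sub t0 (ltn_ord (c a))) + _].
      by rewrite /= !in_itv/= => /andP[/ltW->].
  by apply/seteqP; split => p [[? ?] [? ?]].
- by move=> i j ij; apply: cell_disjoint => //; apply: contra_neq ij; exact: c_inj.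
- move=> a; apply: prm_sigma_setI; first exact: sig_nu.
  by apply: sig_nu => //; exact: subIsetl.
Qed.

Let Ev_ae : {ae P, forall w, Ev A B w <->
  (one_each w /\ box A (mark_times w) /\ colbox B (mark_jumps w))}.
Proof.
apply: filterS (ae_good_configuration t0 prm) => w gw.
have colE a : col a (mark_jumps w) = (mark (nu w) (C a)).2.
  by apply/matrixP => i j; rewrite (ord1 j) !mxE.
have key a : nu w (C a) = 1%E -> nu w (C a `&` (A a `*` B a)) = 1%E <->
    A a (mark_times w a 0) /\ B a (col a (mark_jumps w)).
  move=> C1; have [p [pC p1 mp]] := good_cell gw C1.
  rewrite colE mxE mp; split.
    move=> h; apply: contrapT => np.
    have : nu w (C a `&` (A a `*` B a)) = 0%E.
      apply: (subset_measure0 _ _ _ (atom_diff (mC a) (measurable_point2 p) pC C1 p1)) => //.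
        by apply: measurableD => //; exact: measurable_point2.
      by move=> x [xC xAB]; split => //= xp; apply: np; rewrite -xp.
    by rewrite h => /eqP; rewrite eqe oner_eq0.
  move=> pAB; apply/eqP; rewrite eq_le -{1}C1 -p1 !le_measure ?inE//.
  - exact: measurable_point2.
  - by move=> _ ->.
rewrite /Ev -bigcap_seq; split.
  move=> h; have h' a : nu w (C a) = 1%E /\ nu w (C a `&` (A a `*` B a)) = 1%E.
    by apply: (h a); rewrite /= mem_index_enum.
  split; first by move=> a; have [] := h' a.
  by split => a; have [h1 h2] := h' a; have [] := (key a h1).1 h2.
move=> [g [hA hB]] a _; split; first exact: g.
by apply/(key a (g a)); split; [exact: hA|exact: hB].
Qed.

(** On [one_each] a rectangle condition on times and sizes is, almost surely, a condition on counts
    inside the cells, hence independent of the outside event [h]. *)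
Lemma marked_rectangle (h : set Omega) : <<s outside_system >> h ->
  P ((mark_times @^-1` box A `&` mark_jumps @^-1` colbox B `&` h) `&` one_each) =
  ((\prod_a rate A B a)%:E * P h)%E.
Proof.
move=> Hh; have mh : measurable h.
  exact: (sub_sigma_measurable outside_system_measurable).
rewrite -P_Ev muleC -(outside_independent Hh Ev_sigma).
apply: measure_ae_eq.
- apply: measurableI; last exact: measurable_one_each.
  apply: measurableI => //; apply: measurableI.
    rewrite -[X in measurable X]setTI; apply: measurable_mark_times => //.
    exact: measurable_box.
  rewrite -[X in measurable X]setTI; apply: measurable_mark_jumps => //.
  exact: measurable_colbox.
- by apply: measurableI => //; exact: (prm_sigma_measurable prm Ev_sigma).
- apply: filterS Ev_ae => w ew; split; first by move=> [[[h1 h2] h3] h4]; split => //; apply/ew.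
  by move=> [h3 /ew[h4 [h1 h2]]].
Qed.

End Rectangles.


Variables (L : {sigma_finite_measure set 'cV[R]_m -> \bar R}).
Hypothesis Lbox : forall B : 'I_m -> set R, (forall i, measurable (B i)) ->
  L (box B) = (\prod_(i < m) lebesgue_measure (B i))%E.
Variables (y : Omega -> 'cV[R]_m).
Hypothesis my : measurable_fun (setT : set (g_sigma_algebraType outside_system)) y.

(** The conditional law given one jump per chosen cell, left unnormalized to avoid dividing by a
    probability that may be zero. *)
Let q := restm P measurable_one_each.

Let my' : measurable_fun setT y.
Proof. exact: measurable_sub_sigma outside_system_measurable my. Qed.

Let V w := (mark_jumps w, y w).

Let mV : measurable_fun setT V.
Proof. exact: (measurable_fun_pair measurable_mark_jumps my'). Qed.

Let Sb : set (set Omega) := [set mark_times @^-1` A | A in @boxes R m].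

Let Vb : set (set Omega) := [set mark_jumps @^-1` colbox B `&` h |
  B in [set B : 'I_m -> set 'cV[R]_d | forall a, measurable (B a)] &
  h in <<s outside_system >>].

Let rect_q A B h : (forall a, measurable (A a)) -> (forall a, measurable (B a)) ->
  <<s outside_system >> h ->
  q (mark_times @^-1` box A `&` (mark_jumps @^-1` colbox B `&` h)) =
  ((\prod_a rate A B a)%:E * P h)%E.
Proof. by move=> mA mB Hh; rewrite /q restmE setIA; exact: marked_rectangle. Qed.

Let boxT : box (fun _ : 'I_m => (setT : set R)) = setT.
Proof. by apply/seteqP; split. Qed.

Let colboxT : colbox (fun _ => setT) = setT.
Proof. by apply/seteqP; split. Qed.

Let HT : <<s outside_system >> setT.
Proof. exact: (@measurableT _ (g_sigma_algebraType outside_system)). Qed.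

Let HI : setI_closed <<s outside_system >>.
Proof. by move=> A B HA HB; exact: (@measurableI _ (g_sigma_algebraType outside_system)). Qed.

Let ind_pi X Y : Sb X -> Vb Y -> (q (X `&` Y) * q setT = q X * q Y)%E.
Proof.
move=> [_ [A mA <-] <-] [B mB [h Hh <-]].
have mT1 : forall a : 'I_m, measurable (setT : set R) by [].
have mT2 : forall a : 'I_m, measurable (setT : set 'cV[R]_d) by [].
rewrite rect_q//.
have -> : q setT = ((\prod_a rate (fun=> setT) (fun=> setT) a)%:E * P setT)%E.
  rewrite -(rect_q mT1 mT2 HT).
  by congr (q _); rewrite boxT colboxT !preimage_setT !setIT.
have -> : q (mark_times @^-1` box A) = ((\prod_a rate A (fun=> setT) a)%:E * P setT)%E.
  rewrite -(rect_q mA mT2 HT).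
  by congr (q _); rewrite colboxT !preimage_setT !setIT.
have -> : q (mark_jumps @^-1` colbox B `&` h) = ((\prod_a rate (fun=> setT) B a)%:E * P h)%E.
  rewrite -(rect_q mT1 mB Hh).
  by congr (q _); rewrite boxT !preimage_setT !setTI.
rewrite probability_setT !mule1 muleAC muleA; congr (_ * _)%E.
rewrite -!EFinM; congr EFin; rewrite -!big_split; apply: eq_bigr => a _ /=.
by rewrite /rate; ring.
Qed.

Let ind_q A B : measurable A -> measurable B ->
  (q (mark_times @^-1` A `&` V @^-1` B) * q setT =
   q (mark_times @^-1` A) * q (V @^-1` B))%E.
Proof.
move=> mA mB.
apply: (@indep_sigma _ _ _ q Sb Vb).
- apply: (@le_lt_trans _ _ (P setT)); last by rewrite probability_setT ltry.
  by rewrite /q restmE le_measure ?inE//; apply: measurableI => //; exact: measurable_one_each.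
- move=> _ [_ [C0 mC0 <-] <-]; rewrite -[X in measurable X]setTI.
  by apply: measurable_mark_times => //; exact: measurable_box.
- move=> _ _ [X HX <-] [Y HY <-]; exists (X `&` Y); last by [].
  exact: setI_closed_boxes.
- by exists setT => //; exists (fun=> setT).
- move=> _ [B0 mB0 [h Hh <-]]; apply: measurableI.
    rewrite -[X in measurable X]setTI; apply: measurable_mark_jumps => //.
    exact: measurable_colbox.
  exact: (sub_sigma_measurable outside_system_measurable).
- move=> _ _ [B1 mB1 [h1 Hh1 <-]] [B2 mB2 [h2 Hh2 <-]].
  exists (fun a => B1 a `&` B2 a); first by move=> a; exact: measurableI.
  exists (h1 `&` h2); first exact: HI.
  apply/seteqP; split => w.
    by move=> [h [? ?]]; split; split => // a; have [] := h a.
  by move=> [[x1 ?] [x2 ?]]; split; [move=> a; split; [exact: x1|exact: x2]|split].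
- exists (fun=> setT) => //; exists setT; first exact: HT.
  by rewrite colboxT preimage_setT setIT.
- exact: ind_pi.
- have ms : measurable_fun (setT : set (g_sigma_algebraType Sb)) mark_times.
    apply: measurable_fun_mx => i j _ B0 mB0; rewrite setTI (ord1 j).
    apply: sub_sigma_algebra; exists (box (fun k => if k == i then B0 else setT)).
      by exists (fun k => if k == i then B0 else setT) => // k'; case: ifP.
    apply/seteqP; split => w /=; first by move=> /(_ i); rewrite eqxx.
    by move=> Bw k'; case: eqP => // ->.
  by have := ms measurableT A mA; rewrite setTI.
- have ms : measurable_fun (setT : set (g_sigma_algebraType Vb)) V.
    apply: measurable_fun_pair.
      apply: measurable_fun_mx => i j _ B0 mB0; rewrite setTI.
      have mB0' : measurable [set u : 'cV[R]_d | B0 (u i 0)].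
        by rewrite -[X in measurable X]setTI; exact: (measurable_mx_entry i 0).
      apply: sub_sigma_algebra; exists (fun k => if k == j then [set u : 'cV[R]_d | B0 (u i 0)] else setT).
        by move=> k'; case: ifP.
      exists setT; first exact: HT.
      rewrite setIT; apply/seteqP; split => w /=.
        by move=> /(_ j); rewrite eqxx /= !mxE.
      by move=> Bw k'; case: eqP => // ->; rewrite /= mxE.
    move=> _ B0 mB0; rewrite setTI; apply: sub_sigma_algebra.
    exists (fun=> setT) => //; exists (y @^-1` B0).
      by have := my measurableT mB0; rewrite setTI.
    by rewrite colboxT preimage_setT setTI.
  by have := ms measurableT B mB; rewrite setTI.
Qed.

Let ac_q (B : 'I_m -> set R) : (forall i, measurable (B i)) ->
  (q (mark_times @^-1` box B) <=
   (\prod_a (fine (Pi (annulus n `&` setT)) * expR (- fine (lam (C a)))))%:E * L (box B))%E.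
Proof.
move=> mB; have mT2 : forall a : 'I_m, measurable (setT : set 'cV[R]_d) by [].
have -> : q (mark_times @^-1` box B) = ((\prod_a rate B (fun=> setT) a)%:E * P setT)%E.
  rewrite -(rect_q mB mT2 HT).
  by congr (q _); rewrite colboxT !preimage_setT !setIT.
rewrite probability_setT mule1 big_split/= mulrC EFinM lee_wpmul2l//.
  by rewrite lee_fin prodr_ge0// => a _; rewrite mulr_ge0 ?fine_ge0// expR_ge0.
have mS a : measurable (slot t k (c a) `&` B a).
  by apply: measurableI => //; exact: measurable_slot.
apply: (@le_trans _ _ (L (box (fun a => slot t k (c a) `&` B a)))).
  rewrite Lbox// -prodEFin le_eqVlt; apply/orP; left; apply/eqP; apply: eq_bigr => a _.
  rewrite fineK// ge0_fin_numE//; apply: (@le_lt_trans _ _ (lebesgue_measure (slot t k (c a)))).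
    have mSa := mS a; by rewrite le_measure ?inE//; exact: measurable_slot.
  by rewrite slot_measure// ltry.
rewrite le_measure ?inE//; try exact: measurable_box.
by move=> v h a; have [] := h a.
Qed.

(** Given the sizes and the outside variable, the times have a law dominated by a multiple of
    Lebesgue measure, so a set with null time sections is almost surely avoided. *)
Lemma marked_law_null (N : set (('M[R]_(d, m) * 'cV[R]_m) * 'cV[R]_m)) :
  measurable N -> (forall v, L (xsection N v) = 0%E) ->
  P (one_each `&` [set w | N ((mark_jumps w, y w), mark_times w)]) = 0%E.
Proof.
move=> mN N0; rewrite setIC.
have qoo : (q setT < +oo)%E.
  apply: (@le_lt_trans _ _ (P setT)); last by rewrite probability_setT ltry.
  by rewrite /q restmE le_measure ?inE//; apply: measurableI => //; exact: measurable_one_each.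
have c0 : 0 <= \prod_a (fine (Pi (annulus n `&` setT)) * expR (- fine (lam (C a)))).
  by rewrite prodr_ge0// => a _; rewrite mulr_ge0 ?fine_ge0// expR_ge0.
exact: (law_null Lbox qoo measurable_mark_times mV ind_q c0 ac_q mN N0).
Qed.

End MarkedCells.

Section CellIntegral.
Context (R : realType) (d : nat) (t : R).
Hypothesis t0 : 0 < t.
Notation T := (R * 'cV[R]_d)%type.
Variables (mu : {measure set T -> \bar R}) (n k : nat) (i : 'I_(2 ^ k)).

Definition cell_until (s : R) : set T := cell t n i `&` (`[0, s] `*` setT).

Lemma measurable_cell_until s : measurable (cell_until s).
Proof. by apply: measurableI; [exact: measurable_cell|exact: measurableX]. Qed.

Lemma cell_until_integral s : good_configuration t mu -> mu (cell t n i) = 1%E ->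
  vintegral mu (cell_until s) snd =
  if (mark mu (cell t n i)).1 <= s then (mark mu (cell t n i)).2 else 0.
Proof.
move=> g c1; have [p [pC p1 ->]] := good_cell g c1.
have mC : measurable (cell t n i : set T) by exact: measurable_cell.
have mp := measurable_point2 p; have mCs := measurable_cell_until s.
have [ps|ps] := leP p.1 s.
  have pCs : cell_until s p.
    split => //; split => //=; rewrite in_itv/= ps andbT.
    by have [/(slot_sub t0 (ltn_ord i)) + _] := pC; rewrite /= in_itv/= => /andP[/ltW].
  have Cs1 : mu (cell_until s) = 1%E.
    apply/eqP; rewrite eq_le -{1}c1 -p1 !le_measure ?inE//; last exact: subIsetl.
    by move=> _ ->.
  by rewrite -[in RHS](mark_atom mCs pCs Cs1 p1).
have Cs0 : mu (cell_until s) = 0%E.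
  apply: (subset_measure0 _ _ _ (atom_diff mC mp pC c1 p1)) => //.
    by apply: measurableD.
  move=> x [xC [/= + _]]; rewrite in_itv/= => /andP[_ xs]; split => //= xp.
  by move: ps; rewrite -xp ltNge xs.
apply/matrixP => a b; rewrite (ord1 b) !mxE.
have mg : measurable_fun setT (fun x : T => x.2 a 0).
  by apply: measurable_fun_mx_entry; exact: measurable_snd.
rewrite /Rintegral (null_set_integral mCs _ Cs0)//.
by apply/measurable_EFinP; exact: measurable_funTS.
Qed.

End CellIntegral.

(** * Variation of constants with isolated jumps *)

Section DuhamelJumps.
Context (R : realType) (m : nat) (A : 'M[R]_m) (t : R).
Hypothesis t0 : 0 < t.
Local Notation leb := (@lebesgue_measure R).
Variables (x v v' : R -> 'cV[R]_m) (N : nat) (tau : 'I_N -> R) (z : 'I_N -> 'cV[R]_m).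
Hypotheses (mx : measurable_fun (`[0, +oo[ : set R) x) (bx : locally_bounded x)
  (xE : forall s, 0 <= s -> x s = vintegral leb `[0, s] (fun r => A *m x r) + v s)
  (cv : forall i s, 0 < s < t -> v r i 0 @[r --> s^'+] --> v s i 0)
  (tauP : forall a, 0 < tau a <= t)
  (vE : forall s, 0 <= s <= t -> v s = v' s + \sum_a (if tau a <= s then z a else 0)).

Let bxi i : bounded_on `[0, t] (fun s => x s i 0).
Proof.
have [C hC] := bx (ltW t0); exists C => s; rewrite /= in_itv/= => /hC.
apply: le_trans; rewrite -sqrtr_sqr; apply: ler_wsqrtr.
by rewrite (bigD1 i)//= lerDl sumr_ge0// => j _; exact: sqr_ge0.
Qed.

Let bAx i : bounded_on `[0, t] (fun s => (A *m x s) i 0).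
Proof. by apply: bounded_on_mulmx => a b; [exact: bounded_on_cst|rewrite (ord1 b)]. Qed.

Let mxi i s : measurable_fun (`[0, s] : set R) (fun s => x s i 0).
Proof.
apply: measurable_fun_mx_entry; apply: measurable_funS mx => //.
by move=> r; rewrite /= !in_itv/= => /andP[->].
Qed.

(** The driving path is bounded because the solution is: v equals x minus the integral of Ax. *)
Let bv i : bounded_on `[0, t] (fun s => v s i 0).
Proof.
have [M hM] := bxi i; have [M' hM'] := bAx i.
exists (M + `|M'| * fine (leb `[0, t]%classic)) => s st; have := st.
rewrite /= in_itv/= => /andP[s0 sst].
have -> : v s i 0 = x s i 0 - \int[leb]_(r in `[0, s]) (A *m x r) i 0.
  by rewrite xE// !mxE addrAC subrr add0r.
rewrite (le_trans (ler_normB _ _))// lerD//; first exact: hM.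
have iA : leb.-integrable `[0, s] (EFin \o (fun r => (A *m x r) i 0)).
  apply: integrable_bounded_on => //; first exact: lebesgue_segment_lty.
    apply: measurable_fun_mx_entry; apply: measurable_fun_mulmx; first exact: measurable_cst.
    by apply: measurable_fun_mx => a b; rewrite (ord1 b); exact: mxi.
  exists M' => r; rewrite /= in_itv/= => /andP[r0 rs]; apply: hM'.
  by rewrite /= in_itv/= r0 (le_trans rs).
rewrite (le_trans (le_normr_Rintegral _ _))//.
apply: (@le_trans _ _ (\int[leb]_(r in `[0, s]) `|M'|)).
  apply: le_Rintegral => //.
  - by apply: (@integrable_norm _ _ _ leb _ (fun r => (A *m x r) i 0)).
  - apply: integrable_bounded_on => //; first exact: lebesgue_segment_lty.
    by exists `|M'| => r _; rewrite normr_id.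
  - move=> r; rewrite /= in_itv/= => /andP[r0 rs].
    rewrite (le_trans _ (ler_norm M'))//; apply: hM'.
    by rewrite /= in_itv/= r0 (le_trans rs).
rewrite Rintegral_cst// ler_wpM2l// fine_le ?ge0_fin_numE//; try exact: lebesgue_segment_lty.
rewrite le_measure ?inE// => r; rewrite /= !in_itv/= => /andP[-> rs].
exact: le_trans rs sst.
Qed.

Let step_right_continuous a i s : (if tau a <= r then z a else 0) i 0 @[r --> s^'+] -->
  (if tau a <= s then z a else 0) i 0.
Proof.
apply: cvg_near_cst; have [ts|st] := leP (tau a) s.
  near=> r; have sr : s < r by near: r; exact: nbhs_right_gt.
  by rewrite (le_trans ts (ltW sr)).
near=> r; have rt : r < tau a by near: r; exact: nbhs_right_lt.
by rewrite leNgt rt.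
Unshelve. all: by end_near. Qed.

Lemma jump_right_continuous i s : 0 < s < t -> v' r i 0 @[r --> s^'+] --> v' s i 0.
Proof.
move=> /andP[s0 st].
have e r : 0 <= r <= t -> v' r i 0 = v r i 0 - \sum_a (if tau a <= r then z a else 0) i 0.
  by move=> /vE ->; rewrite mxE summxE addrK.
rewrite e ?(ltW s0) ?ltW//.
apply: (@cvg_trans _ ((v r i 0 - \sum_a (if tau a <= r then z a else 0) i 0) @[r --> s^'+])).
  apply: near_eq_cvg; near=> r; rewrite e//.
  by apply/andP; split; [rewrite ltW// (lt_trans s0)|rewrite ltW].
apply: cvgB; first by apply: cv; rewrite s0.
elim: (index_enum _) => [|a r IH].
  by under eq_fun do rewrite big_nil; rewrite big_nil; exact: cvg_cst.
under eq_fun do rewrite big_cons; rewrite big_cons.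
by apply: cvgD => //; exact: step_right_continuous.
Unshelve. all: by end_near. Qed.

Lemma jump_bounded i : bounded_on `[0, t] (fun s => v' s i 0).
Proof.
have [M hM] := bv i; exists (M + \sum_a `|z a i 0|) => s st.
have -> : v' s i 0 = v s i 0 - \sum_a (if tau a <= s then z a else 0) i 0.
  by move: st; rewrite /= in_itv/= => /vE ->; rewrite mxE summxE addrK.
rewrite (le_trans (ler_normB _ _))// lerD//; first exact: hM.
rewrite (le_trans (ler_norm_sum _ _ _))// ler_sum// => a _.
by case: ifP => // _; rewrite mxE normr0.
Qed.

Let measurable_rc (f : R -> R) : bounded_on `[0, t] f ->
  (forall s, 0 < s < t -> f r @[r --> s^'+] --> f s) ->
  measurable_fun (`[0, t] : set R) f.
Proof.
move=> bf cf; apply/measurable_fun_itv_bndo_bndcP/measurable_fun_itv_obnd_cbndP.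
exact: right_continuous_measurable cf.
Qed.

(** A jump z at time tau enters directly and through the integral from tau to t, whose value exp((t
    - tau)A) z - z turns the direct term z into exp((t - tau)A) z. The remainder [v'] inherits
    enough regularity from [v] for the integrals to be split. *)
Lemma duhamel_jumps :
  x t = (v' t + vintegral leb `[0, t] (fun s => exp_mx A (t - s) *m A *m v' s)) +
    \sum_a exp_mx A (t - tau a) *m z a.
Proof.
(* The path is extended by zero to negative times, where the hypotheses say nothing about it. *)
pose xg s := if 0 <= s then x s else 0.
have xgE s : 0 <= s -> xg s = x s by rewrite /xg => ->.
have mxg : measurable_fun setT xg.
  apply: measurable_fun_mx => i j; rewrite (ord1 j).
  rewrite (_ : (fun s => _) = (fun s => x s i 0) \_ `[0, +oo[).
    by apply/(measurable_restrictT _ _).1 => //; exact: measurable_fun_mx_entry.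
  apply/funext => s; rewrite patchE /xg; case: ifPn => s0.
    by rewrite mem_set//= in_itv/= s0.
  by rewrite memNset ?mxE//= in_itv/= andbT; exact/negP.
have bxg i : bounded_on `[0, t] (fun s => xg s i 0).
  have [M hM] := bxi i; exists M => s st; rewrite xgE; first exact: hM.
  by move: st; rewrite /= in_itv/= => /andP[].
have eqx s : 0 <= s <= t -> xg s = vintegral leb `[0, s] (fun r => A *m xg r) + v s.
  move=> /andP[s0 _]; rewrite xgE// xE//; congr (_ + _).
  apply/matrixP => i j; rewrite (ord1 j) !mxE; apply: eq_Rintegral => r.
  by rewrite inE/= in_itv/= => /andP[r0 _]; rewrite xgE.
rewrite -xgE ?ltW// (variation_of_constants (ltW t0) mxg bxg eqx).
have mv' i : measurable_fun (`[0, t] : set R) (fun s => v' s i 0).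
  by apply: measurable_rc; [exact: jump_bounded|exact: jump_right_continuous].
have bE i j : bounded_on `[0, t] (fun s => (exp_mx A (t - s) *m A) i j).
  apply: bounded_on_mulmx => a b; last exact: bounded_on_cst.
  have [M EM] := @bounded_exp_mx R m A 0 t a b; exists M => s; rewrite /= in_itv/= => /andP[s0 st].
  by apply: EM; rewrite /= in_itv/= subr_ge0 st gerBl.
have mE (D : set R) : measurable_fun D (fun s => exp_mx A (t - s) *m A).
  apply: measurable_fun_mulmx; last exact: measurable_cst.
  by apply: measurable_exp_mx; exact: measurable_funB.
pose g a s := exp_mx A (t - s) *m (A *m z a).
have tauE a i : (fun s => if tau a <= s then g a s i 0 else 0) = (fun s => g a s i 0) \_ `[tau a, +oo[.
  apply/funext => s; rewrite patchE; case: ifPn => ts.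
    by rewrite mem_set//= in_itv/= ts.
  by rewrite memNset//= in_itv/= andbT; exact/negP.
have mg a i : measurable_fun setT (fun s => g a s i 0).
  apply: measurable_fun_mx_entry; rewrite /g.
  under eq_fun do rewrite mulmxA.
  by apply: measurable_fun_mulmx; [exact: mE|exact: measurable_cst].
have bg a i : bounded_on `[0, t] (fun s => g a s i 0).
  rewrite (_ : (fun s => _) = fun s => (exp_mx A (t - s) *m A *m z a) i 0); last first.
    by apply/funext => s; rewrite /g mulmxA.
  by apply: bounded_on_mulmx => // b j; exact: bounded_on_cst.
have Ig a i : leb.-integrable `[0, t] (EFin \o (fun s => if tau a <= s then g a s i 0 else 0)).
  have mr : measurable_fun (setT : set R) ((fun s => g a s i 0) \_ `[tau a, +oo[).
    apply/(measurable_restrictT _ _).1 => //; exact: measurable_funTS (mg a i).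
  have mr' : measurable_fun (`[0, t] : set R) ((fun s => g a s i 0) \_ `[tau a, +oo[).
    exact: measurable_funTS mr.
  apply: integrable_bounded_on => //; first exact: lebesgue_segment_lty.
    by rewrite tauE; exact: mr'.
  have [M hM] := bg a i; exists `|M| => s /hM h; case: ifP => _; last by rewrite normr0.
  by rewrite (le_trans h)// ler_norm.
have jumpE a i : \int[leb]_(s in `[0, t]) (if tau a <= s then g a s i 0 else 0) =
    (exp_mx A (t - tau a) *m z a) i 0 - z a i 0.
  have /andP[ta0 tat] := tauP a.
  rewrite tauE -Rintegral_mkcondr (_ : _ `&` _ = `[tau a, t]%classic).
    have := integral_exp_mx_rev A 1%:M (z a) i tat.
    by rewrite !mul1mx => <-; apply: eq_Rintegral => s _; rewrite mul1mx.
  apply/seteqP; split => s; rewrite /= !in_itv/= ?andbT.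
    by move=> [/andP[_ ->] ->].
  by move=> /andP[ts ->]; rewrite (le_trans (ltW ta0) ts).
have I' i : leb.-integrable `[0, t] (EFin \o (fun s => (exp_mx A (t - s) *m A *m v' s) i 0)).
  apply: integrable_bounded_on => //; first exact: lebesgue_segment_lty.
    apply: measurable_fun_mx_entry; apply: measurable_fun_mulmx; first exact: mE.
    by apply: measurable_fun_mx => a b; rewrite (ord1 b); exact: mv'.
  by apply: bounded_on_mulmx => // a b; rewrite (ord1 b); exact: jump_bounded.
rewrite vE ?lexx ?ltW//.
apply/matrixP => i j; rewrite (ord1 j) !mxE.
have -> : \int[leb]_(s in `[0, t]) (exp_mx A (t - s) *m A *m v s) i 0 =
  \int[leb]_(s in `[0, t]) ((exp_mx A (t - s) *m A *m v' s) i 0 +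
     \sum_a (if tau a <= s then g a s i 0 else 0)).
  apply: eq_Rintegral => s; rewrite inE/= in_itv/= => /vE ->.
  rewrite mulmxDr mxE; congr (_ + _); rewrite mulmx_sumr summxE; apply: eq_bigr => a _.
  by case: ifP => _; rewrite /g ?mulmxA// mulmx0 mxE.
have IS : leb.-integrable `[0, t] (EFin \o (fun s => \sum_a (if tau a <= s then g a s i 0 else 0))).
  rewrite (_ : EFin \o _ = fun s => (\sum_a (EFin \o (fun s => if (tau a <= s)%R then g a s i 0%R else 0%R)) s)%E).
    by apply: integrable_sum.
  by apply/funext => s /=; rewrite sumEFin.
rewrite RintegralD// Rintegral_sum//.
have -> : \sum_a \int[leb]_(s in `[0, t]) (if tau a <= s then g a s i 0 else 0) =
    \sum_a ((exp_mx A (t - tau a) *m z a) i 0 - z a i 0).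
  by apply: eq_bigr => a _; exact: jumpE.
have -> : (\sum_a (if tau a <= t then z a else 0)) i 0 = \sum_a z a i 0.
  by rewrite summxE; apply: eq_bigr => a _; have /andP[_ ->] := tauP a.
by rewrite sumrB summxE; ring.
Qed.

End DuhamelJumps.

Lemma ae_restm (disp : measure_display) (T : measurableType disp) (R : realType)
    (mu : {measure set T -> \bar R}) (G : set T) (mG : measurable G) (Q : T -> Prop) :
  {ae mu, forall w, G w -> Q w} -> {ae restm mu mG, forall w, Q w}.
Proof.
move=> [N [mN N0 NQ]]; exists (N `|` ~` G); split.
- by apply: measurableU => //; exact: measurableC.
- apply: (subset_measure0 _ _ _ N0) => //; last by move=> w [[]].
  by apply: measurableI => //; apply: measurableU => //; exact: measurableC.
- move=> w /= nQ; case: (pselect (G w)) => Gw; [left|by right].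
  by apply: NQ => /= h; apply: nQ; exact: h.
Qed.

Lemma enorm_entry (R : realType) n (u : 'cV[R]_n) i : `|u i 0| ^+ 2 <= enorm u ^+ 2.
Proof.
rewrite /enorm sqr_sqrtr; last by rewrite sumr_ge0// => j _; exact: sqr_ge0.
rewrite -normrX ger0_norm ?sqr_ge0// (bigD1 i)//= lerDl sumr_ge0// => j _.
exact: sqr_ge0.
Qed.

Lemma enorm_entry_le (R : realType) n (u : 'cV[R]_n) i : `|u i 0| <= enorm u.
Proof. by rewrite -(ler_pXn2r (n := 2)) ?nnegrE ?enorm_ge0//; exact: enorm_entry. Qed.

(** * Measurability of the noise without the chosen jumps *)

Section RemovedJumps.
Context (R : realType) (m d : nat) (t : R).
Hypothesis t0 : 0 < t.
Notation T := (R * 'cV[R]_d)%type.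
Context (disp : measure_display) (Omega : measurableType disp) (P : probability Omega R).
Variable Pi : {measure set 'cV[R]_d -> \bar R}.
Hypothesis levy : is_levy_measure Pi.
Variable nu : Omega -> {measure set T -> \bar R}.
Hypothesis prm : is_poisson_random_measure P (intensity_measure levy) nu.
Variable Sig : set (set Omega).
Hypothesis SigT : Sig setT.
Variables (n k : nat) (c : 'I_m -> 'I_(2 ^ k)).
Hypothesis c_inj : injective c.
Let E : set T := chosen_cells t n c.
Let H : set (set Omega) := outside_system t nu Sig n c.

Let mE : measurable E. Proof. exact: measurable_chosen_cells. Qed.

Let q := restm P (measurable_one_each t prm n c).

Lemma outside_measurable_fun d' (T' : measurableType d') (f : Omega -> T') :
  measurable_fun (setT : set (g_sigma_algebraType (prm_alg nu (~` E)))) f ->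
  measurable_fun (setT : set (g_sigma_algebraType H)) f.
Proof.
move=> mf _ B mB; have := mf measurableT B mB; rewrite setTI => h.
apply: sub_sigma_algebra; exists setT => //.
by exists (f @^-1` B) => //; rewrite setTI.
Qed.

Lemma outside_Sig_measurable_fun d' (T' : measurableType d') (f : Omega -> T') :
  (forall B, measurable B -> Sig (f @^-1` B)) ->
  measurable_fun (setT : set (g_sigma_algebraType H)) f.
Proof.
move=> mf _ B mB; rewrite setTI; apply: sub_sigma_algebra; exists (f @^-1` B).
  exact: mf.
by exists setT; [exact: prm_sigma_setT|rewrite setIT].
Qed.

Definition removed_jumps (s : R) (w : Omega) : 'cV[R]_d :=
  \sum_a vintegral (nu w) (cell_until t n (c a) s) snd.

Let mcoord (i : 'I_d) : measurable_fun setT (fun x : T => x.2 i 0).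
Proof. by apply: measurable_fun_mx_entry; exact: measurable_snd. Qed.

Let outside_integral F i : measurable F -> F `&` E = set0 ->
  measurable_fun (setT : set (g_sigma_algebraType H))
    (fun w => \int[nu w]_(x in F) x.2 i 0).
Proof.
move=> mF FE; apply: outside_measurable_fun.
have sub : F `<=` ~` E by apply/disjoints_subset.
have h := measurable_prm_integral mF sub (@mcoord i); exact: (h _ _ nu).
Qed.

Let strip (e s : R) : set T := `[0, s] `*` shell e 1.

Let mstrip e s : measurable (strip e s).
Proof. by apply: measurableX => //; exact: measurable_shell. Qed.

Let strip_lty e s : 0 < e -> (intensity_measure levy (strip e s) < +oo)%E.
Proof.
move=> e0; rewrite intensity_measure_rect//; last 2 first.
- exact: measurable_shell.
- by move=> r; rewrite /= !in_itv/= => /andP[->].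
apply: lte_mul_pinfty => //; last exact: levy_shell_lty.
by rewrite ge0_fin_numE//; exact: lebesgue_segment_lty.
Qed.

Let cell_until_strip e s a : e <= n.+1%:R^-1 ->
  cell_until t n (c a) s = cell t n (c a) `&` strip e s.
Proof.
move=> en; apply/seteqP; split => x [xC [x1 x2]]; split => //; split => //.
by have [_ /andP[y1 y2]] := xC; apply/andP; split => //; exact: le_lt_trans y1.
Qed.

(** For a cutoff not above the inner radius of the annulus, the strip contains the cells up to time
    s, so subtracting their jumps leaves the integral over the rest of the strip. The integral may
    be split because the strip has finite mass almost surely. *)
Lemma truncated_removed (e s : R) i : 0 < e -> e <= n.+1%:R^-1 ->
  {ae P, forall w, (truncated_small_jumps Pi nu e s w - removed_jumps s w) i 0 =
    \int[nu w]_(x in strip e s `\` E) x.2 i 0 - s * vintegral Pi (shell e 1) id i 0}.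
Proof.
move=> e0 en; apply: filterS (prm_nat prm (mstrip e s) (strip_lty s e0)) => w [N nuN].
have fin : (nu w (strip e s) < +oo)%E by rewrite nuN ltry.
have mC a : measurable (cell_until t n (c a) s : set T) by exact: measurable_cell_until.
pose U := \big[setU/set0]_a (cell_until t n (c a) s : set T).
have mU : measurable U by apply: bigsetU_measurable.
have stripE : strip e s = (strip e s `\` E) `|` U.
  apply/seteqP; split => x.
    move=> xs; case: (pselect (E x)) => xE; last by left.
    right; apply/bigsetU_mem; move/bigsetU_mem : xE => [a _ xa]; exists a => //.
    by rewrite (cell_until_strip _ _ en).
  by move=> [[]//|/bigsetU_mem[a _]]; rewrite (cell_until_strip _ _ en) => -[].
have iS : (nu w).-integrable (strip e s) (EFin \o (fun x : T => x.2 i 0)).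
  apply: integrable_bounded_on => //; first exact: measurable_funTS.
  by exists 1 => x [_ /andP[_ x1]]; apply: le_trans (enorm_entry_le _ _) x1.
rewrite /truncated_small_jumps -/(shell e 1) -/(strip e s) !mxE.
rewrite addrAC; congr (_ - _).
rewrite {1}stripE Rintegral_setU//; last 3 first.
- exact: measurableD.
- by rewrite -stripE.
- by apply/disj_set2P/seteqP; split => // x [[_ nE] /bigsetU_mem[a _ [xa _]]]; apply: nE; exact: cell_chosen xa.
rewrite -addrA -[RHS]addr0; congr (_ + _); apply/eqP; rewrite subr_eq0; apply/eqP.
rewrite /removed_jumps summxE /Rintegral /U integral_bigsetU_EFin//; last 3 first.
- exact: index_enum_uniq.
- move=> a b _ _ [x [[xa _] [xb _]]]; apply: c_inj; apply: contrapT => /eqP ab.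
  have h : cell t n (c a) `&` cell t n (c b) = set0 :> set T by apply: cell_disjoint.
  by move/seteqP : h => [h _]; apply: (h x).
- by apply/measurable_EFinP; exact: measurable_funTS.
have ifin a : (\int[nu w]_(x in cell_until t n (c a) s) (x.2 i 0)%:E)%E \is a fin_num.
  apply: integrable_fin_num => //; apply: (integrableS _ _ _ iS) => //.
  by rewrite (cell_until_strip _ _ en).
rewrite (eq_bigr (fun a => (\int[nu w]_(x in cell_until t n (c a) s) x.2 i 0)%:E)).
  by rewrite sumEFin/=; apply: eq_bigr => a _; rewrite mxE.
by move=> a _; rewrite /Rintegral fineK.
Qed.

Lemma removed_small_jumps_sigma (M : Omega -> 'cV[R]_d) (s : R) i :
  is_small_jumps P Pi nu s M -> ae_sigma q H (fun w => (M w - removed_jumps s w) i 0).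
Proof.
move=> [mM Mlim].
(* An L2-limit yields almost sure convergence only along a subsequence: the cutoffs are chosen with
   mean squared error at most 2^-j, which is summable. *)
have hc j : exists e : R, [/\ 0 < e, e <= n.+1%:R^-1 &
    (\int[P]_w (enorm (M w - truncated_small_jumps Pi nu e s w) ^+ 2)%:E <=
     ((2 ^+ j)^-1)%:E)%E].
  have p0 : (0 < ((2 ^+ j)^-1)%:E :> \bar R)%E by rewrite lte_fin invr_gt0 exprn_gt0.
  have h := Mlim _ (open_ereal_lt' p0).
  have n0 : 0 < n.+1%:R^-1 :> R by rewrite invr_gt0.
  have [e [h1 [h2 h3]]] := @filter_ex _ _ (at_right_proper_filter (0 : R)) _
    (filterI (nbhs_right_gt (0 : R)) (filterI (nbhs_right_lt n0) h)).
  by exists e; split => //; exact: ltW.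
have [e he] := choice hc.
have mT j : measurable_fun setT (truncated_small_jumps Pi nu (e j) s).
  apply: measurable_fun_addmx; last exact: measurable_cst.
  apply: measurable_fun_mx => a b; rewrite (ord1 b); under eq_fun do rewrite mxE.
  apply: (@measurable_sub_sigma _ _ _ _ (prm_alg nu setT)); first exact: (prm_alg_measurable prm).
  have h := measurable_prm_integral (mstrip (e j) s) (@subsetT _ _) (@mcoord a); exact: (h _ _ nu).
have cvg0 : {ae P, forall w,
    enorm (M w - truncated_small_jumps Pi nu (e j) s w) ^+ 2 @[j --> \oo] --> 0}.
  apply: ae_cvg0_of_summable.
  - move=> j; apply: measurable_funX; apply: measurableT_comp; first exact: measurable_enorm.
    by apply: measurable_fun_addmx => //; apply: measurable_fun_oppmx.
  - by move=> j w; rewrite exprn_ge0 ?enorm_ge0.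
  - by move=> j; have [] := he j.
apply: (@ae_sigma_cvg _ _ _ _ _
    (fun j w => (truncated_small_jumps Pi nu (e j) s w - removed_jumps s w) i 0)).
  move=> j; have [e0 en _] := he j.
  apply: (@ae_sigma_eq _ _ _ _ _ _ (fun w => \int[nu w]_(x in strip (e j) s `\` E) x.2 i 0 +
      (- (s * vintegral Pi (shell (e j) 1) id i 0)))).
    by apply: ae_restm; apply: filterS (truncated_removed s i e0 en).
  apply: ae_sigma_measurable; apply: measurable_funD; last exact: measurable_cst.
  apply: outside_integral; first exact: measurableD.
  by apply/seteqP; split => x // [[]].
apply: ae_restm; apply: filterS cvg0 => w cw _.
apply/cvgrPdist_le => r r0.
have r20 : 0 < r ^+ 2 by rewrite exprn_gt0.
move: cw => /cvgrPdist_le/(_ _ r20); apply: filterS => j.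
rewrite sub0r normrN ger0_norm ?exprn_ge0 ?enorm_ge0// => hj.
rewrite -(ler_pXn2r (n := 2)) ?nnegrE ?normr_ge0 ?(ltW r0)//.
apply: le_trans hj; apply: le_trans (enorm_entry _ i); rewrite !mxE.
by rewrite opprB addrA addrNK.
Qed.

Lemma removed_jumps_sigma (Z : R -> Omega -> 'cV[R]_d) (s : R) i : 0 <= s ->
  is_levy_ito P Pi nu Z -> ae_sigma q H (fun w => (Z s w - removed_jumps s w) i 0).
Proof.
move=> s0 /(_ s s0)[M hM ZE].
apply: (@ae_sigma_eq _ _ _ _ _ _ (fun w =>
   large_jumps nu s w i 0 + (M w - removed_jumps s w) i 0)).
  by apply: ae_restm; apply: filterS ZE => w -> _; rewrite !mxE addrA.
apply: ae_sigmaD; last exact: removed_small_jumps_sigma.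
apply: ae_sigma_measurable; rewrite /large_jumps; under eq_fun do rewrite mxE.
apply: outside_integral.
  apply: measurableX => //; apply: measurable_set_lt; [exact: measurable_cst|exact: measurable_enorm].
apply/seteqP; split => x // [[_ /= x1] /bigsetU_mem[a _ [_ /andP[_ x2]]]].
by have := lt_le_trans x1 x2; rewrite ltxx.
Qed.

End RemovedJumps.

Lemma ae_restm_inv (disp : measure_display) (T : measurableType disp) (R : realType)
    (mu : {measure set T -> \bar R}) (G : set T) (mG : measurable G) (Q : T -> Prop) :
  {ae restm mu mG, forall w, Q w} -> {ae mu, forall w, G w -> Q w}.
Proof.
move=> [N [mN N0 NQ]]; exists (N `&` G); split => //; first exact: measurableI.
by move=> w /= /not_implyP[Gw nQ]; split => //; exact: NQ.
Qed.

Lemma cvg_sum_filter (R : realType) (T : Type) (F : set_system T) {FF : Filter F} (I : Type)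
    (r : seq I) (f : I -> T -> R) (l : I -> R) :
  (forall i, f i x @[x --> F] --> l i) ->
  \sum_(i <- r) f i x @[x --> F] --> \sum_(i <- r) l i.
Proof.
move=> fl; elim: r => [|i r IH].
  by rewrite big_nil (_ : (fun x => _) = cst 0);
    [exact: cvg_cst|apply/funext => x; rewrite big_nil].
rewrite big_cons (_ : (fun x => _) = fun x => f i x + \sum_(j <- r) f j x).
  exact: cvgD.
by apply/funext => x; rewrite big_cons.
Qed.

Lemma right_continuous_mulmx (R : realType) p n (B : 'M[R]_(p, n)) (x : R -> 'cV[R]_n) s i :
  x r @[r --> s^'+] --> x s -> (B *m x r) i 0 @[r --> s^'+] --> (B *m x s) i 0.
Proof.
move=> cx; rewrite mxE (_ : (fun r => _) = fun r => \sum_j B i j * x r j 0); last first.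
  by apply/funext => r; rewrite mxE.
apply: cvg_sum_filter => j; apply: cvgM; first exact: cvg_cst.
by apply: (cvg_comp _ (fun M : 'cV[R]_n => M j 0) cx); exact: coord_continuous.
Qed.

(** * The solution conditioned on the chosen cells *)

Section ChosenCells.
Context (R : realType) (m kW d : nat) (A : 'M[R]_m) (B : 'M[R]_(m, kW)) (D : 'M[R]_(m, d)).
Variable t : R.
Hypothesis t0 : 0 < t.
Notation T := (R * 'cV[R]_d)%type.
Local Notation leb := (@lebesgue_measure R).
Context (disp : measure_display) (Omega : measurableType disp) (P : probability Omega R).
Variables (W : R -> Omega -> 'cV[R]_kW) (Z : R -> Omega -> 'cV[R]_d) (X : R -> Omega -> 'cV[R]_m).
Variable Pi : {measure set 'cV[R]_d -> \bar R}.
Hypothesis levy : is_levy_measure Pi.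
Variable nu : Omega -> {measure set T -> \bar R}.
Hypothesis prm : is_poisson_random_measure P (intensity_measure levy) nu.
Hypothesis WP : is_wiener_process P W.
Hypothesis ZP : is_levy_process P Z.
Hypothesis ito : is_levy_ito P Pi nu Z.
Hypothesis XP : is_solution P A B D W Z X.
Let Sig := sigma_generated [set s : R | 0 <= s] W.
Hypothesis W_nu : independent_systems P Sig
  (sigma_generated [set E : set T | measurable E] (fun E w => nu w E)).
Variables (n k : nat) (c : 'I_m -> 'I_(2 ^ k)).
Hypothesis c_inj : injective c.
Let H : set (set Omega) := outside_system t nu Sig n c.
Let q := restm P (measurable_one_each t prm n c).
Let G : set Omega := one_each t nu n c.
Let tau w a := mark_times t nu n c w a 0.
Let jump w a := col a (mark_jumps t nu n c w).

Let v' s w := B *m W s w + D *m (Z s w - removed_jumps t nu n c s w).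

Let Y w := v' t w + vintegral leb `[0, t] (fun s => exp_mx A (t - s) *m A *m v' s w).

Let representation : {ae P, forall w, G w ->
  [/\ X t w = Y w + \sum_a exp_mx A (t - tau w a) *m (D *m jump w a),
      forall i, bounded_on `[0, t] (fun s => v' s w i 0) &
      forall i s, 0 < s < t -> v' r w i 0 @[r --> s^'+] --> v' s w i 0]}.
Proof.
have [_ _ _ _ Wc] := WP; have [_ _ _ _ Zc] := ZP; have [_ Xae] := XP.
have WZ : {ae P, forall w, {within `[0, +oo[, continuous (fun s => W s w)} /\
    cadlag (fun s => Z s w)} by apply: filterS2 Wc Zc => w.
apply: filterS3 (ae_good_configuration t0 prm) WZ Xae => w gw [wc zc] [mx bx xE] Gw.
pose v s := B *m W s w + D *m Z s w.
have xE' s : 0 <= s -> X s w = vintegral leb `[0, s] (fun r => A *m X r w) + v s.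
  by move=> s0; rewrite xE// addrA.
have cv i s : 0 < s < t -> v r i 0 @[r --> s^'+] --> v s i 0.
  move=> /andP[s0 st]; rewrite /v mxE; under eq_fun do rewrite mxE.
  apply: cvgD.
    apply: (@right_continuous_mulmx _ _ _ _ (fun s => W s w)); apply: cvg_at_right_filter.
    by move/continuous_within_itvcyP : wc => [+ _]; apply; rewrite in_itv/= s0.
  by apply: (@right_continuous_mulmx _ _ _ _ (fun s => Z s w)); apply: zc.1; exact: ltW.
have mark_in a : exists2 p, cell t n (c a) p & mark (nu w) (cell t n (c a)) = p.
  by have [p [? _ ?]] := good_cell gw (Gw a); exists p.
have tauP a : 0 < tau w a <= t.
  rewrite /tau mxE; have [p [p1 _] ->] := mark_in a.
  by have := slot_sub t0 (ltn_ord (c a)) p1; rewrite /= in_itv.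
have jumpE a : jump w a = (mark (nu w) (cell t n (c a))).2.
  by apply/matrixP => i j; rewrite (ord1 j) !mxE.
have vE s : 0 <= s <= t ->
    v s = v' s w + \sum_a (if tau w a <= s then D *m jump w a else 0).
  move=> _; rewrite /v /v' mulmxBr -[RHS]addrA; congr (_ + _).
  rewrite -addrA -[LHS]addr0; congr (_ + _); apply/esym.
  rewrite /removed_jumps mulmx_sumr -sumrN -big_split big1// => a _ /=.
  rewrite (cell_until_integral t0 _ gw (Gw a)) /tau mxE jumpE.
  by case: ifP => _; rewrite ?mulmx0 ?addNr ?oppr0 ?addr0.
split.
- have := duhamel_jumps t0 mx bx xE' cv tauP vE; exact.
- exact: (jump_bounded t0 mx bx xE' vE).
- exact: (jump_right_continuous cv vE).
Qed.

Let SigT : Sig setT.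
Proof. exact: (@measurableT _ (g_sigma_algebraType _)). Qed.

Let v'_sigma s i : 0 <= s -> ae_sigma q H (fun w => v' s w i 0).
Proof.
move=> s0.
apply: (@ae_sigma_eq _ _ _ _ _ _ (fun w => \sum_j B i j * W s w j 0 +
   \sum_j D i j * (Z s w - removed_jumps t nu n c s w) j 0)).
  by apply: aeW => w; rewrite /v' !mxE.
apply: ae_sigmaD; apply: ae_sigma_sum => j; apply: ae_sigmaZ; last exact: removed_jumps_sigma.
apply: ae_sigma_measurable; apply: outside_Sig_measurable_fun => C mC.
have h : measurable_fun (setT : set (g_sigma_algebraType
    (\bigcup_(i in [set s : R | 0 <= s]) preimage_set_system setT (W i) measurable))) (fun w => W s w j 0).
  by apply: measurable_fun_mx_entry; exact: sigma_generated_measurable_fun.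
by have := h measurableT C mC; rewrite setTI.
Qed.

Let representation_q : {ae q, forall w,
  [/\ X t w = Y w + \sum_a exp_mx A (t - tau w a) *m (D *m jump w a),
      forall i, bounded_on `[0, t] (fun s => v' s w i 0) &
      forall i s, 0 < s < t -> v' r w i 0 @[r --> s^'+] --> v' s w i 0]}.
Proof. by apply: ae_restm; exact: representation. Qed.

(** [Y] contains a time integral of a process whose value at each fixed time is measurable up to a
    null set; sampling at countably many times keeps the union of these null sets null. *)
Let Y_sigma i : ae_sigma q H (fun w => Y w i 0).
Proof.
pose K i j s := (exp_mx A (t - s) *m A) i j.
have mK j : measurable_fun setT (K i j).
  apply: measurable_fun_mx_entry; apply: measurable_fun_mulmx; last exact: measurable_cst.
  by apply: measurable_exp_mx; exact: measurable_funB.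
have bK j : bounded_on `[0, t] (K i j).
  apply: bounded_on_mulmx => a b; last exact: bounded_on_cst.
  have [M EM] := @bounded_exp_mx R m A 0 t a b; exists M => s; rewrite /= in_itv/= => /andP[s0 st].
  by apply: EM; rewrite /= in_itv/= subr_ge0 st gerBl.
apply: (@ae_sigma_eq _ _ _ _ _ _ (fun w => v' t w i 0 +
    \sum_j \int[leb]_(s in `[0, t]) (K i j s * v' s w j 0))).
  move: representation_q; apply: filterS => w [_ bv cv]; rewrite /Y [LHS]mxE [X in _ + X]mxE; congr (_ + _).
  rewrite -Rintegral_sum//.
    by apply: eq_Rintegral => s _; rewrite mxE.
  move=> j; apply: integrable_bounded_on => //; first exact: lebesgue_segment_lty.
    apply/measurable_fun_itv_bndo_bndcP/measurable_fun_itv_obnd_cbndP.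
    apply: measurable_funM; first exact: measurable_funTS.
    exact: (right_continuous_measurable t0 (cv j)).
  exact: bounded_onM.
apply: ae_sigmaD; first by apply: v'_sigma; exact: ltW.
apply: ae_sigma_sum => j.
apply: (@ae_sigma_cvg _ _ _ _ _ (fun l w => \sum_(r < 2 ^ l)
   v' (t / 2 ^+ l * r.+1%:R) w j 0 *
   \int[leb]_(s in `]0, t[) (K i j s * \1_(slot t l r) s))).
  move=> l; apply: ae_sigma_sum => r.
  apply: (@ae_sigma_eq _ _ _ _ _ _ (fun w =>
    \int[leb]_(s in `]0, t[) (K i j s * \1_(slot t l r) s) *
    v' (t / 2 ^+ l * r.+1%:R) w j 0)).
    by apply: aeW => w; rewrite mulrC.
  by apply: ae_sigmaZ; apply: v'_sigma; rewrite mulr_ge0// divr_ge0 ?exprn_ge0 ?ltW.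
move: representation_q; apply: filterS => w [_ bv cv].
exact: (step_integral_cvg t0 (mK j) (bK j) (bv j) (cv j)).
Qed.

Let kernel (U : 'M[R]_(d, m)) a s := exp_mx A (t - s) *m (D *m col a U).

Let kernel' (U : 'M[R]_(d, m)) a s := velocity A D t (s, col a U).

Let kernelE U a s i : kernel U a s i 0 = (1%:M *m exp_mx A (t - s) *m (D *m col a U)) i 0.
Proof. by rewrite mul1mx. Qed.

Let kernel'E U a s i : kernel' U a s i 0 =
  - (1%:M *m exp_mx A (t - s) *m (A *m (D *m col a U))) i 0.
Proof. by rewrite mul1mx /kernel' /velocity mxE mulmx_exp_mx !mulmxA. Qed.

Let kernel_derive U a i s :
  is_derive s (1 : R) (fun s => kernel U a s i 0) (kernel' U a s i 0).
Proof.
rewrite (_ : (fun s => _) = fun s => (1%:M *m exp_mx A (t - s) *m (D *m col a U)) i 0); last first.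
  by apply/funext => r; exact: kernelE.
rewrite kernel'E.
have d1 := @is_derive_exp_mx R m A _ 1 1%:M (D *m col a U) i 0 (t - s).
have d2 : is_derive s (1 : R) (fun s => t - s) (-1).
  rewrite (_ : (fun s => t - s) = (cst t - id))//.
  by apply: is_derive_eq; rewrite sub0r.
have := @is_derive1_comp _ (fun t => (1%:M *m exp_mx A t *m (D *m col a U)) i 0) (fun s => t - s) s _ _ d1 d2.
by rewrite ?mulrN1 ?mulN1r.
Qed.

Let kernel'_continuous U a i : continuous (fun s => kernel' U a s i 0).
Proof.
rewrite (_ : (fun s => _) = fun s => - (1%:M *m exp_mx A (t - s) *m (A *m (D *m col a U))) i 0).
  move=> s; apply: cvgN; apply: (@continuous_comp _ _ _ (fun s => t - s)
    (fun t => (1%:M *m exp_mx A t *m (A *m (D *m col a U))) i 0)).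
    by apply: cvgB; [exact: cvg_cst|exact: cvg_id].
  exact: continuous_exp_mx.
by apply/funext => r; exact: kernel'E.
Qed.

Variable L : {sigma_finite_measure set 'cV[R]_m -> \bar R}.
Hypothesis Lbox : forall C : 'I_m -> set R, (forall i, measurable (C i)) ->
  L (box C) = (\prod_(i < m) leb (C i))%E.

Lemma chosen_cells_null (N : set 'cV[R]_m) : measurable N -> L N = 0%E ->
  {ae P, forall w, G w ->
    \det (velocities A D t (fun a => mark (nu w) (cell t n (c a)))) != 0 -> ~ N (X t w)}.
Proof.
move=> mN N0.
have hy i : exists g, measurable_fun (setT : set (g_sigma_algebraType H)) g /\
    {ae q, forall w, Y w i 0 = g w}.
  by have [g ? ?] := Y_sigma i; exists g.
have [g hg] := choice hy.
(* A version of [Y] that is measurable in the strict sense for the outside information, as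
   [marked_law_null] requires. *)
pose y (w : Omega) : 'cV[R]_m := \col_i g i w.
have my : measurable_fun (setT : set (g_sigma_algebraType H)) y.
  apply: measurable_fun_mx => i j; under eq_fun do rewrite mxE; exact: (hg i).1.
have Yy : {ae q, forall w, Y w = y w}.
  have h : {ae q, forall w, forall i, Y w i 0 = g i w}.
    by apply: ae_countable => i; exact: (hg i).2.
  apply: filterS h => w h; apply/matrixP => i j; rewrite (ord1 j) h mxE //.
(* The configurations to be excluded. For fixed sizes and outside value, the section is a null set
   of times by [curve_sum_null]. *)
pose M : set (('M[R]_(d, m) * 'cV[R]_m) * 'cV[R]_m) := [set p |
  \det (curve_jacobian (kernel' p.1.1) p.2) != 0 /\ N (curve_sum (kernel p.1.1) p.1.2 p.2)].
have mM : measurable M.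
  have mcol a : measurable_fun setT (fun p : ('M[R]_(d, m) * 'cV[R]_m) * 'cV[R]_m => col a p.1.1).
    apply: measurable_fun_mx => i j; under eq_fun do rewrite mxE.
    by apply: measurable_fun_mx_entry; apply: measurableT_comp; exact: measurable_fst.
  have mtime a : measurable_fun setT (fun p : ('M[R]_(d, m) * 'cV[R]_m) * 'cV[R]_m => p.2 a 0).
    by apply: measurable_fun_mx_entry; exact: measurable_snd.
  apply: measurableI.
    apply: measurable_set_neq0; apply: measurable_fun_det.
    apply: measurable_fun_mx => i a; under eq_fun do rewrite mxE.
    apply: measurable_fun_mx_entry; apply: measurableT_comp; first exact: measurable_velocity.
    by apply: measurable_fun_pair; [exact: mtime|exact: mcol].
  rewrite -[X in measurable X]setTI.
  have mS : measurable_fun setT (fun p : ('M[R]_(d, m) * 'cV[R]_m) * 'cV[R]_m =>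
      curve_sum (kernel p.1.1) p.1.2 p.2).
    apply: measurable_fun_addmx.
      by apply: measurableT_comp; [exact: measurable_snd|exact: measurable_fst].
    apply: measurable_fun_mx => i j; under eq_fun do rewrite summxE.
    apply: measurable_sum => a; apply: measurable_fun_mx_entry; rewrite /kernel.
    apply: measurable_fun_mulmx.
      by apply: measurable_exp_mx; apply: measurable_funB => //; exact: mtime.
    by apply: measurable_fun_mulmx; [exact: measurable_cst|exact: mcol].
  exact: (mS measurableT N mN).
have M0 (v : 'M[R]_(d, m) * 'cV[R]_m) : L (xsection M v) = 0%E.
  have h1 := @kernel_derive v.1; have h2 := @kernel'_continuous v.1.
  have <- := curve_sum_null Lbox v.2 h1 h2 mN N0.
  congr (L _); apply/seteqP; split => s; rewrite xsectionP //.
have SigI : setI_closed Sig.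
  by move=> C C' h h'; exact: (@measurableI _ (g_sigma_algebraType _)).
have Sig_prm : independent_systems P Sig (prm_sigma nu setT).
  move=> C C' h h'; apply: W_nu => //.
  have := h'; apply: sub_sigma_generated => F [] //.
have Sig_meas : Sig `<=` measurable.
  by apply: sigma_generated_measurable => s s0; have [+ _ _ _ _] := WP; exact.
have null := marked_law_null t0 prm SigT SigI Sig_prm Sig_meas c_inj Lbox my mM M0.
have nae : {ae P, forall w, G w -> ~ M ((mark_jumps t nu n c w, y w), mark_times t nu n c w)}.
  exists (one_each t nu n c `&` [set w | M ((mark_jumps t nu n c w, y w), mark_times t nu n c w)]).
  split => //; last by move=> w /= /not_implyP[? /contrapT].
  apply: measurableI; first exact: (measurable_one_each t prm n c).
  rewrite -[X in measurable X]setTI.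
  have my' : measurable_fun (setT : set Omega) y.
    have h : H `<=` @measurable _ Omega by exact: (outside_system_measurable prm Sig_meas).
    move=> _ C mC; rewrite setTI.
    have h' : <<s H >> (y @^-1` C) by have := my measurableT C mC; rewrite setTI.
    have := sub_sigma_measurable h h'.
    exact.
  have mp := measurable_fun_pair (measurable_fun_pair (measurable_mark_jumps t prm n c) my')
    (measurable_mark_times t prm n c).
  exact: (mp measurableT M mM).
apply: filterS3 nae representation (ae_restm_inv Yy) => w hM hX hY Gw dJ NX.
have [XE _ _] := hX Gw; apply: (hM Gw); split.
  have -> : curve_jacobian (kernel' (mark_jumps t nu n c w)) (mark_times t nu n c w) =
      velocities A D t (fun a => mark (nu w) (cell t n (c a))); last exact: dJ.
  apply/matrixP => i a; rewrite [LHS]mxE [RHS]mxE /kernel'.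
  have -> // : (mark_times t nu n c w a 0, col a (mark_jumps t nu n c w)) =
    mark (nu w) (cell t n (c a)).
  rewrite [RHS]surjective_pairing; congr pair; first by rewrite mxE.
  by apply/matrixP => i' j; rewrite (ord1 j) [LHS]mxE mxE.
by move: NX; rewrite XE hY.
Qed.

End ChosenCells.

Lemma kalman_absolutely_continuous (R : realType) (m d : nat) (A : 'M[R]_m) (D : 'M[R]_(m, d))
    (k : nat) (B : 'M[R]_(m, k)) (disp : measure_display) (Omega : measurableType disp)
    (P : probability Omega R) (W : R -> Omega -> 'cV[R]_k)
    (Pi : {measure set 'cV[R]_d -> \bar R})
    (nu : Omega -> {measure set (R * 'cV[R]_d) -> \bar R})
    (Z : R -> Omega -> 'cV[R]_d) (X : R -> Omega -> 'cV[R]_m) :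
  \rank (\mxrow_(j < m) (A ^+ j.+1 *m D)) = m ->
  is_wiener_process P W -> is_levy_measure Pi -> ess_lin_nondegenerated Pi ->
  is_poisson_random_measure P (intensity Pi) nu ->
  is_levy_process P Z -> is_levy_ito P Pi nu Z ->
  independent_systems P (sigma_generated [set t : R | 0 <= t] W)
    (sigma_generated [set E : set (R * 'cV[R]_d) | measurable E] (fun E w => nu w E)) ->
  is_solution P A B D W Z X ->
  forall t : R, 0 < t -> pushforward P (X t) `<< @lebesgue_cV R m.
Proof.
move=> rk WP levy nondeg prm ZP ito W_nu XP t t0 S S0 N mN NS.
have [L [LE Lbox]] := lebesgue_cV_measure R m.
have LN : L N = 0%E by rewrite -LE//; exact: S0.
have prm' : is_poisson_random_measure P (intensity_measure levy) nu by exact: prm.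
have mX : measurable_fun setT (X t) by have [mX _] := XP; apply: mX; exact: ltW.
have mXN : measurable (X t @^-1` N) by rewrite -[X in measurable X]setTI; exact: mX.
(* The null sets are united over the countably many choices of cells before the random choice
   supplied by [ae_spanning_jumps] is inserted. *)
have cells : {ae P, forall w, forall x : {n : nat & {k : nat & {ffun 'I_m -> 'I_(2 ^ k)}}},
    injective (tagged (tagged x)) -> one_each t nu (tag x) (tagged (tagged x)) w ->
    \det (velocities A D t (fun a => mark (nu w) (cell t (tag x) (tagged (tagged x) a)))) != 0 ->
    ~ N (X t w)}.
  apply: ae_countable => -[n [l c]] /=.
  have [c_inj|nc] := pselect (injective c); last by apply: aeW => w /nc.
  have := chosen_cells_null t0 prm' WP ZP ito XP W_nu n c_inj Lbox mN LN.
  by apply: filterS => w h _; exact: h.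
have never : {ae P, forall w, ~ N (X t w)}.
  apply: filterS2 cells (ae_spanning_jumps t0 rk nondeg prm') => w h [_ [n [l [c [c_inj c1 dc]]]]].
  apply: (h (Tagged _ (Tagged (fun k => {ffun 'I_m -> 'I_(2 ^ k)}) (finfun c)))) => /=.
  - by move=> a b; rewrite !ffunE; exact: c_inj.
  - by move=> a; rewrite ffunE; exact: c1.
  - rewrite (_ : (fun a => _) = fun a => mark (nu w) (cell t n (c a)))//.
    by apply/funext => a; rewrite ffunE.
have null : P (X t @^-1` N) = 0%E.
  have neg : P.-negligible (X t @^-1` N) by apply: negligibleS never => w Nw /(_ Nw).
  exact: measure_negligible mXN neg.
exact: null.
Qed.

(** * Coin tossing *)

Definition probability_copy d (T : measurableType d) (R : realType)
    (m : {measure set T -> \bar R}) (m1 : m setT = 1%E) : set T -> \bar R := m.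

HB.instance Definition _ d (T : measurableType d) (R : realType)
    (m : {measure set T -> \bar R}) (m1 : m setT = 1%E) :=
  Measure.on (probability_copy m1).

HB.instance Definition _ d (T : measurableType d) (R : realType)
    (m : {measure set T -> \bar R}) (m1 : m setT = 1%E) :=
  @Measure_isProbability.Build _ _ _ (probability_copy m1) m1.

Section Constraints.
Context {E : Type}.

(* Cylinder events form a pi-system generating the sigma-algebra of streams. *)
Definition constrained (J : nat -> bool) (v : nat -> E) : set (nat -> E) :=
  [set b | forall i, J i -> b i = v i].

Definition bounded_support (J : nat -> bool) (p : nat) := forall i, J i -> (i < p)%N.

(** The empty set is included because incompatible cylinders have empty intersection; bounded
    supports make the events finite-dimensional. *)
Definition constraints : set (set (nat -> E)) :=
  [set S | S = set0 \/ exists J v p, bounded_support J p /\ S = constrained J v].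

Lemma setI_closed_constraints : setI_closed constraints.
Proof.
move=> S S' [->|[J [v [p [Jp ->]]]]]; first by rewrite set0I; left.
move=> [->|[K [w [q [Kq ->]]]]]; first by rewrite setI0; left.
have [vw|vw] := pselect (forall i, J i -> K i -> v i = w i); last first.
  left; apply/seteqP; split => // b [bv bw]; apply: vw => i Ji Ki.
  by rewrite -bv// bw.
right; exists (fun i => J i || K i), (fun i => if J i then v i else w i), (maxn p q).
split; first by move=> i /orP[/Jp|/Kq] h; rewrite leq_max h ?orbT.
apply/seteqP; split => b.
  by move=> [bv bw] i /orP[Ji|Ki]; [rewrite Ji bv|case: ifPn => [/bv//|_]; exact: bw].
move=> h; split => i Hi; first by rewrite h ?Hi.
by rewrite h ?Hi ?orbT//; case: ifPn => // Ji; exact: vw.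
Qed.

Lemma constraintsT (v0 : E) : constraints setT.
Proof. by right; exists (fun=> false), (fun=> v0), 0%N; split => //; apply/seteqP; split. Qed.

End Constraints.

Definition streams := g_sigma_algebraType (@constraints bool).

Lemma measurable_constrained (J v : nat -> bool) p : bounded_support J p ->
  measurable (constrained J v : set streams).
Proof. by move=> Jp; apply: sub_sigma_algebra; right; exists J, v, p. Qed.

Definition evens (b : nat -> bool) (i : nat) : bool := b i.*2.
Definition odds (b : nat -> bool) (i : nat) : bool := b i.*2.+1.

Lemma evens_odds_constrained J K (v w : nat -> bool) :
  evens @^-1` constrained J v `&` odds @^-1` constrained K w =
  constrained (fun i => if odd i then K i./2 else J i./2)
              (fun i => if odd i then w i./2 else v i./2).
Proof.
apply/seteqP; split => b.
  move=> [bv bw] i; have := odd_double_half i; case: (odd i) => /= e h.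
    by rewrite -[in LHS]e add1n; exact: bw.
  by rewrite -[in LHS]e add0n; exact: bv.
move=> h; split => i Hi.
  by have := h i.*2; rewrite odd_double doubleK => /(_ Hi).
by have := h i.*2.+1; rewrite /= odd_double /= uphalf_double => /(_ Hi).
Qed.

Section Uniform.
Context (R : realType).

Definition doubling (x : R) : R := 2 * x - (2^-1 <= x)%R%:R.

Definition digit (x : R) (i : nat) : bool := 2^-1 <= iter i doubling x.

Fixpoint binary (p : nat) (b : nat -> bool) : R :=
  if p is p'.+1 then ((b 0%N)%:R + binary p' (fun i => b i.+1)) / 2 else 0.

Lemma binary_bound p b : 0 <= binary p b <= 1 - (2 ^+ p)^-1.
Proof.
elim: p b => [|p IH] b /=; first by rewrite expr0 invr1 subrr lexx.
have := IH (fun i => b i.+1); rewrite exprS invfM.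
by case: (b 0%N) => /=; lra.
Qed.

Lemma digit_doubling x i : digit (doubling x) i = digit x i.+1.
Proof. by rewrite /digit iterSr. Qed.

Lemma digitP p v x : 0 <= x < 1 ->
  (forall i, (i < p)%N -> digit x i = v i) <->
  binary p v <= x < binary p v + (2 ^+ p)^-1.
Proof.
elim: p v x => [|p IH] v x x01; first by rewrite /= add0r expr0 invr1; split.
have d01 : 0 <= doubling x < 1 by rewrite /doubling; case: (leP 2^-1 x) => h /=; lra.
have {IH} := IH (fun i => v i.+1) (doubling x) d01.
have := binary_bound p (fun i => v i.+1).
rewrite /= exprS invfM; set y := binary p _; set e := (2 ^+ p)^-1 => yb IH.
have e0 : 0 < e by rewrite invr_gt0 exprn_gt0.
split.
  move=> h; have h0 : digit x 0 = v 0%N := h 0%N isT.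
  have /IH : forall i, (i < p)%N -> digit (doubling x) i = v i.+1.
    by move=> i ip; rewrite digit_doubling h.
  rewrite /doubling -[(2^-1 <= x)%R]/(digit x 0) h0.
  by case: (v 0%N) => /=; lra.
move=> h; have h0 : digit x 0 = v 0%N.
  by rewrite /digit /=; case: (v 0%N) h => /= h; apply/idP; [|apply/negP]; lra.
have : y <= doubling x < y + e.
  rewrite /doubling -[(2^-1 <= x)%R]/(digit x 0) h0.
  by case: (v 0%N) h => /=; lra.
by move=> /IH hi [|i] ip //; rewrite -digit_doubling hi.
Qed.

Lemma measurable_digit i : measurable_fun setT (fun x : R => digit x i).
Proof.
have mi : measurable_fun setT (iter i doubling).
  elim: i => [|i IH]; first exact: measurable_id.
  apply: (measurableT_comp (f := doubling)) => //.
  apply: measurable_funB; first exact: measurable_funM.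
  rewrite (_ : (fun x => _) = \1_[set x | 2^-1 <= x]).
    apply: measurable_indic; apply: measurable_set_le; [exact: measurable_cst|exact: measurable_id].
  by apply/funext => x; rewrite indicE; congr ((nat_of_bool _)%:R); apply/idP/idP; rewrite inE.
by apply: measurable_fun_ler => //; exact: measurable_cst.
Qed.

Lemma measurable_digits : measurable_fun setT (digit : R -> streams).
Proof.
apply: (@measurability _ _ _ _ setT (digit : R -> streams) (@constraints bool)) => // _ [S [->|[J [v [p [Jp ->]]]]] <-].
  by rewrite preimage_set0 setI0.
rewrite setTI (_ : _ @^-1` _ = \bigcap_i [set x | J i -> digit x i = v i]).
  apply: bigcapT_measurable => i; case Ji : (J i); last first.
    by rewrite (_ : [set x | _] = setT)//; apply/seteqP; split.
  rewrite (_ : [set x | _] = [set x | digit x i = v i]).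
    by have := measurable_digit i measurableT (I : measurable [set v i]); rewrite setTI.
  by apply/seteqP; split => x /=; [exact|].
by apply/seteqP; split => x h i; [move=> _; exact: h|exact: (h i I)].
Qed.

Let unit_lebesgue := restm (@lebesgue_measure R) (measurable_itv `[0, 1[).

Let streams_measure := pushm unit_lebesgue measurable_digits.

Let streams_measureT : streams_measure setT = 1%E.
Proof.
have -> : streams_measure setT = @lebesgue_measure R `[0, 1[%classic.
  by rewrite /streams_measure pushmE preimage_setT /unit_lebesgue restmE setTI.
by rewrite lebesgue_measure_itv/= lte_fin ltr01 oppr0 adde0.
Qed.

(** The law of the binary digits of a uniform point of [[0, 1[]: Lebesgue measure takes the place of
    an extension theorem. *)
Definition coin_tossing : probability streams R := probability_copy streams_measureT.

Let coin_tossingE S : coin_tossing S =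
  lebesgue_measure ([set x : R | S (digit x)] `&` `[0, 1[).
Proof. by []. Qed.

Let cylinder p (v : nat -> bool) : coin_tossing (constrained (fun i => (i < p)%N) v) = ((2 ^+ p)^-1)%:E.
Proof.
have yb := binary_bound p v.
have -> : coin_tossing (constrained (fun i => (i < p)%N) v) =
    @lebesgue_measure R `[binary p v, binary p v + (2 ^+ p)^-1[%classic.
  rewrite coin_tossingE; congr (_ _); apply/seteqP; split => x.
    move=> [h /=]; rewrite !in_itv/= => x01.
    by apply/(digitP p v x01) => i /h.
  rewrite /= !in_itv/= => h; have x01 : 0 <= x < 1 by lra.
  by split => //; apply/(digitP p v x01).
rewrite lebesgue_measure_itv/= lte_fin ltrDl invr_gt0 exprn_gt0//.
by rewrite -EFinB addrAC subrr add0r.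
Qed.

(** Induction on the number of free positions below [p]: fixing one of them splits the event into
    two of equal probability, until a full prefix is reached, where [cylinder] applies. *)
Lemma coin_tossing_constrained J (v : nat -> bool) p : bounded_support J p ->
  coin_tossing (constrained J v) = ((2 ^+ count J (iota 0 p))^-1)%:E.
Proof.
move=> Jp; have [k hk] := ubnP (count (predC J) (iota 0 p)).
elim: k => // k IH in J v Jp hk *.
have [hJ|] := boolP (all J (iota 0 p)).
  have -> : J = (fun i => (i < p)%N).
    apply/funext => i; apply/idP/idP => [/Jp//|ip].
    by move/allP : hJ; apply; rewrite mem_iota add0n.
  rewrite cylinder; congr ((2 ^+ _)^-1)%:E.
  rewrite (eq_in_count (a2 := predT)) ?count_predT ?size_iota// => i.
  by rewrite mem_iota add0n => /andP[_ ->].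
move=> /allPn[i]; rewrite mem_iota add0n => /andP[_ ip] nJi.
pose J' j := (j == i) || J j.
have J'p : bounded_support J' p by move=> j /orP[/eqP ->//|/Jp].
have cJ : count J' (iota 0 p) = (count J (iota 0 p)).+1.
  have := count_predUI (pred1 i) J (iota 0 p).
  rewrite (_ : count (predI _ _) _ = 0%N); last first.
    by apply/eqP; rewrite -leqn0 leqNgt -has_count; apply/hasPn => j _ /=;
      case: eqP => //= ->.
  by rewrite addn0 (count_uniq_mem _ (iota_uniq 0 p)) mem_iota add0n ip add1n.
have cJ' : (count (predC J') (iota 0 p) < k)%N.
  have := count_predC J' (iota 0 p); rewrite -(count_predC J (iota 0 p)) cJ addSnnS.
  by move=> /addnI e; rewrite -e in hk.
pose w e j := if j == i then e else v j.
have E e : coin_tossing (constrained J' (w e)) = ((2 ^+ (count J (iota 0 p)).+1)^-1)%:E.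
  by rewrite IH// cJ.
have -> : constrained J v = constrained J' (w true) `|` constrained J' (w false).
  apply/seteqP; split => b.
    move=> h; case bi : (b i); [left|right] => j; rewrite /J' /w;
      (case: eqP => [->//|_ /= Jj]; exact: h).
  move=> [] h j Jj; have := h j; rewrite /J' /w Jj orbT => /(_ isT) ->.
    by case: eqP => // ji; move: Jj; rewrite ji (negbTE nJi).
  by case: eqP => // ji; move: Jj; rewrite ji (negbTE nJi).
have mJ e : measurable (constrained J' (w e) : set streams) := measurable_constrained (w e) J'p.
rewrite [LHS](measureU coin_tossing (mJ _) (mJ _)).
  apply: (etrans (congr2 _ (E true) (E false))).
  rewrite -EFinD; congr EFin; rewrite exprS invfM; lra.
apply/seteqP; split => // b [/(_ i) h1 /(_ i) h2].
by move: h1 h2; rewrite /J' /w eqxx/= => -> // /(_ isT).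
Qed.

Let half_support J K p q : bounded_support J p -> bounded_support K q ->
  bounded_support (fun i => if odd i then K i./2 else J i./2) (maxn p q).*2.
Proof.
move=> Jp Kq i; rewrite -ltn_half_double.
by case: ifP => _ h; rewrite leq_max ?(Jp _ h)// (Kq _ h) orbT.
Qed.

Let count_half J K r : count (fun i => if odd i then K i./2 else J i./2) (iota 0 r.*2) =
  (count J (iota 0 r) + count K (iota 0 r))%N.
Proof.
elim: r => // r IH; rewrite doubleS -addn2 iotaD count_cat IH.
rewrite -[in RHS]addn1 !iotaD !count_cat !add0n /= !odd_double /= doubleK uphalf_double.
by rewrite !addn0 addnACA.
Qed.

Let split_pi S S' : constraints S -> constraints S' ->
  coin_tossing (evens @^-1` S `&` odds @^-1` S') = (coin_tossing S * coin_tossing S')%E.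
Proof.
move=> [->|[J [v [p [Jp ->]]]]]; first by rewrite preimage_set0 set0I !measure0 mul0e.
move=> [->|[K [w [q [Kq ->]]]]]; first by rewrite preimage_set0 setI0 !measure0 mule0.
rewrite evens_odds_constrained (coin_tossing_constrained _ (half_support Jp Kq)) count_half.
have Jm : bounded_support J (maxn p q) by move=> i /Jp h; rewrite leq_max h.
have Km : bounded_support K (maxn p q) by move=> i /Kq h; rewrite leq_max h orbT.
by rewrite (coin_tossing_constrained _ Jm) (coin_tossing_constrained _ Km) exprD invfM EFinM.
Qed.

Lemma measurable_evens : measurable_fun setT (evens : streams -> streams).
Proof.
apply: (@measurability _ _ _ _ setT (evens : streams -> streams) (@constraints bool)) => //.
move=> _ [S [->|[J [v [p [Jp ->]]]]] <-]; first by rewrite preimage_set0 setI0.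
rewrite setTI; apply: sub_sigma_algebra; right.
have K0 : bounded_support (fun=> false) 0 by [].
have := evens_odds_constrained J (fun=> false) v v.
have -> : odds @^-1` constrained (fun=> false) v = setT by apply/seteqP; split.
rewrite setIT => ->; do 2 eexists; exists (maxn p 0).*2; split; last by reflexivity.
exact: half_support Jp K0.
Qed.

Lemma measurable_odds : measurable_fun setT (odds : streams -> streams).
Proof.
apply: (@measurability _ _ _ _ setT (odds : streams -> streams) (@constraints bool)) => //.
move=> _ [S [->|[J [v [p [Jp ->]]]]] <-]; first by rewrite preimage_set0 setI0.
rewrite setTI; apply: sub_sigma_algebra; right.
have K0 : bounded_support (fun=> false) 0 by [].
have := evens_odds_constrained (fun=> false) J v v.
have -> : evens @^-1` constrained (fun=> false) v = setT by apply/seteqP; split.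
rewrite setTI => ->; do 2 eexists; exists (maxn 0 p).*2; split; last by reflexivity.
exact: half_support K0 Jp.
Qed.

Let preserving (f : streams -> streams) (mf : measurable_fun setT f) :
  (forall S, constraints S -> coin_tossing (f @^-1` S) = coin_tossing S) ->
  forall A, measurable A -> coin_tossing (f @^-1` A) = coin_tossing A.
Proof.
move=> h A mA.
have := @measure_unique _ R streams (@constraints bool) (fun=> setT) (erefl _) setI_closed_constraints
  (fun=> constraintsT false) _ (pushm coin_tossing mf) coin_tossing.
apply => //.
- by apply/seteqP; split => // x _; exists 0%N.
- move=> n; have -> : pushm coin_tossing mf setT = 1%E; last exact: ltry.
  by rewrite -(probability_setT coin_tossing).
Qed.

Lemma evens_preserving (A : set streams) : measurable A -> coin_tossing (evens @^-1` A) = coin_tossing A.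
Proof.
apply: preserving; first exact: measurable_evens.
move=> S cS; have := split_pi cS (constraintsT false).
by rewrite preimage_setT setIT probability_setT mule1.
Qed.

Lemma odds_preserving (A : set streams) : measurable A -> coin_tossing (odds @^-1` A) = coin_tossing A.
Proof.
apply: preserving; first exact: measurable_odds.
move=> S cS; have := split_pi (constraintsT false) cS.
by rewrite preimage_setT setTI probability_setT mul1e.
Qed.

Lemma coin_tossing_split (A B : set streams) : measurable A -> measurable B ->
  coin_tossing (evens @^-1` A `&` odds @^-1` B) = (coin_tossing A * coin_tossing B)%E.
Proof.
move=> mA mB; rewrite -(evens_preserving mA) -(odds_preserving mB).
pose Se := [set evens @^-1` S | S in @constraints bool].
pose So := [set odds @^-1` S | S in @constraints bool].
have pull (f : streams -> streams) C : measurable C ->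
    <<s [set f @^-1` S | S in @constraints bool] >> (f @^-1` C).
  move=> mC; have mf : measurable_fun
      (setT : set (g_sigma_algebraType [set f @^-1` S | S in @constraints bool])) (f : _ -> streams).
    apply: (@measurability _ _ (g_sigma_algebraType [set f @^-1` S | S in @constraints bool]) streams setT f (@constraints bool)) => //.
    by move=> _ [S cS <-]; rewrite setTI; apply: sub_sigma_algebra; exists S.
  by have := mf measurableT C mC; rewrite setTI.
have meas (f : streams -> streams) : measurable_fun setT f ->
    [set f @^-1` S | S in @constraints bool] `<=` measurable.
  move=> mf _ [S cS <-]; rewrite -[X in measurable X]setTI; apply: mf => //.
  exact: sub_sigma_algebra.
have clos (f : streams -> streams) : setI_closed [set f @^-1` S | S in @constraints bool].
  by move=> _ _ [S cS <-] [S' cS' <-]; exists (S `&` S') => //; exact: setI_closed_constraints.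
have full (f : streams -> streams) : [set f @^-1` S | S in @constraints bool] setT.
  by exists setT => //; exact: constraintsT false.
apply: (@independent_systems_sigma _ _ _ coin_tossing Se So).
- exact: meas measurable_evens.
- exact: clos.
- exact: full.
- exact: meas measurable_odds.
- exact: clos.
- exact: full.
- move=> _ _ [S cS <-] [S' cS' <-]; rewrite split_pi//.
  by rewrite evens_preserving ?odds_preserving//; exact: sub_sigma_algebra.
- exact: pull.
- exact: pull.
Qed.

(** The upper limit makes the value of a binary expansion total and measurable, with no convergence
    to be established for arbitrary streams. *)
Definition uniform (b : streams) : R :=
  fine (limn_esup (fun p => (binary p b)%:E)).

Lemma measurable_uniform : measurable_fun setT uniform.
Proof.
have mcoord i : measurable_fun setT (fun b : streams => (b i)%:R : R).
  have -> : (fun b : streams => (b i)%:R : R) = \1_(constrained (pred1 i) (fun=> true)).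
    apply/funext => b; rewrite indicE; congr ((nat_of_bool _)%:R); apply/idP/idP => bi.
      by rewrite inE => j /eqP ->.
    by move: bi; rewrite inE => /(_ i); apply; rewrite /= eqxx.
  apply: measurable_indic; apply: (@measurable_constrained _ _ i.+1).
  by move=> j /eqP ->.
have mb p k : measurable_fun setT (fun b : streams => binary p (fun i => b (k + i)%N) : R).
  elim: p k => [|p IH] k /=; first exact: measurable_cst.
  apply: measurable_funM => //; apply: measurable_funD; first exact: mcoord.
  rewrite (_ : (fun b => _) = (fun b : streams => binary p (fun i => b (k.+1 + i)%N)))//.
  by apply/funext => b; congr binary; apply/funext => i; rewrite addSnnS.
apply: measurableT_comp; first exact: fine_measurable.
apply: measurable_fun_limn_esup => p; apply/measurable_EFinP.
exact: (mb p 0%N).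
Qed.

Lemma uniform_digit x : 0 <= x < 1 -> uniform (digit x) = x.
Proof.
move=> x01; rewrite /uniform.
have c : (binary p (digit x))%:E @[p --> \oo] --> x%:E.
  apply: cvg_EFin; first by near=> n.
  apply/cvgrPdist_lt => e e0.
  have /cvgrPdist_lt/(_ _ e0) : (2^-1 : R) ^+ k @[k --> \oo] --> 0.
    by apply: cvg_expr; rewrite gtr0_norm ?invr_gt0// invf_lt1// ltr1n.
  apply: filterS => p; rewrite sub0r normrN exprVn gtr0_norm ?invr_gt0 ?exprn_gt0// => pe.
  have /andP[h1 h2] : binary p (digit x) <= x < binary p (digit x) + (2 ^+ p)^-1.
    by apply/digitP.
  by rewrite /= ger0_norm ?subr_ge0//; lra.
by rewrite (cvg_limn_einf_sup c).2.
Unshelve. all: by end_near. Qed.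

Lemma uniform_law A : measurable A ->
  coin_tossing (uniform @^-1` A) = lebesgue_measure (A `&` `[0, 1[).
Proof.
move=> mA; rewrite coin_tossingE; congr (_ _); apply/seteqP; split => x.
  by move=> [/= h x01]; split => //; move: x01 h; rewrite /= in_itv/= => /uniform_digit ->.
by move=> [/= h x01]; split => //=; move: x01 h; rewrite /= in_itv/= => /uniform_digit ->.
Qed.

End Uniform.

Section IndependentStreams.
Context (R : realType).
Local Notation mu := (coin_tossing R).

Lemma coin_tossing_integral_split (g h : streams -> R) :
  (forall w, 0 <= g w) -> (forall w, 0 <= h w) ->
  measurable_fun setT g -> measurable_fun setT h ->
  (\int[mu]_w (g (evens w) * h (odds w))%:E =
   (\int[mu]_w (g w)%:E) * (\int[mu]_w (h w)%:E))%E.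
Proof.
move=> g0 h0 mg mh.
have mT : measurable_fun setT (fun w : streams => (evens w : streams, odds w : streams)).
  by apply: measurable_fun_pair; [exact: measurable_evens|exact: measurable_odds].
have mgE : measurable_fun setT (EFin \o g) by exact/measurable_EFinP.
have mhE : measurable_fun setT (EFin \o h) by exact/measurable_EFinP.
pose F (p : streams * streams) := (g p.1 * h p.2)%:E.
have mF : measurable_fun setT F.
  by apply/measurable_EFinP; apply: measurable_funM; apply: measurableT_comp.
have F0 p : (0 <= F p)%E by rewrite lee_fin mulr_ge0.
have -> : (\int[mu]_w (g (evens w) * h (odds w))%:E = \int[pushm mu mT]_p F p)%E.
  rewrite (@ge0_integral_pushforward _ _ _ _ _ _ mT mu setT F)//.
have -> : (\int[pushm mu mT]_p F p = \int[mu \x mu]_p F p)%E.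
  apply: eq_measure_integral => A mA _; apply/esym.
  apply: product_measure_unique => // B C mB mC.
  exact: coin_tossing_split.
rewrite fubini_tonelli1//; transitivity (\int[mu]_x ((\int[mu]_y (h y)%:E) * (g x)%:E))%E.
  apply: eq_integral => x _; rewrite /fubini_F muleC -ge0_integralZl//.
  - by move=> y _; rewrite lee_fin.
  - by rewrite lee_fin.
rewrite ge0_integralZl// 1?muleC//; first by move=> y _; rewrite lee_fin.
by apply: integral_ge0 => y _; rewrite lee_fin.
Qed.

(** Each use consumes the even positions and passes the odd ones on, so a single stream contains
    countably many independent streams of the same law. *)
Definition substream (c : nat) (w : streams) : streams := evens (iter c odds w).

Lemma measurable_substream c : measurable_fun setT (substream c).
Proof.
apply: (measurableT_comp (f := evens : streams -> streams)); first exact: measurable_evens.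
elim: c => [|c IH]; first exact: measurable_id.
by apply: (measurableT_comp (f := odds : streams -> streams)) => //; exact: measurable_odds.
Qed.

Lemma substreamS c w : substream c.+1 w = substream c (odds w).
Proof. by rewrite /substream iterSr. Qed.

Lemma coin_tossing_prod n (psi : nat -> streams -> R) :
  (forall c w, 0 <= psi c w) -> (forall c, measurable_fun setT (psi c)) ->
  (\int[mu]_w (\prod_(c < n) psi c (substream c w))%:E =
   \prod_(c < n) \int[mu]_w (psi c w)%:E)%E.
Proof.
elim: n psi => [|n IH] psi psi0 mpsi.
  rewrite big_ord0; under eq_integral do rewrite big_ord0.
  by rewrite integral_cst// mul1e; exact: probability_setT.
rewrite big_ord_recl -[X in (_ * X)%E](IH (fun c => psi c.+1))//.
rewrite -coin_tossing_integral_split//.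
- by apply: eq_integral => w _; rewrite big_ord_recl; congr ((_ * _)%:E);
    apply: eq_bigr => i _; rewrite substreamS.
- by move=> w; apply: prodr_ge0.
- apply: measurable_prod => i _; apply: measurableT_comp; [exact: mpsi|exact: measurable_substream].
Qed.

Section Sampling.
Variable p : nat -> R.
Hypothesis p0 : forall k, 0 <= p k.
Hypothesis p1 : series p @ \oo --> (1 : R).

(** The inverse distribution function of the weights. The default 0 is met only on a null event,
    where the uniform variable leaves [[0, 1[]. *)
Definition sample (w : streams) : nat :=
  xget 0%N [set k | series p k <= uniform R w < series p k.+1].

Let F_nd : nondecreasing_seq (series p).
Proof. by apply/nondecreasing_seqP => n; rewrite seriesSr lerDl. Qed.

Let F_le1 k : series p k <= 1.
Proof.
by have := nondecreasing_cvgn_le F_nd (cvgP _ p1) k; rewrite (cvg_lim _ p1).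
Qed.

Let F_ge0 k : 0 <= series p k.
Proof. by rewrite /series; apply: sumr_ge0. Qed.

Let F_inj x k l : series p k <= x < series p k.+1 -> series p l <= x < series p l.+1 -> k = l.
Proof.
move=> /andP[a b] /andP[c e]; case: (ltngtP k l) => // h.
  by have := le_lt_trans (le_trans (F_nd h) c) b; rewrite ltxx.
by have := le_lt_trans (le_trans (F_nd h) a) e; rewrite ltxx.
Qed.

Let F_ex x : 0 <= x < 1 -> exists k, series p k <= x < series p k.+1.
Proof.
move=> /andP[x0 x1].
have [n hn] : exists n, x < series p n.
  have /filter_ex[n hn] : \forall n \near \oo, x < series p n by exact: (cvgr_gt _ p1).
  by exists n.
case: (ex_minnP (P := fun n => x < series p n)) => [|[|m] hm mini]; first by exists n.
  by move: hm; rewrite [series p 0%N]big_geq// ltNge x0.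
exists m; rewrite hm andbT leNgt; apply/negP => /mini; by rewrite ltnn.
Qed.

Let mI (a b : R) : measurable [set w : streams | a <= uniform R w < b].
Proof.
have := @measurable_uniform R measurableT `[a, b[%classic (measurable_itv _); rewrite setTI.
by congr (measurable _); apply/seteqP; split => w; rewrite /= in_itv.
Qed.

Lemma sample_uniform w k : 0 <= uniform R w < 1 ->
  sample w = k <-> series p k <= uniform R w < series p k.+1.
Proof.
move=> u01; rewrite /sample; case: xgetP => [l _ hl|no].
  by split=> [<-//|/(F_inj hl)].
by have [l hl] := F_ex u01; have := no l hl.
Qed.

Lemma measurable_sample k : measurable [set w : streams | sample w = k].
Proof.
rewrite (_ : mkset _ = [set w | series p k <= uniform R w < series p k.+1] `|`
   (~` (\bigcup_l [set w | series p l <= uniform R w < series p l.+1]) `&` [set w | k = 0%N])).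
  apply: measurableU => //; apply: measurableI; first by apply: measurableC; apply: bigcupT_measurable => l.
  case: k => [|k]; first by rewrite (_ : mkset _ = setT)//; apply/seteqP; split.
  by rewrite (_ : mkset _ = set0)//; apply/seteqP; split.
apply/seteqP; split => w /=.
  rewrite /sample; case: xgetP => [l _ hl <-|no <-]; first by left.
  by right; split => // -[l _ /no].
case=> [h|[h ->]]; rewrite /sample; case: xgetP => [l _ hl|no].
- exact: F_inj hl h.
- by have := no k h.
- by case: h; exists l.
- by [].
Qed.

Lemma sample_law k : mu [set w | sample w = k] = (p k)%:E.
Proof.
have e : `[series p k, series p k.+1[ `<=` (`[0, 1[ : set R).
  move=> x /=; rewrite !in_itv/= => /andP[a b]; apply/andP; split.
    exact: le_trans (F_ge0 k) a.
  exact: lt_le_trans b (F_le1 _).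
transitivity (mu (uniform R @^-1` `[series p k, series p k.+1[)).
  have muU : mu (~` [set w : streams | 0 <= uniform R w < 1]) = 0%E.
    have -> : (~` [set w : streams | 0 <= uniform R w < 1]) = uniform R @^-1` (~` `[0, 1[).
      by apply/seteqP; split => w /=; rewrite in_itv.
    rewrite uniform_law; last exact: measurableC.
    by rewrite setICl measure0.
  have h : {ae mu, forall w, 0 <= uniform R w < 1}.
    by exists (~` [set w : streams | 0 <= uniform R w < 1]); split => //; apply: measurableC.
  apply: measure_ae_eq.
  - exact: measurable_sample.
  - by have := @measurable_uniform R measurableT `[series p k, series p k.+1[%classic (measurable_itv _); rewrite setTI.
  - by apply: filterS h => w /(sample_uniform k) [a b]; rewrite /= in_itv/=; split.
rewrite uniform_law// setIidl// lebesgue_measure_itv/= lte_fin.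
rewrite seriesSr ltrDl lt_neqAle p0 andbT.
case: eqP => [<-//|_] /=; by rewrite -EFinB addrAC subrr add0r.
Qed.

End Sampling.
End IndependentStreams.

(** * Laplace transforms of counting variables *)

Section GeneratingFunctions.
Context (R : realType).

Lemma nneseries_cvg (u : nat -> R) (c : R) : (forall k, 0 <= u k) ->
  (\sum_(0 <= k <oo) (u k)%:E)%E = c%:E -> series u @ \oo --> c.
Proof.
move=> u0 uc.
have h : cvgn (fun n => (\sum_(0 <= k < n) (u k)%:E)%E).
  by apply: is_cvg_nneseries => n _ _; rewrite lee_fin.
have {}h : (\sum_(0 <= k < n) (u k)%:E)%E @[n --> \oo] --> c%:E by rewrite -uc; exact: h.
rewrite (_ : series u = fine \o (fun n => (\sum_(0 <= k < n) (u k)%:E)%E)); first exact: fine_cvg.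
by apply/funext => n; rewrite /= sumEFin.
Qed.

(* The first nonzero coefficient would dominate the series near the origin. *)
Lemma power_series_eq0 (a : nat -> R) : (forall k, `|a k| <= 1) ->
  (forall s, 0 < s < 1 -> series (fun k => s ^+ k * a k) @ \oo --> 0) ->
  forall k, a k = 0.
Proof.
move=> a1 sa; elim/ltn_ind => k IH; apply/eqP; rewrite -normr_eq0 eq_le normr_ge0 andbT.
have main s : 0 < s < 1 -> `|a k| <= s / (1 - s).
  move=> /[dup] s01 /andP[s0 s1].
  suff : s ^+ k * `|a k| <= s ^+ k * (s / (1 - s)) by rewrite ler_pM2l// exprn_gt0.
  apply/ler_addgt0Pr => e e0.
  have /cvgrPdist_lt/(_ _ e0) := sa _ s01; rewrite /=.
  move=> [n _ hn]; have := hn (maxn n k.+1) (leq_maxl _ _).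
  rewrite /= sub0r normrN /series /= (big_cat_nat (n := k.+1)) ?leq_maxr//= big_nat_recr//=.
  rewrite big1_seq ?add0r; last first.
    by move=> i /andP[_]; rewrite mem_index_iota => /andP[_ /IH ->]; rewrite mulr0.
  set u := \sum_(_ <= i < _) _ => h.
  have hu : `|u| <= s ^+ k * (s / (1 - s)).
    apply: (le_trans (ler_norm_sum _ _ _)).
    apply: (@le_trans _ _ (\sum_(k.+1 <= i < maxn n k.+1) s ^+ i)).
      apply: ler_sum => i _; rewrite normrM normrX (gtr0_norm s0).
      by rewrite ler_piMr// exprn_ge0// ltW.
    rewrite -{1}[k.+1]add0n big_addn.
    have := @geometric_le_lim R (maxn n k.+1 - k.+1) (s ^+ k.+1) s
      (exprn_ge0 _ (ltW s0)) s0.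
    rewrite gtr0_norm// => /(_ s1); rewrite exprSr mulrA; apply: le_trans.
    rewrite /series /= le_eqVlt; apply/orP; left; apply/eqP.
    by apply: eq_bigr => i _; rewrite /= -exprSr -exprD addnC.
  have := ler_normB (s ^+ k * a k + u) u; rewrite addrK normrM normrX (gtr0_norm s0).
  by move=> h'; lra.
apply/ler_addgt0Pr => e e0; rewrite add0r; have [e1|e1] := leP 1 e.
  exact: le_trans (a1 k) e1.
have := main (e / 2).
have : (e / 2) / (1 - e / 2) <= e.
  rewrite ler_pdivrMr; last lra.
  have : 0 < e * (1 - e) by rewrite mulr_gt0//; lra.
  by lra.
by move=> h1 h2; apply: le_trans h1; apply: h2; lra.
Qed.

(** The value at infinity is the limit of exp(-theta x): 0 for positive [theta] and 1 for [theta]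
    zero. The latter makes [laplace 0] constantly one, which is how marginals are extracted from a
    joint transform. *)
Definition laplace (theta : R) (x : \bar R) : R :=
  if x == +oo%E then (theta == 0)%:R else expR (- (theta * fine x)).

Lemma laplace_ge0 theta x : 0 <= laplace theta x.
Proof. by rewrite /laplace; case: ifPn => // _; rewrite expR_ge0. Qed.

Lemma laplace_le1 theta x : 0 <= theta -> (0 <= x)%E -> laplace theta x <= 1.
Proof.
move=> t0 x0; rewrite /laplace; case: ifPn => [_|_]; first by case: eqP.
by rewrite -expR0 ler_expR oppr_le0 mulr_ge0// fine_ge0.
Qed.

Lemma laplace_nat theta k : laplace theta k%:R%:E = expR (- theta) ^+ k.
Proof. by rewrite /laplace /= -mulNr mulrC -expRM_natl mulrC. Qed.

Lemma laplace0 x : laplace 0 x = 1.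
Proof. by rewrite /laplace eqxx mul0r oppr0 expR0; case: ifP. Qed.

Lemma measurable_laplace theta : measurable_fun setT (laplace theta).
Proof.
apply: measurable_fun_ifT.
- by apply: measurable_fun_eqe; [exact: measurable_id|exact: measurable_cst].
- exact: measurable_cst.
- apply: measurableT_comp => //; apply: measurableT_comp => //.
  by apply: measurable_funM => //; exact: fine_measurable.
Qed.

Context (disp : measure_display) (Omega : measurableType disp).
Variable P : probability Omega R.

Definition extended_nat (x : \bar R) := x = +oo%E \/ exists k : nat, x = k%:R%:E.

Section OneVariable.
Variables (X : Omega -> \bar R) (Y : Omega -> R).
Hypothesis mX : measurable_fun setT X.
Hypothesis XN : forall w, extended_nat (X w).
Hypothesis mY : measurable_fun setT Y.
Hypothesis Y01 : forall w, 0 <= Y w <= 1.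

Definition point_mass k := (\int[P]_w (\1_[set w | X w = k%:R%:E] w * Y w)%:E)%E.

Local Notation mass := point_mass.

Let mXk k : measurable [set w | X w = k%:R%:E].
Proof. by have := mX measurableT (emeasurable_set1 k%:R%:E); rewrite setTI. Qed.

Let m1Y k : measurable_fun setT (fun w => (\1_[set w | X w = k%:R%:E] w * Y w)%:E).
Proof. by apply/measurable_EFinP; apply: measurable_funM => //; exact: measurable_indic. Qed.

Let indic01 (A : set Omega) w : 0 <= (\1_A w : R) <= 1.
Proof. by rewrite indicE; case: (_ \in _); rewrite ?ler01 ?lexx. Qed.

Let bound1 (f : Omega -> R) : (forall w, 0 <= f w <= 1) -> measurable_fun setT f ->
  (0 <= \int[P]_w (f w)%:E <= 1)%E.
Proof.
move=> f01 mf; apply/andP; split.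
  by apply: integral_ge0 => w _; rewrite lee_fin; case/andP: (f01 w).
rewrite -(probability_setT P) -[leRHS]mul1e -integral_cst//.
apply: ge0_le_integral => //.
- by move=> w _; rewrite lee_fin; case/andP: (f01 w).
- exact/measurable_EFinP.
- by move=> w _; rewrite lee_fin; case/andP: (f01 w).
Qed.

Let mass01 k : (0 <= mass k <= 1)%E.
Proof.
apply: bound1; last by apply: measurable_funM => //; exact: measurable_indic.
move=> w; have /andP[a b] := indic01 [set w | X w = k%:R%:E] w.
by have /andP[c e] := Y01 w; rewrite mulr_ge0//= mulr_ile1.
Qed.

Let mass_fin k : mass k = (fine (mass k))%:E.
Proof.
have /andP[a b] := mass01 k; rewrite fineK// ge0_fin_numE//.
exact: le_lt_trans b (ltry _).
Qed.

Lemma expectation_extended_nat (F : \bar R -> R) :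
  (forall x, 0 <= F x) -> F +oo%E = 0 ->
  (\int[P]_w (F (X w) * Y w)%:E = \sum_(0 <= k <oo) (F k%:R%:E)%:E * mass k)%E.
Proof.
move=> F0 Foo.
have Y0 w : 0 <= Y w by case/andP: (Y01 w).
transitivity (\int[P]_w (\sum_(0 <= k <oo)
    (F k%:R%:E)%:E * (\1_[set w | X w = k%:R%:E] w * Y w)%:E))%E.
  apply: eq_integral => w _.
  have [Xw|[k Xw]] := XN w.
    rewrite Xw Foo mul0r eseries0// => k _ _.
    by rewrite indicE memNset ?mul0r ?mule0//= Xw.
  rewrite (nneseriesD1 (n := k))//; last first.
    by move=> j _; rewrite -EFinM lee_fin mulr_ge0// mulr_ge0// indicE.
  rewrite eseries0 ?adde0.
    by rewrite indicE mem_set//= mul1r Xw.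
  move=> j _ /= jk; rewrite indicE memNset ?mul0r ?mule0//= Xw => -[] /eqP.
  by rewrite eqr_nat eq_sym (negbTE jk).
rewrite integral_nneseries//.
- apply: eq_eseriesr => k _; rewrite ge0_integralZl//.
  + by move=> w _; rewrite lee_fin mulr_ge0// indicE.
  + by rewrite lee_fin.
- move=> k; apply: emeasurable_funM => //; exact: measurable_cst.
- by move=> k w _; rewrite -EFinM lee_fin mulr_ge0// mulr_ge0// indicE.
Qed.

(** With s = exp(-theta) the transform is a power series in s whose coefficients are the masses, the
    value infinity contributing nothing for positive [theta]. Uniqueness of the coefficients
    identifies them with [b]. *)
Lemma laplace_masses (b : nat -> R) (phi : R -> R) :
  (forall k, 0 <= b k <= 1) ->
  (forall s, 0 < s < 1 -> series (fun k => s ^+ k * b k) @ \oo --> phi s) ->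
  (forall theta : R, (0 < theta)%R ->
    \int[P]_w (laplace theta (X w) * Y w)%:E = (phi (expR (- theta)))%:E)%E ->
  forall k, mass k = (b k)%:E.
Proof.
move=> b01 sb lp k; rewrite mass_fin; congr EFin; apply/eqP; rewrite -subr_eq0; apply/eqP.
move: k; apply: power_series_eq0 => [k|s s01].
  have /andP[a c] := mass01 k; move: a c; rewrite mass_fin !lee_fin => a c.
  by have /andP[? ?] := b01 k; rewrite ler_norml; lra.
have [s0 s1] := andP s01; pose theta := - ln s.
have th0 : 0 < theta by rewrite oppr_gt0 ln_lt0.
have es : expR (- theta) = s by rewrite opprK lnK// posrE.
have c1 : series (fun k => s ^+ k * fine (mass k)) @ \oo --> phi s.
  apply: nneseries_cvg => [k|].
    have /andP[a _] := mass01 k; rewrite mulr_ge0 ?exprn_ge0 ?fine_ge0//; exact: ltW.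
  rewrite -[in RHS]es -lp// expectation_extended_nat; last 2 first.
  - by move=> x; exact: laplace_ge0.
  - by rewrite /laplace eqxx gt_eqF.
  by apply: eq_eseriesr => k _; rewrite laplace_nat es EFinM -mass_fin.
rewrite -(subrr (phi s)) (_ : series _ = series (fun k => s ^+ k * fine (mass k)) \- series (fun k => s ^+ k * b k)).
  exact: (cvgB c1 (sb _ s01)).
apply/funext => n; rewrite /series /= -[RHS]sumrB; apply: eq_bigr => k _.
by rewrite mulrBr.
Qed.

End OneVariable.

Lemma point_mass1 (X : Omega -> \bar R) k : measurable_fun setT X ->
  point_mass X (fun=> 1) k = P [set w | X w = k%:R%:E].
Proof.
move=> mX; rewrite /point_mass; under eq_integral do rewrite mulr1.
have mXk : measurable [set w | X w = k%:R%:E].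
  by have := mX measurableT _ (emeasurable_set1 k%:R%:E); rewrite setTI.
by rewrite integral_indic// setIT.
Qed.

Let one01 (w : Omega) : 0 <= (1 : R) <= 1. Proof. by rewrite ler01 lexx. Qed.

Lemma laplace_poisson (X : Omega -> \bar R) (a : R) : measurable_fun setT X ->
  (forall w, extended_nat (X w)) -> 0 <= a ->
  (forall theta : R, (0 < theta)%R ->
    \int[P]_w (laplace theta (X w))%:E = (expR (- (a * (1 - expR (- theta)))))%:E)%E ->
  forall k, P [set w | X w = k%:R%:E] = poisson_prob a 0 [set k].
Proof.
move=> mX XN a0 lp k; rewrite -point_mass1// poisson_prob_set1//.
apply: (laplace_masses mX XN (Y := fun=> 1) (measurable_cst _) one01
  (b := fun k => a ^+ k * k`!%:R^-1 * expR (- a)) (phi := fun s => expR (- (a * (1 - s))))).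
- move=> j; have b0 : 0 <= a ^+ j * j`!%:R^-1 * expR (- a).
    by rewrite mulr_ge0 ?expR_ge0// mulr_ge0 ?exprn_ge0// invr_ge0.
  by rewrite b0 /= -lee_fin -(poisson_prob_set1 j 0 a0) probability_le1.
- move=> s _.
  rewrite (_ : - (a * (1 - s)) = s * a - a); last by ring.
  rewrite expRD (_ : series _ = (fun n => series (exp_coeff (s * a)) n * expR (- a))).
    apply: cvgM; last exact: cvg_cst.
    exact: is_cvg_series_exp_coeff.
  apply/funext => n; rewrite /series /= mulr_suml; apply: eq_bigr => j _.
  by rewrite /exp_coeff /= exprMn !mulrA.
- by move=> theta t0; rewrite -lp//; apply: eq_integral => w _; rewrite mulr1.
Qed.

Lemma laplace_infinite (X : Omega -> \bar R) : measurable_fun setT X ->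
  (\int[P]_w (laplace 1 (X w))%:E = 0)%E -> {ae P, forall w, X w = +oo%E}.
Proof.
move=> mX X0.
have /(ae_eq_integral_abs P measurableT) : measurable_fun setT (fun w => (laplace 1 (X w))%:E).
  by apply/measurable_EFinP; apply: measurableT_comp => //; exact: measurable_laplace.
move=> [+ _]; case.
  rewrite -[RHS]X0; apply: eq_integral => w _.
  by rewrite gee0_abs// lee_fin laplace_ge0.
move=> N [mN N0 h]; exists N; split => // w /= Xw; apply: h => /= /(_ I) [].
by rewrite /laplace; case: eqP => // _ /eqP; rewrite gt_eqF// expR_gt0.
Qed.

Lemma expectation01_fin (f : Omega -> R) : (forall w, 0 <= f w <= 1) ->
  measurable_fun setT f -> (\int[P]_w (f w)%:E)%E \is a fin_num.
Proof.
move=> f01 mf; rewrite ge0_fin_numE; last first.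
  by apply: integral_ge0 => w _; rewrite lee_fin; case/andP: (f01 w).
apply: (@le_lt_trans _ _ 1%E); last exact: ltry.
rewrite -(probability_setT P) -[leRHS]mul1e -integral_cst//.
apply: ge0_le_integral => //.
- by move=> w _; rewrite lee_fin; case/andP: (f01 w).
- exact/measurable_EFinP.
- by move=> w _; rewrite lee_fin; case/andP: (f01 w).
Qed.

(** Comparison of coefficients settles the sets without the point at infinity; the others follow by
    complementation, all quantities being finite. *)
Lemma laplace_factorisation (X : Omega -> \bar R) (Y : Omega -> R) :
  measurable_fun setT X -> (forall w, extended_nat (X w)) ->
  measurable_fun setT Y -> (forall w, 0 <= Y w <= 1) ->
  (forall theta : R, (0 <= theta)%R -> (\int[P]_w (laplace theta (X w) * Y w)%:E =
    (\int[P]_w (laplace theta (X w))%:E) * \int[P]_w (Y w)%:E)%E) ->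
  forall A : set (\bar R), measurable A ->
  (\int[P]_w (\1_A (X w) * Y w)%:E = P (X @^-1` A) * \int[P]_w (Y w)%:E)%E.
Proof.
move=> mX XN mY Y01 lp.
have Yfin := expectation01_fin Y01 mY; set y := fine (\int[P]_w (Y w)%:E)%E.
have yE : (\int[P]_w (Y w)%:E)%E = y%:E by rewrite fineK.
have Y0 w : 0 <= Y w by case/andP: (Y01 w).
have y01 : 0 <= y <= 1.
  rewrite -!lee_fin -yE; apply/andP; split.
    by apply: integral_ge0 => w _; rewrite lee_fin.
  rewrite -(probability_setT P) -[leRHS]mul1e -integral_cst//.
  apply: ge0_le_integral => //.
  - by move=> w _; rewrite lee_fin.
  - exact/measurable_EFinP.
  - by move=> w _; rewrite lee_fin; case/andP: (Y01 w).
have pfin (A : set Omega) : measurable A -> P A = (fine (P A))%:E.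
  by move=> mA; rewrite fineK// fin_num_measure.
have mXA (A : set (\bar R)) : measurable A -> measurable (X @^-1` A).
  by move=> mA; rewrite -[X in measurable X]setTI; exact: mX.
have mXk k : measurable [set w | X w = k%:R%:E] by exact: (mXA _ (emeasurable_set1 k%:R%:E)).
have EF (F : \bar R -> R) : (forall x, 0 <= F x) -> F +oo%E = 0 ->
    (\int[P]_w (F (X w))%:E = \sum_(0 <= k <oo) (F k%:R%:E)%:E * P [set w | X w = k%:R%:E])%E.
  move=> F0 Foo; under eq_eseriesr do rewrite -point_mass1//.
  rewrite -(expectation_extended_nat mX XN (measurable_cst _) one01)//.
  by apply: eq_integral => w _; rewrite mulr1.
have lfin theta : 0 <= theta -> (\int[P]_w (laplace theta (X w))%:E)%E \is a fin_num.
  move=> t0; apply: expectation01_fin => [w|].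
    rewrite laplace_ge0 laplace_le1//.
    by case: (XN w) => [->|[k ->]]//; rewrite lee_fin.
  by apply: measurableT_comp => //; exact: measurable_laplace.
have mk k : point_mass X Y k = (P [set w | X w = k%:R%:E] * y%:E)%E.
  rewrite [in RHS]pfin// -EFinM.
  apply: (laplace_masses mX XN mY Y01 (b := fun k => fine (P [set w | X w = k%:R%:E]) * y)
    (phi := fun s => fine (\int[P]_w (laplace (- ln s) (X w))%:E)%E * y)).
  - move=> j; have p0 : 0 <= fine (P [set w | X w = j%:R%:E]) by exact: fine_ge0.
    have p1 : fine (P [set w | X w = j%:R%:E]) <= 1.
      by rewrite -lee_fin -pfin//; exact: probability_le1.
    have /andP[? ?] := y01; rewrite mulr_ge0//=; exact: mulr_ile1.
  - move=> s /andP[s0 s1].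
    rewrite (_ : series _ = (fun n => series (fun k => s ^+ k * fine (P [set w | X w = k%:R%:E])) n * y)); last first.
      apply/funext => n; rewrite /series /= mulr_suml; apply: eq_bigr => j _.
      by rewrite mulrA.
    apply: cvgM; last exact: cvg_cst.
    have th0 : 0 < - ln s by rewrite oppr_gt0 ln_lt0// s0.
    apply: nneseries_cvg => [j|]; first by rewrite mulr_ge0 ?fine_ge0// exprn_ge0// ltW.
    rewrite fineK; last by apply: lfin; exact: ltW.
    rewrite EF; last 2 first.
    + by move=> x; exact: laplace_ge0.
    + by rewrite /laplace eqxx gt_eqF.
    by apply: eq_eseriesr => j _; rewrite laplace_nat opprK lnK ?posrE// EFinM -pfin.
  - move=> theta t0; rewrite lp ?(ltW t0)// EFinM fineK.
      by rewrite expRK opprK -yE.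
    by rewrite expRK opprK; apply: lfin; exact: ltW.
have fac0 A : measurable A -> ~ A +oo%E ->
    (\int[P]_w (\1_A (X w) * Y w)%:E = P (X @^-1` A) * y%:E)%E.
  move=> mA Aoo; have A0 : \1_A (+oo%E : \bar R) = 0 :> R by rewrite indicE memNset.
  have A1 x : 0 <= (\1_A x : R) by rewrite indicE.
  rewrite (expectation_extended_nat mX XN mY Y01)//.
  have -> : P (X @^-1` A) = (\int[P]_w (\1_A (X w) : R)%:E)%E.
    by rewrite (_ : (fun w => _) = (fun w => (\1_(X @^-1` A) w)%:E)) ?integral_indic ?setIT//; exact: mXA.
  rewrite EF// muleC -nneseriesZl//; last by move=> k _; rewrite mule_ge0// lee_fin.
  by apply: eq_eseriesr => k _; rewrite mk muleA muleC.
move=> A mA; rewrite yE; have [Aoo|] := pselect (A +oo%E); last exact: fac0.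
have mB : measurable (~` A) by exact: measurableC.
have Boo : ~ (~` A) (+oo%E : \bar R) by move=> h; exact: h.
have mI B : measurable B -> measurable_fun setT (fun w => (\1_B (X w) * Y w)%:E).
  move=> mB'; apply/measurable_EFinP; apply: measurable_funM => //.
  by apply: (measurableT_comp (f := \1_B : \bar R -> R)) => //; exact: measurable_indic.
have I0 B w : (0 <= (\1_B (X w) * Y w)%:E)%E by rewrite lee_fin mulr_ge0// indicE.
have sumI : (\int[P]_w (\1_A (X w) * Y w)%:E + \int[P]_w (\1_(~` A) (X w) * Y w)%:E = y%:E)%E.
  rewrite -yE -ge0_integralD//; try exact: mI.
  apply: eq_integral => w _; rewrite -EFinD -mulrDl !indicE in_setC.
  by case: (_ \in _); rewrite ?addr0 ?add0r mul1r.
have sumP : (P (X @^-1` A) + P (X @^-1` (~` A)) = 1)%E.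
  have -> : X @^-1` (~` A) = ~` (X @^-1` A) by [].
  rewrite -[RHS](probability_setT P) -(setUv (X @^-1` A)).
  apply/esym/measureU.
  - exact: mXA.
  - by apply: measurableC; exact: mXA.
  - by rewrite setICr.
move: sumI sumP; rewrite (fac0 _ mB Boo) (pfin _ (mXA _ mA)) (pfin _ (mXA _ mB)).
have fi : (\int[P]_w (\1_A (X w) * Y w)%:E)%E \is a fin_num.
  apply: expectation01_fin => [w|]; last exact/measurable_EFinP/mI.
  have /andP[? ?] := Y01 w; rewrite indicE; case: (_ \in _); rewrite ?mul1r ?mul0r ?lexx ?ler01//; apply/andP.
rewrite -(fineK fi) -!EFinM -!EFinD => -[e1] [e2]; congr EFin.
have -> : fine (P (X @^-1` A)) = 1 - fine (P (X @^-1` (~` A))) by rewrite -e2 addrK.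
by rewrite mulrBl mul1r -[X in _ = X - _]e1 addrK.
Qed.

Lemma laplace_independent (N : nat) (X : 'I_N -> Omega -> \bar R) :
  (forall i, measurable_fun setT (X i)) -> (forall i w, extended_nat (X i w)) ->
  (forall theta : 'I_N -> R, (forall i, 0 <= theta i)%R ->
    \int[P]_w (\prod_(i < N) laplace (theta i) (X i w))%:E =
    \prod_(i < N) \int[P]_w (laplace (theta i) (X i w))%:E)%E ->
  mutually_independent P X.
Proof.
move=> mX XN lp A mA.
(* Coordinates below [j] already carry indicators and the others still carry transforms; the
   induction on [j] converts one coordinate at a time. *)
pose G j (theta : 'I_N -> R) (i : 'I_N) x := if (i < j)%N then \1_(A i) x else laplace (theta i) x.
have X0 i w : (0 <= X i w)%E by case: (XN i w) => [->|[k ->]] //; rewrite lee_fin.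
have G01 j theta (i : 'I_N) w : (forall i, 0 <= theta i) -> 0 <= G j theta i (X i w) <= 1.
  move=> th0; rewrite /G; case: ifP => _.
    by rewrite indicE; case: (_ \in _); rewrite ?ler01 ?lexx.
  by rewrite laplace_ge0 laplace_le1.
have mG j theta i : measurable_fun setT (fun w => G j theta i (X i w)).
  rewrite /G; case: (i < j)%N.
    by apply: (measurableT_comp (f := \1_(A i) : \bar R -> R)) => //; exact: measurable_indic.
  by apply: (measurableT_comp (f := laplace (theta i))) => //; exact: measurable_laplace.
have ind (i : 'I_N) : (\int[P]_w (\1_(A i) (X i w) : R)%:E = P (X i @^-1` A i))%E.
  have mXA : measurable (X i @^-1` A i) by rewrite -[X in measurable X]setTI; exact: mX.
  by rewrite (_ : (fun w => _) = (fun w => (\1_(X i @^-1` A i) w)%:E)) ?integral_indic ?setIT//.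
have claim j : (j <= N)%N -> forall theta, (forall i, 0 <= theta i) ->
    (\int[P]_w (\prod_(i < N) G j theta i (X i w))%:E =
     \prod_(i < N) \int[P]_w (G j theta i (X i w))%:E)%E.
  elim: j => [_|j IH jN] theta th0; first by rewrite /G /=; exact: lp.
  pose io := Ordinal jN.
  pose Y w := \prod_(i < N | i != io) G j theta i (X i w).
  have mY : measurable_fun setT Y.
    rewrite (_ : Y = fun w => \prod_(i < N) (if i != io then G j theta i (X i w) else 1)).
      apply: measurable_prod => i _; case: (i != io); [exact: mG|exact: measurable_cst].
    by apply/funext => w; rewrite /Y big_mkcond.
  have Y01 w : 0 <= Y w <= 1.
    rewrite prodr_ge0 /=; last by move=> i _; case/andP: (G01 j theta i w th0).
    by rewrite prodr_ile1// => i _; exact: G01.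
  pose upd x i := if i == io then x else theta i.
  have step x : 0 <= x -> (\int[P]_w (laplace x (X io w) * Y w)%:E =
      (\int[P]_w (laplace x (X io w))%:E) * \prod_(i < N | i != io) \int[P]_w (G j theta i (X i w))%:E)%E.
    move=> x0; have u0 i : 0 <= upd x i by rewrite /upd; case: eqP.
    have Gio y : G j (upd x) io y = laplace x y by rewrite /G ltnn /upd eqxx.
    have Gne i y : i != io -> G j (upd x) i y = G j theta i y by move=> ii; rewrite /G /upd (negbTE ii).
    transitivity (\int[P]_w (\prod_(i < N) G j (upd x) i (X i w))%:E)%E.
      apply: eq_integral => w _; rewrite (bigD1 io)//= Gio; congr ((_ * _)%:E).
      by apply: eq_bigr => i ii; rewrite Gne.
    have h := IH (ltnW jN) (upd x) u0; rewrite h.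
    apply: (etrans (bigD1 io isT)); congr (_ * _)%E.
      by apply: eq_integral => w _; rewrite Gio.
    by apply: eq_bigr => i ii; apply: eq_integral => w _; rewrite Gne.
  (* Setting the parameter of coordinate [io] to 0 turns its factor into 1 and leaves the
     expectation of the remaining product. *)
  have EY : (\int[P]_w (Y w)%:E = \prod_(i < N | i != io) \int[P]_w (G j theta i (X i w))%:E)%E.
    have := step 0 (lexx _); under eq_integral do rewrite laplace0 mul1r.
    move=> ->; under eq_integral do rewrite laplace0.
    have -> : (\int[P]__ 1 = 1)%E by rewrite integral_cst// mul1e; exact: probability_setT.
    by rewrite mul1e.
  have fac x : 0 <= x -> (\int[P]_w (laplace x (X io w) * Y w)%:E =
      (\int[P]_w (laplace x (X io w))%:E) * \int[P]_w (Y w)%:E)%E.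
    by move=> x0; rewrite EY step.
  have := laplace_factorisation (mX io) (XN io) mY Y01 fac (mA io).
  have jj i : i != io -> (i < j.+1)%N = (i < j)%N.
    by move=> ii; rewrite ltnS leq_eqVlt; case: eqP => // e; case/eqP: ii; apply/val_inj.
  have Gio y : G j.+1 theta io y = \1_(A io) y by rewrite /G ltnSn.
  have Gne i y : i != io -> G j.+1 theta i y = G j theta i y by move=> ii; rewrite /G jj.
  rewrite EY => h; transitivity (\int[P]_w (\1_(A io) (X io w) * Y w)%:E)%E.
    apply: eq_integral => w _; rewrite (bigD1 io)//= Gio; congr ((_ * _)%:E).
    by apply: eq_bigr => i ii; rewrite Gne.
  rewrite h; apply/esym/(etrans (bigD1 io isT)); congr (_ * _)%E.
    by rewrite -ind; apply: eq_integral => w _; rewrite Gio.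
  by apply: eq_bigr => i ii; apply: eq_integral => w _; rewrite Gne.
have := claim N (leqnn N) (fun=> 0) (fun=> lexx _).
under [RHS]eq_bigr do rewrite /G ltn_ord ind.
move=> <-; have mC : measurable (\bigcap_(i in [set: 'I_N]) X i @^-1` A i).
  apply: fin_bigcap_measurable => // i _.
  by rewrite -[X in measurable X]setTI; exact: mX.
rewrite -[in LHS](setIT (\bigcap_(i in _) _)) -integral_indic//.
apply: eq_integral => w _; congr EFin; rewrite indicE.
have [h|h] := pselect (forall i, A i (X i w)).
  rewrite mem_set; last by move=> i _; exact: h.
  by rewrite big1// => i _; rewrite /G ltn_ord indicE mem_set.
rewrite memNset; last by move=> h'; apply: h => i; exact: h'.
have /existsNP[i ni] := h.
by rewrite (bigD1 i)//= /G ltn_ord indicE memNset// mul0r.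
Qed.

End GeneratingFunctions.

(** * Construction of Poisson random measures *)

Lemma measurable_fun_countable d d' (S : measurableType d) (T : measurableType d')
    (N : S -> nat) (F : nat -> S -> T) :
  (forall k, measurable [set w | N w = k]) -> (forall k, measurable_fun setT (F k)) ->
  measurable_fun setT (fun w => F (N w) w).
Proof.
move=> mN mF _ B mB; rewrite setTI.
rewrite (_ : _ @^-1` _ = \bigcup_k ([set w | N w = k] `&` F k @^-1` B)).
  apply: bigcupT_measurable => k; apply: measurableI => //.
  by rewrite -[X in measurable X]setTI; exact: mF.
apply/seteqP; split => [w h|w [k _ [/= <-]]//].
by exists (N w).
Qed.

Section LaplaceLimit.
Context (R : realType).

Lemma laplace_cvg (theta : R) (u : nat -> R) (x : \bar R) : 0 <= theta ->
  (u n)%:E @[n --> \oo] --> x -> x != -oo%E ->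
  expR (- (theta * u n)) @[n --> \oo] --> laplace theta x.
Proof.
move=> t0; case: x => [r||] ux // _; rewrite /laplace/=.
  apply: continuous_cvg; first exact: continuous_expR.
  by apply: cvgN; apply: cvgM; [exact: cvg_cst|exact: (fine_cvg ux)].
have [->|tn] := eqVneq theta 0.
  rewrite (_ : (fun n => _) = cst 1); first exact: cvg_cst.
  by apply/funext => n; rewrite mul0r oppr0 expR0.
have tp : 0 < theta by rewrite lt_neqAle eq_sym tn.
apply/cvgrPdist_lt => e e0; move/cvgeyPgt : ux => /(_ (- ln e / theta)).
apply: filterS => n; rewrite lte_fin ltr_pdivrMr// => h.
rewrite sub0r normrN gtr0_norm ?expR_gt0//.
by rewrite -[ltRHS](lnK (x := e)) ?posrE// ltr_expR ltrNl mulrC.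
Qed.

Lemma cvg_nneseries (u : nat -> R) (c : R) : (forall k, 0 <= u k) ->
  series u @ \oo --> c -> (\sum_(0 <= k <oo) (u k)%:E)%E = c%:E.
Proof.
move=> u0 uc; apply: cvg_lim => //.
rewrite (_ : (fun n => _) = EFin \o series u).
  by apply: cvg_EFin; [exact: nearW|exact: uc].
by apply/funext => n; rewrite /= /series /= sumEFin.
Qed.

End LaplaceLimit.

Section PoissonConstruction.
Context (R : realType) (d : measure_display) (T : measurableType d).
Local Notation mu := (coin_tossing R).
Variable f : nat -> streams -> T.
Hypothesis mf : forall c, measurable_fun setT (f c).

Definition poisson_weight (k : nat) : R := k`!%:R^-1 * expR (-1).

Let poisson_weight_ge0 k : 0 <= poisson_weight k.
Proof. by rewrite mulr_ge0 ?expR_ge0// invr_ge0. Qed.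

Let poisson_weight_series q : series (fun k => poisson_weight k * q ^+ k) @ \oo --> expR (q - 1).
Proof.
rewrite expRD (_ : series _ = (fun n => series (exp_coeff q) n * expR (- 1))).
  by apply: cvgM; [exact: is_cvg_series_exp_coeff|exact: cvg_cst].
apply/funext => n; rewrite /series /= mulr_suml; apply: eq_bigr => j _.
by rewrite /poisson_weight /exp_coeff /= mulrAC; congr (_ * _); rewrite mulrC.
Qed.

Let poisson_weight1 : series poisson_weight @ \oo --> (1 : R).
Proof.
have := @poisson_weight_series 1; rewrite subrr expR0.
by under eq_fun do rewrite expr1n mulr1.
Qed.

Definition cluster_size (w : streams) : nat := sample poisson_weight (evens w).

Definition cluster_point c i (w : streams) : T := f c (substream i (odds w)).

Definition cluster c (w : streams) : {measure set T -> \bar R} :=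
  msum (fun i => dirac (cluster_point c i w)) (cluster_size w).

(** Poisson(1) many independent points of a common law form a Poisson random measure with that law
    as intensity, and superposing independent clusters adds the intensities. Every countable sum of
    probability laws is reached in this way. *)
Definition clusters (w : streams) : {measure set T -> \bar R} :=
  mseries (fun c => cluster c (substream c w)) 0.

Definition cluster_law c : {measure set T -> \bar R} := pushm mu (mf c).

Definition clusters_mean : {measure set T -> \bar R} := mseries cluster_law 0.

Let msize k : measurable [set w | cluster_size w = k].
Proof.
have := measurable_evens measurableT (measurable_sample poisson_weight_ge0 k).
by rewrite setTI.
Qed.

Let mpoint c i : measurable_fun setT (cluster_point c i).
Proof.
apply: (measurableT_comp (f := f c)); first exact: mf.
by apply: (measurableT_comp (f := substream i)); [exact: measurable_substream|exact: measurable_odds].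
Qed.

Lemma clusterE c w E : cluster c w E =
  (\sum_(i < cluster_size w) \1_E (cluster_point c i w))%:E.
Proof.
rewrite [LHS]/= /msum -sumEFin; apply: eq_bigr => i _.
by rewrite /dirac indicE.
Qed.

Lemma measurable_cluster c E : measurable E -> measurable_fun setT (fun w => cluster c w E).
Proof.
move=> mE.
rewrite (_ : (fun w : streams => _) = EFin \o (fun w => \sum_(i < cluster_size w) \1_E (cluster_point c i w))); last first.
  by apply/funext => w; rewrite clusterE.
apply/measurable_EFinP.
apply: (@measurable_fun_countable _ _ _ _ cluster_size (fun k w => \sum_(i < k) (\1_E (cluster_point c i w) : R))) => // k.
apply: measurable_sum => i; apply: (measurableT_comp (f := \1_E : T -> R)) => //.
Qed.

Lemma measurable_clusters E : measurable E -> measurable_fun setT (fun w => clusters w E).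
Proof.
move=> mE; rewrite (_ : (fun w : streams => _) = (fun w => (\sum_(0 <= c <oo) cluster c (substream c w) E)%E)) //.
apply: ge0_emeasurable_sum => [c w _ _|c _]; first exact: measure_ge0.
by apply: (measurableT_comp (f := fun w => cluster c w E)); [exact: measurable_cluster|exact: measurable_substream].
Qed.

Lemma cluster_nat c w E : exists k : nat, cluster c w E = k%:R%:E.
Proof.
exists (\sum_(i < cluster_size w) (cluster_point c i w \in E))%N.
by rewrite clusterE natr_sum; congr EFin; apply: eq_bigr => i _; rewrite indicE.
Qed.

(** The partial sums are nondecreasing integers, so they either stabilize or diverge. *)
Lemma clusters_extended_nat w E : extended_nat (clusters w E).
Proof.
have /choice[n hn] : forall c, exists k : nat, cluster c (substream c w) E = k%:R%:E.
  by move=> c; exact: cluster_nat.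
pose S m := (\sum_(0 <= c < m) n c)%N.
have Snd k l : (k <= l)%N -> (S k <= S l)%N.
  by move=> kl; rewrite /S [leqRHS](big_cat_nat (n := k))//= leq_addr.
have lim : (S m)%:R%:E @[m --> \oo] --> clusters w E.
  have h : cvgn (fun m => (\sum_(0 <= c < m) cluster c (substream c w) E)%E).
    by apply: is_cvg_nneseries => ? _ _; exact: measure_ge0.
  rewrite (_ : (fun m => _) = (fun m => (\sum_(0 <= c < m) cluster c (substream c w) E)%E)).
    exact: h.
  apply/funext => m; rewrite /S natr_sum -sumEFin; apply: eq_bigr => c _.
  by rewrite hn.
have [[K SK]|noK] := pselect (exists K, forall m, (S m <= K)%N).
  right; have exS : exists i, (fun i => `[< exists m, S m = i >]) i by exists (S 0%N); apply/asboolP; exists 0%N.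
  have bS i : `[< exists m, S m = i >] -> (i <= K)%N by move=> /asboolP[m <-].
  case: (ex_maxnP exS bS) => M /asboolP[m Sm] Mmax; exists M.
  apply: (cvg_unique _ lim) => //; apply: cvg_near_cst; exists m => // l /= ml.
  congr (_%:R%:E); apply/eqP; rewrite eqn_leq Mmax/=; last by apply/asboolP; exists l.
  by rewrite -Sm; exact: Snd.
left; apply: (cvg_unique _ lim) => //; apply/cvgeyPge => A.
have [k Ak] : exists k : nat, A <= k%:R.
  by exists (Num.bound `|A|); rewrite (le_trans (ler_norm A))// ltW// archi_boundP.
have [m /negP] : exists m, ~ (S m <= k)%N.
  by apply: contrapT => h; apply: noK; exists k => m; apply: contrapT => hm; apply: h; exists m.
rewrite -ltnNge => km; exists m => // l /= ml; rewrite lee_fin (le_trans Ak)// ler_nat.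
exact: leq_trans (ltnW km) (Snd _ _ ml).
Qed.

(* Conditioning on the Poisson number of points. *)
Lemma cluster_expectation c (phi : T -> R) (q : R) :
  (forall x, 0 <= phi x) -> measurable_fun setT phi ->
  (\int[mu]_w (phi (f c w))%:E = q%:E)%E ->
  (\int[mu]_w (\prod_(i < cluster_size w) phi (cluster_point c i w))%:E =
   (expR (q - 1))%:E)%E.
Proof.
move=> phi0 mphi phiq.
pose psi k (w : streams) := \prod_(i < k) phi (f c (substream i w)).
have psi0 k w : 0 <= psi k w by apply: prodr_ge0.
have mpsi k : measurable_fun setT (psi k).
  apply: measurable_prod => i _; apply: (measurableT_comp (f := phi)) => //.
  by apply: (measurableT_comp (f := f c)); [exact: mf|exact: measurable_substream].
have psiq k : (\int[mu]_w (psi k w)%:E = (q ^+ k)%:E)%E.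
  rewrite /psi (@coin_tossing_prod _ _ (fun=> phi \o f c)).
  - by under eq_bigr do rewrite phiq; rewrite prodEFin prodr_const card_ord.
  - by move=> ? ?; exact: phi0.
  - by move=> _; apply: (measurableT_comp (f := phi)) => //; exact: mf.
pose S k := [set w : streams | sample poisson_weight w = k].
have mS k : measurable (S k) := measurable_sample poisson_weight_ge0 k.
transitivity (\int[mu]_w \sum_(0 <= k <oo) (\1_(S k) (evens w) * psi k (odds w))%:E)%E.
  apply: eq_integral => w _; rewrite (nneseriesD1 (n := cluster_size w))//; last first.
    by move=> k _; rewrite lee_fin mulr_ge0// indicE.
  rewrite eseries0 ?adde0.
    by rewrite indicE mem_set// mul1r.
  move=> k _ /= ks; rewrite indicE memNset ?mul0r// /S/= => e.
  by rewrite /cluster_size e eqxx in ks.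
rewrite integral_nneseries//; last 2 first.
- move=> k; apply/measurable_EFinP; apply: measurable_funM.
    apply: (measurableT_comp (f := \1_(S k) : streams -> R)); last exact: measurable_evens.
    exact: measurable_indic.
  by apply: (measurableT_comp (f := psi k)) => //; exact: measurable_odds.
- by move=> k w _; rewrite lee_fin mulr_ge0// indicE.
rewrite -(cvg_nneseries _ (@poisson_weight_series q)); last first.
  move=> k; rewrite mulr_ge0// exprn_ge0//.
  rewrite -lee_fin -phiq; apply: integral_ge0 => w _; by rewrite lee_fin.
apply: eq_eseriesr => k _.
rewrite (@coin_tossing_integral_split _ (\1_(S k)) (psi k))//.
rewrite psiq integral_indic// setIT EFinM; congr (_ * _)%E.
exact: sample_law poisson_weight_ge0 poisson_weight1 k.
Qed.

(** The exponential of minus the weighted counts is a product of [phi] over the points and, the sets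
    being disjoint, [phi] is affine in their indicators with slopes [th']. Each cluster then
    contributes the exponential of a finite sum, and the partial superpositions converge under the
    bound 1 even if the intensity is infinite. *)
Lemma clusters_laplace (N : nat) (E : 'I_N -> set T) (theta : 'I_N -> R) :
  (forall i, measurable (E i)) -> trivIset [set: 'I_N] E ->
  (forall i, 0 <= theta i) ->
  (\int[mu]_w (\prod_(i < N) laplace (theta i) (clusters w (E i)))%:E =
   (\prod_(i < N) laplace (1 - expR (- theta i)) (clusters_mean (E i)))%:E)%E.
Proof.
move=> mE tE th0.
pose th' i := 1 - expR (- theta i).
have th'0 i : 0 <= th' i by rewrite subr_ge0 -expR0 ler_expR oppr_le0.
pose phi (x : T) := expR (- \sum_(i < N) theta i * \1_(E i) x).
have phi0 x : 0 <= phi x by exact: expR_ge0.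
have m1 i : measurable_fun setT (\1_(E i) : T -> R) by exact: measurable_indic.
have mphi : measurable_fun setT phi.
  apply: measurableT_comp => //; apply: measurableT_comp => //.
  by apply: measurable_sum => i; apply: measurable_funM.
have phiE x : phi x = 1 - \sum_(i < N) th' i * \1_(E i) x.
  have [[i Ex]|no] := pselect (exists i, E i x); last first.
    by rewrite /phi !big1 ?oppr0 ?expR0 ?addr0// => i _;
      rewrite indicE memNset ?mulr0// => Ex; apply: no; exists i.
  have Ej j : j != i -> \1_(E j) x = 0 :> R.
    move=> ji; rewrite indicE memNset// => Ejx; case/eqP: ji.
    by apply: (tE j i) => //; exists x.
  have Esum (g : 'I_N -> R) : \sum_(j < N) g j * \1_(E j) x = g i.
    apply: (etrans (bigD1 i isT)); rewrite /= big1 ?addr0; last by move=> j /Ej ->; rewrite mulr0.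
    by rewrite indicE mem_set// mulr1.
  by rewrite /phi !Esum /th' opprB addrCA subrr addr0.
pose ml c i := fine (cluster_law c (E i)).
have mfE c i : measurable (f c @^-1` E i).
  by rewrite -[X in measurable X]setTI; exact: mf.
have law_le1 c i : (cluster_law c (E i) <= 1)%E.
  by rewrite /cluster_law pushmE; exact: (probability_le1 mu (mfE c i)).
have mlE c i : cluster_law c (E i) = (ml c i)%:E.
  by rewrite fineK// ge0_fin_numE// (le_lt_trans (law_le1 c i))// ltry.
have Elaw c i : (\int[mu]_w (\1_(E i) (f c w))%:E = (ml c i)%:E)%E.
  rewrite -mlE (_ : (fun w : streams => _) = (fun w => (\1_(f c @^-1` E i) w)%:E))//.
  by rewrite integral_indic// setIT.
have mphif c : measurable_fun setT (fun w => phi (f c w)).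
  by apply: (measurableT_comp (f := phi)).
have m1f c i : measurable_fun setT (fun w => \1_(E i) (f c w) : R).
  by apply: (measurableT_comp (f := \1_(E i) : T -> R)).
have phif_fin c : (\int[mu]_w (phi (f c w))%:E)%E \is a fin_num.
  apply: expectation01_fin => // w; rewrite phi0 /phi -expR0 ler_expR oppr_le0.
  by apply: sumr_ge0 => i _; rewrite mulr_ge0// indicE.
have Ephi c : (\int[mu]_w (phi (f c w))%:E = (1 - \sum_(i < N) th' i * ml c i)%:E)%E.
  have : (\int[mu]_w (phi (f c w))%:E + (\sum_(i < N) th' i * ml c i)%:E = 1)%E.
    have -> : ((\sum_(i < N) th' i * ml c i)%:E = \int[mu]_w \sum_(i < N) (th' i * \1_(E i) (f c w))%:E)%E.
      rewrite ge0_integral_sum//; last 2 first.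
      - by move=> i; apply/measurable_EFinP; exact: measurable_funM.
      - by move=> i w _; rewrite lee_fin mulr_ge0// indicE.
      rewrite -sumEFin; apply: eq_bigr => i _; under eq_integral do rewrite EFinM.
      rewrite ge0_integralZl// ?Elaw ?EFinM// ?lee_fin//.
      exact/measurable_EFinP.
    rewrite -ge0_integralD//; last 4 first.
    - by move=> w _; rewrite lee_fin.
    - exact/measurable_EFinP.
    - by move=> w _; apply: sume_ge0 => i _; rewrite lee_fin mulr_ge0// indicE.
    - by apply: emeasurable_sum => i; apply/measurable_EFinP; exact: measurable_funM.
    transitivity (\int[mu]_w cst 1 w)%E.
      by apply: eq_integral => w _; rewrite sumEFin -EFinD phiE subrK.
    by rewrite integral_cst// mul1e; exact: probability_setT.
  rewrite -(fineK (phif_fin c)) -EFinD => -[e].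
  by congr EFin; rewrite -e addrK.
pose Psi c w := \prod_(i < cluster_size w) phi (cluster_point c i w).
have EPsi c : (\int[mu]_w (Psi c w)%:E = (expR (- \sum_(i < N) th' i * ml c i))%:E)%E.
  rewrite /Psi (cluster_expectation phi0 mphi (Ephi c)); congr (expR _)%:E.
  by rewrite addrAC subrr add0r.
have Psi0 c w : 0 <= Psi c w by apply: prodr_ge0.
have mPsi c : measurable_fun setT (Psi c).
  apply: (measurable_fun_countable (F := fun k w => \prod_(i < k) phi (cluster_point c i w))) => // k.
  by apply: measurable_prod => i _; apply: (measurableT_comp (f := phi)).
pose S n i w := \sum_(0 <= c < n) fine (cluster c (substream c w) (E i)).
have PsiS n w : \prod_(c < n) Psi c (substream c w) =
    \prod_(i < N) expR (- (theta i * S n i w)).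
  rewrite -expR_sum /Psi /phi; under eq_bigr do rewrite -expR_sum.
  rewrite -expR_sum; congr expR.
  under eq_bigr do rewrite sumrN.
  rewrite !sumrN; congr (- _).
  under [RHS]eq_bigr do rewrite /S mulr_sumr big_mkord.
  rewrite [RHS]exchange_big/=; apply: eq_bigr => c _.
  rewrite exchange_big/=; apply: eq_bigr => i _.
  by rewrite clusterE /= mulr_sumr.
have En n : (\int[mu]_w (\prod_(i < N) expR (- (theta i * S n i w)))%:E =
    (\prod_(i < N) expR (- (th' i * \sum_(0 <= c < n) ml c i)))%:E)%E.
  under eq_integral do rewrite -PsiS.
  rewrite coin_tossing_prod//; under eq_bigr do rewrite EPsi.
  rewrite prodEFin; congr EFin; rewrite -!expR_sum; congr expR.
  rewrite !sumrN; congr (- _).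
  under [RHS]eq_bigr do rewrite mulr_sumr big_mkord.
  by rewrite [RHS]exchange_big.
have Sge0 n i w : 0 <= S n i w by apply: sumr_ge0 => c _; exact: fine_ge0.
have cfin c w i : cluster c w (E i) \is a fin_num.
  by have [k ->] := cluster_nat c w (E i).
have Slim i w : (S n i w)%:E @[n --> \oo] --> clusters w (E i).
  have h : cvgn (fun m => (\sum_(0 <= c < m) cluster c (substream c w) (E i))%E).
    by apply: is_cvg_nneseries => ? _ _; exact: measure_ge0.
  rewrite (_ : (fun m => _) = (fun m => (\sum_(0 <= c < m) cluster c (substream c w) (E i))%E)).
    exact: h.
  apply/funext => m; rewrite /S -sumEFin; apply: eq_bigr => c _.
  by rewrite fineK.
have cvgprod (u : 'I_N -> nat -> R) (l : 'I_N -> R) :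
    (forall i, u i @ \oo --> l i) -> \prod_(i < N) u i n @[n --> \oo] --> \prod_(i < N) l i.
  move=> ul; apply: cvg_big => // -[x y]; exact: mul_continuous.
have lhs : (\int[mu]_w (\prod_(i < N) expR (- (theta i * S n i w)))%:E)%E @[n --> \oo] -->
    (\int[mu]_w (\prod_(i < N) laplace (theta i) (clusters w (E i)))%:E)%E.
  apply: (dominated_cvg measurableT (g := cst 1%E)).
  - move=> n; apply/measurable_EFinP; apply: measurable_prod => i _.
    apply: measurableT_comp => //; apply: measurableT_comp => //; apply: measurable_funM => //.
    apply: measurable_sum => c; apply: (measurableT_comp (f := fine)); first exact: fine_measurable.
    by apply: (measurableT_comp (f := fun w => cluster c w (E i))); [exact: measurable_cluster|exact: measurable_substream].
  - move=> w _; apply: cvg_EFin; first exact: nearW.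
    apply: cvgprod => i; apply: laplace_cvg => //.
    by rewrite gt_eqF// (lt_le_trans ltNy0)// measure_ge0.
  - by [].
  - exact: finite_measure_integrable_cst.
  - move=> n w _; rewrite /= lee_fin ger0_norm; last by apply: prodr_ge0 => i _; exact: expR_ge0.
    apply: prodr_ile1 => i _; rewrite expR_ge0 -expR0 ler_expR oppr_le0.
    exact: mulr_ge0.
have rhs : (\int[mu]_w (\prod_(i < N) expR (- (theta i * S n i w)))%:E)%E @[n --> \oo] -->
    (\prod_(i < N) laplace (1 - expR (- theta i)) (clusters_mean (E i)))%:E%E.
  rewrite (_ : (fun n => _) = EFin \o (fun n => \prod_(i < N) expR (- (th' i * \sum_(0 <= c < n) ml c i)))).
    apply: cvg_EFin; first exact: nearW.
    apply: cvgprod => i; apply: laplace_cvg => //.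
      have h : cvgn (fun m => (\sum_(0 <= c < m) cluster_law c (E i))%E).
        by apply: is_cvg_nneseries => ? _ _; exact: measure_ge0.
      rewrite (_ : (fun m => _) = (fun m => (\sum_(0 <= c < m) cluster_law c (E i))%E)).
        exact: h.
      by apply/funext => m; rewrite -sumEFin; apply: eq_bigr => c _; rewrite mlE.
    by rewrite gt_eqF// (lt_le_trans ltNy0)// measure_ge0.
  by apply/funext => n; rewrite /= En.
exact: cvg_unique lhs rhs.
Qed.

Lemma clusters_poisson_random_measure (lam : set T -> \bar R) :
  (forall E, measurable E -> lam E = clusters_mean E) ->
  is_poisson_random_measure mu lam clusters.
Proof.
move=> lamE.
have nd1 (E : set T) : trivIset [set: 'I_1] (fun=> E).
  by move=> i j _ _ _; rewrite !ord1.
have lap1 E theta : measurable E -> 0 <= theta ->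
    (\int[mu]_w (laplace theta (clusters w E))%:E =
     (laplace (1 - expR (- theta)) (lam E))%:E)%E.
  move=> mE t0; have := @clusters_laplace 1 (fun=> E) (fun=> theta) (fun=> mE) (nd1 E) (fun=> t0).
  rewrite big_ord1 lamE// => <-; apply: eq_integral => w _; by rewrite big_ord1.
split.
- exact: measurable_clusters.
- move=> E mE lamfin k; have l0 : (0 <= lam E)%E by rewrite lamE.
  apply: laplace_poisson.
  + exact: measurable_clusters.
  + by move=> w; exact: clusters_extended_nat.
  + exact: fine_ge0.
  + move=> theta t0; rewrite lap1 ?(ltW t0)//; congr EFin.
    rewrite /laplace lt_eqF// mulrC; congr (expR (- (_ * _))).
- move=> E mE lamoo; apply: laplace_infinite; first exact: measurable_clusters.
  rewrite lap1// lamoo /laplace eqxx subr_eq0 gt_eqF// expR_lt1; lra.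
- move=> N E mE tE; apply: laplace_independent.
  + by move=> i; exact: measurable_clusters.
  + by move=> i w; exact: clusters_extended_nat.
  + move=> theta t0; rewrite clusters_laplace// -prodEFin; apply: eq_bigr => i _.
    by rewrite lap1// lamE.
Qed.

End PoissonConstruction.

Lemma restm_poisson_random_measure (R : realType) (disp : measure_display)
    (Omega : measurableType disp) (P : probability Omega R) (d : measure_display)
    (T : measurableType d) (lam lam' : set T -> \bar R) (nu : Omega -> {measure set T -> \bar R})
    (F : set T) (mF : measurable F) :
  (forall E, measurable E -> lam' E = lam (E `&` F)) ->
  is_poisson_random_measure P lam nu ->
  is_poisson_random_measure P lam' (fun w => restm (nu w) mF).
Proof.
move=> lamE [nu1 nu2 nu3 nu4]; split.
- by move=> E mE; apply: nu1; exact: measurableI.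
- by move=> E mE; rewrite lamE// => h k; apply: nu2 => //; exact: measurableI.
- by move=> E mE; rewrite lamE// => h; apply: nu3 => //; exact: measurableI.
- move=> N E mE tE; apply: (nu4 N (fun i => E i `&` F)).
    by move=> i; exact: measurableI.
  by move=> i j _ _ [x [[Ei _] [Ej _]]]; apply: tE => //; exists x.
Qed.

Lemma pushm_poisson_random_measure (R : realType) (disp : measure_display)
    (Omega : measurableType disp) (P : probability Omega R) (d d' : measure_display)
    (T : measurableType d) (T' : measurableType d')
    (lam : set T -> \bar R) (lam' : set T' -> \bar R) (nu : Omega -> {measure set T -> \bar R})
    (g : T -> T') (mg : measurable_fun setT g) :
  (forall E, measurable E -> lam' E = lam (g @^-1` E)) ->
  is_poisson_random_measure P lam nu ->
  is_poisson_random_measure P lam' (fun w => pushm (nu w) mg).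
Proof.
move=> lamE [nu1 nu2 nu3 nu4].
have mp E : measurable E -> measurable (g @^-1` E).
  by move=> mE; rewrite -[X in measurable X]setTI; exact: mg.
split.
- by move=> E mE; apply: nu1; exact: mp.
- by move=> E mE; rewrite lamE// => h k; apply: nu2 => //; exact: mp.
- by move=> E mE; rewrite lamE// => h; apply: nu3 => //; exact: mp.
- move=> N E mE tE; apply: (nu4 N (fun i => g @^-1` E i)).
    by move=> i; exact: mp.
  by move=> i j _ _ [x [Ei Ej]]; apply: tE => //; exists (g x).
Qed.

Lemma pairing_exists : exists e : nat -> nat * nat, set_bij setT setT e.
Proof.
have /ppcard_eqP[e] : ([set: nat] #= [set: nat * nat])%card by rewrite card_eq_sym; exact: card_nat2.
by exists e; exact: bij.
Qed.

Definition pairing : nat -> nat * nat := projT1 (cid pairing_exists).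

Lemma nneseries_pairing (R : realType) (a : nat -> nat -> \bar R) :
  (forall i j, (0 <= a i j)%E) ->
  (\sum_(0 <= c <oo) a (pairing c).1 (pairing c).2 =
   \sum_(0 <= j <oo) \sum_(0 <= i <oo) a i j)%E.
Proof.
move=> a0; rewrite nneseries_interchange//.
rewrite nneseries_esumT// nneseries_esumT//; last first.
  by move=> i; apply: nneseries_ge0 => j _ _.
under [RHS]eq_esum do rewrite nneseries_esumT//.
rewrite esum_esum//.
rewrite (reindex_esum setT _ pairing)//.
have := projT2 (cid pairing_exists); congr (set_bij _ _ _).
by apply/seteqP; split.
Qed.

Section Marks.
Context (R : realType).
Local Notation mu := (coin_tossing R).
Local Notation leb := (@lebesgue_measure R).

Lemma lebesgue_translation (a : R) (B : set R) : measurable B ->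
  leb [set x | B (a + x)] = leb B.
Proof.
move=> mB.
have ma : measurable_fun (setT : set R) ((fun x => a + x) : R -> measurableTypeR R) by exact: measurable_funD.
apply/esym; have := @lebesgue_measure_unique R (pushm leb ma) _ B mB.
apply => _ [[x y] _ <-].
rewrite pushmE (_ : _ @^-1` _ = `]x - a, y - a]%classic).
  rewrite [LHS]lebesgue_measure_itv [RHS]lebesgue_measure_itv/= !lte_fin ltrBlDr subrK.
  case: ifP => // _; rewrite -!EFinB; congr EFin; ring.
by apply/seteqP; split => z; rewrite /= !in_itv/= ltrBlDl lerBrDl.
Qed.

(** The index [c] codes a pair (i, n): the point has label n and a uniform time in the unit interval
    starting at i. Over all [c] this produces, for every label, Lebesgue measure on the
    half-line. *)
Definition mark_point (c : nat) (w : streams) : R * nat :=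
  ((pairing c).1%:R + uniform R w, (pairing c).2).

Lemma measurable_mark_point c : measurable_fun setT (mark_point c).
Proof.
apply: measurable_fun_pair; last exact: measurable_cst.
by apply: measurable_funD => //; exact: measurable_uniform.
Qed.

Definition marks (w : streams) : {measure set (R * nat) -> \bar R} := clusters R mark_point w.

Definition marks_mean (G : set (R * nat)) : \bar R :=
  (\sum_(0 <= n <oo) leb [set s | (0 <= s)%R /\ G (s, n)])%E.

Lemma marks_meanE G : measurable G ->
  marks_mean G = clusters_mean R measurable_mark_point G.
Proof.
move=> mG; rewrite /clusters_mean [RHS]/= /mseries.
pose a i j := leb (([set s | G (s, j)] : set R) `&` `[i%:R, i.+1%:R[).
have msec n : measurable [set s : R | G (s, n)].
  by have := measurable_ysection n mG; congr measurable; apply/seteqP; split => s;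
    rewrite /ysection /= inE.
transitivity (\sum_(0 <= c <oo) a (pairing c).1 (pairing c).2)%E; last first.
  apply: eq_eseriesr => c _; rewrite /cluster_law pushmE /a.
  rewrite -(@lebesgue_translation (pairing c).1%:R); last exact: measurableI.
  have -> : mark_point c @^-1` G = uniform R @^-1` [set x | G ((pairing c).1%:R + x, (pairing c).2)].
    by apply/seteqP; split.
  apply/esym; apply: etrans (uniform_law _) _.
    have mt : measurable_fun (setT : set R) (fun x : R => (pairing c).1%:R + x) by exact: measurable_funD.
    by have := mt measurableT _ (msec (pairing c).2); rewrite setTI.
    apply/esym; congr (leb _); apply/seteqP; split => x /=; rewrite !in_itv/=.
      by move=> [h1 /andP[h2 h3]]; split => //; move: h2 h3; rewrite lerDl -natr1 ltrD2l => -> ->.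
    by move=> [h1 /andP[h2 h3]]; split => //; rewrite lerDl h2 -natr1 ltrD2l.
rewrite nneseries_pairing//; apply: eq_eseriesr => n _.
have <- : \bigcup_i (([set s | G (s, n)] : set R) `&` `[i%:R, i.+1%:R[) = [set s | 0 <= s /\ G (s, n)].
  apply/seteqP; split => s.
    by move=> [i _ [/= Gs]]; rewrite in_itv/= => /andP[h _]; split => //; exact: le_trans h.
  move=> [s0 Gs]; exists (Num.trunc s) => //; split => //=; rewrite in_itv/=.
  exact: truncn_itv.
rewrite measure_bigcup.
- by rewrite [LHS]eseries_mkcond; apply: eq_eseriesr => i _; rewrite in_setT.
- by move=> i _; apply: measurableI; [exact: msec|exact: measurable_itv].
move=> i j _ _ [s [[_ +] [_ +]]]; rewrite /= !in_itv/= => /andP[a1 a2] /andP[b1 b2].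
have := le_lt_trans a1 b2; have := le_lt_trans b1 a2; rewrite !ltr_nat !ltnS => h1 h2.
by apply/eqP; rewrite eqn_leq h1 h2.
Qed.

Lemma marks_prm : is_poisson_random_measure mu marks_mean marks.
Proof. exact: clusters_poisson_random_measure marks_meanE. Qed.

Lemma marks_mean_slice (B : set R) n : measurable B -> (forall s, B s -> 0 <= s) ->
  marks_mean (B `*` [set n]) = leb B.
Proof.
move=> mB B0; rewrite /marks_mean (nneseriesD1 (n := n))// eseries0 ?adde0.
  congr (leb _); apply/seteqP; split => s /=; first by move=> [_ []].
  by move=> Bs; split => //; exact: B0.
move=> k _ /= kn; rewrite (_ : mkset _ = set0) ?measure0//.
by apply/seteqP; split => s // [_ [_ /= e]]; rewrite e eqxx in kn.
Qed.

End Marks.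

(** * A Levy process with sparse jumps *)

Lemma marked_integral (R : realType) (m : {measure set (R * nat) -> \bar R})
    (B : set R) (c : nat -> R) : measurable B -> (forall n, 0 <= c n) ->
  (\int[m]_q (c q.2 * \1_B q.1)%:E = \sum_(0 <= n <oo) (c n)%:E * m (B `*` [set n]))%E.
Proof.
move=> mB c0.
have mc : measurable_fun (setT : set (R * nat)) (fun q => c q.2).
  by apply: (measurableT_comp (f := c)) => //; exact: measurable_snd.
have m1 : measurable_fun (setT : set (R * nat)) (fun q => \1_B q.1 : R).
  by apply: (measurableT_comp (f := \1_B : R -> R)).
have mh : measurable_fun (setT : set (R * nat)) (fun q => (c q.2 * \1_B q.1)%:E).
  by apply/measurable_EFinP; exact: measurable_funM.
have mS n : measurable ([set: R] `*` [set n] : set (R * nat)) by apply: measurableX.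
have -> : [set: R * nat] = \bigcup_n ([set: R] `*` [set n]).
  by apply/seteqP; split => // q _; exists q.2.
rewrite ge0_integral_bigcup//; last 3 first.
- exact: measurable_funS mh.
- by move=> q _; rewrite lee_fin mulr_ge0// indicE.
- by move=> i j _ _ [q [[_ /= <-] [_ /= <-]]].
apply: eq_eseriesr => n _.
transitivity (\int[m]_(q in [set: R] `*` [set n]) ((c n)%:E * (\1_(B `*` [set n]) q)%:E))%E.
  apply: eq_integral => q; rewrite inE => -[_ /= qn].
  rewrite qn EFinM; congr (_ * (_)%:E)%E; rewrite !indicE; congr (_%:R).
  have [Bq|Bq] := pselect (B q.1); first by rewrite !mem_set.
  by rewrite !memNset// => -[].
rewrite ge0_integralZl ?lee_fin//; last first.
  apply/measurable_EFinP; apply: measurable_funTS; apply: measurable_indic.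
  exact: measurableX.
rewrite integral_indic//; last exact: measurableX.
by congr (_ * m _)%E; apply/seteqP; split => [q []//|q [h1 h2]]; split.
Qed.

Section JumpMeasure.
Context (R : realType) (d : nat).
Local Notation mu := (coin_tossing R).
Local Notation leb := (@lebesgue_measure R).

(* Consecutive sizes have ratio 16^-(n.+2): sums in which the jump of index n
   occurs at most 4^(n.+1) times then form a null set. *)
Definition scale (n : nat) : R := \prod_(k < n.+1) (16^-1) ^+ k.+1.

Lemma scaleS n : scale n.+1 = scale n * (16^-1) ^+ n.+2.
Proof. by rewrite /scale big_ord_recr. Qed.

Lemma scale_gt0 n : 0 < scale n.
Proof. by apply: prodr_gt0 => k _; rewrite exprn_gt0. Qed.

Lemma scale_le n : scale n <= (16^-1) ^+ n.+1.
Proof.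
have e1 k : (16^-1 : R) ^+ k <= 1 by rewrite exprn_ile1// invf_le1// ler1n.
elim: n => [|n IH]; first by rewrite /scale big_ord1.
by rewrite scaleS ler_piMl ?exprn_ge0// (le_trans IH).
Qed.

(** The directions cycle through the basis vectors, so infinitely many jumps lie along each axis and
    no proper subspace contains all but finitely many of them. *)
Definition jump (n : nat) : 'cV[R]_d := \col_i (scale n * ((n %% d)%N == i)%:R).

Lemma jump_ge0 n i : 0 <= jump n i 0.
Proof. by rewrite mxE mulr_ge0// ltW// scale_gt0. Qed.

Lemma jump_le n i : jump n i 0 <= scale n.
Proof. by rewrite mxE; case: eqP => _; rewrite ?mulr1 ?mulr0// ltW// scale_gt0. Qed.

Lemma enorm_jump n : enorm (jump n) <= scale n.
Proof.
have s0 := ltW (scale_gt0 n).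
rewrite /enorm -[leRHS](ger0_norm s0) -sqrtr_sqr ler_wsqrtr//.
have [d0|d0] := posnP d.
  by rewrite big1 ?sqr_ge0// => i _; have := ltn_ord i; rewrite {2}d0.
rewrite (bigD1 (Ordinal (ltn_pmod n d0)))//= mxE eqxx mulr1 big1 ?addr0// => i ii.
rewrite mxE; case: eqP => [e|_]; last by rewrite mulr0 expr0n.
by case/eqP: ii; apply/val_inj.
Qed.

Lemma scale_summable : (\sum_(0 <= n <oo) (scale n)%:E < +oo)%E.
Proof.
have h : series (geometric (16^-1 : R) 16^-1) @ \oo --> 16^-1 / (1 - 16^-1 : R).
  by apply: cvg_geometric_series; rewrite gtr0_norm ?invr_gt0// invf_lt1// ltr1n.
apply: (@le_lt_trans _ _ (16^-1 / (1 - 16^-1 : R))%:E); last exact: ltry.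
rewrite -(cvg_nneseries _ h); last by move=> k /=; rewrite mulr_ge0// exprn_ge0.
apply: lee_nneseries => [n _ _|n _]; rewrite lee_fin; first exact: ltW (scale_gt0 n).
by rewrite /= -exprS; exact: scale_le.
Qed.

Definition jump_atoms : {measure set 'cV[R]_d -> \bar R} := mseries (fun n => dirac (jump n)) 0.

Lemma measurable_nonzero : measurable [set u : 'cV[R]_d | u != 0].
Proof.
rewrite (_ : mkset _ = ~` [set 0]); first by apply: measurableC; exact: measurable_point.
by apply/seteqP; split => u /= /eqP.
Qed.

(* In dimension 0 the jumps vanish; removing the origin makes this case regular. *)
Definition jump_measure : {measure set 'cV[R]_d -> \bar R} := restm jump_atoms measurable_nonzero.

Lemma jump_measureE (V : set 'cV[R]_d) :
  jump_measure V = (\sum_(0 <= n <oo) ((jump n \in V) && (jump n != 0))%:R%:E)%E.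
Proof.
rewrite /jump_measure restmE [LHS]/= /mseries; apply: eq_eseriesr => n _.
rewrite [LHS]/= /dirac indicE; congr ((nat_of_bool _)%:R%:E).
rewrite in_setI; congr andb; by apply/idP/idP; rewrite inE.
Qed.

Lemma jump_measure_integral (V : set 'cV[R]_d) (g : 'cV[R]_d -> R) :
  measurable V -> measurable_fun setT g -> (forall u, 0 <= g u) -> g 0 = 0 ->
  (\int[jump_measure]_(u in V) (g u)%:E =
   \sum_(0 <= n <oo) (g (jump n) * \1_V (jump n))%:E)%E.
Proof.
move=> mV mg g0 g00.
transitivity (\int[jump_atoms]_(u in V) (g u)%:E)%E.
  rewrite integral_mkcond.
  have -> : (fun u => (g u)%:E) \_ V = ((fun u => (g u)%:E) \_ V) \_ [set u : 'cV[R]_d | u != 0].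
    apply/funext => u; rewrite /patch; have [->|u0] := eqVneq u 0.
      by rewrite g00; case: ifP => _; case: ifP.
    by rewrite [X in _ = if X then _ else _]mem_set.
  rewrite integral_restm [in RHS]integral_mkcond [in LHS]integral_mkcond.
  apply: eq_integral => u _; rewrite /patch; have [->|u0] := eqVneq u 0.
    by rewrite g00; case: ifP => _; case: ifP.
  by rewrite [X in if X then _ else _]mem_set.
rewrite ge0_integral_measure_series//; last 2 first.
- by move=> u _; rewrite lee_fin.
- by apply: measurable_funTS; exact/measurable_EFinP.
apply: eq_eseriesr => n _; rewrite integral_dirac//.
  by rewrite /dirac -EFinM mulrC.
by apply: measurable_funTS; exact/measurable_EFinP.
Qed.

Lemma jump_measure_levy : is_levy_measure jump_measure.
Proof.
split.
  rewrite /jump_measure restmE (_ : _ `&` _ = set0) ?measure0//.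
  by apply/seteqP; split => u // [/= ->] /eqP.
rewrite jump_measure_integral//; last 3 first.
- apply: measurable_minr; last exact: measurable_cst.
  by apply: measurable_funX; exact: measurable_enorm.
- by move=> u; rewrite le_min ler01 sqr_ge0.
- rewrite /enorm big1 ?sqrtr0 ?expr0n ?min_l// => i _; by rewrite mxE expr0n.
apply: (@le_lt_trans _ _ (\sum_(0 <= n <oo) (scale n)%:E)%E); last exact: scale_summable.
have s0 n := ltW (scale_gt0 n).
apply: lee_nneseries => [n _ _|n _]; rewrite lee_fin.
  by rewrite mulr_ge0 ?indicE// le_min ler01 sqr_ge0.
rewrite indicE in_setT mulr1; apply: (@le_trans _ _ (enorm (jump n) ^+ 2)).
  by rewrite ge_min lexx.
have s1 : scale n <= 1.
  by apply: le_trans (scale_le n) _; rewrite exprn_ile1// invf_le1// ler1n.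
rewrite expr2 -[leRHS]mulr1 ler_pM ?enorm_ge0 ?enorm_jump//.
exact: le_trans (enorm_jump n) s1.
Qed.

Lemma jump_measure_nondegenerated : ess_lin_nondegenerated jump_measure.
Proof.
move=> L Lfull.
have [i Li] : exists i : 'I_d, delta_mx i 0 \notin L.
  apply: contrapT => h; case/eqP: Lfull; apply/vspaceP => u; rewrite memvf.
  rewrite [u]matrix_sum_delta; apply: memv_suml => i _; apply: memv_suml => j _.
  rewrite ord1; apply: memvZ; apply: contrapT => /negP Li; apply: h; by exists i.
have d0 : (0 < d)%N := leq_ltn_trans (leq0n i) (ltn_ord i).
have jumpi k : jump (k * d + i) = scale (k * d + i) *: delta_mx i 0.
  apply/colP => j; rewrite !mxE eqxx andbT modnMDl modn_small//; congr (_ * _%:R).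
  by rewrite eq_sym.
pose b n := (((jump n \in ~` [set u | u \in L]) && (jump n != 0)) : nat).
have bi k : b (k * d + i)%N = 1%N.
  rewrite /b jumpi scaler_eq0 (gt_eqF (scale_gt0 _))/=.
  have -> : delta_mx i 0 != 0 :> 'cV[R]_d.
    by apply/eqP => h; move: Li; rewrite h mem0v.
  rewrite andbT mem_set//= => h; case/negP: Li.
  have := memvZ (scale (k * d + i))^-1 h.
  by rewrite scalerA mulVf ?scale1r// gt_eqF// scale_gt0.
(* Every block of [d] consecutive indices contains a jump along the axis [i], hence one outside
   [L]. *)
have Sb K : (K <= \sum_(0 <= n < K * d) b n)%N.
  elim: K => // K IH; rewrite mulSn addnC.
  rewrite (big_cat_nat (n := (K * d)%N)) ?leq_addr//= -addn1 leq_add//.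
  rewrite -{1}[(K * d)%N]add0n big_addn addKn big_mkord (bigD1 i)//= addnC.
  by rewrite [(i + _)%N]addnC bi addn1.
rewrite jump_measureE; apply/eqyP => A _.
apply: (@le_trans _ _ (\sum_(0 <= n < Num.bound `|A| * d) (b n)%:R%:E)%E); last first.
  by apply: nneseries_lim_ge => n _ _; rewrite lee_fin.
rewrite sumEFin lee_fin -natr_sum; apply: (@le_trans _ _ (Num.bound `|A|)%:R).
  by rewrite (le_trans (ler_norm A))// ltW// archi_boundP.
by rewrite ler_nat.
Qed.

Definition embed (q : R * nat) : R * 'cV[R]_d := (q.1, jump q.2).

Lemma measurable_embed : measurable_fun setT embed.
Proof.
apply: measurable_fun_pair; first exact: measurable_fst.
by apply: (measurableT_comp (f := jump)) => //; exact: measurable_snd.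
Qed.

Lemma measurable_nonzero_marks : measurable [set q : R * nat | jump q.2 != 0].
Proof.
rewrite (_ : mkset _ = setT `*` [set n | jump n != 0]); first by apply: measurableX.
by apply/seteqP; split => q // [].
Qed.

(** The underlying points carry the label n and not the vector, because later estimates need the
    count of each index separately; the random measure on vectors is an image. *)
Definition jump_prm (w : streams) : {measure set (R * 'cV[R]_d) -> \bar R} :=
  pushm (restm (marks R w) measurable_nonzero_marks) measurable_embed.

Lemma jump_prm_prm : is_poisson_random_measure mu (intensity jump_measure) jump_prm.
Proof.
apply: (pushm_poisson_random_measure measurable_embed (lam := fun E =>
   marks_mean (E `&` [set q : R * nat | jump q.2 != 0]))).
  move=> E mE; rewrite /intensity [LHS]/product_measure1.
  have msec n : measurable [set s : R | E (s, jump n)].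
    by have := measurable_ysection (jump n) mE; congr measurable; apply/seteqP; split => s;
      rewrite /ysection /= inE.
  pose S n : set R := [set s | 0 <= s /\ (E (s, jump n) /\ jump n != 0)].
  have mS n : measurable (S n).
    have -> : S n = `[0, +oo[ `&` ([set s : R | E (s, jump n)] `&` [set s : R | jump n != 0]).
      by apply/seteqP; split => s; rewrite /S/= in_itv/= andbT.
    apply: measurableI => //; apply: measurableI => //.
    by case: (jump n != 0); [rewrite (_ : mkset _ = setT)//; apply/seteqP; split|rewrite (_ : mkset _ = set0)//; apply/seteqP; split].
  have i1 n : (\int[leb]_(s in (setT : set (measurableTypeR R))) (\1_(S n) s)%:E = leb (S n))%E.
    rewrite integral_indic//; last exact: mS.
    by congr (leb _); apply/seteqP; split => [s []|s].
  transitivity (\int[leb]_s \sum_(0 <= n <oo) (\1_(S n) s)%:E)%E.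
    apply: eq_integral => s _; rewrite /= jump_measureE; apply: eq_eseriesr => n _.
    rewrite indicE; congr ((nat_of_bool _)%:R%:E); apply/andP/idP; rewrite !inE.
      by rewrite /xsection/= inE => -[[Es [/=]]]; rewrite in_itv/= andbT => s0 _ jn; split.
    move=> [s0 [Es jn]]; split => //; rewrite /xsection/= inE; split => //; split => //.
    by rewrite /= in_itv/= andbT.
  have m1 n : measurable_fun (setT : set R) (fun s : R => (\1_(S n) s : R)%:E).
    by apply/measurable_EFinP; exact: measurable_indic.
  rewrite integral_nneseries//.
  rewrite /marks_mean; apply: eq_eseriesr => n _.
  exact: i1.
apply: (restm_poisson_random_measure measurable_nonzero_marks (lam := @marks_mean R)) => //.
exact: marks_prm.
Qed.

Lemma jump_prm_integral w (B : set R) (V : set 'cV[R]_d) (g : 'cV[R]_d -> R) :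
  measurable B -> measurable V -> measurable_fun setT g -> (forall u, 0 <= g u) -> g 0 = 0 ->
  (\int[jump_prm w]_(p in B `*` V) (g p.2)%:E =
   \sum_(0 <= n <oo) (g (jump n) * \1_V (jump n))%:E * marks R w (B `*` [set n]))%E.
Proof.
move=> mB mV mg g0 g00.
have mgE : measurable_fun setT (fun p : R * 'cV[R]_d => (g p.2)%:E).
  by apply/measurable_EFinP; apply: (measurableT_comp (f := g)).
have mBV : measurable (B `*` V) by exact: measurableX.
rewrite -(@marked_integral _ _ B (fun n => g (jump n) * \1_V (jump n)))//; last first.
  by move=> n; rewrite mulr_ge0// indicE.
rewrite /jump_prm integral_mkcond.
rewrite (@ge0_integral_pushforward _ _ _ _ _ _ measurable_embed _ setT)//; last 2 first.
- by apply: (measurable_restrictT _ mBV).1; exact: measurable_funTS.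
- by move=> p _; rewrite /patch; case: ifP => // _; rewrite lee_fin.
pose G := [set q : R * nat | jump q.2 != 0].
have e : ((fun p : R * 'cV[R]_d => (g p.2)%:E) \_ (B `*` V)) \o embed =
   (fun q : R * nat => (g (jump q.2) * \1_V (jump q.2) * \1_B q.1)%:E).
  apply/funext => q; rewrite /patch /= !indicE /embed.
  case: ifPn; first by rewrite inE => -[/= Bq Vq]; rewrite !mem_set// !mulr1.
  rewrite notin_setE => nq; have [Vq|Vq] := pselect (V (jump q.2)).
    have -> : (q.1 \in B) = false by rewrite memNset// => Bq; apply: nq.
    by rewrite mulr0.
  have -> : (jump q.2 \in V) = false by rewrite memNset.
  by rewrite mulr0 mul0r.
rewrite e preimage_setT.
have -> : (fun q : R * nat => (g (jump q.2) * \1_V (jump q.2) * \1_B q.1)%:E) =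
   (fun q : R * nat => (g (jump q.2) * \1_V (jump q.2) * \1_B q.1)%:E) \_ G.
  apply/funext => q; rewrite /patch; case: ifPn => //.
  by rewrite notin_setE => /negP; rewrite negbK => /eqP ->; rewrite g00 !mul0r.
rewrite [LHS]integral_restm integral_mkcond; apply: eq_integral => q _.
rewrite {1}/patch; case: ifPn => //.
Qed.

End JumpMeasure.

Lemma square_le_exp2 k : (k ^ 2 <= 2 * 2 ^ k)%N.
Proof.
case: k => [|[|[|k]]] //; elim: k => // k IH.
rewrite expnS; apply: (@leq_trans (2 * k.+3 ^ 2)); last first.
  by rewrite leq_mul2l/=.
have h : (3 * k.+3 <= k.+3 ^ 2)%N by rewrite -mulnn leq_mul2r.
rewrite expn1 mulnn -(addn1 k.+3) sqrnD [X in (_ <= X)%N]mul2n -addnn -addnA leq_add2l exp1n muln1.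
by apply: leq_trans h; rewrite (mulSn 2) leq_add2r.
Qed.

Lemma cvg_entries (R : realType) (T : Type) (F : set_system T) {FF : Filter F} (m n : nat)
    (f : T -> 'M[R]_(m, n)) (l : 'M[R]_(m, n)) :
  (forall i j, f x i j @[x --> F] --> l i j) -> f x @[x --> F] --> l.
Proof.
move=> fl; apply/cvg_ballP => e e0.
have : \forall x \near F, forall ij : 'I_m * 'I_n, ball (l ij.1 ij.2) e (f x ij.1 ij.2).
  by apply: filter_forall => -[i j]; exact: (cvg_ballP _ _).1 (fl i j) e e0.
by apply: filterS => x h; split => // i j; exact: (h (i, j)).
Qed.

Lemma nneseries_coefficients_lt (R : realType) (a b : nat -> R) (N : nat -> \bar R) :
  (forall n, 0 <= a n <= b n) -> (forall n, (0 <= N n)%E) ->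
  (\sum_(0 <= n <oo) (b n)%:E * N n < +oo)%E ->
  (\sum_(0 <= n <oo) (a n)%:E * N n < +oo)%E.
Proof.
move=> ab N0; apply: le_lt_trans; apply: lee_nneseries => [n _ _|n _].
  by rewrite mule_ge0// lee_fin; case/andP: (ab n).
by apply: lee_wpmul2r => //; rewrite lee_fin; case/andP: (ab n).
Qed.

(** * Summability of the jumps *)

Section Paths.
Context (R : realType) (d : nat).
Local Notation mu := (coin_tossing R).
Local Notation leb := (@lebesgue_measure R).
Local Notation jump := (jump R d).

Definition marks_intensity : {measure set (R * nat) -> \bar R} :=
  clusters_mean R (@measurable_mark_point R).

Lemma marks_prm_intensity : is_poisson_random_measure mu marks_intensity (marks R).
Proof. exact: (clusters_poisson_random_measure (fun E _ => erefl)). Qed.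

Lemma marks_intensity_slice (B : set R) n : measurable B -> (forall s, B s -> 0 <= s) ->
  marks_intensity (B `*` [set n]) = leb B.
Proof.
move=> mB B0; rewrite -(marks_mean_slice n mB B0) marks_meanE//.
by apply: measurableX.
Qed.

Lemma marks_finite (B : set R) n : measurable B -> (forall s, B s -> 0 <= s) ->
  (leb B < +oo)%E -> {ae mu, forall w, exists k : nat, marks R w (B `*` [set n]) = k%:R%:E}.
Proof.
move=> mB B0 Bfin; apply: (prm_nat marks_prm_intensity); first by apply: measurableX.
by rewrite /= marks_intensity_slice.
Qed.

(** The inequality k^2 <= 2 2^k turns the second moment into an exponential series, with sum 2
    exp(-b) exp(2b). *)
Lemma marks_second_moment (B : set R) n (b : R) : measurable B -> (forall s, B s -> 0 <= s) ->
  leb B = b%:E ->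
  (\int[mu]_w (fine (marks R w (B `*` [set n])) ^+ 2)%:E <= (2 * expR b)%:E)%E.
Proof.
move=> mB B0 Bb; set X := fun w => marks R w (B `*` [set n]).
have mBn : measurable (B `*` [set n]) by apply: measurableX.
have mX : measurable_fun setT X := measurable_clusters (@measurable_mark_point R) mBn.
have b0 : 0 <= b by rewrite -lee_fin -Bb.
under eq_integral do rewrite -[_ ^+ 2]mulr1.
rewrite (@expectation_extended_nat R _ _ mu X (fun=> 1) mX _ (measurable_cst _) _ (fun x => fine x ^+ 2)).
- have h : series (fun k => 2 * (expR (- b) * exp_coeff (2 * b) k)) @ \oo --> 2 * expR b.
    rewrite (_ : expR b = expR (- b) * expR (2 * b)); last by rewrite -expRD; congr expR; ring.
    rewrite (_ : series _ = (fun n => 2 * (expR (- b) * series (exp_coeff (2 * b)) n))).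
      apply: cvgM; first exact: cvg_cst.
      by apply: cvgM; [exact: cvg_cst|exact: is_cvg_series_exp_coeff].
    by apply/funext => m; rewrite /series /= !mulr_sumr.
  rewrite -(cvg_nneseries _ h); last first.
    by move=> k; rewrite mulr_ge0// mulr_ge0 ?expR_ge0// divr_ge0// exprn_ge0// mulr_ge0.
  apply: lee_nneseries => [k _ _|k _].
    rewrite mule_ge0 ?lee_fin ?sqr_ge0//; apply: integral_ge0 => w _.
    by rewrite lee_fin mulr1 indicE.
  rewrite point_mass1// (prm_poisson marks_prm_intensity)//; last first.
    by rewrite [X in (X < _)%E]marks_intensity_slice// Bb ltry.
  rewrite marks_intensity_slice// Bb /= -EFinM lee_fin /exp_coeff /= exprMn.
  have k2 : (k%:R ^+ 2 : R) <= 2 * 2 ^+ k.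
    by rewrite -!natrX -natrM ler_nat; exact: square_le_exp2.
  have e0 : 0 <= b ^+ k / k`!%:R * expR (- b).
    by rewrite mulr_ge0 ?expR_ge0// divr_ge0// exprn_ge0.
  rewrite (_ : 2 * (expR (- b) * (2 ^+ k * b ^+ k / k`!%:R)) =
    2 * 2 ^+ k * (b ^+ k / k`!%:R * expR (- b))); last by ring.
  by apply: ler_wpM2r.
- by move=> w; exact: clusters_extended_nat.
- by move=> w; rewrite ler01 lexx.
- by move=> x; exact: sqr_ge0.
- by rewrite expr0n.
Qed.

(** It dominates all coordinates of the jump sum at once, since every coordinate of the jump of
    index n lies between 0 and [scale R n]. *)
Definition weight (B : set R) (w : streams) : \bar R :=
  (\sum_(0 <= n <oo) (scale R n)%:E * marks R w (B `*` [set n]))%E.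

Definition good_stream (w : streams) := forall k : nat, (weight (`[0%R, k%:R%R]%classic : set R) w < +oo)%E.

(** Almost surely the counts are integers, so N <= N^2 and the second moment bound already makes the
    expected total size finite. *)
Lemma ae_good_stream : {ae mu, forall w, good_stream w}.
Proof.
apply/ae_foralln => k; set B : set R := `[0, k%:R]%classic.
have mB : measurable B by exact: measurable_itv.
have B0 s : B s -> 0 <= s by rewrite /B/= in_itv/= => /andP[].
have Bk : leb B = k%:R%:E.
  rewrite /B lebesgue_measure_itv/= lte_fin oppr0 adde0.
  by case: ltP => // k0; congr EFin; apply/eqP; rewrite eq_le ler0n k0.
have fin : {ae mu, forall w, forall n, exists j : nat, marks R w (B `*` [set n]) = j%:R%:E}.
  by apply/ae_foralln => n; apply: marks_finite => //; rewrite Bk ltry.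
pose f w := (\sum_(0 <= n <oo) (scale R n * fine (marks R w (B `*` [set n])) ^+ 2)%:E)%E.
have mN n : measurable_fun setT (fun w => fine (marks R w (B `*` [set n])) ^+ 2).
  apply: measurable_funX; apply: (measurableT_comp (f := fine)); first exact: fine_measurable.
  by apply: measurable_clusters; [exact: measurable_mark_point|apply: measurableX].
have mf n : measurable_fun setT (fun w => (scale R n * fine (marks R w (B `*` [set n])) ^+ 2)%:E).
  by apply/measurable_EFinP; exact: measurable_funM.
have s0 n : 0 <= scale R n := ltW (scale_gt0 R n).
have f0 n w : (0 <= (scale R n * fine (marks R w (B `*` [set n])) ^+ 2)%:E)%E.
  by rewrite lee_fin mulr_ge0// sqr_ge0.
have ff : (\int[mu]_w f w < +oo)%E.
  rewrite integral_nneseries//.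
  apply: (@le_lt_trans _ _ (\sum_(0 <= n <oo) (2 * expR k%:R)%:E * (scale R n)%:E)%E).
    apply: lee_nneseries => [n _ _|n _]; first exact: integral_ge0.
    under eq_integral do rewrite EFinM.
    rewrite ge0_integralZl ?lee_fin//; last exact/measurable_EFinP.
    by rewrite muleC lee_wpmul2r// ?lee_fin//; exact: marks_second_moment.
  rewrite nneseriesZl; last by move=> n _; rewrite lee_fin.
  have := scale_summable R; have s : (0 <= \sum_(0 <= n <oo) (scale R n)%:E)%E.
    by apply: nneseries_ge0 => n _ _; rewrite lee_fin.
  by rewrite -ge0_fin_numE// => sf; rewrite -(fineK sf) -EFinM ltry.
have ae_f : {ae mu, forall w, f w \is a fin_num}.
  have : mu.-integrable setT f.
    apply/integrableP; split; first exact: ge0_emeasurable_sum.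
    by under eq_integral do rewrite gee0_abs ?nneseries_ge0//.
  move/(integrable_ae measurableT); apply: filterS => w; exact.
apply: filterS2 fin ae_f => w finw fw.
apply: (@le_lt_trans _ _ (f w)); last by rewrite -ge0_fin_numE// nneseries_ge0.
apply: lee_nneseries => [n _ _|n _]; first by rewrite mule_ge0// lee_fin.
have [j ->] := finw n; rewrite -EFinM lee_fin ler_wpM2l//=.
by rewrite -natrX ler_nat; case: j => // j; rewrite expnS expn1 leq_pmulr.
Qed.

Lemma weight_subset (B B' : set R) w : measurable B -> measurable B' -> B `<=` B' ->
  (weight B w <= weight B' w)%E.
Proof.
move=> mB mB' BB'; have s0 n : 0 <= scale R n := ltW (scale_gt0 R n).
apply: lee_nneseries => [n _ _|n _]; first by rewrite mule_ge0// lee_fin.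
apply: lee_wpmul2l; rewrite ?lee_fin//; apply: le_measure; rewrite ?inE.
- by apply: measurableX.
- by apply: measurableX.
- by move=> q [/= h1 h2]; split => //; exact: BB'.
Qed.

Lemma weight_finite (B : set R) (t : R) w : measurable B -> good_stream w ->
  B `<=` `[0, t] -> (weight B w < +oo)%E.
Proof.
move=> mB gw Bt; apply: (@le_lt_trans _ _ (weight (`[0%R, (Num.bound `|t|)%:R%R]%classic : set R) w)) => //.
apply: weight_subset => //; apply: subset_trans Bt _ => s /=.
rewrite !in_itv/= => /andP[-> st]/=; apply: le_trans st _.
by rewrite (le_trans (ler_norm t))// ltW// archi_boundP.
Qed.

Definition jump_sum (B : set R) (w : streams) : 'cV[R]_d :=
  \col_i fine (\sum_(0 <= n <oo) (jump n i 0)%:E * marks R w (B `*` [set n]))%E.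

Let jump_sum_fin (B : set R) w i : (weight B w < +oo)%E ->
  (\sum_(0 <= n <oo) (jump n i 0)%:E * marks R w (B `*` [set n]))%E \is a fin_num.
Proof.
move=> Bw; rewrite ge0_fin_numE; last first.
  by apply: nneseries_ge0 => n _ _; rewrite mule_ge0// lee_fin jump_ge0.
apply: nneseries_coefficients_lt Bw => // n.
by rewrite jump_ge0 jump_le.
Qed.

Lemma jump_sumU (B B' : set R) w : measurable B -> measurable B' ->
  B `&` B' = set0 -> (weight B w < +oo)%E -> (weight B' w < +oo)%E ->
  jump_sum (B `|` B') w = jump_sum B w + jump_sum B' w.
Proof.
move=> mB mB' BB' Bw B'w; apply/colP => i; rewrite !mxE.
rewrite -fineD; try exact: jump_sum_fin.
rewrite -nneseriesD//; last 2 first.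
- by move=> n _ _; rewrite mule_ge0// lee_fin jump_ge0.
- by move=> n _ _; rewrite mule_ge0// lee_fin jump_ge0.
congr fine; apply: eq_eseriesr => n _.
rewrite -ge0_muleDr//; congr (_ * _)%E; rewrite -measureU//.
- by congr (marks R w _); apply/seteqP; split => q /=; [move=> [[]]|move=> [[]|[]]]; tauto.
- by apply: measurableX.
- by apply: measurableX.
- apply/seteqP; split => // q [[h1 _] [h2 _]].
  by have : (B `&` B') q.1 by []; rewrite BB'.
Qed.

Lemma measurable_jump_sum d' (S : measurableType d') (g : S -> streams) (B : set R) :
  (forall n, measurable_fun setT (fun s => marks R (g s) (B `*` [set n]))) ->
  measurable_fun setT (fun s => jump_sum B (g s)).
Proof.
move=> mg; apply: measurable_fun_mx => i j; rewrite ord1.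
rewrite (_ : (fun s => _) = fine \o (fun s => (\sum_(0 <= n <oo) (jump n i 0)%:E * marks R (g s) (B `*` [set n]))%E)); last first.
  by apply/funext => s; rewrite mxE.
apply: (measurableT_comp (f := fine)); first exact: fine_measurable.
apply: ge0_emeasurable_sum => [n s _ _|n _].
  by rewrite mule_ge0// lee_fin jump_ge0.
by apply: emeasurable_funM => //; exact: measurable_cst.
Qed.

End Paths.

Lemma bigsetI_mem (T : Type) (I : finType) (f : I -> set T) x :
  (\big[setI/setT]_(i <- enum I) f i) x <-> forall i, f i x.
Proof.
split; last by move=> h; elim/big_ind : _ => // A B.
by move=> + i; rewrite (big_rem i) ?mem_enum//= => -[].
Qed.

Section JumpProcess.
Context (R : realType) (d : nat).
Local Notation mu := (coin_tossing R).
Local Notation leb := (@lebesgue_measure R).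
Local Notation jump := (jump R d).
Local Notation jump_sum := (@jump_sum R d).

Definition drift : 'cV[R]_d := \col_i fine (\sum_(0 <= n <oo) (jump n i 0)%:E)%E.

(** All jumps have norm at most one and their sizes are summable, so the compensated integral is a
    plain sum minus its mean [t *: drift]. *)
Definition jump_process (t : R) (w : streams) : 'cV[R]_d := jump_sum `[0, t] w - t *: drift.

Lemma jump_sum_split (s t : R) w : good_stream R w -> 0 <= s -> s <= t ->
  jump_sum `[0, t] w = jump_sum `[0, s] w + jump_sum `]s, t] w.
Proof.
move=> gw s0 st.
have e : (`[0, t]%classic : set R) = `[0, s]%classic `|` `]s, t]%classic.
  apply/seteqP; split => r /=; rewrite !in_itv/=.
    by move=> /andP[r0 rt]; case: (leP r s) => rs; [left; rewrite r0|right].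
  by move=> [/andP[r0 rs]|/andP[sr ->]]; rewrite ?r0 ?(le_trans rs st)// (le_trans s0 (ltW sr)).
have d0 : (`[0, s]%classic : set R) `&` `]s, t]%classic = set0.
  apply/seteqP; split => // r [] /=; rewrite !in_itv/= => /andP[_ rs] /andP[sr _].
  by move: (le_lt_trans rs sr); rewrite ltxx.
rewrite e jump_sumU//.
- exact: (weight_finite (t := s)).
- apply: (weight_finite (t := t)) => // r /=; rewrite !in_itv/= => /andP[sr ->].
  by rewrite (le_trans s0 (ltW sr)).
Qed.

Lemma jump_processE t w i :
  jump_process t w i 0 = jump_sum `[0, t] w i 0 - t * drift i 0.
Proof. by rewrite [LHS]mxE; congr (_ + _); rewrite [LHS]mxE; congr (- _); rewrite [LHS]mxE. Qed.

Lemma jump_process_increment (s t : R) w : good_stream R w -> 0 <= s -> s <= t ->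
  jump_process t w - jump_process s w = jump_sum `]s, t] w - (t - s) *: drift.
Proof.
move=> gw s0 st; rewrite /jump_process (jump_sum_split gw s0 st).
rewrite scalerBl; move: (jump_sum _ _) (jump_sum _ _) (t *: drift) (s *: drift) => a b x y.
by apply/colP => i; rewrite !mxE; ring.
Qed.

Lemma jump_sum_ge0 (B : set R) w i : 0 <= jump_sum B w i 0.
Proof.
rewrite mxE fine_ge0// nneseries_ge0// => n _ _.
by rewrite mule_ge0// lee_fin jump_ge0.
Qed.

Lemma measurable_slice (B : set R) n : measurable B -> measurable (B `*` [set n] : set (R * nat)).
Proof. by move=> mB; apply: measurableX. Qed.

Definition slice_measure (w : streams) (n : nat) : {measure set R -> \bar R} :=
  pushm (restm (marks R w) (measurable_slice n measurableT)) measurable_fst.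

Lemma slice_measureE w n B : slice_measure w n B = marks R w (B `*` [set n]).
Proof.
rewrite /slice_measure pushmE restmE; congr (marks R w _).
by apply/seteqP; split => q /=; [move=> [? []]|move=> [? ?]].
Qed.

(** A coordinate of the jump sum as a measure of the time set, so that right-continuity in time
    becomes continuity of a measure from above. *)
Definition coordinate_measure (w : streams) (i : 'I_d) : {measure set R -> \bar R} :=
  mseries (fun n => mscale (NngNum (jump_ge0 R n i)) (slice_measure w n)) 0.

Lemma coordinate_measureE w i B :
  coordinate_measure w i B = (\sum_(0 <= n <oo) (jump n i 0)%:E * marks R w (B `*` [set n]))%E.
Proof.
rewrite /coordinate_measure [LHS]/= /mseries; apply: eq_eseriesr => n _.
by rewrite -slice_measureE.
Qed.

Lemma jump_sum_right (t : R) w i : good_stream R w -> 0 <= t ->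
  fine (coordinate_measure w i `]t, (t + k.+1%:R^-1)%R]%classic) @[k --> \oo] --> 0.
Proof.
move=> gw t0.
have k0 k : 0 < (k.+1%:R^-1 : R) by rewrite invr_gt0.
have fin : (coordinate_measure w i `]t, (t + 1)%R]%classic < +oo)%E.
  rewrite coordinate_measureE; apply: (@nneseries_coefficients_lt R _ (scale R)) => //.
    by move=> n; rewrite jump_ge0 jump_le.
  apply: (weight_finite (t := t + 1)) => // r /=; rewrite !in_itv/= => /andP[tr ->].
  by rewrite (le_trans t0 (ltW tr)).
apply: fine_cvg; rewrite -[X in _ --> X%:E]/(fine 0%E).
have -> : (fine 0%E)%:E = coordinate_measure w i (\bigcap_k `]t, t + k.+1%:R^-1]%classic).
  rewrite (_ : \bigcap_k _ = set0) ?measure0//; apply/seteqP; split => // r h.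
  have /andP[tr _] : t < r <= t + 1%:R^-1 by have := h 0%N I; rewrite /= in_itv.
  have rt0 : 0 < r - t by rewrite subr_gt0.
  have := h (Num.bound (r - t)^-1) I; rewrite /= in_itv/= => /andP[_].
  rewrite leNgt -ltrBrDl => /negP; apply.
  rewrite -[ltRHS]invrK ltf_pV2 ?posrE ?invr_gt0//.
  apply: (@lt_trans _ _ (Num.bound (r - t)^-1)%:R); last by rewrite ltr_nat.
  by apply: archi_boundP; rewrite invr_ge0 ltW.
apply: (@nonincreasing_cvg_mu _ _ _ (coordinate_measure w i) (fun k => `]t, (t + k.+1%:R^-1)%R]%classic)) => //.
- by rewrite invr1.
- by apply: bigcapT_measurable.
- apply/nonincreasing_seqP => k; apply/subsetPset => r /=; rewrite !in_itv/= => /andP[-> h]/=.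
  by apply: le_trans h _; rewrite lerD2l lef_pV2 ?posrE// ler_nat.
Qed.

Lemma jump_sum_monotone (s t : R) w i : good_stream R w -> 0 <= s -> s <= t ->
  jump_sum `[0, s] w i 0 <= jump_sum `[0, t] w i 0.
Proof.
by move=> gw s0 st; rewrite (jump_sum_split gw s0 st) [leRHS]mxE lerDl jump_sum_ge0.
Qed.

(** The jumps have nonnegative coordinates, so each coordinate of the path is a nondecreasing
    function minus a linear one: monotonicity gives left limits, [jump_sum_right] gives
    right-continuity. *)
Lemma jump_process_cadlag w : good_stream R w -> cadlag (fun t => jump_process t w).
Proof.
move=> gw; split => t t0.
  apply: cvg_entries => i j; rewrite ord1 jump_processE.
  rewrite (_ : (fun s => _) = (fun s => jump_sum `[0, s] w i 0 - s * drift i 0)); last first.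
    by apply/funext => s; rewrite jump_processE.
  apply: cvgB; last first.
    by apply: cvgM; [exact: cvg_at_right_filter cvg_id|exact: cvg_cst].
  apply/cvgrPdist_lt => e e0.
  have /cvgrPdist_lt/(_ _ e0)[k _ /(_ k (leqnn k))] := jump_sum_right i gw t0.
  move=> /= ke0.
  have ke : `|fine (coordinate_measure w i `]t, (t + k.+1%:R^-1)%R]%classic)| < e.
    by rewrite -normrN -sub0r; exact: ke0.
  near=> s.
  have ts : t <= s by apply: ltW; near: s; exact: nbhs_right_gt.
  have sk : s < t + k.+1%:R^-1 by near: s; apply: nbhs_right_lt; rewrite ltrDl invr_gt0.
  have -> : jump_sum `[0, s] w i 0 = jump_sum `[0, t] w i 0 + jump_sum `]t, s] w i 0.
    by rewrite (jump_sum_split gw t0 ts) [LHS]mxE.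
  rewrite opprD addrA subrr sub0r normrN.
  rewrite ger0_norm ?jump_sum_ge0//; apply: le_lt_trans ke.
  rewrite ger0_norm ?fine_ge0// [leLHS]mxE -coordinate_measureE.
  have sub : (`]t, s]%classic : set R) `<=` `]t, t + k.+1%:R^-1]%classic.
    by move=> r /=; rewrite !in_itv/= => /andP[-> rs]/=; apply: le_trans rs (ltW sk).
  have fin (B : set R) : measurable B -> B `<=` `]t, t + k.+1%:R^-1]%classic -> coordinate_measure w i B \is a fin_num.
    move=> mB Bs; rewrite ge0_fin_numE// coordinate_measureE.
    apply: (@nneseries_coefficients_lt R _ (scale R)) => //.
      by move=> n; rewrite jump_ge0 jump_le.
    apply: (weight_finite (t := t + k.+1%:R^-1)) => // r /Bs /=.
    by rewrite !in_itv/= => /andP[tr ->]; rewrite (le_trans t0 (ltW tr)).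
  apply: fine_le; try exact: fin.
  by rewrite le_measure ?inE.
apply/cvg_ex; exists (\col_i (lim (jump_sum `[0, s] w i 0 @[s --> t^'-]) - t * drift i 0)).
apply: cvg_entries => i j; rewrite ord1.
rewrite (_ : (fun s => _) = (fun s => jump_sum `[0, s] w i 0 - s * drift i 0)); last first.
  by apply/funext => s; rewrite jump_processE.
rewrite [X in _ --> X]mxE; apply: cvgB; last first.
  by apply: cvgM; [exact: cvg_at_left_filter cvg_id|exact: cvg_cst].
apply: nondecreasing_at_left_is_cvgr.
  near=> x => r s; rewrite !in_itv/= => /andP[xr rt] /andP[xs st] rs.
  apply: jump_sum_monotone => //; apply: ltW; apply: le_lt_trans xr; apply: ltW.
  by near: x; exact: nbhs_left_gt.
near=> x; exists (jump_sum `[0, t] w i 0) => y [r rI <-].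
have /andP[xr rt] : x < r < t by move: rI; rewrite /= in_itv.
apply: jump_sum_monotone => //; last exact: ltW.
apply: ltW; apply: le_lt_trans xr; apply: ltW.
by near: x; exact: nbhs_left_gt.
Unshelve. all: by end_near. Qed.

Lemma measurable_jump_process t : measurable_fun setT (jump_process t).
Proof.
apply: measurable_fun_addmx; last exact: measurable_cst.
apply: (measurable_jump_sum (g := fun w : streams => w)) => n; apply: measurable_clusters.
  exact: measurable_mark_point.
exact: measurable_slice.
Qed.

Lemma jump_process0 : {ae mu, forall w, jump_process 0 w = 0}.
Proof.
pose O : set R := `[0, 0]%classic.
have n0 (n : nat) : {ae mu, forall w, marks R w (O `*` [set n]) = 0%E}.
  have mB : measurable (O `*` [set n]) by apply: measurable_slice; exact: measurable_itv.
  have l0 : marks_intensity R (O `*` [set n]) = 0%E.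
    rewrite marks_intensity_slice; first by rewrite /O lebesgue_measure_itv/= ltxx.
      exact: measurable_itv.
    by move=> s; rewrite /O /= in_itv/= => /andP[].
  have mX : measurable_fun setT (fun w => marks R w (O `*` [set n])).
    by apply: measurable_clusters => //; exact: measurable_mark_point.
  have mS : measurable [set w | marks R w (O `*` [set n]) = 0%E].
    by have := mX measurableT _ (emeasurable_set1 0%E); rewrite setTI.
  exists (~` [set w | marks R w (O `*` [set n]) = 0%E]); split => //.
    exact: measurableC.
  have lfin : (marks_intensity R (O `*` [set n]) < +oo)%E by rewrite l0 ltry.
  have := prm_poisson (marks_prm_intensity R) 0 mB lfin.
  rewrite l0 /= expr0 fact0 invr1 !mul1r oppr0 expR0 => h.
  by have := probability_setC mu mS; rewrite [X in (1 - X)%E]h subee// => ->.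
have := ae_foralln n0; apply: filterS => w h.
rewrite /jump_process scale0r subr0; apply/colP => i; rewrite !mxE eseries0// => n _ _.
by rewrite h mule0.
Qed.

Lemma jump_process_independent : independent_increments mu jump_process.
Proof.
move=> N s s0 smon A mA.
have sge0 i : 0 <= s i by apply: le_trans s0 _; exact: smon.
pose E (i : 'I_N) : set (R * nat) := `]s i, s i.+1]%classic `*` setT.
have mE i : measurable (E i) by exact: measurableX.
(* [Y i] agrees with the increment on good streams only, but it is everywhere a function of the
   counts in the strip [E i]. *)
pose Y (i : 'I_N) w := jump_sum `]s i, s i.+1] w - (s i.+1 - s i) *: drift.
have Edisj i j : i != j -> E i `&` E j = set0.
  wlog ij : i j / (i < j)%N.
    move=> h ij; case: (ltngtP i j) => [l|l|e]; first exact: h.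
      by rewrite setIC; apply: h => //; rewrite eq_sym.
    by case/eqP: ij; exact: val_inj.
  move=> _; apply/seteqP; split => // q [[+ _] [+ _]].
  rewrite /= !in_itv/= => /andP[_ a] /andP[b _].
  by have := lt_le_trans b (le_trans a (smon _ _ ij)); rewrite ltxx.
have EY i : prm_sigma (marks R) (E i) (Y i @^-1` A i).
  have mY : measurable_fun (setT : set (g_sigma_algebraType (prm_alg (marks R) (E i)))) (Y i).
    apply: measurable_fun_addmx; last exact: measurable_cst.
    apply: (measurable_jump_sum (g := (fun w => w) : g_sigma_algebraType (prm_alg (marks R) (E i)) -> streams)) => n.
    by apply: measurable_prm_alg; [exact: measurable_slice|move=> q []].
  by have := mY measurableT _ (mA i); rewrite setTI.
have YX : {ae mu, forall w, forall i : 'I_N, Y i w = jump_process (s i.+1) w - jump_process (s i) w}.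
  apply: filterS (@ae_good_stream R) => w gw i; rewrite jump_process_increment//.
  exact: smon.
have mX (i : 'I_N) : measurable ((fun w => jump_process (s i.+1) w - jump_process (s i) w) @^-1` A i).
  rewrite -[X in measurable X]setTI; apply: (_ : measurable_fun setT _) => //.
  apply: measurable_fun_addmx; first exact: measurable_jump_process.
  by apply: measurable_fun_oppmx; exact: measurable_jump_process.
have mYi (i : 'I_N) : measurable (Y i @^-1` A i).
  exact: (prm_sigma_measurable (marks_prm_intensity R)) (EY i).
have := prm_independent_family (marks_prm_intensity R) (enum_uniq 'I_N) mE Edisj EY.
move=> h.
transitivity (mu (\big[setI/setT]_(i <- enum 'I_N) (Y i @^-1` A i))).
  apply: measure_ae_eq.
  - by apply: fin_bigcap_measurable.
  - by apply: bigsetI_measurable.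
  - apply: filterS YX => w YXw; split.
      by move=> Xw; apply/bigsetI_mem => i; rewrite /= YXw; exact: Xw.
    by move=> /bigsetI_mem Yw i _; rewrite /= -YXw; exact: Yw.
rewrite h big_enum; apply: eq_bigr => i _; apply: measure_ae_eq => //.
by apply: filterS YX => w YXw; rewrite /= YXw.
Qed.

End JumpProcess.

(** * Stationary increments *)

Definition counts := g_sigma_algebraType (@constraints nat).

Section Stationarity.
Context (R : realType) (d : nat).
Local Notation mu := (coin_tossing R).
Local Notation leb := (@lebesgue_measure R).
Local Notation jump := (jump R d).
Local Notation jump_sum := (@jump_sum R d).
Local Notation jump_process := (@jump_process R d).

(** The jump sum as a function of the sequence of counts. Its law is thereby determined by the
    finite-dimensional laws of the counts, which depend on the time set through its length alone. *)
Definition decode (a : counts) : 'cV[R]_d :=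
  \col_i fine (\sum_(0 <= n <oo) (jump n i 0)%:E * (a n)%:R%:E)%E.

Lemma measurable_decode : measurable_fun setT decode.
Proof.
have mc n : measurable_fun setT (fun a : counts => a n).
  move=> _ B _; rewrite setTI.
  rewrite (_ : _ @^-1` _ = \bigcup_(k in B) constrained (pred1 n) (fun=> k)).
    apply: bigcup_measurable => k _; apply: sub_sigma_algebra; right.
    exists (pred1 n), (fun=> k), n.+1; split => //.
    by move=> i /eqP ->.
  apply/seteqP; split => [a Ba|a [k Bk ak]]; last by rewrite /= (ak n) //= eqxx.
  by exists (a n) => // i /eqP ->.
apply: measurable_fun_mx => i j; rewrite ord1.
rewrite (_ : (fun s => _) = fine \o (fun a : counts => (\sum_(0 <= n <oo) (jump n i 0)%:E * (a n)%:R%:E)%E)); last first.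
  by apply/funext => s; rewrite mxE.
apply: (measurableT_comp (f := fine)); first exact: fine_measurable.
apply: ge0_emeasurable_sum => [n s _ _|n _].
  by rewrite mule_ge0// lee_fin jump_ge0.
apply: emeasurable_funM; first exact: measurable_cst.
apply/measurable_EFinP; apply: (measurableT_comp (f := fun k : nat => k%:R : R)) => //.
Qed.

Section OneSet.
Variables (B : set R) (h : R).
Hypotheses (mB : measurable B) (B0 : forall s, B s -> 0 <= s) (Bh : leb B = h%:E).

Definition jump_counts (w : streams) : counts :=
  fun n => Num.trunc (fine (marks R w (B `*` [set n]))).

Let mX n : measurable_fun setT (fun w => marks R w (B `*` [set n])).
Proof.
by apply: measurable_clusters; [exact: measurable_mark_point|exact: measurable_slice].
Qed.

Let mcount n k : measurable [set w | jump_counts w n = k].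
Proof.
rewrite (_ : mkset _ = [set w | k%:R <= fine (marks R w (B `*` [set n]))] `&`
   [set w | fine (marks R w (B `*` [set n])) < k.+1%:R]).
  have mf : measurable_fun setT (fun w => fine (marks R w (B `*` [set n]))).
    by apply: (measurableT_comp (f := fine)) => //; exact: fine_measurable.
  apply: measurableI; first by apply: measurable_set_le => //; exact: measurable_cst.
  by apply: measurable_set_lt => //; exact: measurable_cst.
have f0 w : 0 <= fine (marks R w (B `*` [set n])) by exact: fine_ge0.
apply/seteqP; split => w /=; rewrite /jump_counts.
  by move=> <-; have /andP[] := truncn_itv (f0 w).
by move=> [a b]; apply: truncn_def; rewrite a b.
Qed.

Lemma measurable_jump_counts : measurable_fun setT jump_counts.
Proof.
apply: (@measurability _ _ _ _ setT jump_counts (@constraints nat)) => // _ [S [->|[J [v [p [Jp ->]]]]] <-].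
  by rewrite preimage_set0 setI0.
rewrite setTI (_ : _ @^-1` _ = \bigcap_i [set w | J i -> jump_counts w i = v i]).
  apply: bigcapT_measurable => i; case Ji : (J i); last first.
    by rewrite (_ : [set x | _] = setT)//; apply/seteqP; split.
  rewrite (_ : [set x | _] = [set w | jump_counts w i = v i])//.
  by apply/seteqP; split => x /=; [exact|].
by apply/seteqP; split => x hx i; [move=> _; exact: hx|exact: (hx i I)].
Qed.

Lemma decode_jump_counts : {ae mu, forall w, decode (jump_counts w) = jump_sum B w}.
Proof.
have fin : {ae mu, forall w, forall n, exists j : nat, marks R w (B `*` [set n]) = j%:R%:E}.
  by apply/ae_foralln => n; apply: marks_finite => //; rewrite Bh ltry.
apply: filterS fin => w hw; apply/colP => i; rewrite [LHS]mxE [RHS]mxE; congr fine.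
apply: eq_eseriesr => n _; have [j hj] := hw n.
by rewrite /jump_counts hj/= natrK.
Qed.

Definition count_pmf k : \bar R := (h ^+ k * k`!%:R^-1 * expR (- h))%:E.

Lemma jump_counts_law J v p : bounded_support J p ->
  mu (jump_counts @^-1` constrained J v) =
  (\prod_(n < p) if J n then count_pmf (v n) else 1)%E.
Proof.
move=> Jp.
pose A (n : 'I_p) : set (\bar R) := if J n then [set (v n)%:R%:E] else setT.
have mA n : measurable (A n) by rewrite /A; case: (J n) => //; exact: emeasurable_set1.
have [_ _ _ indep] := marks_prm_intensity R.
have mE (n : 'I_p) : measurable (B `*` [set (n : nat)]) by exact: measurable_slice.
have tE : trivIset [set: 'I_p] (fun n : 'I_p => B `*` [set (n : nat)]).
  by move=> i j _ _ [q [[_ /= qi] [_ /= qj]]]; apply/val_inj; rewrite /= -qi -qj.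
have := indep p _ mE tE A mA; set C := \bigcap_(i in _) _ => hC.
have mC : measurable C.
  apply: fin_bigcap_measurable => // i _; rewrite -[X in measurable X]setTI; exact: mX.
transitivity (mu C).
  have fin : {ae mu, forall w, forall n, exists j : nat, marks R w (B `*` [set n]) = j%:R%:E}.
    by apply/ae_foralln => n; apply: marks_finite => //; rewrite Bh ltry.
  apply: measure_ae_eq => //.
    rewrite -[X in measurable X]setTI; apply: measurable_jump_counts => //.
    by apply: sub_sigma_algebra; right; exists J, v, p.
  apply: filterS fin => w hw; split.
    move=> Jv n _ /=; rewrite /A; case Jn : (J n) => //=.
    have [j hj] := hw n; have := Jv n Jn; rewrite /jump_counts hj [fine _]/= natrK => <-.
    exact: hj.
  move=> Cw n Jn.
  have e0 : A (Ordinal (Jp n Jn)) (marks R w (B `*` [set n])) := Cw (Ordinal (Jp n Jn)) I.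
  have e : marks R w (B `*` [set n]) = (v n)%:R%:E.
    by move: e0; rewrite /A [nat_of_ord _]/= Jn.
  by rewrite /jump_counts e [fine _]/= natrK.
rewrite hC; apply: eq_bigr => n _; rewrite /A; case: (J n).
  rewrite [LHS](prm_poisson (marks_prm_intensity R) (v n) (mE n)).
    by rewrite /= marks_intensity_slice// Bh.
  by rewrite /= marks_intensity_slice// Bh ltry.
by rewrite preimage_setT; exact: probability_setT.
Qed.

End OneSet.

Lemma jump_sum_law (B B' : set R) (h : R) (A : set 'cV[R]_d) :
  measurable B -> (forall s, B s -> 0 <= s) -> leb B = h%:E ->
  measurable B' -> (forall s, B' s -> 0 <= s) -> leb B' = h%:E ->
  measurable A -> mu [set w | A (jump_sum B w)] = mu [set w | A (jump_sum B' w)].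
Proof.
move=> mB B0 Bh mB' B'0 B'h mA.
have mJ (C : set R) : measurable C -> measurable [set w | A (jump_sum C w)].
  move=> mC; have mj : measurable_fun setT (jump_sum C).
    apply: (measurable_jump_sum (g := fun w : streams => w)) => n.
    by apply: measurable_clusters; [exact: measurable_mark_point|exact: measurable_slice].
  by have := mj measurableT _ mA; rewrite setTI.
pose D := decode @^-1` A.
have mD : measurable D by rewrite -[X in measurable X]setTI; exact: measurable_decode.
have step (C : set R) : measurable C -> (forall s, C s -> 0 <= s) -> leb C = h%:E ->
    mu [set w | A (jump_sum C w)] = mu (jump_counts C @^-1` D).
  move=> mC C0 Ch; apply: measure_ae_eq; first exact: mJ.
    by rewrite -[X in measurable X]setTI; exact: (measurable_jump_counts mC).
  apply: filterS (decode_jump_counts mC C0 Ch) => w e.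
  by change (A (jump_sum C w) <-> A (decode (jump_counts C w))); rewrite e.
apply: etrans (step _ mB B0 Bh) _; apply/esym/(etrans (step _ mB' B'0 B'h))/esym.
pose m1 := pushm mu (measurable_jump_counts mB).
pose m2 := pushm mu (measurable_jump_counts mB').
have m12 S : constraints S -> m1 S = m2 S.
  move=> [->|[J [v [p [Jp ->]]]]]; first by rewrite !measure0.
  exact: etrans (jump_counts_law mB B0 Bh v Jp) (esym (jump_counts_law mB' B'0 B'h v Jp)).
have goo : (m1 setT < +oo)%E.
  have -> : m1 setT = 1%E by rewrite /m1 pushmE preimage_setT; exact: probability_setT.
  exact: ltry.
have cover : \bigcup_(k : nat) (setT : set counts) = setT.
  by apply/seteqP; split => // x _; exists 0%N.
exact: (@measure_unique _ R counts (@constraints nat) (fun=> setT) (erefl _)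
  (@setI_closed_constraints nat) (fun=> constraintsT 0%N) cover m1 m2 m12 (fun=> goo) D mD).
Qed.

Lemma jump_process_stationary : stationary_increments mu jump_process.
Proof.
move=> s h A s0 h0 mA.
have mS (r t : R) : measurable [set w | A (jump_process t w - jump_process r w)].
  have mf : measurable_fun setT (fun w => jump_process t w - jump_process r w : 'cV[R]_d).
    apply: measurable_fun_addmx; first exact: measurable_jump_process.
    by apply: measurable_fun_oppmx; exact: measurable_jump_process.
  by have := mf measurableT _ mA; rewrite setTI.
pose A' := [set v : 'cV[R]_d | A (v - h *: drift R d)].
have mA' : measurable A'.
  have mf : measurable_fun setT (fun v : 'cV[R]_d => v - h *: drift R d).
    by apply: measurable_fun_addmx; [exact: measurable_id|exact: measurable_cst].
  by have := mf measurableT _ mA; rewrite setTI.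
have mJ (C : set R) : measurable C -> measurable [set w | A' (jump_sum C w)].
  move=> mC; have mj : measurable_fun setT (jump_sum C).
    apply: (measurable_jump_sum (g := fun w : streams => w)) => n.
    by apply: measurable_clusters; [exact: measurable_mark_point|exact: measurable_slice].
  by have := mj measurableT _ mA'; rewrite setTI.
have step (r : R) : 0 <= r -> mu [set w | A (jump_process (r + h) w - jump_process r w)] =
    mu [set w | A' (jump_sum `]r, r + h] w)].
  move=> r0; apply: measure_ae_eq; first exact: mS.
    exact: mJ.
  apply: filterS (@ae_good_stream R) => w gw.
  by rewrite /A' /= jump_process_increment ?lerDl// addrAC subrr add0r.
rewrite step//; have := step 0 (lexx _); rewrite add0r => ->.
have lI (r : R) : leb `]r, r + h]%classic = h%:E.
  rewrite lebesgue_measure_itv/= lte_fin ltrDl lt_neqAle h0 andbT.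
  by case: eqP => [<-//|_] /=; rewrite -EFinB addrAC subrr add0r.
apply: (@jump_sum_law _ _ h) => //.
- by move=> r /=; rewrite in_itv/= => /andP[sr _]; exact: le_trans s0 (ltW sr).
- by move=> r /=; rewrite in_itv/= => /andP[sr _]; exact: ltW.
- by have := lI 0; rewrite add0r.
Qed.

Lemma jump_process_levy : is_levy_process mu jump_process.
Proof.
split.
- by move=> t _; exact: measurable_jump_process.
- exact: jump_process0.
- exact: jump_process_independent.
- exact: jump_process_stationary.
- by apply: filterS (@ae_good_stream R) => w; exact: jump_process_cadlag.
Qed.

End Stationarity.

(** Weighted Cauchy-Schwarz, from 2 z y <= y^2 + z^2 with the optimal value z = S / C. *)
Lemma nneseries_square (R : realType) (c y : nat -> R) (C S : R) :
  (forall n, 0 <= c n) -> (forall n, 0 <= y n) -> 0 < C ->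
  (\sum_(0 <= n <oo) (c n)%:E = C%:E)%E -> (\sum_(0 <= n <oo) (c n * y n)%:E = S%:E)%E ->
  ((S ^+ 2)%:E <= C%:E * \sum_(0 <= n <oo) (c n * y n ^+ 2)%:E)%E.
Proof.
move=> c0 y0 C0 cC cyS; set Q := (\sum_(0 <= n <oo) (c n * y n ^+ 2)%:E)%E.
have Q0 : (0 <= Q)%E by apply: nneseries_ge0 => n _ _; rewrite lee_fin mulr_ge0// sqr_ge0.
have S0 : 0 <= S.
  by rewrite -lee_fin -cyS; apply: nneseries_ge0 => n _ _; rewrite lee_fin mulr_ge0.
have [<-|Sn] := eqVneq 0 S; first by rewrite expr0n/= mule_ge0// lee_fin ltW.
have {S0 Sn} S0 : 0 < S by rewrite lt_neqAle Sn.
have [Qoo|] := eqVneq Q +oo%E; first by rewrite Qoo gt0_muley ?leey// lte_fin.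
move=> Qoo; have Qfin : Q \is a fin_num by rewrite ge0_fin_numE// lt_neqAle Qoo leey.
pose q := fine Q; have Qq : Q = q%:E by rewrite fineK.
pose z := S / C; have z0 : 0 < z by rewrite divr_gt0.
have : ((2 * z * S)%:E <= Q + (z ^+ 2 * C)%:E)%E.
  rewrite EFinM -cyS -nneseriesZl; last by move=> n _; rewrite lee_fin mulr_ge0.
  rewrite (EFinM (z ^+ 2)) -cC -nneseriesZl -?nneseriesD.
  - apply: lee_nneseries => [n _ _|n _]; rewrite -EFinM -?EFinD lee_fin.
      by apply: mulr_ge0; [rewrite mulr_ge0// ltW|exact: mulr_ge0].
    have : 0 <= c n * (y n - z) ^+ 2 by rewrite mulr_ge0// sqr_ge0.
    by rewrite sqrrB; lra.
  - by move=> n _ _; rewrite lee_fin mulr_ge0// sqr_ge0.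
  - by move=> n _ _; rewrite -EFinM lee_fin mulr_ge0// sqr_ge0.
  - by move=> n _; rewrite lee_fin.
rewrite Qq -EFinD -EFinM !lee_fin /z expr2 => h.
have e1 : 2 * (S / C) * S = 2 * (S ^+ 2 / C) by rewrite expr2; ring.
have e2 : S / C * (S / C) * C = S ^+ 2 / C by rewrite expr2 mulrA divfK ?gt_eqF//; ring.
move: h; rewrite e1 e2 mulr_natl mulr2n lerD2r ler_pdivrMr// mulrC.
by [].
Qed.

(** * The compensated sum as an L2-limit *)

Section LevyIto.
Context (R : realType) (d : nat).
Local Notation mu := (coin_tossing R).
Local Notation leb := (@lebesgue_measure R).
Local Notation jump := (jump R d).
Local Notation jump_sum := (@jump_sum R d).
Local Notation jump_process := (@jump_process R d).
Local Notation jump_prm := (@jump_prm R d).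
Local Notation jump_measure := (jump_measure R d).

Definition weighted_sum (a : nat -> R) (B : set R) (w : streams) : R :=
  fine (\sum_(0 <= n <oo) (a n)%:E * marks R w (B `*` [set n]))%E.

Lemma measurable_weighted_sum a B : (forall n, 0 <= a n) -> measurable B ->
  measurable_fun setT (weighted_sum a B).
Proof.
move=> a0 mB; apply: (measurableT_comp (f := fine)); first exact: fine_measurable.
apply: ge0_emeasurable_sum => [n s _ _|n _]; first by rewrite mule_ge0// lee_fin.
apply: emeasurable_funM; first exact: measurable_cst.
by apply: measurable_clusters; [exact: measurable_mark_point|exact: measurable_slice].
Qed.

Lemma weighted_sum_fin a (t : R) w : (forall n, 0 <= a n <= scale R n) -> good_stream R w ->
  (\sum_(0 <= n <oo) (a n)%:E * marks R w (`[0%R, t] `*` [set n]))%E \is a fin_num.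
Proof.
move=> a0 gw; rewrite ge0_fin_numE; last first.
  by apply: nneseries_ge0 => n _ _; rewrite mule_ge0// lee_fin; case/andP: (a0 n).
by apply: (@nneseries_coefficients_lt R a (scale R)) => //; exact: (weight_finite (t := t)).
Qed.

Lemma jump_vintegral w (B : set R) (V : set 'cV[R]_d) i : measurable B -> measurable V ->
  vintegral (jump_prm w) (B `*` V) snd i 0 =
  weighted_sum (fun n => jump n i 0 * \1_V (jump n)) B w.
Proof.
move=> mB mV; rewrite mxE /Rintegral /weighted_sum; congr fine.
have mi : measurable_fun setT (fun u : 'cV[R]_d => u i 0) by exact: measurable_mx_entry.
have mp : measurable_fun setT (fun p : R * 'cV[R]_d => p.2 i 0).
  by apply: (measurableT_comp (f := fun u : 'cV[R]_d => u i 0)).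
transitivity (\int[jump_prm w]_(p in B `*` V) (`|p.2 i 0|)%:E)%E.
  apply: ae_eq_integral; first exact: measurableX.
  - by apply: measurable_funTS; exact/measurable_EFinP.
  - by apply: measurable_funTS; apply/measurable_EFinP; apply: measurableT_comp.
  exists [set p : R * 'cV[R]_d | p.2 i 0 < 0]; split.
  - by apply: measurable_set_lt => //; exact: measurable_cst.
  - rewrite /jump_prm pushmE restmE (_ : _ `&` _ = set0) ?measure0//.
    by apply/seteqP; split => // q [/=]; rewrite ltNge jump_ge0.
  - move=> p /= h; rewrite ltNge; apply/negP => p0; apply: h => _.
    by rewrite ger0_norm.
rewrite (@jump_prm_integral R d w B V (fun u => `|u i 0|))//.
- by apply: eq_eseriesr => n _; rewrite ger0_norm ?jump_ge0.
- exact: measurableT_comp.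
- by rewrite mxE normr0.
Qed.

Lemma jump_measure_vintegral (V : set 'cV[R]_d) i : measurable V ->
  vintegral jump_measure V id i 0 =
  fine (\sum_(0 <= n <oo) (jump n i 0 * \1_V (jump n))%:E)%E.
Proof.
move=> mV; rewrite mxE /Rintegral; congr fine.
have mi : measurable_fun setT (fun u : 'cV[R]_d => u i 0) by exact: measurable_mx_entry.
transitivity (\int[jump_measure]_(p in V) (`|p i 0|)%:E)%E.
  apply: ae_eq_integral => //.
  - by apply: measurable_funTS; exact/measurable_EFinP.
  - by apply: measurable_funTS; apply/measurable_EFinP; apply: measurableT_comp.
  exists [set p : 'cV[R]_d | p i 0 < 0]; split.
  - by apply: measurable_set_lt => //; exact: measurable_cst.
  - rewrite jump_measureE eseries0// => n _ _; rewrite memNset//=.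
    by rewrite ltNge jump_ge0.
  - move=> p /= h; rewrite ltNge; apply/negP => p0; apply: h => _.
    by rewrite ger0_norm.
rewrite (@jump_measure_integral R d V (fun u => `|u i 0|))//.
- by apply: eq_eseriesr => n _; rewrite ger0_norm ?jump_ge0.
- exact: measurableT_comp.
- by rewrite mxE normr0.
Qed.

Let measurable_band (e : R) : measurable [set u : 'cV[R]_d | e < enorm u <= 1].
Proof.
rewrite (_ : mkset _ = [set u | e < enorm u] `&` [set u | enorm u <= 1]).
  apply: measurableI; [apply: measurable_set_lt|apply: measurable_set_le];
    by [exact: measurable_cst|exact: measurable_enorm].
by apply/seteqP; split => u /= => [/andP[]|[-> ->]].
Qed.

Lemma scale_le1 n : scale R n <= 1.
Proof. by apply: le_trans (scale_le R n) _; rewrite exprn_ile1// invf_le1// ler1n. Qed.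

Lemma scale_decreasing n k : (n <= k)%N -> scale R k <= scale R n.
Proof.
elim: k => [|k IH]; first by rewrite leqn0 => /eqP ->.
rewrite leq_eqVlt => /predU1P[->//|nk]; apply: le_trans (IH nk).
by rewrite scaleS ler_piMr ?(ltW (scale_gt0 _ _))// exprn_ile1// invf_le1// ler1n.
Qed.

Definition tail_scale (K n : nat) : R := if (K <= n)%N then scale R n else 0.

Let tail0 K n : 0 <= tail_scale K n <= scale R n.
Proof. by rewrite /tail_scale; case: ifP => _; rewrite ?lexx ltW// scale_gt0. Qed.

Let tail_total K := fine (\sum_(0 <= n <oo) (tail_scale K n)%:E)%E.

Let scale_sum_fin (a : nat -> R) : (forall n, 0 <= a n <= scale R n) ->
  (\sum_(0 <= n <oo) (a n)%:E)%E \is a fin_num.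
Proof.
move=> a0; rewrite ge0_fin_numE; last first.
  by apply: nneseries_ge0 => n _ _; rewrite lee_fin; case/andP: (a0 n).
apply: le_lt_trans (scale_summable R); apply: lee_nneseries => [n _ _|n _]; rewrite lee_fin;
  by case/andP: (a0 n).
Qed.

Let tail_totalE K : (\sum_(0 <= n <oo) (tail_scale K n)%:E = (tail_total K)%:E)%E.
Proof. by rewrite fineK//; exact: scale_sum_fin. Qed.

Let tail_total_gt0 K : 0 < tail_total K.
Proof.
rewrite -lte_fin -tail_totalE; apply: (@lt_le_trans _ _ (tail_scale K K)%:E).
  by rewrite lte_fin /tail_scale leqnn scale_gt0.
apply: le_trans (nneseries_lim_ge (P := xpredT) K.+1 _); last first.
  by move=> n _ _; rewrite lee_fin; case/andP: (tail0 K n).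
rewrite big_nat_recr//= leeDr// sume_ge0// => n _.
by rewrite lee_fin; case/andP: (tail0 K n).
Qed.

Let tail_total_cvg : tail_total @ \oo --> 0.
Proof.
have h : (\sum_(K <= n <oo) (scale R n)%:E)%E @[K --> \oo] --> 0%E.
  apply: nneseries_tail_cvg; first exact: scale_summable.
  by move=> n _; rewrite lee_fin ltW// scale_gt0.
rewrite (_ : tail_total = fine \o (fun K => \sum_(K <= n <oo) (scale R n)%:E)%E).
  exact: (fine_cvg h).
apply/funext => K; rewrite /= /tail_total; congr fine.
rewrite [RHS](eseries_cond _ xpredT) [RHS]eseries_mkcond; apply: eq_eseriesr => n _ /=.
by rewrite /tail_scale; case: ifP.
Qed.

(* The jumps of norm at most eps < scale K all have index beyond K. *)
Lemma small_jump_le (eps : R) K n i : eps < scale R K ->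
  jump n i 0 * \1_(~` [set u : 'cV[R]_d | eps < enorm u <= 1]) (jump n) <= tail_scale K n.
Proof.
move=> eK; have /andP[t0 _] := tail0 K n.
have [->|jn] := eqVneq (jump n i 0) 0; first by rewrite mul0r.
rewrite indicE; case: (boolP (_ \in _)) => [|_]; last by rewrite mulr0.
rewrite inE /= mulr1 => /negP; rewrite negb_and -leNgt -ltNge => /orP[h|h]; last first.
  have := lt_le_trans h (le_trans (enorm_jump R d n) (scale_le1 n)); by rewrite ltxx.
have js : jump n i 0 = scale R n.
  by move: jn; rewrite !mxE; case: ((n %% d)%N == i) => /=; rewrite ?mulr1// mulr0 eqxx.
have sK : scale R n < scale R K.
  apply: le_lt_trans eK; apply: le_trans h; rewrite -js.
  by rewrite -[leLHS]ger0_norm ?jump_ge0// enorm_entry_le.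
rewrite js /tail_scale leqNgt; case: ltnP => // nK.
by have := lt_le_trans sK (scale_decreasing (ltnW nK)); rewrite ltxx.
Qed.

(** The retained jumps cancel exactly, together with their compensators. What is left consists of
    discarded jumps, whose coefficients are bounded by [tail_scale K]. *)
Lemma truncation_error (eps t : R) K w i : 0 <= t -> eps < scale R K -> good_stream R w ->
  `|(jump_process t w - truncated_small_jumps jump_measure jump_prm eps t w) i 0| <=
  weighted_sum (tail_scale K) `[0, t] w + t * tail_total K.
Proof.
move=> t0 eK gw; pose V := [set u : 'cV[R]_d | eps < enorm u <= 1].
have mV : measurable V by exact: measurable_band.
pose a1 n := jump n i 0 * \1_V (jump n); pose a2 n := jump n i 0 * \1_(~` V) (jump n).
have i01 (C : set 'cV[R]_d) u : 0 <= (\1_C u : R) <= 1.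
  by rewrite indicE; case: (_ \in _); rewrite ?lexx ?ler01.
have a01 (C : set 'cV[R]_d) n : 0 <= jump n i 0 * \1_C (jump n) <= scale R n.
  have /andP[u0 u1] := i01 C (jump n); have j0 := jump_ge0 R n i.
  by rewrite mulr_ge0//= (le_trans _ (jump_le R n i))// ler_piMr.
have aD n : jump n i 0 = a1 n + a2 n.
  rewrite /a1 /a2 -mulrDr !indicE in_setC.
  by case: (_ \in _); rewrite ?addr0 ?add0r mulr1.
have fa1 n : 0 <= a1 n <= scale R n := a01 V n.
have fa2 n : 0 <= a2 n <= scale R n := a01 (~` V) n.
have W1 := weighted_sum_fin t fa1 gw; have W2 := weighted_sum_fin t fa2 gw.
have D1 := scale_sum_fin fa1; have D2 := scale_sum_fin fa2.
have wD : jump_sum `[0, t] w i 0 = weighted_sum a1 `[0, t] w + weighted_sum a2 `[0, t] w.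
  rewrite [LHS]mxE /weighted_sum -fineD//.
  rewrite -nneseriesD; last 2 first.
  - by move=> n _ _; rewrite mule_ge0// lee_fin; case/andP: (a01 V n).
  - by move=> n _ _; rewrite mule_ge0// lee_fin; case/andP: (a01 (~` V) n).
  congr fine; apply: eq_eseriesr => n _.
  rewrite aD EFinD ge0_muleDl// lee_fin; [by case/andP: (a01 V n)|by case/andP: (a01 (~` V) n)].
have dD : drift R d i 0 = fine (\sum_(0 <= n <oo) (a1 n)%:E)%E + fine (\sum_(0 <= n <oo) (a2 n)%:E)%E.
  rewrite [LHS]mxE -fineD//.
  rewrite -nneseriesD; last 2 first.
  - by move=> n _ _; rewrite lee_fin; case/andP: (a01 V n).
  - by move=> n _ _; rewrite lee_fin; case/andP: (a01 (~` V) n).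
  by congr fine; apply: eq_eseriesr => n _; rewrite aD EFinD.
have -> : (jump_process t w - truncated_small_jumps jump_measure jump_prm eps t w) i 0 =
    weighted_sum a2 `[0, t] w - t * fine (\sum_(0 <= n <oo) (a2 n)%:E)%E.
  have -> : (jump_process t w - truncated_small_jumps jump_measure jump_prm eps t w) i 0 =
    jump_process t w i 0 - (vintegral (jump_prm w) (`[0, t] `*` V) snd i 0 -
      t * vintegral jump_measure V id i 0).
    by rewrite [LHS]mxE; congr (_ + _); rewrite [LHS]mxE; congr (- _);
      rewrite [LHS]mxE; congr (_ + _); rewrite [LHS]mxE; congr (- _); rewrite [LHS]mxE.
  rewrite jump_processE wD dD jump_vintegral// jump_measure_vintegral//.
  rewrite -/a1; move: (weighted_sum _ _ _) (weighted_sum _ _ _) (fine _) (fine _) => x y u v; ring.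
have le2 n : 0 <= a2 n <= tail_scale K n.
  by rewrite small_jump_le// andbT; case/andP: (a01 (~` V) n).
apply: (le_trans (ler_normB _ _)); rewrite normrM (ger0_norm t0).
have w0 a : (forall n, 0 <= a n) -> 0 <= weighted_sum a `[0, t] w.
  move=> a0; apply: fine_ge0; apply: nneseries_ge0 => n _ _.
  by rewrite mule_ge0// lee_fin.
rewrite !ger0_norm ?fine_ge0 ?w0//; last 2 first.
- by apply: nneseries_ge0 => n _ _; rewrite mule_ge0// lee_fin; case/andP: (le2 n).
- by apply: nneseries_ge0 => n _ _; rewrite lee_fin; case/andP: (le2 n).
apply: lerD.
  apply: fine_le; try exact: weighted_sum_fin.
  apply: lee_nneseries => [n _ _|n _].
    by rewrite mule_ge0// lee_fin; case/andP: (le2 n).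
  by apply: lee_wpmul2r => //; rewrite lee_fin; case/andP: (le2 n).
apply: ler_wpM2l => //; apply: fine_le; try exact: scale_sum_fin.
apply: lee_nneseries => [n _ _|n _]; rewrite lee_fin; by case/andP: (le2 n).
Qed.

Lemma jump_process_levy_ito : is_levy_ito mu jump_measure jump_prm jump_process.
Proof.
move=> t t0; exists (jump_process t); last first.
  apply: aeW => w; rewrite (_ : large_jumps _ _ _ = 0) ?add0r//; apply/colP => i.
  rewrite jump_vintegral//; last first.
    by apply: measurable_set_lt; [exact: measurable_cst|exact: measurable_enorm].
  rewrite mxE /weighted_sum eseries0// => n _ _.
  rewrite indicE memNset ?mulr0 ?mul0e//= => h.
  by have := lt_le_trans h (le_trans (enorm_jump R d n) (scale_le1 n)); rewrite ltxx.
split; first exact: measurable_jump_process.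
(* A bound for the second moment of a count plus t, from (a + b)^2 <= 2 a^2 + 2 b^2 and
   [marks_second_moment]. *)
pose M : R := 2 * (2 * expR t) + 2 * t ^+ 2.
have mI : measurable (`[0%R, t]%classic : set R) by exact: measurable_itv.
have I0 s : (`[0%R, t]%classic : set R) s -> 0 <= s by rewrite /= in_itv/= => /andP[].
have It : leb `[0%R, t]%classic = t%:E.
  rewrite lebesgue_measure_itv/= lte_fin oppr0 adde0.
  by case: ltP => // h; congr EFin; apply/eqP; rewrite eq_le h t0.
have mN n : measurable_fun setT (fun w => fine (marks R w (`[0%R, t]%classic `*` [set n]))).
  apply: (measurableT_comp (f := fine)); first exact: fine_measurable.
  by apply: measurable_clusters; [exact: measurable_mark_point|exact: measurable_slice].
pose y n w := fine (marks R w (`[0%R, t]%classic `*` [set n])) + t.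
have y0 n w : 0 <= y n w by rewrite addr_ge0// fine_ge0.
have Ey n : (\int[mu]_w (y n w ^+ 2)%:E <= M%:E)%E.
  apply: (@le_trans _ _ (\int[mu]_w (2%:E * (fine (marks R w (`[0%R, t]%classic `*` [set n])) ^+ 2)%:E + (2 * t ^+ 2)%:E))%E).
    apply: ge0_le_integral => //.
    - by move=> w _; rewrite lee_fin sqr_ge0.
    - by apply/measurable_EFinP; apply: measurable_funX; exact: measurable_funD.
    - apply: emeasurable_funD => //; apply: emeasurable_funM => //.
      by apply/measurable_EFinP; exact: measurable_funX.
    - move=> w _; rewrite -EFinM -EFinD lee_fin /y.
      have := sqr_ge0 (fine (marks R w (`[0%R, t]%classic `*` [set n])) - t); rewrite sqrrB sqrrD; lra.
  have m2 : measurable_fun setT (fun w => (fine (marks R w (`[0%R, t]%classic `*` [set n])) ^+ 2)%:E).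
    by apply/measurable_EFinP; exact: measurable_funX.
  have m22 : measurable_fun setT (fun w => 2%:E * (fine (marks R w (`[0%R, t]%classic `*` [set n])) ^+ 2)%:E)%E.
    by apply: emeasurable_funM.
  rewrite ge0_integralD//; try by move=> w _; rewrite -?EFinM lee_fin mulr_ge0// sqr_ge0.
  rewrite ge0_integralZl//; try by move=> w _; rewrite lee_fin sqr_ge0.
  have -> : (\int[mu]__ (2 * t ^+ 2)%:E = (2 * t ^+ 2)%:E)%E.
    by rewrite integral_cst// -[RHS]mule1; congr (_ * _)%E; exact: probability_setT.
  have -> : M%:E = (2%:E * (2 * expR t)%:E + (2 * t ^+ 2)%:E)%E by [].
  by apply: leeD => //; apply: lee_wpmul2l => //; exact: marks_second_moment.
have mtrunc eps : measurable_fun setT (fun w => truncated_small_jumps jump_measure jump_prm eps t w).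
  apply: measurable_fun_addmx; last exact: measurable_cst.
  apply: measurable_fun_mx => i j; rewrite ord1.
  rewrite (_ : (fun w => _) = weighted_sum (fun n => jump n i 0 * \1_[set u : 'cV[R]_d | eps < enorm u <= 1] (jump n)) `[0, t]).
    by apply: measurable_weighted_sum => // n; rewrite mulr_ge0 ?jump_ge0// indicE.
  by apply/funext => w; rewrite jump_vintegral//; exact: measurable_band.
pose err eps w := enorm (jump_process t w - truncated_small_jumps jump_measure jump_prm eps t w) ^+ 2.
have merr eps : measurable_fun setT (err eps).
  apply: measurable_funX; apply: (measurableT_comp (f := @enorm R d)); first exact: measurable_enorm.
  apply: measurable_fun_addmx; first exact: measurable_jump_process.
  exact: measurable_fun_oppmx.
have fin : {ae mu, forall w, forall n, exists j : nat, marks R w (`[0%R, t]%classic `*` [set n]) = j%:R%:E}.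
  by apply/ae_foralln => n; apply: marks_finite => //; rewrite It ltry.
have tail_ge0 K n : 0 <= tail_scale K n by case/andP: (tail0 K n).
pose G K w : \bar R := (\sum_(0 <= n <oo) (tail_scale K n * y n w ^+ 2)%:E)%E.
have mG1 K n : measurable_fun setT (fun w => (tail_scale K n * y n w ^+ 2)%:E).
  apply/measurable_EFinP; apply: measurable_funM => //; apply: measurable_funX.
  exact: measurable_funD.
have G0 K w : (0 <= G K w)%E.
  by apply: nneseries_ge0 => n _ _; rewrite lee_fin mulr_ge0// sqr_ge0.
have mG K : measurable_fun setT (G K).
  by apply: ge0_emeasurable_sum => // n w _ _; rewrite lee_fin mulr_ge0// sqr_ge0.
have EG K : (\int[mu]_w G K w <= (tail_total K * M)%:E)%E.
  rewrite integral_nneseries//; last by move=> n w _; rewrite lee_fin mulr_ge0// sqr_ge0.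
  apply: (@le_trans _ _ (\sum_(0 <= n <oo) (M%:E * (tail_scale K n)%:E))%E).
    apply: lee_nneseries => [n _ _|n _].
      by apply: integral_ge0 => w _; rewrite lee_fin mulr_ge0// sqr_ge0.
    under eq_integral do rewrite EFinM.
    have mY : measurable_fun setT (fun w => (y n w ^+ 2)%:E).
      by apply/measurable_EFinP; apply: measurable_funX; exact: measurable_funD.
    rewrite ge0_integralZl ?lee_fin//; try by move=> w _; rewrite lee_fin sqr_ge0.
    by rewrite muleC lee_wpmul2r// lee_fin.
  rewrite nneseriesZl; last by move=> n _; rewrite lee_fin.
  by rewrite tail_totalE -EFinM mulrC.
(* Cauchy-Schwarz takes one tail total out of the square; the expectation of [G K] supplies a second
   one, so the error vanishes as K grows. *)
have point K eps w : eps < scale R K -> good_stream R w ->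
    (forall n, exists j : nat, marks R w (`[0%R, t]%classic `*` [set n]) = j%:R%:E) ->
    ((err eps w)%:E <= (d%:R * tail_total K)%:E * G K w)%E.
  move=> eK gw finw; set T := weighted_sum (tail_scale K) `[0, t] w + t * tail_total K.
  have TT : (\sum_(0 <= n <oo) (tail_scale K n * y n w)%:E = T%:E)%E.
    rewrite /T EFinD fineK; last by apply: weighted_sum_fin => //; exact: tail0.
    rewrite EFinM -tail_totalE -nneseriesZl; last by move=> n _; rewrite lee_fin.
    rewrite -nneseriesD; last 2 first.
    - by move=> n _ _; rewrite mule_ge0// lee_fin.
    - by move=> n _ _; rewrite -EFinM lee_fin mulr_ge0.
    apply: eq_eseriesr => n _; rewrite /y; have [j ->] := finw n.
    by rewrite -!EFinM -EFinD mulrDr [t * _]mulrC.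
  have T2 := nneseries_square (tail_ge0 K) (fun n => y0 n w) (tail_total_gt0 K) (tail_totalE K) TT.
  rewrite (EFinM d%:R) -muleA; apply: (@le_trans _ _ (d%:R%:E * (T ^+ 2)%:E)%E); last first.
    by apply: lee_wpmul2l => //; rewrite lee_fin.
  rewrite -EFinM lee_fin /err /enorm sqr_sqrtr; last by apply: sumr_ge0 => i _; exact: sqr_ge0.
  apply: (@le_trans _ _ (\sum_(i < d) T ^+ 2)); last by rewrite sumr_const card_ord mulr_natl.
  apply: ler_sum => i _; rewrite -real_normK ?num_real//.
  have h := truncation_error i t0 eK gw.
  by rewrite ler_pXn2r ?nnegrE// (le_trans _ h).
have key K eps : eps < scale R K ->
    (\int[mu]_w (err eps w)%:E <= (d%:R * tail_total K * (tail_total K * M))%:E)%E.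
  move=> eK; apply: (@le_trans _ _ (\int[mu]_w ((d%:R * tail_total K)%:E * G K w))%E).
    apply: ae_ge0_le_integral => //.
    - by move=> w _; rewrite lee_fin sqr_ge0.
    - exact/measurable_EFinP.
    - by move=> w _; rewrite mule_ge0// lee_fin mulr_ge0// ltW.
    - by apply: emeasurable_funM => //; exact: measurable_cst.
    - apply: filterS2 (@ae_good_stream R) fin => w gw fw _; exact: point.
  have dC0 : 0 <= d%:R * tail_total K by rewrite mulr_ge0// ltW.
  rewrite ge0_integralZl ?lee_fin//; rewrite [leRHS]EFinM; apply: lee_wpmul2l; rewrite ?lee_fin//.
have M0 : 0 <= M by rewrite addr_ge0 ?mulr_ge0 ?expR_ge0 ?sqr_ge0.
have lim : (fun K => d%:R * tail_total K * (tail_total K * M)) @ \oo --> 0.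
  rewrite -[X in _ --> X](mulr0 (d%:R * 0)) -[X in _ * X](mul0r M).
  apply: cvgM; first by apply: cvgM; [exact: cvg_cst|exact: tail_total_cvg].
  by apply: cvgM; [exact: tail_total_cvg|exact: cvg_cst].
have I0' eps : (0 <= \int[mu]_w (err eps w)%:E)%E.
  by apply: integral_ge0 => w _; rewrite lee_fin sqr_ge0.
have fin' K eps : eps < scale R K -> (\int[mu]_w (err eps w)%:E)%E \is a fin_num.
  by move=> eK; rewrite ge0_fin_numE// (le_lt_trans (key _ _ eK))// ltry.
apply/fine_cvgP; split.
  near=> eps; apply: (fin' 0%N); near: eps; apply: nbhs_right_lt; exact: scale_gt0.
apply/cvgrPdist_lt => e e0.
have /filter_ex[K] : \forall K \near \oo, d%:R * tail_total K * (tail_total K * M) < e.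
  exact: (cvgr_lt _ lim).
move=> Ke; near=> eps.
have eK : eps < scale R K by near: eps; apply: nbhs_right_lt; exact: scale_gt0.
rewrite sub0r normrN /= ger0_norm; last by apply: fine_ge0; exact: I0'.
apply: le_lt_trans Ke.
by rewrite -lee_fin fineK ?(fin' K)//; exact: key.
Unshelve. all: by end_near. Qed.

End LevyIto.

(** * The equation driven by the sparse process *)

Section SolutionPath.
Context (R : realType) (m : nat) (A : 'M[R]_m) (v : R -> 'cV[R]_m).
Local Notation leb := (@lebesgue_measure R).
Hypotheses (mv : measurable_fun setT v)
  (bv : forall t i, bounded_on `[0, t] (fun s => v s i 0)).

Let x s := v s + vintegral leb `[0, s] (fun r => exp_mx A (s - r) *m A *m v r).

Let k i (p : R * R) := (exp_mx A (p.1 - p.2) *m A *m v p.2) i 0.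

Let mk i : measurable_fun setT (k i).
Proof.
apply: measurable_fun_mx_entry; apply: measurable_fun_mulmx.
  apply: measurable_fun_mulmx; last exact: measurable_cst.
  by apply: measurable_exp_mx; exact: measurable_funB.
by apply: (measurableT_comp mv); exact: measurable_snd.
Qed.

Let bk t i : bounded_on (`[0, t] `*` `[0, t]) (k i).
Proof.
apply: bounded_on_mulmx => [a b|a b]; last first.
  by rewrite ord1; have [M EM] := bv t a; exists M => p [/= p1 p2]; exact: EM.
apply: bounded_on_mulmx => a' b'; last exact: bounded_on_cst.
have [M EM] := @bounded_exp_mx R m A (- t) t a' b'; exists M => -[s r] /= [].
rewrite /= !in_itv/= => /andP[s0 st] /andP[r0 rt].
by apply: EM; rewrite /= in_itv/=; lra.
Qed.

Let xE s i : x s i 0 = v s i 0 + \int[leb]_(r in `[0, s]) k i (s, r).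
Proof. by rewrite [LHS]mxE; congr (_ + _); rewrite [LHS]mxE. Qed.

Lemma solution_path_measurable : measurable_fun (`[0, +oo[ : set R) x.
Proof.
have -> : (`[0, +oo[%classic : set R) = \bigcup_n `[0, n%:R]%classic.
  apply/seteqP; split => s /=; rewrite in_itv/= ?andbT.
    move=> s0; exists (Num.bound s) => //=; rewrite in_itv/= s0 ltW//.
    exact: archi_boundP.
  by move=> [n _]; rewrite /= in_itv/= => /andP[].
apply/measurable_fun_bigcup => n; first exact: measurable_itv.
apply: measurable_fun_mx => i j; rewrite ord1.
rewrite (_ : (fun s => _) = (fun s => v s i 0 + \int[leb]_(r in `[0, s]) k i (s, r))); last first.
  by apply/funext => s; rewrite xE.
apply: measurable_funD; first by apply: measurable_funTS; exact: measurable_fun_mx_entry.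
have := triangle_integrable (mk i) (bk n%:R i) => /integrableP[+ _].
by move/measurable_EFinP.
Qed.

Lemma solution_integrable t i : 0 <= t ->
  leb.-integrable `[0, t] (EFin \o (fun r => (exp_mx A (t - r) *m A *m v r) i 0)).
Proof.
move=> t0; have [M EM] := bk t i.
have ik : leb.-integrable `[0, t] (EFin \o (fun r => k i (t, r))).
  apply: integrable_bounded_on => //; first exact: lebesgue_segment_lty.
    apply: measurable_funTS; apply: (measurableT_comp (mk i)).
    exact: measurable_fun_pair.
  exists M => r rt; apply: EM; split; last exact: rt.
  by rewrite /= in_itv/= t0 lexx.
exact: ik.
Qed.

Lemma solution_path_bounded : locally_bounded x.
Proof.
move=> t t0.
have bx i : bounded_on `[0, t] (fun s => x s i 0).
  have [M EM] := bk t i; have [N vN] := bv t i.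
  exists (N + M * t) => s st; have /andP[s0 ts] : 0 <= s <= t by move: st; rewrite /= in_itv.
  rewrite xE (le_trans (ler_normD _ _))// lerD//; first exact: vN.
  have M0 : 0 <= M.
    apply: le_trans (EM (0, 0) _); first exact: normr_ge0.
    by split; rewrite /= in_itv/= lexx t0.
  have kM r : `[0, s]%classic r -> `|k i (s, r)| <= M.
    rewrite /= in_itv/= => /andP[r0 rs]; apply: EM; split; rewrite /= in_itv/= ?s0 ?r0//.
    exact: le_trans rs ts.
  have ik : leb.-integrable `[0, s] (EFin \o (fun r => k i (s, r))).
    apply: integrable_bounded_on => //; first exact: lebesgue_segment_lty.
      apply: measurable_funTS; apply: (measurableT_comp (mk i)).
      exact: measurable_fun_pair.
    by exists M.
  apply: (le_trans (le_normr_Rintegral _ ik)) => //.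
  apply: (@le_trans _ _ (\int[leb]_(r in `[0, s]) M)).
    apply: le_Rintegral => //.
    - exact: integrable_norm ik.
    - apply: integrable_bounded_on => //; first exact: lebesgue_segment_lty.
      exact: bounded_on_cst.
  rewrite Rintegral_cst//; have -> : fine (leb `[0, s]%classic) = s.
    rewrite lebesgue_measure_itv/= lte_fin oppr0 adde0.
    by case: ltP => // h; apply/eqP; rewrite eq_le s0 h.
  by rewrite ler_wpM2l.
have /choice[M EM] : forall i, exists M, forall s, `[0, t]%classic s -> `|x s i 0| <= M by exact: bx.
exists (Num.sqrt (\sum_i M i ^+ 2)) => s st; rewrite /enorm ler_wsqrtr//.
apply: ler_sum => i _; rewrite -real_normK ?num_real//.
have h : `|x s i 0| <= M i by apply: EM; rewrite /= in_itv.
by rewrite ler_pXn2r ?nnegrE// (le_trans _ h).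
Qed.

End SolutionPath.

Section JumpSolution.
Context (R : realType) (m d : nat) (A : 'M[R]_m) (D : 'M[R]_(m, d)).
Local Notation mu := (coin_tossing R).
Local Notation leb := (@lebesgue_measure R).
Local Notation jump_process := (@jump_process R d).
Local Notation jump_sum := (@jump_sum R d).

Let jump_sum_neg (s : R) w : s < 0 -> jump_sum `[0, s] w = 0.
Proof.
move=> s0; apply/colP => i; rewrite [LHS]mxE mxE eseries0// => n _ _.
rewrite (_ : _ `*` _ = set0) ?measure0 ?mule0//.
apply/seteqP; split => // q [/=]; rewrite in_itv/= => /andP[a b].
by have := lt_le_trans s0 (le_trans a b); rewrite ltxx.
Qed.

Let path_monotone w i : good_stream R w ->
  {homo (fun s => jump_sum `[0, s] w i 0) : s t / s <= t}.
Proof.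
move=> gw s t st; case: (ltP s 0) => s0; last exact: jump_sum_monotone.
by rewrite jump_sum_neg// mxE jump_sum_ge0.
Qed.

Let path_measurable w : good_stream R w -> measurable_fun setT (fun s => jump_process s w).
Proof.
move=> gw; apply: measurable_fun_mx => i j; rewrite ord1.
rewrite (_ : (fun s => _) = (fun s => jump_sum `[0, s] w i 0 - s * drift R d i 0)); last first.
  by apply/funext => s; rewrite jump_processE.
apply: measurable_funB; last by apply: measurable_funM => //; exact: measurable_cst.
by apply: nondecreasing_measurable => //; exact: path_monotone.
Qed.

Let path_bounded w t i : good_stream R w -> bounded_on `[0, t] (fun s => jump_process s w i 0).
Proof.
move=> gw; exists (jump_sum `[0, t] w i 0 + t * `|drift R d i 0|) => s.
rewrite /= in_itv/= => /andP[s0 st]; rewrite jump_processE (le_trans (ler_normB _ _))// lerD//.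
  by rewrite ger0_norm ?jump_sum_ge0//; exact: path_monotone.
by rewrite normrM (ger0_norm s0) ler_wpM2r.
Qed.

Definition forcing (t : R) (w : streams) : 'cV[R]_m := D *m jump_process t w.

Definition raw_solution (t : R) (w : streams) : 'cV[R]_m :=
  forcing t w + vintegral leb `[0, t] (fun s => exp_mx A (t - s) *m A *m forcing s w).

(** Set to zero off the good streams, where the defining series may be infinite, so that
    measurability has to be checked along good paths only. *)
Definition jump_solution (t : R) (w : streams) : 'cV[R]_m :=
  (\1_[set w | good_stream R w] w : R) *: raw_solution t w.

Let forcing_measurable w : good_stream R w -> measurable_fun setT (fun s => forcing s w).
Proof.
by move=> gw; apply: measurable_fun_mulmx; [exact: measurable_cst|exact: path_measurable].
Qed.

Let forcing_bounded w t i : good_stream R w -> bounded_on `[0, t] (fun s => forcing s w i 0).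
Proof.
move=> gw; apply: bounded_on_mulmx => a b; first exact: bounded_on_cst.
by rewrite ord1; exact: path_bounded.
Qed.

Lemma measurable_good_stream : measurable [set w | good_stream R w].
Proof.
rewrite (_ : mkset _ = \bigcap_k [set w | (weight (`[0%R, k%:R%R]%classic : set R) w < +oo)%E]).
  apply: bigcapT_measurable => k.
  have mw : measurable_fun setT (fun w => weight (`[0%R, k%:R%R]%classic : set R) w).
    apply: ge0_emeasurable_sum => [n w _ _|n _].
      by rewrite mule_ge0// lee_fin ltW// scale_gt0.
    apply: emeasurable_funM; first exact: measurable_cst.
    by apply: measurable_clusters; [exact: measurable_mark_point|exact: measurable_slice].
  by have := emeasurable_fun_infty_o measurableT mw +oo%E; rewrite setTI.
by apply/seteqP; split => w h k; [move=> _; exact: h|exact: (h k I)].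
Qed.

Lemma jump_solutionE t w : good_stream R w -> jump_solution t w = raw_solution t w.
Proof. by move=> gw; rewrite /jump_solution indicE mem_set// scale1r. Qed.

Lemma measurable_jump_solution t : 0 <= t -> measurable_fun setT (jump_solution t).
Proof.
move=> t0; apply: measurable_fun_mx => i j; rewrite ord1 {j}.
have mforc : measurable_fun setT (fun w => forcing t w i 0).
  apply: measurable_fun_mx_entry; apply: measurable_fun_mulmx; first exact: measurable_cst.
  exact: measurable_jump_process.
have m1 : measurable_fun setT (\1_[set w | good_stream R w] : streams -> R).
  by apply: measurable_indic; exact: measurable_good_stream.
pose K j s := (exp_mx A (t - s) *m A *m D) i j.
have mK j : measurable_fun setT (K j).
  apply: measurable_fun_mx_entry; apply: measurable_fun_mulmx; last exact: measurable_cst.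
  apply: measurable_fun_mulmx; last exact: measurable_cst.
  by apply: measurable_exp_mx; exact: measurable_funB.
have bK j : bounded_on `[0, t] (K j).
  apply: bounded_on_mulmx => a b; last exact: bounded_on_cst.
  apply: bounded_on_mulmx => a' b'; last exact: bounded_on_cst.
  have [M EM] := @bounded_exp_mx R m A 0 t a' b'; exists M => s.
  by rewrite /= in_itv/= => /andP[s0 st]; apply: EM; rewrite /= in_itv/=; lra.
have rawE w : good_stream R w -> raw_solution t w i 0 = forcing t w i 0 +
    \sum_j \int[leb]_(s in `[0, t]) (K j s * jump_process s w j 0).
  move=> gw; rewrite [LHS]mxE; congr (_ + _); rewrite [LHS]mxE.
  rewrite -Rintegral_sum//.
    by apply: eq_Rintegral => s _; rewrite /forcing mulmxA [LHS]mxE.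
  move=> j; apply: integrable_bounded_on => //; first exact: lebesgue_segment_lty.
    have mKx : measurable_fun (setT : set R) (fun s => K j s * jump_process s w j 0).
      apply: measurable_funM; first exact: mK.
      by apply: measurable_fun_mx_entry; exact: path_measurable.
    exact: measurable_funTS mKx.
  by apply: bounded_onM => //; exact: path_bounded.
(* Approximation by sampled values needs t > 0; at t = 0 the integral over a single point
   vanishes. *)
move: (t0); rewrite le_eqVlt => /predU1P[t00|tp].
  rewrite (_ : (fun w => _) = (fun w => \1_[set w | good_stream R w] w * forcing t w i 0)).
    exact: measurable_funM.
  apply/funext => w; rewrite [LHS]mxE; have [gw|gw] := pselect (good_stream R w); last first.
    by rewrite indicE memNset// !mul0r.
  rewrite rawE// big1 ?addr0// => k _.
  by rewrite -t00 set_itv1 Rintegral_set1.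
pose step k w := \1_[set w | good_stream R w] w * (forcing t w i 0 +
   \sum_j \sum_(l < 2 ^ k) jump_process (t / 2 ^+ k * l.+1%:R) w j 0 *
      \int[leb]_(s in `]0, t[) (K j s * \1_(slot t k l) s)).
apply: (@measurable_fun_cvg _ _ _ _ step) => [k|w _].
  apply: measurable_funM => //; apply: measurable_funD => //.
  apply: measurable_sum => a; apply: measurable_sum => l; apply: measurable_funM.
    by apply: measurable_fun_mx_entry; exact: measurable_jump_process.
  exact: measurable_cst.
rewrite [X in _ --> X]mxE; have [gw|gw] := pselect (good_stream R w); last first.
  rewrite /step indicE memNset//= mul0r; under eq_fun do rewrite mul0r.
  exact: cvg_cst.
rewrite rawE//; apply: cvgM; first exact: cvg_cst.
apply: cvgD; first exact: cvg_cst.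
apply: cvg_sum_filter => a; apply: step_integral_cvg => //; first exact: path_bounded.
move=> s /andP[s0 _]; have [rc _] := jump_process_cadlag d gw.
apply: (cvg_comp _ (fun M : 'cV[R]_d => M a 0) (rc s (ltW s0))).
exact: coord_continuous.
Qed.

Lemma jump_solution_is_solution :
  is_solution mu A (0 : 'M[R]_(m, 0)) D (fun _ _ => 0) jump_process jump_solution.
Proof.
split; first by move=> t; exact: measurable_jump_solution.
apply: filterS (@ae_good_stream R) => w gw.
have e : (fun s => jump_solution s w) = (fun s => raw_solution s w).
  by apply/funext => s; exact: jump_solutionE.
split.
- rewrite e; apply: solution_path_measurable; first exact: forcing_measurable.
  by move=> t i; exact: forcing_bounded.
- rewrite e; apply: solution_path_bounded; first exact: forcing_measurable.
  by move=> t i; exact: forcing_bounded.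
- move=> t t0; rewrite mulmx0 addr0.
  rewrite (_ : (fun s => A *m jump_solution s w) = (fun s => A *m raw_solution s w)); last first.
    by apply/funext => s; rewrite jump_solutionE.
  rewrite jump_solutionE//.
  by apply: (variation_of_constants_solution A t0 (forcing_measurable gw)) => i; exact: forcing_bounded.
Qed.

(** In l exp((t - s)A) A D every term of the exponential series contains some l A^(k+1) D, so the
    integral in the formula for the solution disappears. *)
Lemma jump_solution_projection (l : 'rV[R]_m) t w : 0 <= t -> good_stream R w ->
  (forall j, l *m (A ^+ j.+1 *m D) = 0) ->
  l *m jump_solution t w = l *m D *m jump_process t w.
Proof.
move=> t0 gw lAD; rewrite jump_solutionE// /raw_solution mulmxDr mulmxA.
rewrite mulmx_vintegral//; last first.
  move=> i; apply: solution_integrable => //; first exact: forcing_measurable.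
  by move=> t' i'; exact: forcing_bounded.
rewrite (_ : vintegral _ _ _ = 0) ?addr0//; apply/colP => i; rewrite [LHS]mxE mxE.
transitivity (\int[leb]_(x in `[0, t]) (0 : R)); last by rewrite Rintegral_cst// mul0r.
apply: eq_Rintegral => s _; rewrite /forcing !mulmxA -(mulmxA _ A D).
rewrite (_ : l *m _ *m (A *m D) = 0) ?mul0mx ?mxE//.
apply/matrixP => a b; rewrite exp_mxE [RHS]mxE; apply: cvg_lim => //.
rewrite (_ : pseries _ _ = cst 0); first exact: cvg_cst.
apply/funext => n; rewrite /pseries /series /= big1// => k _.
have -> : exp_mx_coef A l (A *m D) a b k = 0.
  rewrite /exp_mx_coef -mulmxA [_ *m (A *m D)]mulmxA -[A ^+ k *m A]/(A ^+ k * A) -exprSr.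
  by rewrite lAD mxE mul0r.
by rewrite mul0r.
Qed.

End JumpSolution.

(** * Necessity of the rank condition *)

(** A vector in the left kernel of the block matrix handles the exponents up to m; Cayley-Hamilton
    expresses each higher power by the m preceding ones. *)
Lemma kalman_left_kernel (F : fieldType) (m d : nat) (A : 'M[F]_m) (D : 'M[F]_(m, d)) :
  \rank (\mxrow_(j < m) (A ^+ j.+1 *m D)) != m ->
  exists2 l : 'rV[F]_m, l != 0 & forall j, l *m (A ^+ j.+1 *m D) = 0.
Proof.
case: m A D => [|n] A D rk.
  by case/eqP: rk; apply/eqP; rewrite -leqn0 rank_leq_row.
set N := \mxrow_(_ < _) _ in rk.
have [l l0 lN] : exists2 l : 'rV[F]_n.+1, l != 0 & l *m N = 0.
  have : kermx N != 0 by rewrite kermx_eq0.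
  by move=> /rowV0Pn[l lk l0]; exists l => //; exact/sub_kermxP.
exists l => //; have base j : (j < n.+1)%N -> l *m (A ^+ j.+1 *m D) = 0.
  move=> jn; have := congr1 (fun M => submxrow M (Ordinal jn)) lN.
  by rewrite /N mul_mxrow mxrowK submxrow0.
have CH : \sum_(i < n.+2) (char_poly A)`_i *: A ^+ i = 0.
  have := Cayley_Hamilton A; rewrite -[X in horner_mx A X]coefK poly_def size_char_poly.
  rewrite raddf_sum /= => e; rewrite -[RHS]e; apply: eq_bigr => i _.
  by rewrite linearZ /= rmorphXn /= horner_mx_X.
elim/ltn_ind => j IH; have [/base//|nj] := ltnP j n.+1.
have lead : (char_poly A)`_n.+1 = 1.
  by have /monicP := char_poly_monic A; rewrite lead_coefE size_char_poly.
(* The factor A^(j - n) lifts the leading term to exponent j + 1. As j > n here, the other exponents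
   are positive and smaller, hence covered by the induction. *)
have {CH} : l *m ((A ^+ (j - n) * (\sum_(i < n.+2) (char_poly A)`_i *: A ^+ i)) *m D) = 0.
  by rewrite CH mulr0 mul0mx mulmx0.
rewrite big_ord_recr /= lead scale1r mulrDr -exprD mulmxDl mulmxDr.
rewrite (_ : (j - n + n.+1)%N = j.+1); last by rewrite addnS subnK// ltnW.
rewrite mulr_sumr mulmx_suml mulmx_sumr big1 ?add0r// => i _.
rewrite -scalerAr -scalemxAl -scalemxAr -exprD.
have h : (j - n + i)%N = (j - n.+1 + i).+1 by rewrite -addSn subnSK.
rewrite h IH ?scaler0//.
by rewrite -[X in (_ < X)%N](subnK nj) ltn_add2l; exact: ltn_ord.
Qed.

Section NullPreimage.
Context (R : realType).
Local Notation leb := (@lebesgue_measure R).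

Lemma lebesgue_affine_null (a c : R) (N : set R) : a != 0 -> measurable N -> leb N = 0%E ->
  leb [set x | N (a * x + c)] = 0%E.
Proof.
move=> a0 mN N0.
have ma : measurable_fun (setT : set R) ((fun x => a * x + c) : R -> measurableTypeR R).
  by apply: measurable_funD => //; exact: measurable_funM.
pose nu : {measure set (measurableTypeR R) -> \bar R} := mscale (NngNum (normr_ge0 a)) (pushm leb ma).
have nuE B : nu B = (`|a|%:E * leb [set x | B ((a * x + c)%R)])%E by [].
have H X : ocitv X -> leb X = nu X.
  move=> [[x y] _ <-]; rewrite [RHS]nuE [LHS]lebesgue_measure_itv/= lte_fin.
  have [a1|a1] := ltP 0 a.
    rewrite (_ : mkset _ = `](x - c) / a, (y - c) / a]%classic).
      rewrite [X in (_ * X)%E]lebesgue_measure_itv/= lte_fin ltr_pM2r ?invr_gt0// ltrD2r.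
      case: ifP => _; last by rewrite mule0.
      by rewrite -!EFinB -EFinM gtr0_norm//; congr EFin; field.
    by apply/seteqP; split => z; rewrite /= !in_itv/= ltr_pdivrMr// ler_pdivlMr// ltrBlDr lerBrDr mulrC.
  have {}a1 : a < 0 by rewrite lt_neqAle a0.
  rewrite (_ : mkset _ = `[(y - c) / a, (x - c) / a[%classic).
    rewrite [X in (_ * X)%E]lebesgue_measure_itv/= lte_fin ltr_nM2r ?invr_lt0// ltrD2r.
    case: ifP => _; last by rewrite mule0.
    by rewrite -!EFinB -EFinM ltr0_norm//; congr EFin; field.
  apply/seteqP; split => z; rewrite /= !in_itv/= ltr_ndivlMr// ler_ndivrMr// ltrBlDr lerBrDr mulrC;
    by move=> /andP[-> ->].
have /esym/eqP : leb N = (`|a|%:E * leb [set x | N ((a * x + c)%R)])%E.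
  by rewrite -nuE; exact: lebesgue_measure_unique H _ mN.
by rewrite N0 mule_eq0 eqe normr_eq0 (negbTE a0)/= => /eqP.
Qed.

(** Fubini over the first coordinate: if the rest [l'] of the row is nonzero, every section is null
    by induction; otherwise the condition is affine in the first coordinate alone. *)
Lemma lebesgue_linear_null (m : nat) (l : 'rV[R]_m) (c : R) (N : set R) :
  l != 0 -> measurable N -> leb N = 0%E ->
  @lebesgue_cV R m [set v | N ((l *m v) 0 0 + c)] = 0%E.
Proof.
elim: m l c => [|m IH] l c l0 mN N0.
  by case/eqP: l0; apply/rowP => -[].
pose a := l 0 0; pose l' : 'rV[R]_m := \row_j l 0 (lift 0 j).
have E (x : R) (v : 'cV[R]_m) : (l *m (col_mx (x%:M : 'cV[R]_1) v : 'cV[R]_m.+1)) 0 0 = a * x + (l' *m v) 0 0.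
  rewrite [LHS]mxE big_ord_recl col_mx1_0; congr (_ + _); rewrite [RHS]mxE.
  by apply: eq_bigr => i _; rewrite [l' 0 i]mxE col_mx1_S.
have S (x : R) : [set v : 'cV[R]_m | [set v : 'cV[R]_m.+1 | N ((l *m v) 0 0 + c)] (col_mx (x%:M : 'cV[R]_1) v)] =
    [set v : 'cV[R]_m | N ((l' *m v) 0 0 + (a * x + c))].
  apply/seteqP; split => v /=; rewrite E; (rewrite (_ : a * x + _ + c = (l' *m v) 0 0 + (a * x + c)); [by []|ring]).
rewrite /=; under eq_integral do rewrite S.
have [l'0|l'0] := eqVneq l' 0; last by apply: integral0_eq => x _; exact: IH.
have a0 : a != 0.
  apply: contra_neq l0 => a0; apply/rowP => j; rewrite mxE.
  case: (unliftP 0 j) => [i|] ->; last exact: a0.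
  by have := congr1 (fun M : 'rV[R]_m => M 0 i) l'0; rewrite !mxE.
(* This constant may be infinite, but it is multiplied by the measure of a null set. *)
pose K := @lebesgue_cV R m setT.
transitivity (\int[leb]_(x in [set x : R | N (a * x + c)%R]) K)%E.
  rewrite [RHS]integral_mkcond; apply: eq_integral => x _; rewrite /patch l'0.
  case: ifPn => [|]; rewrite ?inE ?notin_setE /= => Nx.
    by congr lebesgue_cV; apply/seteqP; split => // v _ /=; rewrite mul0mx mxE add0r.
  have [L [LE _]] := lebesgue_cV_measure R m.
  rewrite (_ : [set v : 'cV[R]_m | _] = set0); first by rewrite LE ?measure0.
  by apply/seteqP; split => // v /=; rewrite mul0mx mxE add0r.
have ma : measurable_fun (setT : set R) (fun x => a * x + c).
  by apply: measurable_funD => //; exact: measurable_funM.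
rewrite integral_cst; last by have := ma measurableT _ mN; rewrite setTI.
exact: etrans (congr1 (mule K) (lebesgue_affine_null c a0 mN N0)) (mule0 K).
Qed.

End NullPreimage.

(** * A null set of jump sums *)

Section SingularSums.
Context (R : realType) (d : nat) (b : 'I_d -> R).
Local Notation mu := (coin_tossing R).
Local Notation leb := (@lebesgue_measure R).
Local Notation jump := (jump R d).
Local Notation jump_sum := (@jump_sum R d).

Let beta k := \sum_i b i * jump k i 0.

Let B := \sum_i `|b i|.

Let beta_le k : `|beta k| <= B * scale R k.
Proof.
rewrite (le_trans (ler_norm_sum _ _ _))// mulr_suml ler_sum// => i _.
by rewrite normrM (ger0_norm (jump_ge0 _ _ _)) ler_wpM2l// jump_le.
Qed.

(** The candidates for the sum of the first n terms when index k occurs at most 4^(k+1) times. *)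
Fixpoint partial_values (n : nat) : seq R :=
  if n is n'.+1 then
    [seq s + beta n' * a%:R | s <- partial_values n', a <- iota 0 (4 ^ n).+1]
  else [:: 0].

(** Up to the factor [B], the largest contribution of index k; twice [x n] dominates the
    contributions of all indices from n on. *)
Let x k : R := scale R k * 4 ^+ k.+1.

Let x_gt0 k : 0 < x k.
Proof. by rewrite mulr_gt0 ?scale_gt0// exprn_gt0. Qed.

Let xS k : x k.+1 = x k * (4 * 16^-1 ^+ k.+2).
Proof. by rewrite /x scaleS [4 ^+ k.+2]exprS; ring. Qed.

Let x_tail n m : (n <= m)%N -> \sum_(n <= k < m) x k + 2 * x m <= 2 * x n.
Proof.
elim: m => [|m IH]; first by rewrite leqn0 => /eqP ->; rewrite big_geq// add0r.
rewrite leq_eqVlt => /predU1P[->|nm]; first by rewrite big_geq// add0r.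
rewrite big_nat_recr//= -addrA; apply: le_trans (IH nm); rewrite lerD2l.
have e : (16^-1 : R) ^+ m.+2 <= 16^-1.
  by rewrite exprS ler_piMr// exprn_ile1// invf_le1// ler1n.
rewrite xS; have := ler_wpM2l (ltW (x_gt0 m)) e.
by have := x_gt0 m; lra.
Qed.

(** Here the ratio 16^-(n+2) pays off: one step multiplies the number of candidates by 4^(n+1) + 1
    <= 8^(n+1) and [x] by 4 times 16^-(n+2), and the product of both is at most 1/2. *)
Let size_values n : (size (partial_values n))%:R * x n <= 2^-1 ^+ n.
Proof.
elim: n => [|n IH].
  by rewrite /= mul1r /x expr0 expr1; have := scale_le R 0; rewrite expr1; lra.
have -> : partial_values n.+1 =
  [seq s + beta n * a%:R | s <- partial_values n, a <- iota 0 (4 ^ n.+1).+1] by [].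
rewrite size_allpairs size_iota natrM xS.
have h : ((4 ^ n.+1).+1)%:R * (4 * 16^-1 ^+ n.+2) <= 2^-1 :> R.
  apply: (@le_trans _ _ ((8 ^ n.+1)%:R * (4 * 16^-1 ^+ n.+2))).
    rewrite ler_wpM2r// ?mulr_ge0 ?exprn_ge0// ler_nat.
    rewrite -[8%N]/(2 * 4)%N expnMn; apply: (@leq_trans (2 * 4 ^ n.+1)).
      by rewrite mul2n -addnn -addn1 leq_add2l expn_gt0.
    by rewrite leq_mul2r orbC -{1}[2%N]expn1 leq_pexp2l.
  rewrite natrX [16^-1 ^+ n.+2]exprS.
  have e : (8%:R : R) ^+ n.+1 * 16^-1 ^+ n.+1 <= 1.
    by rewrite -exprMn; apply: exprn_ile1; lra.
  by move: e; move: (8%:R ^+ n.+1) (16^-1 ^+ n.+1) => p q; lra.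
rewrite [2^-1 ^+ n.+1]exprS mulrACA [leRHS]mulrC; apply: ler_pM => //.
by rewrite mulr_ge0// ltW.
Qed.

Let near_values n := \big[setU/set0]_(s <- partial_values n)
  (`[s - 2 * B * x n, s + 2 * B * x n]%classic : set R).

(** At level n the candidates are thickened by 2 B x n, a bound for the remaining sum. The total
    length is at most 4 B 2^-n, so the intersection over n is null. *)
Definition singular_values : set R := \bigcap_n near_values n.

Let B0 : 0 <= B. Proof. exact: sumr_ge0. Qed.

Let near_valuesP n y : near_values n y <->
  exists2 s, s \in partial_values n & `|y - s| <= 2 * B * x n.
Proof.
rewrite /near_values; elim: (partial_values n) => [|s r IH].
  by rewrite big_nil; split => // -[].
rewrite big_cons; split.
  move=> [/=|/IH[s' rs' h]]; last by exists s' => //; rewrite inE rs' orbT.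
  by rewrite in_itv/= -ler_distl => h; exists s => //; rewrite mem_head.
move=> [s' /predU1P[->|rs'] h]; last by right; apply/IH; exists s'.
by left; rewrite /= in_itv/= -ler_distl.
Qed.

Let measurable_near n : measurable (near_values n).
Proof. by apply: bigsetU_measurable => s _; exact: measurable_itv. Qed.

Lemma measurable_singular_values : measurable singular_values.
Proof. by apply: bigcapT_measurable. Qed.

Lemma singular_values_null : leb singular_values = 0%E.
Proof.
have len (p q : R) : p <= q -> (leb (`[p, q]%classic : set R) <= (q - p)%:E)%E.
  move=> pq; rewrite lebesgue_measure_itv/= lte_fin; case: ifP => _ //.
  by rewrite lee_fin subr_ge0.
have le n : (leb singular_values <= (4 * B * 2^-1 ^+ n)%:E)%E.
  apply: (@le_trans _ _ (leb (near_values n))).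
    by apply: le_measure; rewrite ?inE; [exact: measurable_singular_values|exact: measurable_near|move=> y h; exact: (h n I)].
  have r0 : 0 <= 2 * B * x n by apply: mulr_ge0; [exact: mulr_ge0|exact: ltW].
  apply: (@le_trans _ _ (((size (partial_values n))%:R * (2 * (2 * B * x n)))%:E)).
    rewrite /near_values; elim: (partial_values n) => [|s r IH].
      by rewrite big_nil measure0 mul0r.
    rewrite big_cons (_ : (size (s :: r))%:R * (2 * (2 * B * x n)) =
      2 * (2 * B * x n) + (size r)%:R * (2 * (2 * B * x n))); last by rewrite /= -natr1; ring.
    rewrite EFinD.
    have mU : measurable (\big[setU/set0]_(s <- r) (`[s - 2 * B * x n, s + 2 * B * x n]%classic : set R)).
      by apply: bigsetU_measurable => s' _; exact: measurable_itv.
    apply: le_trans (@measureU2 _ _ _ leb _ _ (measurable_itv _) mU) _; apply: leeD => //.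
    have li := @len (s - 2 * B * x n) (s + 2 * B * x n).
    apply: le_trans (li _) _; first by lra.
    by rewrite lee_fin; lra.
  rewrite lee_fin (_ : _ * _ = 4 * B * ((size (partial_values n))%:R * x n)); last by ring.
  by rewrite ler_wpM2l// mulr_ge0.
apply/eqP; rewrite eq_le measure_ge0 andbT.
apply/lee_addgt0Pr => e e0; rewrite add0e.
have : (fun n => 4 * B * 2^-1 ^+ n) @ \oo --> 0.
  rewrite -[X in _ --> X](mulr0 (4 * B)); apply: cvgM; first exact: cvg_cst.
  by apply: cvg_expr; rewrite gtr0_norm ?invr_gt0// invf_lt1// ltr1n.
move=> /(cvgr_lt _)/(_ _ e0)/filter_ex[n hn].
by apply: le_trans (le n) _; rewrite lee_fin ltW.
Qed.

Definition sparse_stream (w : streams) := forall n : nat,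
  fine (marks R w (`[0%R, 1%R]%classic `*` [set n])) <= (4 ^ n.+1)%:R.

Let I01 : set R := `[0, 1]%classic.

Lemma singular_values_sum w : good_stream R w -> sparse_stream w ->
  (forall n, exists j : nat, marks R w (I01 `*` [set n]) = j%:R%:E) ->
  singular_values (\sum_i b i * jump_sum I01 w i 0).
Proof.
move=> gw sw /choice[N hN] n _; apply/near_valuesP; set y := \sum_i _.
have Nle k : (N k <= 4 ^ k.+1)%N.
  by have := sw k; rewrite hN /= ler_nat.
exists (\sum_(0 <= k < n) beta k * (N k)%:R).
  elim: n => [|n IH]; first by rewrite big_nil mem_head.
  rewrite big_nat_recr//; have -> : partial_values n.+1 =
    [seq s + beta n * a%:R | s <- partial_values n, a <- iota 0 (4 ^ n.+1).+1] by [].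
  apply/allpairsP.
  exists (\sum_(0 <= k < n) beta k * (N k)%:R, N n); split; [exact: IH| |by []].
  by rewrite mem_iota add0n ltnS; exact: Nle.
have cy : series (fun k => beta k * (N k)%:R) @ \oo --> y.
  have ci i : series (fun k => jump k i 0 * (N k)%:R) @ \oo --> jump_sum I01 w i 0.
    apply: nneseries_cvg => [k|]; first by rewrite mulr_ge0// jump_ge0.
    rewrite mxE fineK; last first.
      have jb k : 0 <= jump k i 0 <= scale R k by rewrite jump_ge0 jump_le.
      exact: weighted_sum_fin jb gw.
    by apply: eq_eseriesr => k _; rewrite EFinM hN.
  rewrite (_ : series _ = (fun m => \sum_i b i * series (fun k => jump k i 0 * (N k)%:R) m)).
    by apply: cvg_sumr => i; apply: cvgM => //; exact: cvg_cst.
  apply/funext => m; rewrite /series /=.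
  under [RHS]eq_bigr do rewrite mulr_sumr.
  rewrite exchange_big/=; apply: eq_bigr => k _; rewrite /beta mulr_suml.
  by apply: eq_bigr => i _; rewrite mulrA.
apply/ler_addgt0Pr => e e0.
move: cy => /cvgr_distC_lt/(_ _ e0)[m _ hm].
have := hm (maxn m n) (leq_maxl _ _).
rewrite /series /= (big_cat_nat (n := n)) ?leq_maxr//=.
set s := \sum_(0 <= k < n) _; set u := \sum_(n <= k < _) _ => h.
have hu : `|u| <= 2 * B * x n.
  apply: (le_trans (ler_norm_sum _ _ _)).
  apply: (@le_trans _ _ (B * \sum_(n <= k < maxn m n) x k)).
    rewrite mulr_sumr; apply: ler_sum => k _; rewrite normrM normr_nat mulrA.
    by apply: ler_pM => //; rewrite -natrX ler_nat.
  rewrite mulrAC [2 * _ * _]mulrC ler_wpM2l//.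
  have := x_tail (leq_maxr m n); have := x_gt0 (maxn m n); lra.
have -> : y - s = (y - (s + u)) + u by ring.
by apply: le_trans (ler_normD _ _) _; rewrite addrC lerD// ltW// distrC.
Qed.

Lemma expR1_le4 : expR 1 <= 4 :> R.
Proof.
have h : 2^-1 <= expR (- 2^-1) :> R by have := expR_ge1Dx (- 2^-1 : R); lra.
have : expR (2^-1) <= 2 :> R.
  by rewrite -[leLHS]invrK -expRN -[leRHS]invrK lef_pV2 ?posrE ?expR_gt0// invr_gt0.
rewrite (_ : expR 1 = expR (2^-1) * expR (2^-1)); last by rewrite -expRD; congr expR; field.
by move=> h2; have := ler_pM (expR_ge0 _) (expR_ge0 _) h2 h2; lra.
Qed.

Let crowded n : set streams := [set w | (4 ^ n.+1)%:R < fine (marks R w (I01 `*` [set n]))].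

Let measurable_count n :
  measurable_fun setT (fun w : streams => fine (marks R w (I01 `*` [set n]))).
Proof.
apply: (measurableT_comp (f := fine)) => //.
have [mm _ _ _] := marks_prm_intensity R.
by apply: mm; apply: measurable_slice; exact: measurable_itv.
Qed.

Let measurable_crowded n : measurable (crowded n).
Proof.
have := measurable_count n measurableT (measurable_itv `](4 ^ n.+1)%:R, +oo[); rewrite setTI.
by rewrite (_ : _ @^-1` _ = crowded n)//; apply/seteqP; split => w; rewrite /crowded /= in_itv/= andbT.
Qed.

(** Chebyshev's inequality with second moment at most 2e <= 8: division by 16^(n+1) gives half of
    16^-n. *)
Let mu_crowded n : (mu (crowded n) <= (geometric (2^-1) (16^-1) n)%:E)%E.
Proof.
have leb1 : leb I01 = 1%:E by rewrite lebesgue_measure_itv/= lte_fin ltr01 oppr0 adde0.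
have I0 (s : R) : I01 s -> 0 <= s by rewrite /I01/= in_itv/= => /andP[].
have m2 := @marks_second_moment R I01 n 1 (measurable_itv _) I0 leb1.
have {}m2 : (\int[mu]_w (fine (marks R w (I01 `*` [set n])) ^+ 2)%:E <= 8%:E)%E.
  apply: (le_trans m2).
  by rewrite lee_fin; have := expR1_le4; lra.
have c0 : 0 < (16 : R) ^+ n.+1 by rewrite exprn_gt0.
have h : (((16 : R) ^+ n.+1)%:E * mu (crowded n) <= 8%:E)%E.
  apply: le_trans m2.
  have -> : mu (crowded n) = (\int[mu]_w (\1_(crowded n) w)%:E)%E.
    by have := integral_indic mu measurableT (measurable_crowded n); rewrite setIT => <-.
  have -> : ((16 ^+ n.+1)%:E * \int[mu]_w (\1_(crowded n) w)%:E =
      \int[mu]_w ((16 ^+ n.+1)%:E * (\1_(crowded n) w)%:E))%E.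
    rewrite ge0_integralZl_EFin//; try exact: ltW; try (by move=> w _; rewrite lee_fin);
      try by apply/measurable_EFinP; exact: measurable_indic.
    apply: ge0_le_integral => //.
    - apply: emeasurable_funM; first exact: measurable_cst.
      by apply/measurable_EFinP; exact: measurable_indic.
    - by apply/measurable_EFinP; apply: measurable_funX; exact: measurable_count.
    - move=> w _; rewrite -EFinM lee_fin indicE.
      have [wn|wn] := boolP (w \in crowded n); last by rewrite mulr0 sqr_ge0.
      move: wn; rewrite inE /crowded/= natrX => wn.
      by rewrite mulr1 (_ : 16 = 4 ^+ 2 :> R) -?exprM 1?mulnC ?exprM; [rewrite ler_pXn2r ?nnegrE ?(ltW wn) ?exprn_ge0// (le_trans _ (ltW wn)) ?exprn_ge0|ring].
rewrite -(@lee_pmul2l _ ((16 : R) ^+ n.+1)%:E) ?lte_fin//.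
apply: (le_trans h); rewrite -EFinM lee_fin /= exprS.
have -> : 16 * 16 ^+ n * (2^-1 * 16^-1 ^+ n) = 8 :> R.
  by rewrite exprVn; field; rewrite expf_neq0.
by [].
Qed.

(** The probabilities of the crowded events add up to at most 8/15, which is less than 1. *)
Lemma not_ae_dense : ~ {ae mu, forall w, ~ sparse_stream w}.
Proof.
move=> [N [mN N0 HN]].
have mC : measurable (\bigcup_n crowded n) by apply: bigcup_measurable => n _; exact: measurable_crowded.
have cover : [set: streams] `<=` N `|` \bigcup_n crowded n.
  move=> w _; have [sw|] := pselect (sparse_stream w); first by left; apply: HN => /= /(_ sw).
  by move=> /existsNP[n /negP]; rewrite -ltNge => h; right; exists n.
have muN : (mu N <= 0)%E by rewrite N0.
have : (mu setT <= 0 + (8 / 15 : R)%:E)%E.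
  apply: (@le_trans _ _ (mu (N `|` \bigcup_n crowded n))).
    by apply: le_measure; rewrite ?inE//; exact: measurableU.
  apply: le_trans (@measureU2 _ _ _ mu _ _ mN mC) _; apply: leeD; first exact: muN.
  apply: le_trans (@generalized_Boole_inequality _ _ _ mu _ measurable_crowded mC) _.
  apply: (@le_trans _ _ (\sum_(0 <= n <oo) (geometric (2^-1) (16^-1 : R) n)%:E)%E).
    by apply: lee_nneseries => [n _ _|n _]; [exact: measure_ge0|exact: mu_crowded].
  have cg : series (geometric (2^-1) (16^-1 : R)) @ \oo --> (8 / 15 : R).
    have -> : 8 / 15 = 2^-1 / (1 - 16^-1) :> R by field.
    by apply: cvg_geometric_series; rewrite gtr0_norm ?invr_gt0// invf_lt1// ltr1n.
  by rewrite (cvg_nneseries _ cg)// => n; rewrite /= mulr_ge0 ?exprn_ge0.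
rewrite add0e; have -> : mu setT = 1%E by exact: probability_setT.
by rewrite lee_fin; lra.
Qed.

End SingularSums.

(** * Independence of constant families *)

Section Deterministic.
Context (R : realType) (disp : measure_display) (Omega : measurableType disp).
Variable P : probability Omega R.
Context (disp' : measure_display) (T : measurableType disp').

Lemma sigma_generated_cst (I : Type) (S : set I) (c : I -> T) (E : set Omega) :
  sigma_generated S (fun i (_ : Omega) => c i) E -> E = set0 \/ E = setT.
Proof.
move: E; apply: smallest_sub; last first.
  move=> _ [i _ [C _ <-]]; rewrite setTI; have [ci|ci] := pselect (C (c i)).
    by right; apply/seteqP; split.
  by left; apply/seteqP; split.
split => [|E [->|->]|F hF]; first by left.
- by right; rewrite setD0.
- by left; rewrite setDv.
- have [[k Fk]|h] := pselect (exists k, F k = setT).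
    by right; apply/seteqP; split => // w _; exists k => //; rewrite Fk.
  left; apply/seteqP; split => // w [k _]; have [->//|Fk] := hF k.
  by case: h; exists k.
Qed.

Lemma independent_trivial (F G : set (set Omega)) :
  (forall E, F E -> E = set0 \/ E = setT) -> independent_systems P F G.
Proof.
move=> FE E C /FE[->|->] _; first by rewrite set0I !measure0 mul0e.
rewrite setTI; have -> : P setT = 1%E by exact: probability_setT.
by rewrite mul1e.
Qed.

Lemma mutually_independent_cst n (c : 'I_n -> T) :
  mutually_independent P (fun i (_ : Omega) => c i).
Proof.
move=> C mC; have [h|/existsNP[i h]] := pselect (forall i, C i (c i)).
  have e i : (fun _ : Omega => c i) @^-1` C i = setT.
    by apply/seteqP; split => // w _; exact: h.
  rewrite big1 => [|i _]; last by rewrite e; exact: probability_setT.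
  rewrite (_ : \bigcap_(i in _) _ = setT); first exact: probability_setT.
  by apply/seteqP; split => // w _ i _; exact: h.
have e : (fun _ : Omega => c i) @^-1` C i = set0.
  by apply/seteqP; split => // w /h.
rewrite (_ : \bigcap_(j in _) _ = set0); last first.
  by apply/seteqP; split => // w /(_ i I) /h.
by rewrite measure0 (bigD1 i)//= e measure0 mul0e.
Qed.

End Deterministic.

(** In dimension zero the constant process is a Wiener process, so the counterexample can be taken
    with k = 0 and no Brownian motion has to be constructed. *)
Lemma wiener_process_dim0 (R : realType) (disp : measure_display)
    (Omega : measurableType disp) (P : probability Omega R) :
  is_wiener_process P (fun (_ : R) (_ : Omega) => 0 : 'cV[R]_0).
Proof.
split.
- by move=> t _; exact: measurable_cst.
- exact: aeW.
- by move=> N s _ _; exact: (mutually_independent_cst P (fun _ : 'I_N => 0 - 0 : 'cV[R]_0)).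
- move=> s t _ _; split => [|[]//].
  exact: (mutually_independent_cst P (fun i : 'I_0 => (0 - 0 : 'cV[R]_0) i 0)).
- by apply: aeW => w; apply: continuous_subspaceT => x; exact: cst_continuous.
Qed.

Section Necessity.
Context (R : realType) (m d : nat) (A : 'M[R]_m) (D : 'M[R]_(m, d)).

Lemma kalman_necessary :
  (forall (k : nat) (B : 'M[R]_(m, k))
      (disp : measure_display) (Omega : measurableType disp)
      (P : probability Omega R)
      (W : R -> Omega -> 'cV[R]_k)
      (Pi : {measure set 'cV[R]_d -> \bar R})
      (nu : Omega -> {measure set (R * 'cV[R]_d) -> \bar R})
      (Z : R -> Omega -> 'cV[R]_d)
      (X : R -> Omega -> 'cV[R]_m),
    is_wiener_process P W ->
    is_levy_measure Pi ->
    ess_lin_nondegenerated Pi ->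
    is_poisson_random_measure P (intensity Pi) nu ->
    is_levy_process P Z ->
    is_levy_ito P Pi nu Z ->
    independent_systems P
      (sigma_generated [set t : R | 0 <= t] W)
      (sigma_generated [set E : set (R * 'cV[R]_d) | measurable E]
        (fun E w => nu w E)) ->
    independent_systems P
      (sigma_generated [set t : R | 0 <= t] W)
      (sigma_generated [set t : R | 0 <= t] Z) ->
    is_solution P A B D W Z X ->
    forall t : R, 0 < t -> pushforward P (X t) `<< @lebesgue_cV R m) ->
  \rank (\mxrow_(j < m) (A ^+ j.+1 *m D)) = m.
Proof.
move=> H; apply/eqP; apply: contrapT => /negP rk.
have [l l0 lAD] := kalman_left_kernel rk.
(* The shift [c] undoes the compensator at time 1, so that [N] tests the uncompensated sum of
   jumps. *)
pose b i := (l *m D) 0 i; pose c := \sum_i b i * drift R d i 0.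
pose N := [set v : 'cV[R]_m | singular_values b ((l *m v) 0 0 + c)].
have mN : measurable N.
  have ml : measurable_fun setT (fun v : 'cV[R]_m => (l *m v) 0 0 + c).
    apply: measurable_funD => //; apply: measurable_fun_mx_entry.
    by apply: measurable_fun_mulmx; [exact: measurable_cst|exact: measurable_id].
  by have := ml measurableT _ (measurable_singular_values b); rewrite setTI.
have N0 : lebesgue_cV N = 0%E.
  exact: (lebesgue_linear_null c l0 (measurable_singular_values b) (singular_values_null b)).
have W_indep F : independent_systems (coin_tossing R)
    (sigma_generated [set t : R | 0 <= t] (fun _ (_ : streams) => 0 : 'cV[R]_0)) F.
  by apply: independent_trivial => E; exact: sigma_generated_cst.
have ac := H 0%N 0 _ _ (coin_tossing R) (fun _ _ => 0) (jump_measure R d) (@jump_prm R d)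
  (@jump_process R d) (jump_solution A D) (wiener_process_dim0 _) (@jump_measure_levy R d)
  (@jump_measure_nondegenerated R d) (@jump_prm_prm R d) (@jump_process_levy R d)
  (@jump_process_levy_ito R d) (W_indep _)
  (W_indep _)
  (jump_solution_is_solution A D) 1 ltr01.
have XN0 : coin_tossing R (jump_solution A D 1 @^-1` N) = 0%E.
  (* Domination asks for nullity of all measurable subsets of [N]; monotonicity comes from the
     genuine measure [L]. *)
  apply: (ac N) => // C mC CN; have [L [LE _]] := lebesgue_cV_measure R m.
  by apply/eqP; rewrite LE// eq_le measure_ge0 andbT -N0 LE// le_measure ?inE.
have XN : {ae coin_tossing R, forall w, ~ N (jump_solution A D 1 w)}.
  exists (jump_solution A D 1 @^-1` N); split => // [|w /= /contrapT//].
  by have := measurable_jump_solution A D (ltW ltr01) measurableT mN; rewrite setTI.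
have mI : measurable (`[0, 1]%classic : set R) by exact: measurable_itv.
have finite : {ae coin_tossing R, forall w, forall n,
    exists j : nat, marks R w ((`[0, 1]%classic : set R) `*` [set n]) = j%:R%:E}.
  apply/ae_foralln => n; apply: marks_finite => //.
    by move=> s; rewrite /= in_itv/= => /andP[].
  by rewrite lebesgue_measure_itv/= lte_fin ltr01 oppr0 adde0 ltry.
have dense : {ae coin_tossing R, forall w, ~ sparse_stream R w}; last exact: not_ae_dense dense.
have FF : Filter (nbhs (almost_everywhere (coin_tossing R))).
  exact: ae_filter_ringOfSetsType.
have all3 := @filterI _ _ FF _ _ XN (@filterI _ _ FF _ _ finite (@ae_good_stream R)).
move: all3; apply: (@filterS _ _ FF) => w [nN [fw gw]] sw; apply: nN.
rewrite /N /= (jump_solution_projection ler01 gw lAD) mxE.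
rewrite (_ : _ + c = \sum_i b i * jump_sum d (`[0, 1]%classic : set R) w i 0); first exact: singular_values_sum.
rewrite /c -big_split/=; apply: eq_bigr => i _.
by rewrite jump_processE -/(b i); ring.
Qed.

End Necessity.

Theorem theorem3 (R : realType) (m d : nat) (A : 'M[R]_m) (D : 'M[R]_(m, d)) :
  \rank (\mxrow_(j < m) (A ^+ j.+1 *m D)) = m
  <->
  (forall (k : nat) (B : 'M[R]_(m, k))
      (disp : measure_display) (Omega : measurableType disp)
      (P : probability Omega R)
      (W : R -> Omega -> 'cV[R]_k)
      (Pi : {measure set 'cV[R]_d -> \bar R})
      (nu : Omega -> {measure set (R * 'cV[R]_d) -> \bar R})
      (Z : R -> Omega -> 'cV[R]_d)
      (X : R -> Omega -> 'cV[R]_m),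
    is_wiener_process P W ->
    is_levy_measure Pi ->
    ess_lin_nondegenerated Pi ->
    is_poisson_random_measure P (intensity Pi) nu ->
    is_levy_process P Z ->
    is_levy_ito P Pi nu Z ->
    independent_systems P
      (sigma_generated [set t : R | 0 <= t] W)
      (sigma_generated [set E : set (R * 'cV[R]_d) | measurable E]
        (fun E w => nu w E)) ->
    independent_systems P
      (sigma_generated [set t : R | 0 <= t] W)
      (sigma_generated [set t : R | 0 <= t] Z) ->
    is_solution P A B D W Z X ->
    forall t : R, 0 < t -> pushforward P (X t) `<< @lebesgue_cV R m).
Proof.
split=> [rk k B disp Omega P W Pi nu Z X WP levy nondeg prm ZP ito W_nu _ XP|].
  exact: (kalman_absolutely_continuous rk WP levy nondeg prm ZP ito W_nu XP).
exact: kalman_necessary.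
Qed.
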